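(* Let $V:\mathbb R^3\to\mathbb R$ with $V\in\mathcal K_0$, and suppose $H=-\Delta+V$ has no eigenvalue or resonance at zero, and no positive eigenvalues. There is a constant $C<\infty$ such that for each eigenvalue $-\mu_j^2<0$ of $H$ (with $\mu_j>0$), the integral kernel of the orthogonal projection $P_j$ onto its eigenspace satisfies $$|P_j(x,y)|\le C\mu_j\frac{e^{-\mu_j|x-y|}}{|x-y|}.$$ Furthermore (each eigenfunction of $H$ being a bounded function), it is also true that $$|P_j(x,y)|\le C\mu_j^{2-\alpha}\frac{e^{-\mu_j|x-y|}}{|x-y|^{\alpha}}\qquad\text{for all }0\le\alpha\le1 .$$
   Context: The global Kato norm is $\|V\|_{\mathcal K}=\sup_{y\in\mathbb R^3}\int_{\mathbb R^3}\frac{|V(x)|}{|x-y|}\,dx$, and $\mathcal K_0$ is the closure of $C_c^\infty(\mathbb R^3)$ in this norm. For real $V\in\mathcal K_0$, $H=-\Delta+V$ is self-adjoint and bounded below with essential spectrum $[0,\infty)$; under the stated hypotheses it has finitely many negative eigenvalues. The constant $C$ may depend on $V$. A resonance at zero is a nontrivial solution $\psi\notin L^2$ of $(-\Delta+V)\psi=0$ with $(1+|x|)^{-s}\psi\in L^2(\mathbb R^3)$ for all $s>\frac12$. *)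

(* Defs.v *)
From HB Require Import structures.
From mathcomp Require Import all_boot all_order all_algebra.
From mathcomp Require Import complex.
From mathcomp Require Import all_classical all_reals all_analysis.
Import Order.TTheory GRing.Theory Num.Theory.
Import numFieldNormedType.Exports.

Set Implicit Arguments.
Unset Strict Implicit.
Unset Printing Implicit Defensive.

Local Open Scope classical_set_scope.
Local Open Scope ring_scope.
Local Open Scope complex_scope.

Lemma sigma_finite_product d1 d2 (T1 : measurableType d1)
    (T2 : measurableType d2) (R : realType)
    (m1 : {sigma_finite_measure set T1 -> \bar R})
    (m2 : {sigma_finite_measure set T2 -> \bar R}) :
  sigma_finite setT (m1 \x m2)%E.
Proof.
have /sigma_finiteP[F [TF ndF Foo]] := sigma_finiteT m1.
have /sigma_finiteP[G [TG ndG Goo]] := sigma_finiteT m2.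
exists (fun n => F n `*` G n).
  rewrite -setXTT TF TG predeqE => -[x y]; split.
    move=> [/= [n _ Fnx] [k _ Gky]]; exists (maxn n k) => //; split.
    - by move: x Fnx; exact/subsetPset/ndF/leq_maxl.
    - by move: y Gky; exact/subsetPset/ndG/leq_maxr.
  by move=> [n _ []/= ? ?]; split; exists n.
move=> k; have [? ?] := Foo k; have [? ?] := Goo k.
split; first exact: measurableX.
by rewrite product_measure1E// lte_mul_pinfty// ge0_fin_numE.
Qed.

Section Euclidean_space.
Variable R : realType.

Definition space3 := (R * R * R)%type.

(* The norm that R * R * R carries in the library is the sup norm. *)
Definition enorm (x : space3) : R :=
  Num.sqrt (x.1.1 ^+ 2 + x.1.2 ^+ 2 + x.2 ^+ 2).

Definition lebesgue2 :=
  ((@lebesgue_measure R) \x (@lebesgue_measure R))%E.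
Definition lebesgue3 := (lebesgue2 \x (@lebesgue_measure R))%E.

(* The sigma-finite structure that the library infers for a product measure is
   the one for subprobabilities, so the general one is declared here. *)
HB.instance Definition _ := Measure.on lebesgue2.
HB.instance Definition _ := Measure_isSigmaFinite.Build _ _ _ lebesgue2
  (sigma_finite_product (@lebesgue_measure R) (@lebesgue_measure R)).
HB.instance Definition _ := Measure.on lebesgue3.
HB.instance Definition _ := Measure_isSigmaFinite.Build _ _ _ lebesgue3
  (sigma_finite_product lebesgue2 (@lebesgue_measure R)).

Definition basis3 (i : 'I_3) : space3 :=
  ((i == 0 :> nat)%:R, (i == 1 :> nat)%:R, (i == 2 :> nat)%:R).

Definition partial (i : 'I_3) (f : space3 -> R) : space3 -> R :=
  fun x => 'D_(basis3 i) f x.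

Definition iter_partial (s : seq 'I_3) (f : space3 -> R) : space3 -> R :=
  foldr partial f s.

Definition laplacian (f : space3 -> R) : space3 -> R :=
  fun x => \sum_(i < 3) partial i (partial i f) x.

(* Differentiability of all iterated partial derivatives includes their
   continuity, so this is C^oo. *)
Definition smooth (f : space3 -> R) : Prop :=
  forall (s : seq 'I_3) (x : space3), differentiable (iter_partial s f) x.

Definition test_function (f : space3 -> R) : Prop :=
  smooth f /\ compact (closure [set x | f x != 0]).

Definition loc_integrable (f : space3 -> R) : Prop :=
  measurable_fun setT f /\
  forall A, compact A -> lebesgue3.-integrable A (EFin \o f).

(* In both factors the division by zero at x = y affects a null set only. *)
Definition kato_norm (V : space3 -> R) : \bar R :=
  ereal_sup [set (\int[lebesgue3]_x (`|V x| / enorm (x - y))%:E)%E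
            | y in [set: space3]].

Definition kato0 (V : space3 -> R) : Prop :=
  measurable_fun setT V /\
  forall e : R, 0 < e -> exists2 phi, test_function phi &
    (kato_norm (fun x => (V x - phi x)%R) < e%:E)%E.

Definition weak_partial_real (i : 'I_3) (u g : space3 -> R) : Prop :=
  forall phi, test_function phi ->
    \int[lebesgue3]_x (u x * partial i phi x) =
    - \int[lebesgue3]_x (g x * phi x).

End Euclidean_space.

Section Complex_functions.
Variable R : realType.

Definition cabs (z : R[i]) : R := complex.Re `|z|.

Definition cmeasurable d (T : measurableType d) (f : T -> R[i]) : Prop :=
  measurable_fun setT (fun x => complex.Re (f x)) /\
  measurable_fun setT (fun x => complex.Im (f x)).

Definition cintegrable (f : space3 R -> R[i]) : Prop :=
  (@lebesgue3 R).-integrable setT (fun x => (complex.Re (f x))%:E) /\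
  (@lebesgue3 R).-integrable setT (fun x => (complex.Im (f x))%:E).

Definition cintegral (f : space3 R -> R[i]) : R[i] :=
  (\int[@lebesgue3 R]_x complex.Re (f x)) +i*
  (\int[@lebesgue3 R]_x complex.Im (f x)).

Definition L2 (f : space3 R -> R[i]) : Prop :=
  cmeasurable f /\ (\int[@lebesgue3 R]_x (cabs (f x) ^+ 2)%:E < +oo)%E.

Definition inner (f g : space3 R -> R[i]) : R[i] :=
  cintegral (fun x => f x * (g x)^*).

Definition null_function (f : space3 R -> R[i]) : Prop :=
  {ae @lebesgue3 R, forall x, f x = 0}.

Definition ess_bounded (f : space3 R -> R[i]) : Prop :=
  exists M : R, {ae @lebesgue3 R, forall x, cabs (f x) <= M}.

Definition weak_partial (i : 'I_3) (u g : space3 R -> R[i]) : Prop :=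
  weak_partial_real i (fun x => complex.Re (u x)) (fun x => complex.Re (g x)) /\
  weak_partial_real i (fun x => complex.Im (u x)) (fun x => complex.Im (g x)).

Definition H1_gradient (u : space3 R -> R[i])
    (du : 'I_3 -> space3 R -> R[i]) : Prop :=
  L2 u /\ forall i, L2 (du i) /\ weak_partial i u (du i).

End Complex_functions.

Section Schroedinger_operator.
Variables (R : realType) (V : space3 R -> R).
Local Notation fT := (space3 R -> R[i]).

(* H psi = f, where H is the self-adjoint operator -Delta + V associated with
   the form <grad u, grad v> + <V u, v> on the Sobolev space H^1.
   For V in kato0 the form is bounded on H^1, since |V| is form-bounded
   relative to -Delta; in particular V u v^* is integrable. *)
Definition schroedinger (psi f : fT) : Prop :=
  L2 f /\
  exists2 dpsi, H1_gradient psi dpsi &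
    forall phi dphi, H1_gradient phi dphi ->
      \sum_(i < 3) inner (dpsi i) (dphi i) +
        inner (fun x => (V x)%:C * psi x) phi = inner f phi.

Definition H_eigenspace (lam : R) : set fT :=
  [set psi | schroedinger psi (fun x => lam%:C * psi x)].

Definition H_eigenfunction (lam : R) (psi : fT) : Prop :=
  H_eigenspace lam psi /\ ~ null_function psi.

Definition H_eigenvalue (lam : R) : Prop := exists psi, H_eigenfunction lam psi.

(* (-Delta + V) psi = 0 in the sense of distributions *)
Definition zero_energy_solution (psi : fT) : Prop :=
  [/\ cmeasurable psi,
      loc_integrable (fun x => complex.Re (psi x)) /\
      loc_integrable (fun x => complex.Im (psi x)),
      loc_integrable (fun x => V x * complex.Re (psi x)) /\
      loc_integrable (fun x => V x * complex.Im (psi x)) &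
      forall phi, test_function phi ->
        cintegral (fun x => psi x * (- laplacian phi x)%:C) +
        cintegral (fun x => (V x)%:C * psi x * (phi x)%:C) = 0].

Definition zero_resonance (psi : fT) : Prop :=
  [/\ zero_energy_solution psi, ~ null_function psi, ~ L2 psi &
      forall s : R, 2^-1 < s ->
        L2 (fun x => ((1 + enorm x) `^ (- s))%:C * psi x)].

End Schroedinger_operator.

Section Projections.
Variable R : realType.
Local Notation fT := (space3 R -> R[i]).

Definition orthogonal_projection (E : set fT) (f g : fT) : Prop :=
  E g /\ forall h, E h -> inner (fun x => f x - g x) h = 0.

(* Functions in L^2 are not quotiented by a.e. equality, hence the
   intermediate representative g of the projection of f. *)
Definition projection_kernel (E : set fT) (K : space3 R -> space3 R -> R[i]) :
    Prop :=
  cmeasurable (fun xy : space3 R * space3 R => K xy.1 xy.2) /\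
  forall f, L2 f -> exists2 g, orthogonal_projection E f g &
    {ae @lebesgue3 R, forall x,
       cintegrable (fun y => K x y * f y) /\
       g x = cintegral (fun y => K x y * f y)}.

End Projections.

(* Main.v *)
From HB Require Import structures.
Require Import Defs.
From mathcomp Require Import all_boot all_order all_algebra.
From mathcomp Require Import ring lra.
From mathcomp Require Import complex.
From mathcomp Require Import all_classical all_reals all_analysis.
From mathcomp Require Import measurable_realfun lebesgue_stieltjes_measure.
Import Order.TTheory GRing.Theory Num.Theory.
Import numFieldNormedType.Exports.

Set Implicit Arguments.
Unset Strict Implicit.
Unset Printing Implicit Defensive.

Local Open Scope classical_set_scope.
Local Open Scope ring_scope.

(** Let [T] denote convolution with the Yukawa kernel [gg] = e^{-mu|x|}/|x|, a multiple of (-Delta +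
    mu^2)^{-1}. A real eigenfunction u of energy -mu^2 solves (-Delta + mu^2) u = -V u, whence c|u|
    <= T(|V||u|) almost everywhere with an explicit c > 0 ([eig_le_tt]). To get this from the weak
    equation, put r = sqrt(|x|^2 + e^2). Then F = e^{-mu r}/r is smooth and (mu^2 - Delta) F is an
    explicit positive bump [kk]. Testing the equation with F(. - y) expresses the convolution of u
    with [kk], called [smear], through V u. As e tends to 0, upper and lower bounds for the mass of
    [kk] together with L^2 continuity of translations recover |u| up to the factor c
    ([approximate_identity]).

    Form bound. With mu = 0 the same identity bounds u by the convolution of its gradient with
    |x|^{-2}. Since |x|^{-2} convolved with itself is at most a multiple of 1/|x| ([int_kn_mul]),
    and the Kato norm controls the energy with kernel 1/|x| ([riesz_energy]), duality gives that the
    integral of |W|u^2 is at most C times the Kato norm of W times the squared norm of the gradient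
    of u ([form_bound]).

    Decay. Split V = phi + W with phi bounded of compact support and W of small Kato norm. The
    weight [ww] = e^{-mu|x|}/(1+|x|) satisfies T(|W| ww) <= 2 ||W|| ww ([tt_ww_le]), and T(|phi||u|)
    <= C ww. Hence the excess m = (|u| - K ww)_+ obeys c m <= T(|W| m) for a suitable K. Multiplying
    by |W| m and integrating gives c q <= 2 ||W|| q, where q is the integral of |W| m^2. It is
    finite by the form bound, so q = 0 when 2 ||W|| < c, and then m = 0. Thus |u| <= K ww
    ([eigenfunction_decay]).

    Finiteness. Finitely many linear conditions on the gradient of u make u small on the ball
    carrying phi, unless the quadratic form of H is positive at u ([weq_form_eq0]). By linear
    algebra an orthonormal family of eigenfunctions with negative eigenvalues has bounded size
    ([eig_count]). So each eigenspace has a finite basis ([eig_basis]) and only finitely many mu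
    occur ([finitely_many_eig]).

    Conclusion. The projection has kernel P(x,y) = sum_k u_k(x) u_k(y), so |P(x,y)| <= N K^2 ww(x)
    ww(y). By the triangle inequality this is at most N K^2 e^{-mu|x-y|}/(1+|x-y|) ([ww_mul_le]),
    and r^a <= 1 + r for 0 <= a <= 1. The power mu^{2-a} is absorbed in a constant depending on mu
    ([scale_le]), and C is the maximum over the finitely many mu. The case a = 1 is the first
    estimate. *)

(** * Real square-integrable functions and their inner product *)

Section Square_integrable.
Context d (T : measurableType d) (R : realType).
Variable mu : {measure set T -> \bar R}.
Implicit Types f g h : T -> R.

Definition L2r f := measurable_fun setT f /\
  (\int[mu]_x ((f x) ^+ 2)%:E < +oo)%E.

Definition ip f g := \int[mu]_x (f x * g x).

Lemma integrable_of_le f h : measurable_fun setT f -> (forall x, `|f x| <= h x) ->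
  measurable_fun setT h -> (\int[mu]_x (h x)%:E < +oo)%E ->
  mu.-integrable setT (EFin \o f).
Proof.
move=> mf fh mh hoo; apply/integrableP; split; first exact/measurable_EFinP.
apply: le_lt_trans hoo; apply: ge0_le_integral => //.
- by apply/measurableT_comp => //; exact/measurable_EFinP.
- exact/measurable_EFinP.
- by move=> x _; rewrite /= lee_fin.
Qed.

Lemma L2r_mul f g : L2r f -> L2r g ->
  mu.-integrable setT (EFin \o (fun x => f x * g x)).
Proof.
move=> [mf fo] [mg go].
apply: (@integrable_of_le _ (fun x => f x ^+ 2 + g x ^+ 2)).
- exact: measurable_funM.
- move=> x; rewrite normrM.
  have := sqr_ge0 (`|f x| - `|g x|); rewrite sqrrB !real_normK ?num_real//.
  have : 0 <= `|f x| * `|g x| by rewrite mulr_ge0.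
  rewrite -mulr_natr; lra.
- by apply: measurable_funD; exact: measurable_funX.
- under eq_integral do rewrite EFinD.
  rewrite ge0_integralD//=.
  + by rewrite lte_add_pinfty.
  + by move=> x _; rewrite lee_fin sqr_ge0.
  + by apply/measurable_EFinP; exact: measurable_funX.
  + by move=> x _; rewrite lee_fin sqr_ge0.
  + by apply/measurable_EFinP; exact: measurable_funX.
Qed.

Lemma L2r_le f g : measurable_fun setT f -> (forall x, `|f x| <= `|g x|) ->
  L2r g -> L2r f.
Proof.
move=> mf fg [mg go]; split => //; apply: le_lt_trans go.
apply: ge0_le_integral => //.
- by move=> x _; rewrite lee_fin sqr_ge0.
- by apply/measurable_EFinP; exact: measurable_funX.
- by apply/measurable_EFinP; exact: measurable_funX.
- move=> x _; rewrite lee_fin -[f x ^+ 2]real_normK ?num_real//.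
  by rewrite -[g x ^+ 2]real_normK ?num_real// ler_pXn2r ?nnegrE.
Qed.

Lemma L2rD f g : L2r f -> L2r g -> L2r (fun x => f x + g x).
Proof.
move=> lf lg; have [mf fo] := lf; have [mg go] := lg.
split; first exact: measurable_funD.
have -> : (\int[mu]_x ((f x + g x) ^+ 2)%:E = \int[mu]_x (((f x) ^+2)%:E
   + (2 * (f x * g x))%:E + ((g x) ^+ 2)%:E))%E.
  by apply: eq_integral => x _; rewrite -!EFinD; congr EFin; ring.
have i1 : mu.-integrable setT (fun x => ((f x) ^+ 2)%:E).
  by under eq_fun do rewrite expr2; exact: L2r_mul.
have i2 : mu.-integrable setT (fun x => ((g x) ^+ 2)%:E).
  by under eq_fun do rewrite expr2; exact: L2r_mul.
have i3 : mu.-integrable setT (fun x => (2 * (f x * g x))%:E).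
  by under eq_fun do rewrite EFinM; apply: integrableZl => //; exact: L2r_mul.
apply: integrable_lty => //; apply: integrableD => //; exact: integrableD.
Qed.

Lemma L2rZ c f : L2r f -> L2r (fun x => c * f x).
Proof.
move=> [mf fo]; split; first exact: measurable_funM.
under eq_integral do rewrite exprMn EFinM.
rewrite ge0_integralZl//.
- by rewrite lte_mul_pinfty// lee_fin sqr_ge0.
- by apply/measurable_EFinP; exact: measurable_funX.
- by move=> x _; rewrite lee_fin sqr_ge0.
- by rewrite lee_fin sqr_ge0.
Qed.

Lemma L2rN f : L2r f -> L2r (fun x => - f x).
Proof.
by move=> /(L2rZ (-1)); under eq_fun do rewrite mulN1r.
Qed.

Lemma L2rB f g : L2r f -> L2r g -> L2r (fun x => f x - g x).
Proof. by move=> lf lg; apply: L2rD => //; exact: L2rN. Qed.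

Lemma L2r0 : L2r (fun=> 0).
Proof. by split => //; under eq_integral do rewrite expr0n; rewrite integral0. Qed.

Lemma L2r_sum (I : Type) (s : seq I) (F : I -> T -> R) :
  (forall i, L2r (F i)) -> L2r (fun x => \sum_(i <- s) F i x).
Proof.
move=> LF; elim: s => [|i s IH].
  by under eq_fun do rewrite big_nil; exact: L2r0.
by under eq_fun do rewrite big_cons; exact: L2rD.
Qed.

Lemma L2r_norm f : L2r f -> L2r (fun x => `|f x|).
Proof.
move=> lf; apply: L2r_le (lf) => [|x]; last by rewrite normr_id.
by apply: measurableT_comp => //; case: lf.
Qed.

Lemma ipC f g : ip f g = ip g f.
Proof. by rewrite /ip; under eq_Rintegral do rewrite mulrC. Qed.

Lemma ipDl f g h : L2r f -> L2r g -> L2r h ->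
  ip (fun x => f x + g x) h = ip f h + ip g h.
Proof.
move=> lf lg lh; rewrite /ip; under eq_Rintegral do rewrite mulrDl.
by rewrite RintegralD//; exact: L2r_mul.
Qed.

Lemma ipZl c f h : L2r f -> L2r h -> ip (fun x => c * f x) h = c * ip f h.
Proof.
move=> lf lh; rewrite /ip; under eq_Rintegral do rewrite -mulrA.
by rewrite RintegralZl//; exact: L2r_mul.
Qed.

Lemma ipNl f h : L2r f -> L2r h -> ip (fun x => - f x) h = - ip f h.
Proof.
move=> lf lh; rewrite -[RHS]mulN1r -ipZl//; congr ip.
by apply/funext => x; rewrite mulN1r.
Qed.

Lemma ipBl f g h : L2r f -> L2r g -> L2r h ->
  ip (fun x => f x - g x) h = ip f h - ip g h.
Proof. by move=> lf lg lh; rewrite ipDl// ?ipNl//; exact: L2rN. Qed.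

Lemma ip_suml (I : Type) (s : seq I) (F : I -> T -> R) h :
  (forall i, L2r (F i)) -> L2r h ->
  ip (fun x => \sum_(i <- s) F i x) h = \sum_(i <- s) ip (F i) h.
Proof.
move=> LF lh; elim: s => [|i s IH].
  rewrite big_nil /ip; under eq_Rintegral do rewrite big_nil mul0r.
  by rewrite /Rintegral integral0.
rewrite big_cons -IH -ipDl//; last exact: L2r_sum.
by congr ip; apply/funext => x; rewrite big_cons.
Qed.

Lemma ip_ge0 f : 0 <= ip f f.
Proof. by apply: Rintegral_ge0 => x _; rewrite -expr2 sqr_ge0. Qed.

Lemma ipE f : L2r f -> (\int[mu]_x ((f x) ^+ 2)%:E = (ip f f)%:E)%E.
Proof.
move=> lf; rewrite /ip /Rintegral fineK//.
by apply: integrable_fin_num => //; exact: L2r_mul.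
Qed.

Lemma ip_cauchy_schwarz f g : L2r f -> L2r g -> ip f g ^+ 2 <= ip f f * ip g g.
Proof.
move=> lf lg.
have key s : 0 <= ip f f - 2 * s * ip f g + s ^+ 2 * ip g g.
  have := ip_ge0 (fun x => f x - s * g x).
  have lsg := L2rZ s lg; have lb := L2rB lf lsg.
  rewrite ipBl// ipZl// !(ipC _ (fun x => f x - s * g x)) !ipBl// !ipZl// (ipC g f).
  by rewrite (_ : _ - _ = ip f f - 2 * s * ip f g + s ^+ 2 * ip g g)//; ring.
have [g0|g0] := eqVneq (ip g g) 0.
  rewrite g0 mulr0.
  have [->|fg] := eqVneq (ip f g) 0; first by rewrite expr0n.
  (* With [ip g g = 0] the quadratic [key] is affine in its parameter; this value makes it equal to
     -1. *)
  have := key ((ip f f + 1) / (2 * ip f g)).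
  rewrite g0 mulr0 addr0.
  rewrite (_ : 2 * _ * _ = ip f f + 1); first lra.
  by field.
have gp : 0 < ip g g by rewrite lt0r g0 ip_ge0.
have := key (ip f g / ip g g).
rewrite (_ : _ + _ = (ip f f * ip g g - ip f g ^+ 2) / ip g g); last by field.
by rewrite pmulr_lge0 ?invr_gt0// subr_ge0.
Qed.

Lemma ip_eq0 f : L2r f -> ip f f = 0 -> {ae mu, forall x, f x = 0}.
Proof.
move=> lf f0; have := ipE lf; rewrite f0 => I0.
have := (ae_eq_integral_abs mu measurableT
  (f := fun x => ((f x) ^+ 2)%:E)).
move=> /(_ _)[].
  by apply/measurable_EFinP; apply: measurable_funX; case: lf.
move=> + _ => /(_ _).
have -> : (\int[mu]_x `|((f x) ^+ 2)%:E| = 0)%E.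
  by apply: etrans I0; apply: eq_integral => x _; rewrite /= ger0_norm// sqr_ge0.
move=> /(_ erefl); apply: filterS => x /(_ I)/= [] /eqP.
by rewrite sqrf_eq0 => /eqP.
Qed.

Lemma ip_ae f f' g : measurable_fun setT f -> measurable_fun setT f' ->
  measurable_fun setT g ->
  {ae mu, forall x, f x = f' x} -> ip f g = ip f' g.
Proof.
move=> mf mf' mg ff'; rewrite /ip /Rintegral; congr fine.
apply: ae_eq_integral => //.
- by apply/measurable_EFinP; exact: measurable_funM.
- by apply/measurable_EFinP; exact: measurable_funM.
- by apply: filterS ff' => x -> _.
Qed.

(* Bessel's inequality: expand |f - sum_i <f,e_i> e_i|^2 >= 0. *)
Lemma bessel n (e : 'I_n -> T -> R) f : (forall i, L2r (e i)) -> L2r f ->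
  (forall i j, ip (e i) (e j) = (i == j)%:R) ->
  \sum_i ip f (e i) ^+ 2 <= ip f f.
Proof.
move=> le lf on.
pose s x := \sum_i (ip f (e i) * e i x).
have les i : L2r (fun x => ip f (e i) * e i x) by exact: L2rZ.
have ls : L2r s by exact: L2r_sum.
have := ip_ge0 (fun x => f x - s x).
have sh h : L2r h -> ip s h = \sum_i ip f (e i) * ip (e i) h.
  by move=> lh; rewrite ip_suml//; apply: eq_bigr => i _; rewrite ipZl.
rewrite ipBl//; last exact: L2rB.
rewrite ![ip _ (fun x => f x - s x)]ipC !ipBl// (ipC f s) !sh//.
have -> : \sum_i ip f (e i) * ip (e i) s = \sum_i ip f (e i) * ip (e i) f.
  apply: eq_bigr => i _; congr (_ * _).
  rewrite ipC sh// (bigD1 i)//= on eqxx mulr1 big1 ?addr0 1?ipC// => j ji.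
  by rewrite on (negbTE ji) mulr0.
rewrite subrr subr0 subr_ge0; apply: le_trans.
by under eq_bigr do rewrite expr2 {2}ipC.
Qed.

End Square_integrable.

(** * Translation invariance, the Euclidean norm and Tonelli on [space3] *)

Lemma ge0_integral_shift1 (R : realType) (z : R) (f : R -> \bar R) :
  measurable_fun setT f -> (forall x, 0 <= f x)%E ->
  (\int[@lebesgue_measure R]_x f (x + z)%R = \int[@lebesgue_measure R]_x f x)%E.
Proof.
move=> mf f0.
pose phi : measurableTypeR R -> measurableTypeR R := fun x => x + z.
have mphi : measurable_fun setT phi by exact: measurable_funD.
have E (A : set R) : measurable A ->
    lebesgue_measure A = pushforward (@lebesgue_measure R) phi A.
  move=> mA; apply: lebesgue_measure_unique => //= _ [[a b]] _ <-.
  rewrite /pushforward /=.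
  have -> : phi @^-1` `]a, b] = `]a - z, b - z]%classic.
    apply/seteqP; split => x /=; rewrite !in_itv/= /phi.
      by move=> /andP[? ?]; apply/andP; split; lra.
    by move=> /andP[? ?]; apply/andP; split; lra.
  rewrite !lebesgue_measure_itv/= !lte_fin ltrD2r; case: ifP => // _.
  by rewrite -!EFinB; congr EFin; lra.
rewrite -[LHS](@ge0_integral_pushforward _ _ _ _ _ phi mphi _ setT f)//.
by apply: eq_measure_integral => A mA _; apply/esym; exact: E.
Qed.

(** Tonelli reduces measure preservation of a product map to that of its factors. Used twice, it
    lifts translation invariance from the line to [lebesgue3]. *)
Lemma ge0_integral_comp_prod d1 d2 (T1 : measurableType d1)
    (T2 : measurableType d2) (R : realType)
    (m1 : {sigma_finite_measure set T1 -> \bar R})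
    (m2 : {sigma_finite_measure set T2 -> \bar R}) (t1 : T1 -> T1) (t2 : T2 -> T2) :
  measurable_fun setT t1 -> measurable_fun setT t2 ->
  (forall f, measurable_fun setT f -> (forall x, 0 <= f x)%E ->
     \int[m1]_x f (t1 x) = \int[m1]_x f x)%E ->
  (forall f, measurable_fun setT f -> (forall x, 0 <= f x)%E ->
     \int[m2]_x f (t2 x) = \int[m2]_x f x)%E ->
  forall f, measurable_fun setT f -> (forall x, 0 <= f x)%E ->
     (\int[m1 \x m2]_x f (t1 x.1, t2 x.2) = \int[m1 \x m2]_x f x)%E.
Proof.
move=> mt1 mt2 H1 H2 f mf f0.
have mg : measurable_fun setT (fun x : T1 * T2 => f (t1 x.1, t2 x.2)).
  apply: (measurableT_comp mf); apply: measurable_fun_pair.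
  - exact: measurableT_comp.
  - exact: measurableT_comp.
rewrite (fubini_tonelli1 (fun x => f (t1 x.1, t2 x.2)))//= (fubini_tonelli1 f)//.
rewrite -(H1 (fubini_F m2 f)).
- apply: eq_integral => x _; rewrite /fubini_F /=.
  rewrite (H2 (fun y => f (t1 x, y)))//.
  exact: measurableT_comp.
- exact: measurable_fun_fubini_tonelli_F.
- by move=> x; exact: integral_ge0.
Qed.

Section R3.
Variable R : realType.
Local Notation sp := (space3 R).
Local Notation mu3 := (@lebesgue3 R).
Implicit Types (x y z : sp).

Lemma measurable_fun_space3 d (T : measurableType d) (h : T -> sp) :
  measurable_fun setT (fun t => (h t).1.1) ->
  measurable_fun setT (fun t => (h t).1.2) ->
  measurable_fun setT (fun t => (h t).2) -> measurable_fun setT h.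
Proof.
move=> m1 m2 m3; rewrite (_ : h = fun t => ((h t).1.1, (h t).1.2, (h t).2)).
  by apply: measurable_fun_pair => //; exact: measurable_fun_pair.
by apply/funext => t; case: (h t) => -[].
Qed.

Lemma measurable_co1 : measurable_fun setT (fun x : sp => x.1.1).
Proof. by apply: measurableT_comp => //; exact: measurable_fst. Qed.

Lemma measurable_co2 : measurable_fun setT (fun x : sp => x.1.2).
Proof. by apply: measurableT_comp => //; exact: measurable_fst. Qed.

Lemma measurable_co3 : measurable_fun setT (fun x : sp => x.2).
Proof. exact: measurable_snd. Qed.

Lemma measurable_add d (T : measurableType d) (f g : T -> sp) :
  measurable_fun setT f -> measurable_fun setT g ->
  measurable_fun setT (fun t => f t + g t).
Proof.
move=> mf mg; apply: measurable_fun_space3 => /=; apply: measurable_funD.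
- exact: (measurableT_comp measurable_co1).
- exact: (measurableT_comp measurable_co1).
- exact: (measurableT_comp measurable_co2).
- exact: (measurableT_comp measurable_co2).
- exact: (measurableT_comp measurable_co3).
- exact: (measurableT_comp measurable_co3).
Qed.

Lemma measurable_opp d (T : measurableType d) (f : T -> sp) :
  measurable_fun setT f -> measurable_fun setT (fun t => - f t).
Proof.
move=> mf; apply: measurable_fun_space3 => /=; apply: measurableT_comp => //.
- exact: (measurableT_comp measurable_co1).
- exact: (measurableT_comp measurable_co2).
- exact: (measurableT_comp measurable_co3).
Qed.

Lemma measurable_sub d (T : measurableType d) (f g : T -> sp) :
  measurable_fun setT f -> measurable_fun setT g ->
  measurable_fun setT (fun t => f t - g t).
Proof. by move=> mf mg; apply: measurable_add => //; exact: measurable_opp. Qed.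

Lemma ge0_integral_shift (z : sp) (f : sp -> \bar R) :
  measurable_fun setT f -> (forall x, 0 <= f x)%E ->
  (\int[mu3]_x f (x + z)%R = \int[mu3]_x f x)%E.
Proof.
move=> mf f0; rewrite /lebesgue3.
have a1 (t : R) : measurable_fun setT (fun p : measurableTypeR R => p + t).
  exact: measurable_funD.
have a2 : measurable_fun setT (fun p : R * R => (p.1 + z.1.1, p.2 + z.1.2)).
  apply: measurable_fun_pair; apply: measurable_funD => //.
have H := @ge0_integral_comp_prod _ _ _ _ _ (@lebesgue2 R) (@lebesgue_measure R)
  (fun p => (p.1 + z.1.1, p.2 + z.1.2)) (fun p => p + z.2) a2 (a1 _).
apply: H => //.
- move=> g mg g0; rewrite /lebesgue2.
  have H' := @ge0_integral_comp_prod _ _ _ _ _ (@lebesgue_measure R)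
    (@lebesgue_measure R) (fun p => p + z.1.1) (fun p => p + z.1.2) (a1 _) (a1 _).
  apply: H' => //.
  + exact: ge0_integral_shift1.
  + exact: ge0_integral_shift1.
- exact: ge0_integral_shift1.
Qed.

Definition n2 x : R := x.1.1 ^+ 2 + x.1.2 ^+ 2 + x.2 ^+ 2.

Lemma n2_ge0 x : 0 <= n2 x.
Proof. by rewrite /n2 !addr_ge0// sqr_ge0. Qed.

Lemma enormE x : enorm x = Num.sqrt (n2 x). Proof. by []. Qed.

Lemma enorm_ge0 x : 0 <= enorm x. Proof. exact: sqrtr_ge0. Qed.

Lemma enorm_sqr x : enorm x ^+ 2 = n2 x.
Proof. by rewrite sqr_sqrtr// n2_ge0. Qed.

Lemma enorm_eq0 x : enorm x = 0 -> x = 0.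
Proof.
move=> /eqP; rewrite sqrtr_eq0 => h.
have {h} : n2 x = 0 by apply/eqP; rewrite eq_le h n2_ge0.
case: x => -[a b] c; rewrite /n2/= => /eqP.
rewrite !paddr_eq0 ?addr_ge0 ?sqr_ge0// !sqrf_eq0.
by move=> /andP[/andP[/eqP-> /eqP->] /eqP->].
Qed.

Lemma enorm0 : enorm (0 : sp) = 0.
Proof. by rewrite enormE /n2/= expr0n/= !addr0 sqrtr0. Qed.

Lemma enorm_gt0 x : x != 0 -> 0 < enorm x.
Proof.
move=> x0; rewrite lt0r enorm_ge0 andbT; apply: contra x0 => /eqP/enorm_eq0 ->.
exact: eqxx.
Qed.

Lemma enormN x : enorm (- x) = enorm x.
Proof. by rewrite !enormE; congr Num.sqrt; rewrite /n2/= !sqrrN. Qed.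

Lemma enormB x y : enorm (x - y) = enorm (y - x).
Proof. by rewrite -enormN opprB. Qed.

Lemma enormD x y : enorm (x + y) <= enorm x + enorm y.
Proof.
have h0 : 0 <= enorm x + enorm y by rewrite addr_ge0 ?enorm_ge0.
rewrite -(@ler_pXn2r _ 2)// ?nnegrE ?enorm_ge0//.
rewrite sqrrD !enorm_sqr.
have : x.1.1 * y.1.1 + x.1.2 * y.1.2 + x.2 * y.2 <= enorm x * enorm y.
  apply: le_trans (ler_norm _) _.
  rewrite -(@ler_pXn2r _ 2)// ?nnegrE ?mulr_ge0 ?enorm_ge0//.
  rewrite real_normK ?num_real// exprMn !enorm_sqr /n2 -subr_ge0.
  rewrite (_ : _ - _ = (x.1.1 * y.1.2 - x.1.2 * y.1.1) ^+ 2
     + (x.1.1 * y.2 - x.2 * y.1.1) ^+ 2 + (x.1.2 * y.2 - x.2 * y.1.2) ^+ 2).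
    by rewrite !addr_ge0// sqr_ge0.
  by ring.
by rewrite /n2/= mulr2n => h; lra.
Qed.

Lemma enorm_triangle y x z : enorm (x - z) <= enorm (x - y) + enorm (y - z).
Proof. by apply: le_trans (enormD _ _); rewrite addrA subrK. Qed.

Lemma measurable_n2 : measurable_fun setT n2.
Proof.
have [m1 m2 m3] := And3 measurable_co1 measurable_co2 measurable_co3.
apply: measurable_funD; [apply: measurable_funD|]; exact: measurable_funX.
Qed.

Lemma measurable_enorm : measurable_fun setT (@enorm R).
Proof. by apply: measurableT_comp; [exact: (continuous_measurable_fun (@sqrt_continuous R))|exact: measurable_n2]. Qed.

Definition ball3 (r : R) : set sp := [set x | enorm x <= r].

Lemma measurable_ball3 r : measurable (ball3 r).
Proof.
rewrite (_ : ball3 r = setT `&` (@enorm R) @^-1` `]-oo, r]%classic).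
  by apply: measurable_enorm => //; exact: measurable_itv.
by apply/seteqP; split => x /=; rewrite in_itv/= ?andbT; [split|case].
Qed.

Lemma coord_le_enorm x : [/\ `|x.1.1| <= enorm x, `|x.1.2| <= enorm x & `|x.2| <= enorm x].
Proof.
have h (a : R) : a ^+ 2 <= n2 x -> `|a| <= enorm x.
  by move=> ax; rewrite enormE -sqrtr_sqr ler_wsqrtr.
have := sqr_ge0 x.1.1; have := sqr_ge0 x.1.2; have := sqr_ge0 x.2.
by move=> *; split; apply: h; rewrite /n2; lra.
Qed.

(** The cube of side 2r contains the ball. Throughout, only cubic upper and lower bounds for the
    volume are needed, so no spherical coordinates enter. *)
Lemma lebesgue3_ball_le r : 0 <= r -> (mu3 (ball3 r) <= (8 * r ^+ 3)%:E)%E.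
Proof.
move=> r0.
have mi : measurable (`[-r, r]%classic : set (measurableTypeR R)) by exact: measurable_itv.
pose Q : set sp := (`[-r, r]%classic `*` `[-r, r]%classic) `*` `[-r, r]%classic.
have mQ : measurable Q by apply: measurableX => //; exact: measurableX.
apply: (@le_trans _ _ (mu3 Q)).
  apply: le_measure; rewrite ?inE//; first exact: measurable_ball3.
  move=> x /=; rewrite /ball3 /= => xr; have [h1 h2 h3] := coord_le_enorm x.
  by rewrite /Q /= !in_itv/= -!ler_norml; split; [split|];
    apply: le_trans xr.
pose I : set (measurableTypeR R) := `[-r, r]%classic.
have -> : mu3 Q = ((@lebesgue_measure R) I * (@lebesgue_measure R) I
    * (@lebesgue_measure R) I)%E.
  have E1 : mu3 Q = ((@lebesgue2 R) (I `*` I) * (@lebesgue_measure R) I)%E.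
    by apply: product_measure1E => //; exact: measurableX.
  have E2 : (@lebesgue2 R) (I `*` I) = ((@lebesgue_measure R) I * (@lebesgue_measure R) I)%E.
    exact: product_measure1E.
  by rewrite E1 E2.
rewrite /I !lebesgue_measure_itv/= !lte_fin.
case: ifPn => h; last by rewrite !mul0e lee_fin mulr_ge0// exprn_ge0.
by rewrite -EFinB -!EFinM lee_fin le_eqVlt; apply/orP; left; apply/eqP; ring.
Qed.

Lemma tonelli3 (f : sp -> sp -> \bar R) :
  measurable_fun setT (fun p : sp * sp => f p.1 p.2) ->
  (forall x y, 0 <= f x y)%E ->
  (\int[mu3]_x \int[mu3]_y f x y = \int[mu3]_y \int[mu3]_x f x y)%E.
Proof.
move=> mf f0; have H := @fubini_tonelli _ _ _ _ R mu3 mu3 (fun p => f p.1 p.2) mf.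
apply: H => -[x y]; exact: f0.
Qed.

Lemma measurable_int1 (f : sp -> sp -> \bar R) :
  measurable_fun setT (fun p : sp * sp => f p.1 p.2) ->
  (forall x y, 0 <= f x y)%E ->
  measurable_fun setT (fun x => \int[mu3]_y f x y)%E.
Proof.
move=> mf f0.
exact: (@measurable_fun_fubini_tonelli_F _ _ _ _ R mu3 (fun p => f p.1 p.2)).
Qed.

Lemma measurable_int2 (f : sp -> sp -> \bar R) :
  measurable_fun setT (fun p : sp * sp => f p.1 p.2) ->
  (forall x y, 0 <= f x y)%E ->
  measurable_fun setT (fun y => \int[mu3]_x f x y)%E.
Proof.
move=> mf f0.
exact: (@measurable_fun_fubini_tonelli_G _ _ _ _ R mu3 (fun p => f p.1 p.2)).
Qed.

End R3.

(** * Integrals of |x|^{-2} near the origin and of |x|^{-4} far from it *)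

Section Kernels.
Variable R : realType.
Local Notation sp := (space3 R).
Local Notation mu3 := (@lebesgue3 R).

(** Since 1/t = t (t^2)^{-1}, also at t = 0, the inverse reduces to a real power of a nonnegative
    base, which is measurable. *)
Lemma measurable_funV d (T : measurableType d) (f : T -> R) :
  measurable_fun setT f -> measurable_fun setT (fun t => (f t)^-1).
Proof.
move=> mf; rewrite (_ : (fun t => _) = (fun t => f t * (f t ^+ 2) `^ (-1))).
  apply: measurable_funM => //.
  apply: (@measurableT_comp _ _ _ _ _ _ (fun a : R => a `^ (-1)) _ (fun t => f t ^+ 2)).
    exact: measurable_powR.
  exact: measurable_funX.
apply/funext => t; rewrite powR_inv1 ?sqr_ge0// expr2.
have [->|h] := eqVneq (f t) 0; first by rewrite invr0 mul0r.
by rewrite invfM mulrA divff// mul1r.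
Qed.

(** On the k-th dyadic shell f is at most [a k], and the shell lies in the ball of radius [b k]. So
    f is dominated by the series of [a k] times the indicators of these balls, and the hypothesis on
    [a k * (8 * b k ^+ 3)] makes the integrals a geometric series. *)
Lemma dyadic_bound (D : set sp) (f : sp -> R) (a b : nat -> R) (M : R) :
  measurable D -> measurable_fun D f -> (forall x, D x -> 0 <= f x) ->
  (forall k, 0 <= a k) -> (forall k, 0 <= b k) ->
  (forall x, D x -> f x = 0 \/ exists2 k, f x <= a k & enorm x <= b k) ->
  (forall k, a k * (8 * b k ^+ 3) <= 2 * M / (2 ^ (k + 1))%:R) ->
  (\int[mu3]_(x in D) (f x)%:E <= (2 * M)%:E)%E.
Proof.
move=> mD mf f0 a0 b0 fab abM.
have M0 : 0 <= 2 * M.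
  have : 0 <= 2 * M / (2 ^ (0 + 1))%:R.
    by apply: le_trans (abM 0%N); rewrite !mulr_ge0// exprn_ge0.
  by rewrite pmulr_lge0// invr_gt0 ltr0n.
pose g (k : nat) (x : sp) := ((a k)%:E * (\1_(ball3 (b k)) x)%:E)%E.
have mg k : measurable_fun setT (g k).
  apply/measurable_EFinP; apply: measurable_funM => //.
  by apply: measurable_indic; exact: measurable_ball3.
have g0 k x : (0 <= g k x)%E by rewrite mule_ge0 ?lee_fin// indicE.
apply: (@le_trans _ _ (\int[mu3]_(x in D) \sum_(k <oo) g k x)%E).
  apply: ge0_le_integral => //.
  - exact/measurable_EFinP.
  - apply: measurable_funTS.
    have := @ge0_emeasurable_sum _ _ _ setT g xpredT.
    by apply => // k x _ _; exact: g0.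
  - move=> x Dx; have [->|[k fk bk]] := fab x Dx.
      by apply: nneseries_ge0 => n _ _; exact: g0.
    apply: (@le_trans _ _ (g k x)).
      by rewrite /g indicE mem_set//= mule1 lee_fin.
    apply: le_trans (nneseries_lim_ge k.+1 _) => //.
    rewrite big_nat_recr//= leeDr// sume_ge0// => i _; exact: g0.
rewrite integral_nneseries//; last first.
  by move=> k; apply: measurable_funTS; exact: mg.
rewrite (_ : (2 * M)%:E = \sum_(k <oo) (2 * M / (2 ^ (k + 1))%:R)%:E)%E; last first.
  apply/esym/cvg_lim => //.
  have := @cvg_geometric_eseries_half R (2 * M) 0.
  by rewrite expr0 divr1.
apply: lee_nneseries => [i _ _|k _]; first exact: integral_ge0.
have mi : measurable_fun setT (fun x => (\1_(ball3 (b k)) x)%:E : \bar R).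
  by apply/measurable_EFinP; apply: measurable_indic; exact: measurable_ball3.
rewrite (ge0_integralZl mu3 mD (measurable_funTS mi))//; last by rewrite lee_fin.
rewrite integral_indic//; last exact: measurable_ball3.
apply: le_trans (_ : ((a k)%:E * (8 * b k ^+ 3)%:E <= _)%E); last first.
  by rewrite -EFinM lee_fin abM.
apply: lee_wpmul2l; rewrite ?lee_fin//.
apply: le_trans (lebesgue3_ball_le (b0 k)).
apply: le_measure; rewrite ?inE//; last exact: measurable_ball3.
by apply: measurableI => //; exact: measurable_ball3.
Qed.

Lemma dyadic_scale (t : R) : 1 <= t -> exists k : nat, 2 ^+ k <= t < 2 ^+ k.+1.
Proof.
move=> t1.
have ex : exists n, t < 2 ^+ n.
  exists (Num.truncn t).+1; apply: lt_le_trans (truncnS_gt t) _.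
  by rewrite -natrX ler_nat; apply: leq_trans (ltn_expl _ _).
pose n := ex_minn ex.
have hn : t < 2 ^+ n by rewrite /n; case: ex_minnP.
have hm m : t < 2 ^+ m -> (n <= m)%N by rewrite /n; case: ex_minnP => ? ? h /h.
have : n != 0%N by apply/eqP => n0; move: hn; rewrite n0 expr0 ltNge t1.
case: n hn hm => // k hk hm _; exists k; rewrite hk andbT leNgt; apply/negP => /hm.
by rewrite ltnn.
Qed.

Lemma n2_gt0 (x : sp) : x != 0 -> 0 < n2 x.
Proof. by move=> x0; rewrite -enorm_sqr exprn_gt0// enorm_gt0. Qed.

(** Shells r/2^{k+1} < |x| <= r/2^k: the k-th contributes at most (4^{k+1}/r^2) 8 (r/2^k)^3 = 32
    r/2^k. *)
Lemma int_ball_inv2 (r : R) : 0 < r ->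
  (\int[mu3]_(x in ball3 r) ((n2 x)^-1)%:E <= (64 * r)%:E)%E.
Proof.
move=> r0; rewrite (_ : 64 * r = 2 * (32 * r)); last by ring.
apply: (@dyadic_bound _ _ (fun k => 4 ^+ k.+1 / r ^+ 2) (fun k => r / 2 ^+ k)).
- exact: measurable_ball3.
- by apply: measurable_funTS; apply: measurable_funV; exact: measurable_n2.
- by move=> x _; rewrite invr_ge0 n2_ge0.
- by move=> k; rewrite divr_ge0// exprn_ge0// ltW.
- by move=> k; rewrite divr_ge0 ?exprn_ge0// ltW.
- move=> x /= xr; have [->|x0] := eqVneq x 0.
    by left; rewrite -enorm_sqr enorm0 expr0n/= invr0.
  right; have ex := enorm_gt0 x0.
  have [|k /andP[k1 k2]] := @dyadic_scale (r / enorm x).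
    by rewrite ler_pdivlMr// mul1r.
  exists k; last first.
    by rewrite ler_pdivlMr ?exprn_gt0// mulrC -ler_pdivlMr.
  rewrite -enorm_sqr (_ : 4 = 2 ^+ 2); last by ring.
  rewrite -exprM mulnC exprM -expr_div_n -exprVn.
  rewrite ler_pXn2r ?nnegrE ?invr_ge0 ?enorm_ge0 ?divr_ge0 ?exprn_ge0 ?(ltW r0)//.
  by rewrite ler_pdivlMr// mulrC ltW.
- move=> k; rewrite natrX exprD expr1 le_eqVlt; apply/orP; left; apply/eqP.
  rewrite exprS (_ : 4 ^+ k = (2 ^+ k) ^+ 2 :> R).
    have : 2 ^+ k != 0 :> R by rewrite expf_neq0.
    by move=> h; field; rewrite h gt_eqF.
  by rewrite -exprM mulnC exprM; congr (_ ^+ _); ring.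
Qed.

(** Shells r 2^k <= |x| < r 2^{k+1}: the k-th contributes at most 8 (r 2^{k+1})^3/(16^k r^4) = 64/(r
    2^k). *)
Lemma int_far_inv4 (r : R) : 0 < r ->
  (\int[mu3]_(x in ~` ball3 r) ((n2 x ^+ 2)^-1)%:E <= (128 / r)%:E)%E.
Proof.
move=> r0; rewrite (_ : 128 / r = 2 * (64 / r)); last by ring.
apply: (@dyadic_bound _ _ (fun k => ((16 ^+ k) * r ^+ 4)^-1) (fun k => r * 2 ^+ k.+1)).
- by apply: measurableC; exact: measurable_ball3.
- apply: measurable_funTS; apply: measurable_funV.
  by apply: measurable_funX; exact: measurable_n2.
- by move=> x _; rewrite invr_ge0 exprn_ge0// n2_ge0.
- by move=> k; rewrite invr_ge0 mulr_ge0// exprn_ge0// ltW.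
- by move=> k; rewrite mulr_ge0 ?exprn_ge0// ltW.
- move=> x /= /negP; rewrite -ltNge => xr; right.
  have [|k /andP[k1 k2]] := @dyadic_scale (enorm x / r).
    by rewrite ler_pdivlMr// mul1r ltW.
  exists k; last by rewrite mulrC -ler_pdivrMr// ltW.
  rewrite -enorm_sqr -exprM lef_pV2 ?posrE ?exprn_gt0 ?mulr_gt0 ?exprn_gt0//; last exact: lt_trans xr.
  rewrite (_ : 16 = 2 ^+ 4); last by ring.
  rewrite -exprM mulnC exprM -exprMn.
  rewrite ler_pXn2r ?nnegrE ?mulr_ge0 ?exprn_ge0 ?enorm_ge0 ?(ltW r0)//.
  by rewrite -ler_pdivlMr.
- move=> k; rewrite natrX exprD expr1 le_eqVlt; apply/orP; left; apply/eqP.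
  rewrite (exprS 2 k) (_ : 16 ^+ k = (2 ^+ k) ^+ 4 :> R).
    have : 2 ^+ k != 0 :> R by rewrite expf_neq0.
    by move=> h; field; rewrite h gt_eqF.
  by rewrite -exprM mulnC exprM; congr (_ ^+ _); ring.
Qed.

End Kernels.

(** * Continuous functions are measurable for the product sigma-algebra *)

Section Continuous_measurable.
Variable R : realType.
Local Notation sp := (space3 R).

(** An open set is the countable union of the boxes with rational centre and radius 1/(n+1) that it
    contains. *)
Lemma open_measurable3 (U : set sp) : open U -> measurable U.
Proof.
move=> oU.
pose B (q1 q2 q3 : rat) (n : nat) : set sp :=
  (ball (ratr q1 : R) n.+1%:R^-1 `*` ball (ratr q2 : R) n.+1%:R^-1) `*`
   ball (ratr q3 : R) n.+1%:R^-1.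
have mB q1 q2 q3 n : measurable (B q1 q2 q3 n).
  by apply: measurableX; [apply: measurableX|]; exact: measurable_ball.
have -> : U = \bigcup_q1 \bigcup_q2 \bigcup_q3 \bigcup_n
    (if `[< B q1 q2 q3 n `<=` U >] then B q1 q2 q3 n else set0).
  apply/seteqP; split=> [x Ux|x [q1 _ [q2 _ [q3 _ [n _]]]]]; last first.
    by case: asboolP => // + Bx; exact.
  have /nbhs_ballP[e /= e0 eU] : nbhs x U by exact: open_nbhs_nbhs.
  pose n := Num.truncn (2 / e).
  have ne : n.+1%:R^-1 < e / 2.
    rewrite -[ltRHS]invrK ltf_pV2 ?posrE ?invr_gt0 ?divr_gt0 ?ltr0n//.
    by rewrite invf_div truncnS_gt.
  have n0 : 0 < n.+1%:R^-1 :> R by rewrite invr_gt0 ltr0n.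
  have rb (a : R) : exists q : rat, ball (ratr q : R) n.+1%:R^-1 a.
    have [|q] := @rat_in_itvoo _ (a - n.+1%:R^-1) (a + n.+1%:R^-1).
      by rewrite ltrBlDr -addrA ltrDl addr_gt0.
    rewrite in_itv/= => /andP[q1 q2]; exists q; rewrite /ball/= ltr_norml.
    by move: q1 q2; move: (n.+1%:R^-1) => r q1 q2; apply/andP; split; lra.
  have [q1 h1] := rb x.1.1; have [q2 h2] := rb x.1.2; have [q3 h3] := rb x.2.
  exists q1 => //; exists q2 => //; exists q3 => //; exists n => //.
  case: asboolP => [_|]; first by split; [split|].
  case=> y [[y1 y2] y3]; apply: eU.
  have tri (q a b : R) : ball q n.+1%:R^-1 a -> ball q n.+1%:R^-1 b -> ball a e b.
    rewrite /ball/= !ltr_norml => /andP[+ +] /andP[+ +].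
    by move: ne; move: (n.+1%:R^-1) => r *; apply/andP; split; lra.
  by split; [split|]; [exact: tri h1 y1|exact: tri h2 y2|exact: tri h3 y3].
apply: bigcupT_measurable_rat => q1; apply: bigcupT_measurable_rat => q2.
apply: bigcupT_measurable_rat => q3; apply: bigcupT_measurable => n.
by case: ifP.
Qed.

Lemma continuous_measurable3 (f : sp -> R) : continuous f -> measurable_fun setT f.
Proof.
move=> cf; apply: (measurability _ (RGenOInfty.measurableE R)).
move=> _ [_ [a ->] <-]; rewrite setTI; apply: open_measurable3.
by apply: open_comp; [move=> x _; exact: cf|exact: interval_open].
Qed.

End Continuous_measurable.

(** * Continuity of translations in L^1 and L^2 *)

Section Ereal_cvg0.
Variable R : realType.
Implicit Type u : nat -> \bar R.

Lemma near_le_of_cvg0 u (e : R) : u @ \oo --> 0%E -> 0 < e ->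
  \forall n \near \oo, (u n <= e%:E)%E.
Proof.
move=> u0 e0; have : nbhs (0%E : \bar R) [set x | (x < e%:E)%E].
  by apply: open_nbhs_nbhs; split; [exact: open_ereal_lt_ereal|rewrite /= lte_fin].
by move=> /u0 [N _ h]; exists N => // n /h /ltW.
Qed.

Lemma cvg0_of_near_le u : (forall n, 0 <= u n)%E ->
  (forall e : R, 0 < e -> \forall n \near \oo, (u n <= e%:E)%E) -> u @ \oo --> 0%E.
Proof.
move=> u0 H; apply/fine_cvgP; split.
  apply: filterS (H 1 ltr01) => n un; rewrite ge0_fin_numE//.
  by apply: le_lt_trans un _; rewrite ltry.
apply/cvgr0Pnorm_le => e e0; apply: filterS (H e e0) => n un.
have un' : u n \is a fin_num.
  by rewrite ge0_fin_numE//; apply: le_lt_trans un _; rewrite ltry.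
by rewrite /= ger0_norm ?fine_ge0// -lee_fin fineK.
Qed.

End Ereal_cvg0.

Section Shift_continuity.
Context d (T : measurableType d) (R : realType).
Variables (mu : {measure set T -> \bar R}) (t : nat -> T -> T).
Hypothesis mt : forall n, measurable_fun setT (t n).
Hypothesis pt : forall n f, measurable_fun setT f -> (forall x, 0 <= f x)%E ->
  (\int[mu]_x f (t n x) = \int[mu]_x f x)%E.

Definition shift_dist (f : T -> R) n := (\int[mu]_x `|f (t n x) - f x|%:E)%E.

Definition shift_cvg (f : T -> R) := shift_dist f @ \oo --> 0%E.

Lemma shift_dist_ge0 f n : (0 <= shift_dist f n)%E.
Proof. by apply: integral_ge0 => x _; rewrite lee_fin. Qed.

Lemma measurable_shift (f : T -> R) n : measurable_fun setT f ->
  measurable_fun setT (fun x => f (t n x)).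
Proof. by move=> mf; exact: measurableT_comp. Qed.

Lemma measurable_shift_dist (f : T -> R) n : measurable_fun setT f ->
  measurable_fun setT (fun x => `|f (t n x) - f x|%:E).
Proof.
move=> mf; apply/measurable_EFinP; apply: measurableT_comp => //.
by apply: measurable_funB => //; exact: measurable_shift.
Qed.

Lemma measurable_dist (f h : T -> R) : measurable_fun setT f ->
  measurable_fun setT h -> measurable_fun setT (fun x => `|f x - h x|%:E).
Proof.
move=> mf mh; apply/measurable_EFinP; apply: measurableT_comp => //.
exact: measurable_funB.
Qed.

Lemma shift_dist_le (f h : T -> R) n : measurable_fun setT f -> measurable_fun setT h ->
  (shift_dist f n <= shift_dist h n + \int[mu]_x `|f x - h x|%:E
     + \int[mu]_x `|f x - h x|%:E)%E.
Proof.
move=> mf mh.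
have md := measurable_dist mf mh.
rewrite -[X in (_ <= _ + X)%E](pt n)//.
rewrite /shift_dist -ge0_integralD//; last first.
  exact: measurable_shift_dist.
have mdt : measurable_fun setT (fun x => `|f (t n x) - h (t n x)|%:E).
  exact: (measurableT_comp md (mt n)).
rewrite -ge0_integralD//; last 2 first.
- by move=> x _; rewrite adde_ge0 ?lee_fin.
- by apply: emeasurable_funD => //; exact: measurable_shift_dist.
apply: ge0_le_integral => //.
- exact: measurable_shift_dist.
- by apply: emeasurable_funD => //; apply: emeasurable_funD => //;
    exact: measurable_shift_dist.
- move=> x _; rewrite -!EFinD lee_fin.
  rewrite (_ : f (t n x) - f x = (h (t n x) - h x) - (f x - h x) + (f (t n x) - h (t n x))); last by ring.
  by apply: le_trans (ler_normD _ _) _; rewrite lerD2r ler_normB.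
Qed.

(** Since [t n] preserves integrals, replacing f by h changes the distance to the shifted function
    by at most twice the L^1 distance of f and h: an epsilon/3 argument. *)
Lemma shift_cvg_closed (f : T -> R) : measurable_fun setT f ->
  (forall e : R, 0 < e -> exists h, [/\ measurable_fun setT h, shift_cvg h &
     (\int[mu]_x `|f x - h x|%:E <= e%:E)%E]) -> shift_cvg f.
Proof.
move=> mf H; apply: cvg0_of_near_le => [n|e e0]; first exact: shift_dist_ge0.
have e3 : 0 < e / 3 by rewrite divr_gt0.
have [h [mh hc fh]] := H _ e3.
apply: filterS (near_le_of_cvg0 hc e3) => n hn.
apply: le_trans (shift_dist_le n mf mh) _.
rewrite (_ : e = e / 3 + e / 3 + e / 3); last by field.
by rewrite !EFinD; apply: leeD => //; exact: leeD.
Qed.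

Lemma shift_dist_le2 (f : T -> R) n : measurable_fun setT f ->
  (shift_dist f n <= \int[mu]_x `|f x|%:E + \int[mu]_x `|f x|%:E)%E.
Proof.
move=> mf.
have mnf : measurable_fun setT (fun x => `|f x|%:E).
  by apply/measurable_EFinP; exact: measurableT_comp.
rewrite -[X in (_ <= X + _)%E](pt n)// -ge0_integralD//; last first.
  exact: (measurableT_comp mnf (mt n)).
apply: ge0_le_integral => //.
- exact: measurable_shift_dist.
- by apply: emeasurable_funD => //; exact: (measurableT_comp mnf (mt n)).
- by move=> x _; rewrite -EFinD lee_fin ler_normB.
Qed.

(* For a, b >= 0, (a - b)^2 <= |a^2 - b^2|, so L^2-continuity of the shifts of u
   follows from L^1-continuity of the shifts of the squares of u+ and u-. *)
Lemma shift_cvg_sqr (u : T -> R) :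
  (forall f, mu.-integrable setT (EFin \o f) -> shift_cvg f) ->
  L2r mu u -> (fun n => \int[mu]_x ((u (t n x) - u x) ^+ 2)%:E)%E @ \oo --> 0%E.
Proof.
move=> TC lu; have mu_ : measurable_fun setT u by case: lu.
pose up x := Num.max (u x) 0; pose un x := Num.max (- u x) 0.
have mup : measurable_fun setT up by apply: measurable_maxr.
have mun : measurable_fun setT un.
  by apply: measurable_maxr => //; exact: measurableT_comp.
have iq (v : T -> R) : measurable_fun setT v -> (forall x, `|v x| <= `|u x|) ->
    mu.-integrable setT (EFin \o (fun x => v x ^+ 2)).
  move=> mv vu; have lv : L2r mu v by exact: L2r_le lu.
  by under eq_fun do rewrite expr2; exact: L2r_mul.
have c1 := TC _ (iq _ mup _).
have c2 := TC _ (iq _ mun _).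
have {}c1 : shift_cvg (fun x => up x ^+ 2).
  by apply: c1 => x; rewrite /up; case: (leP (u x) 0) => ?; rewrite ?normr0.
have {}c2 : shift_cvg (fun x => un x ^+ 2).
  by apply: c2 => x; rewrite /un; case: (leP (- u x) 0) => ?; rewrite ?normr0// normrN.
apply: cvg0_of_near_le => [n|e e0].
  by apply: integral_ge0 => x _; rewrite lee_fin sqr_ge0.
have e4 : 0 < e / 4 by rewrite divr_gt0.
apply: filterS2 (near_le_of_cvg0 c1 e4) (near_le_of_cvg0 c2 e4) => n h1 h2.
have m1 : measurable_fun setT (fun x => `|up (t n x) ^+ 2 - up x ^+ 2|%:E).
  by apply: measurable_shift_dist; exact: measurable_funX.
have m2 : measurable_fun setT (fun x => `|un (t n x) ^+ 2 - un x ^+ 2|%:E).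
  by apply: measurable_shift_dist; exact: measurable_funX.
pose ups x := up x ^+ 2; pose uns x := un x ^+ 2.
apply: (@le_trans _ _ (2%:E * (shift_dist ups n + shift_dist uns n))%E).
  rewrite /shift_dist -ge0_integralD//.
  rewrite -ge0_integralZl//; last 2 first.
  - exact: emeasurable_funD.
  - by move=> x _; rewrite adde_ge0 ?lee_fin.
  apply: ge0_le_integral => //.
  - by move=> x _; rewrite lee_fin sqr_ge0.
  - apply/measurable_EFinP; apply: measurable_funX; apply: measurable_funB => //.
    exact: measurable_shift.
  - by apply: emeasurable_funM => //; exact: emeasurable_funD.
  - move=> x _; rewrite -EFinD -EFinM lee_fin.
    have sq (a b : R) : 0 <= a -> 0 <= b -> (a - b) ^+ 2 <= `|a ^+ 2 - b ^+ 2|.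
      move=> a0 b0; rewrite subr_sqr normrM -[leLHS]real_normK ?num_real// expr2.
      apply: ler_wpM2l => //; rewrite (ger0_norm (addr_ge0 a0 b0)).
      by rewrite ler_norml; apply/andP; split; lra.
    have uE y : u y = up y - un y.
      by rewrite /up /un; case: (leP (u y) 0) => ?; case: (leP (- u y) 0) => ?; lra.
    have up0 y : 0 <= up y by rewrite /up le_max lexx orbT.
    have un0 y : 0 <= un y by rewrite /un le_max lexx orbT.
    have := sq _ _ (up0 (t n x)) (up0 x); have := sq _ _ (un0 (t n x)) (un0 x).
    rewrite !uE => q1 q2.
    apply: le_trans (_ : 2 * ((up (t n x) - up x) ^+ 2 + (un (t n x) - un x) ^+ 2) <= _).
      have sq2 (p q : R) : (p - q) ^+ 2 <= 2 * (p ^+ 2 + q ^+ 2).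
        rewrite -subr_ge0 (_ : _ - _ = (p + q) ^+ 2) ?sqr_ge0//; ring.
      rewrite (_ : _ - _ = (up (t n x) - up x) - (un (t n x) - un x)); last by ring.
      exact: sq2.
    by rewrite ler_pM2l//; exact: lerD.
apply: (@le_trans _ _ (2%:E * ((e / 4)%:E + (e / 4)%:E))%E).
  by apply: lee_wpmul2l; rewrite ?lee_fin//; exact: leeD.
by rewrite -EFinD -EFinM lee_fin; lra.
Qed.

End Shift_continuity.

(** Almost every slice f(., y) is integrable, so the inner integral tends to 0 for almost every y.
    It is dominated by twice the L^1 norm of the slice, which is integrable in y. *)
Lemma shift_cvg_side d1 d2 (T1 : measurableType d1) (T2 : measurableType d2)
    (R : realType) (m1 : {sigma_finite_measure set T1 -> \bar R})
    (m2 : {sigma_finite_measure set T2 -> \bar R}) (t : nat -> T1 -> T1)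
    (f : T1 * T2 -> R) :
  (forall n, measurable_fun setT (t n)) ->
  (forall n g, measurable_fun setT g -> (forall x, 0 <= g x)%E ->
     \int[m1]_x g (t n x) = \int[m1]_x g x)%E ->
  (forall g, m1.-integrable setT (EFin \o g) -> shift_cvg m1 t g) ->
  (m1 \x m2)%E.-integrable setT (EFin \o f) ->
  (fun n => \int[m2]_y \int[m1]_x `|f (t n x, y) - f (x, y)|%:E)%E @ \oo --> 0%E.
Proof.
move=> mt pt TC intf.
have mf : measurable_fun setT f.
  by apply/measurable_EFinP; exact: measurable_int intf.
have mfy y : measurable_fun setT (fun x => f (x, y)) by exact: measurableT_comp.
have maf : measurable_fun setT (fun p => `|f p|%:E).
  by apply/measurable_EFinP; exact: measurableT_comp.
have mF n : measurable_fun setT (fun p : T1 * T2 => `|f (t n p.1, p.2) - f p|%:E).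
  apply/measurable_EFinP; apply: measurableT_comp => //.
  apply: measurable_funB => //; apply: (measurableT_comp mf).
  by apply: measurable_fun_pair => //; exact: measurableT_comp.
pose g n y := shift_dist m1 t (fun x => f (x, y)) n.
pose G y := (\int[m1]_x `|f (x, y)|%:E + \int[m1]_x `|f (x, y)|%:E)%E.
have iabs : m2.-integrable setT (fun y => \int[m1]_x `|f (x, y)|%:E)%E.
  apply/integrableP; split.
    exact: (measurable_fun_fubini_tonelli_G (fun p => `|f p|%:E)).
  have H := (integrable21ltyP m1 m2 (measurable_int _ intf)).1 intf.
  apply: le_lt_trans H.
  rewrite le_eqVlt; apply/orP; left; apply/eqP; apply: eq_integral => y _.
  by rewrite gee0_abs// integral_ge0.
have iG : m2.-integrable setT G by exact: integrableD.
have mg n : measurable_fun setT (g n).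
  exact: (measurable_fun_fubini_tonelli_G (fun p => `|f (t n p.1, p.2) - f p|%:E)).
have cg : {ae m2, forall y, setT y -> g ^~ y @ \oo --> 0%E}.
  have := ae_integrable2 intf; apply: filterS => y iy _.
  exact: (TC (fun x => f (x, y))).
have [] := @dominated_convergence _ _ _ m2 setT measurableT g (cst 0%E) G mg.
- exact: measurable_cst.
- exact: cg.
- exact: iG.
- apply: aeW => y n _; rewrite gee0_abs ?shift_dist_ge0//.
  exact: shift_dist_le2.
by rewrite integral0.
Qed.

(** The variables are moved one at a time through the intermediate point (x, t2 y). In the first
    piece the motion of y is undone by the invariance of the second measure. *)
Lemma shift_cvg_prod d1 d2 (T1 : measurableType d1) (T2 : measurableType d2)
    (R : realType) (m1 : {sigma_finite_measure set T1 -> \bar R})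
    (m2 : {sigma_finite_measure set T2 -> \bar R}) (t1 : nat -> T1 -> T1)
    (t2 : nat -> T2 -> T2) (f : T1 * T2 -> R) :
  (forall n, measurable_fun setT (t1 n)) -> (forall n, measurable_fun setT (t2 n)) ->
  (forall n g, measurable_fun setT g -> (forall x, 0 <= g x)%E ->
     \int[m1]_x g (t1 n x) = \int[m1]_x g x)%E ->
  (forall n g, measurable_fun setT g -> (forall x, 0 <= g x)%E ->
     \int[m2]_x g (t2 n x) = \int[m2]_x g x)%E ->
  (forall g, m1.-integrable setT (EFin \o g) -> shift_cvg m1 t1 g) ->
  (forall g, m2.-integrable setT (EFin \o g) -> shift_cvg m2 t2 g) ->
  (m1 \x m2)%E.-integrable setT (EFin \o f) ->
  shift_cvg (m1 \x m2)%E (fun n p => (t1 n p.1, t2 n p.2)) f.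
Proof.
move=> mt1 mt2 pt1 pt2 TC1 TC2 intf.
have mf : measurable_fun setT f.
  by apply/measurable_EFinP; exact: measurable_int intf.
have c1 := shift_cvg_side mt1 pt1 TC1 intf.
have msw : measurable_fun setT (fun p : T2 * T1 => f (p.2, p.1)).
  by apply: (measurableT_comp mf); exact: measurable_fun_pair.
have intf' : (m2 \x m1)%E.-integrable setT (EFin \o (fun p => f (p.2, p.1))).
  apply/integrable12ltyP; first exact/measurable_EFinP.
  exact: (integrable21ltyP m1 m2 (measurable_int _ intf)).1 intf.
have c2 := shift_cvg_side mt2 pt2 TC2 intf'.
have m12 n : measurable_fun setT (fun p : T1 * T2 => (t1 n p.1, p.2)).
  by apply: measurable_fun_pair => //; exact: measurableT_comp.
have m22 n : measurable_fun setT (fun p : T1 * T2 => (p.1, t2 n p.2)).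
  by apply: measurable_fun_pair => //; exact: measurableT_comp.
have m32 n : measurable_fun setT (fun p : T1 * T2 => (t1 n p.1, t2 n p.2)).
  by apply: measurable_fun_pair; exact: measurableT_comp.
have dist (a b : T1 * T2 -> T1 * T2) : measurable_fun setT a -> measurable_fun setT b ->
    measurable_fun setT (fun p => `|f (a p) - f (b p)|%:E).
  move=> ma mb; apply/measurable_EFinP; apply: measurableT_comp => //.
  by apply: measurable_funB; exact: measurableT_comp.
have mid : measurable_fun setT (fun p : T1 * T2 => p) by exact: measurable_id.
apply: cvg0_of_near_le => [n|e e0]; first exact: shift_dist_ge0.
have e2 : 0 < e / 2 by rewrite divr_gt0.
apply: filterS2 (near_le_of_cvg0 c1 e2) (near_le_of_cvg0 c2 e2) => n h1 h2.
apply: (@le_trans _ _ (\int[m1 \x m2]_p (`|f (t1 n p.1, t2 n p.2) - f (p.1, t2 n p.2)|%:E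
   + `|f (p.1, t2 n p.2) - f p|%:E))%E).
  apply: ge0_le_integral => //.
  - exact: dist.
  - by apply: emeasurable_funD; exact: dist.
  - by move=> p _; rewrite -EFinD lee_fin ler_distD.
rewrite ge0_integralD//; last 2 first.
- exact: dist.
- exact: dist.
rewrite (_ : e = e / 2 + e / 2); last by field.
rewrite EFinD; apply: leeD.
  rewrite (fubini_tonelli2 (fun p => `|f (t1 n p.1, t2 n p.2) - f (p.1, t2 n p.2)|%:E))//; last exact: dist.
  rewrite /fubini_G /=.
  rewrite (pt2 n (fun y => \int[m1]_x `|f (t1 n x, y) - f (x, y)|%:E)%E)//.
  - apply: (measurable_fun_fubini_tonelli_G
      (fun p => `|f (t1 n p.1, p.2) - f (p.1, p.2)|%:E)) => //.
    by apply: (dist (fun p => (t1 n p.1, p.2)) (fun p => (p.1, p.2))) => //; exact: measurable_fun_pair.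
  - by move=> y; exact: integral_ge0.
rewrite (fubini_tonelli1 (fun p => `|f (p.1, t2 n p.2) - f p|%:E))//.
exact: dist.
Qed.

Lemma ae_neq1 (R : realType) (a : R) : {ae @lebesgue_measure R, forall x, x <> a}.
Proof.
exists [set a]; split.
- exact: measurable_set1.
- exact: lebesgue_measure_set1.
- by move=> x /= /contrapT ->.
Qed.

Section Shift1.
Variable R : realType.
Local Notation mu := (@lebesgue_measure R).
Variable z : nat -> R.
Hypothesis z1 : forall n, `|z n| <= 1.
Hypothesis z0 : z @ \oo --> (0 : R).

(** Dominated convergence: the truncated function is bounded, and as |z n| <= 1 all its shifts live
    in [-N-1, N+1]. *)
Lemma shift_cvg1_cont (g : R -> R) (N : R) : continuous g -> 0 <= N ->
  shift_cvg mu (fun n x => x + z n) (fun x => g x * \1_(`[- N, N]%classic) x).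
Proof.
move=> cg N0.
have mg : measurable_fun setT g by exact: continuous_measurable_fun.
set h := fun x => g x * _.
have mh : measurable_fun setT h.
  by apply: measurable_funM => //; apply: measurable_indic; exact: measurable_itv.
have [M M0 hM] : exists2 M, 0 <= M & forall x, `|h x| <= M.
  have [||c _ hc] := @EVT_max R (fun x => `|g x|) (- N) N.
  - by lra.
  - apply: continuous_subspaceT => x.
    by apply: continuous_comp; [exact: cg|exact: norm_continuous].
  exists `|g c| => // x; rewrite /h indicE; case: (boolP (x \in _)) => /= xN.
    by rewrite mulr1; apply: hc; rewrite inE in xN.
  by rewrite mulr0 normr0.
pose G x := M * \1_(`[- N - 1, N + 1]%classic) x + M * \1_(`[- N - 1, N + 1]%classic) x.
have iG : mu.-integrable setT (EFin \o G).
  have i1 : mu.-integrable setT (EFin \o (fun x => M * \1_(`[- N - 1, N + 1]%classic) x)).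
    have -> : EFin \o (fun x => M * \1_(`[- N - 1, N + 1]%classic) x) =
      (fun x => M%:E * (\1_(`[- N - 1, N + 1]%classic) x)%:E)%E.
      by apply/funext => x; rewrite -EFinM.
    apply: integrableZl => //; exact: integrable_indic_itv.
  have -> : EFin \o G = (fun x => (M * \1_(`[- N - 1, N + 1]%classic) x)%:E +
      (M * \1_(`[- N - 1, N + 1]%classic) x)%:E)%E.
    by apply/funext => x; rewrite -EFinD.
  exact: integrableD.
have hout x : ~ (- N <= x <= N) -> h x = 0.
  by move=> xN; rewrite /h indicE memNset ?mulr0//= in_itv/=.
have mt n : measurable_fun setT (fun x : measurableTypeR R => x + z n) by exact: measurable_funD.
have [|||||] := @dominated_convergence _ _ _ mu setT measurableT
   (fun n (x : measurableTypeR R) => `|h (x + z n) - h x|%:E) (cst 0%E) (EFin \o G).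
- by move=> n; exact: (measurable_shift_dist mt n mh).
- exact: measurable_cst.
(* The truncation jumps at N and -N only, so these two points are discarded; elsewhere the function
   is continuous. *)
- have F : Filter (nbhs (almost_everywhere mu)) by exact: ae_filter_ringOfSetsType.
  apply: filterS2 (ae_neq1 N) (ae_neq1 (- N)) => x xN xN' _.
  apply/fine_cvgP; split; first exact: nearW.
  apply/cvgr0Pnorm_le => e e0 /=.
  have [xin|xout] : (- N < x < N) \/ ((x < - N) \/ (N < x)).
    have [?|?|//] := ltgtP x N; last by right; right.
    have [?|?|//] := ltgtP x (- N); first by right; left.
    by left; apply/andP.
  + have zx : (fun n => x + z n) @ \oo --> x.
      by rewrite -[X in _ --> X]addr0; apply: cvgD => //; exact: cvg_cst.
    have : (fun n => g (x + z n)) @ \oo --> g x.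
      by apply: (cvg_comp _ _ zx); exact: cg.
    move=> /cvgrPdist_le /(_ e e0).
    have /andP[xl xr] := xin.
    have nl : \forall n \near \oo, - N < x + z n by exact: (cvgr_gt _ zx).
    have nr : \forall n \near \oo, x + z n < N by exact: (cvgr_lt _ zx).
    apply: filter_app2 nr; apply: filterS nl => n nl nr gn.
    rewrite /= normr_id distrC /h !indicE !mem_set/= ?mulr1//.
      by rewrite in_itv/= !ltW.
    by rewrite in_itv/= !ltW.
  + have zx : (fun n => x + z n) @ \oo --> x.
      by rewrite -[X in _ --> X]addr0; apply: cvgD => //; exact: cvg_cst.
    have hx : h x = 0 by apply: hout => /andP[? ?]; case: xout; lra.
    case: xout => xout.
      have nl : \forall n \near \oo, x + z n < - N by exact: (cvgr_lt _ zx).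
      apply: filterS nl => n nl; rewrite hx hout ?subr0 ?normr0 ?(ltW e0)//.
      by move=> /andP[a _]; move: nl; rewrite ltNge a.
    have nl : \forall n \near \oo, N < x + z n by exact: (cvgr_gt _ zx).
    apply: filterS nl => n nl; rewrite hx hout ?subr0 ?normr0 ?(ltW e0)//.
    by move=> /andP[_ a]; move: nl; rewrite ltNge a.
- exact: iG.
- apply: aeW => x n _; rewrite abse_EFin lee_fin normr_id /G.
  have [xin|xout] := boolP (- N - 1 <= x <= N + 1).
    rewrite indicE mem_set/= ?in_itv//= mulr1.
    by apply: le_trans (ler_normB _ _) _; apply: lerD.
  have := z1 n; rewrite ler_norml => /andP[zl zr].
  rewrite !hout ?subr0 ?normr0.
  + by rewrite addr_ge0// mulr_ge0// indicE.
  + by move=> /andP[? ?]; move/negP: xout; apply; apply/andP; split; lra.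
  + by move=> /andP[? ?]; move/negP: xout; apply; apply/andP; split; lra.
- by rewrite integral0.
Qed.

(** Density: f is approximated in L^1 first by its restriction to [-N, N], then by a continuous
    function on that interval, to which [shift_cvg1_cont] applies. *)
Lemma shift_cvg1 (f : R -> R) : mu.-integrable setT (EFin \o f) ->
  shift_cvg mu (fun n x => x + z n) f.
Proof.
move=> intf; have mf : measurable_fun setT f by apply/measurable_EFinP; exact: measurable_int intf.
pose E (N : nat) : set R := `[- (N%:R), N%:R]%classic.
have mE N : measurable (E N : set (measurableTypeR R)) by exact: measurable_itv.
have mt n : measurable_fun setT (fun x : measurableTypeR R => x + z n) by exact: measurable_funD.
apply: shift_cvg_closed => //.
  by move=> n g mg g0; exact: ge0_integral_shift1.
move=> e e0; have e2 : 0 < e / 2 by rewrite divr_gt0.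
have [N HN] : exists N, (\int[mu]_x `|f x - f x * \1_(E N) x|%:E <= (e / 2)%:E)%E.
  have [|||||_ _] := @dominated_convergence _ _ _ mu setT measurableT
     (fun N (x : measurableTypeR R) => `|f x - f x * \1_(E N) x|%:E) (cst 0%E) (EFin \o (fun x : measurableTypeR R => `|f x|)).
  - move=> n; apply/measurable_EFinP; apply: measurableT_comp => //.
    apply: measurable_funB; first exact: mf.
    by apply: measurable_funM; [exact: mf|apply: measurable_indic; exact: mE].
  - exact: measurable_cst.
  - apply: aeW => x _; apply: cvg_near_cst.
    exists (Num.truncn `|x|).+1 => // n /= xn.
    rewrite indicE mem_set/= ?mulr1 ?subrr ?normr0//.
    rewrite /E /= in_itv/= -ler_norml ltW//; apply: lt_le_trans (truncnS_gt _) _.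
    by rewrite ler_nat.
  - exact: integrable_norm.
  - apply: aeW => x n _; rewrite abse_EFin lee_fin normr_id indicE.
    by case: (_ \in _); rewrite ?mulr1 ?mulr0 ?subr0// subrr normr0.
  rewrite integral0 => /near_le_of_cvg0 /(_ e2) [N _ /(_ N)]/=.
  by move=> H; exists N; apply: H => /=.
have [|||g_ [cg _]] := @approximation_continuous_integrable R (E N) f.
- exact: mE.
- have EE : mu (E N) = _ := lebesgue_measure_itv `[- (N%:R), N%:R]%R.
  have : (mu (E N) < +oo)%E by rewrite EE; case: ifP => // _; rewrite -EFinB ltry.
  exact.
- exact: integrableS intf.
move=> /near_le_of_cvg0 /(_ e2) [k _ /(_ k)] /= hk.
exists (fun x => g_ k x * \1_(E N) x).
have mg : measurable_fun setT (g_ k) by apply: continuous_measurable_fun; exact: cg.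
have mgE : measurable_fun setT (fun x => g_ k x * \1_(E N) x).
  by apply: measurable_funM => //; apply: measurable_indic; exact: mE.
have mfE : measurable_fun setT (fun x => f x * \1_(E N) x).
  by apply: measurable_funM => //; apply: measurable_indic; exact: mE.
split => //; first exact: shift_cvg1_cont.
apply: (@le_trans _ _ (\int[mu]_x (`|f x - f x * \1_(E N) x|%:E +
   `|f x * \1_(E N) x - g_ k x * \1_(E N) x|%:E))%E).
  apply: ge0_le_integral => //.
  - exact: measurable_dist.
  - by apply: emeasurable_funD; exact: measurable_dist.
  - by move=> x _; rewrite -EFinD lee_fin ler_distD.
rewrite ge0_integralD//; last 2 first.
- exact: measurable_dist.
- exact: measurable_dist.
rewrite (_ : e = e / 2 + e / 2); last by field.
rewrite EFinD; apply: leeD => //.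
apply: le_trans (hk _) => //=.
rewrite [leRHS]integral_mkcond le_eqVlt; apply/orP; left; apply/eqP.
apply: eq_integral => x _; rewrite patchE indicE; case: (_ \in _) => /=.
  by rewrite !mulr1.
by rewrite !mulr0 subr0 normr0.
Qed.

End Shift1.

Section Shift3.
Variable R : realType.
Local Notation sp := (space3 R).
Local Notation mu3 := (@lebesgue3 R).

Lemma shift_cvg3 (z : nat -> sp) (f : sp -> R) :
  (forall n, enorm (z n) <= 1) -> (fun n => enorm (z n)) @ \oo --> (0 : R) ->
  mu3.-integrable setT (EFin \o f) -> shift_cvg mu3 (fun n x => x + z n) f.
Proof.
move=> z1 z0 intf.
have cv (a : nat -> R) : (forall n, `|a n| <= enorm (z n)) -> a @ \oo --> (0 : R).
  move=> az; apply/norm_cvg0P; apply: squeeze_cvgr z0; last exact: cvg_cst.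
  by apply: nearW => n; rewrite normr_ge0 az.
have zc n := coord_le_enorm (z n).
have m1 (t : R) : measurable_fun setT (fun p : measurableTypeR R => p + t).
  exact: measurable_funD.
have m2 n : measurable_fun setT (fun p : measurableTypeR R * measurableTypeR R =>
    (p.1 + (z n).1.1, p.2 + (z n).1.2)).
  by apply: measurable_fun_pair; apply: measurable_funD.
have TC1 (a : nat -> R) : (forall n, `|a n| <= enorm (z n)) ->
    forall g, (@lebesgue_measure R).-integrable setT (EFin \o g) ->
    shift_cvg (@lebesgue_measure R) (fun n x => x + a n) g.
  move=> az g; apply: shift_cvg1; last exact: cv.
  by move=> n; apply: le_trans (az n) _.
have h1 n : `|(z n).1.1| <= enorm (z n) by case: (zc n).
have h2 n : `|(z n).1.2| <= enorm (z n) by case: (zc n).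
have h3 n : `|(z n).2| <= enorm (z n) by case: (zc n).
have TC2 g : (@lebesgue2 R).-integrable setT (EFin \o g) ->
    shift_cvg (@lebesgue2 R) (fun n p => (p.1 + (z n).1.1, p.2 + (z n).1.2)) g.
  move=> ig; have H := @shift_cvg_prod _ _ _ _ _ (@lebesgue_measure R)
    (@lebesgue_measure R) (fun n p => p + (z n).1.1) (fun n p => p + (z n).1.2) g
    (fun n => m1 _) (fun n => m1 _).
  apply: H => //.
  - by move=> n; exact: ge0_integral_shift1.
  - by move=> n; exact: ge0_integral_shift1.
  - exact: TC1.
  - exact: TC1.
have H := @shift_cvg_prod _ _ _ _ _ (@lebesgue2 R) (@lebesgue_measure R)
   (fun n p => (p.1 + (z n).1.1, p.2 + (z n).1.2)) (fun n p => p + (z n).2) f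
   (fun n => m2 n) (fun n => m1 _).
apply: H => //.
- move=> n g mg g0.
  have H' := @ge0_integral_comp_prod _ _ _ _ _ (@lebesgue_measure R)
    (@lebesgue_measure R) (fun p => p + (z n).1.1) (fun p => p + (z n).1.2) (m1 _) (m1 _).
  by apply: H' => //; exact: ge0_integral_shift1.
- by move=> n; exact: ge0_integral_shift1.
- exact: TC1.
Qed.

(** If the claim fails, there are shifts z n with |z n| < 1/(n+1) for which the distance stays above
    e, against [shift_cvg_sqr] for this sequence. *)
Lemma L2_shift_continuous (u : sp -> R) : L2r mu3 u -> forall e : R, 0 < e ->
  exists2 del, 0 < del & forall z, enorm z < del ->
    (\int[mu3]_x ((u (x + z) - u x) ^+ 2)%:E <= e%:E)%E.
Proof.
move=> lu e e0; apply: contrapT => H.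
have {}H n : exists z : sp, enorm z < n.+1%:R^-1 /\
    ~ (\int[mu3]_x ((u (x + z)%R - u x) ^+ 2)%:E <= e%:E)%E.
  apply: contrapT => H'; apply: H; exists n.+1%:R^-1 => // z zn.
  by apply: contrapT => H''; apply: H'; exists z.
have [z Hz] := choice H.
have z1 n : enorm (z n) <= 1.
  by apply: le_trans (ltW (Hz n).1) _; rewrite invf_le1 ?ltr0n// ler1n.
have z0 : (fun n => enorm (z n)) @ \oo --> (0 : R).
  apply: squeeze_cvgr; [|exact: cvg_cst|exact: cvg_harmonic].
  by apply: nearW => n; rewrite enorm_ge0/= ltW// (Hz n).1.
have mt n : measurable_fun setT (fun x : sp => x + z n).
  by apply: measurable_add => //; exact: measurable_id.
have TC f : mu3.-integrable setT (EFin \o f) -> shift_cvg mu3 (fun n x => x + z n) f.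
  exact: shift_cvg3.
have c := @shift_cvg_sqr _ _ _ mu3 (fun n x => x + z n) mt u TC lu.
have [N _ /(_ N (leqnn N))] := near_le_of_cvg0 c e0.
exact: (Hz N).2.
Qed.

End Shift3.

(** * The regularized distance and the bump [kk] *)

Section Regularized_kernel.
Variable R : realType.
Local Notation sp := (space3 R).
Local Notation mu3 := (@lebesgue3 R).
Implicit Types (x y z : sp) (e mu : R).

(** Smoothed distance to the origin: it is smooth for e > 0, at least e, and within e of |x|. *)
Definition rr e x : R := Num.sqrt (n2 x + e ^+ 2).

Lemma rr_sqr e x : rr e x ^+ 2 = n2 x + e ^+ 2.
Proof. by rewrite sqr_sqrtr// addr_ge0 ?n2_ge0 ?sqr_ge0. Qed.

Lemma rr_gt0 e x : 0 < e -> 0 < rr e x.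
Proof. by move=> e0; rewrite sqrtr_gt0 ltr_wpDl ?n2_ge0// exprn_gt0. Qed.

Lemma rr_ge0 e x : 0 <= rr e x. Proof. exact: sqrtr_ge0. Qed.

Lemma le_rr e x : 0 < e -> e <= rr e x.
Proof.
move=> e0; rewrite -[leLHS]ger0_norm ?(ltW e0)// -sqrtr_sqr.
by rewrite ler_wsqrtr// lerDr n2_ge0.
Qed.

Lemma enorm_le_rr e x : enorm x <= rr e x.
Proof. by rewrite ler_wsqrtr// lerDl sqr_ge0. Qed.

Lemma rr_le e x : 0 < e -> rr e x <= enorm x + e.
Proof.
move=> e0; have h : 0 <= enorm x + e by rewrite addr_ge0 ?enorm_ge0 ?ltW.
rewrite -[leRHS]ger0_norm// -sqrtr_sqr ler_wsqrtr// sqrrD enorm_sqr.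
by rewrite lerD2r lerDl mulrn_wge0// mulr_ge0 ?enorm_ge0 ?ltW.
Qed.

Lemma rrN e x : rr e (- x) = rr e x.
Proof. by rewrite /rr /n2/= !sqrrN. Qed.

Lemma rrB e x y : rr e (x - y) = rr e (y - x).
Proof. by rewrite -rrN opprB. Qed.

Lemma measurable_rr e : measurable_fun setT (rr e).
Proof.
have -> : rr e = Num.sqrt \o (fun x => n2 x + e ^+ 2) by [].
apply: measurableT_comp; first exact: (continuous_measurable_fun (@sqrt_continuous R)).
by apply: measurable_funD => //; exact: measurable_n2.
Qed.

(** Cubing 1 + s/3 <= e^{s/3} gives e^s >= 1 + s + s^2/3. *)
Lemma expR_quad_le (s : R) : 0 <= s -> expR (- s) * (s ^+ 2 + 3 * s + 3) <= 3.
Proof.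
move=> s0; rewrite expRN mulrC ler_pdivrMr ?expR_gt0//.
have h : 1 + s / 3 <= expR (s / 3) by exact: expR_ge1Dx.
have p0 : 0 <= 1 + s / 3 by rewrite addr_ge0// divr_ge0.
have : (1 + s / 3) ^+ 3 <= expR s.
  rewrite [X in expR X](_ : s = 3%:R * (s / 3)); last by field.
  by rewrite expRM_natl lerXn2r ?nnegrE// ltW ?expR_gt0.
have : 0 <= s ^+ 3 by rewrite exprn_ge0.
rewrite (_ : (1 + s / 3) ^+ 3 = 1 + s + s ^+ 2 / 3 + s ^+ 3 / 27); last by field.
move: (s ^+ 3) (s ^+ 2) (expR s) => a b c; lra.
Qed.

Lemma expR_lin_le (s : R) : 0 <= s -> expR (- s) * (s + 1) <= 1.
Proof.
move=> s0; rewrite expRN mulrC ler_pdivrMr ?expR_gt0// mul1r addrC.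
exact: expR_ge1Dx.
Qed.

(** With r = [rr e], this is (mu^2 - Delta) applied to e^{-mu r}/r, as [sum_dXX] shows. As e tends
    to 0 it concentrates at the origin. *)
Definition kk mu e x : R := e ^+ 2 * (expR (- (mu * rr e x)) *
  ((mu * rr e x) ^+ 2 + 3 * (mu * rr e x) + 3)) / rr e x ^+ 5.

Lemma kk_ge0 mu e x : 0 <= mu -> 0 < e -> 0 <= kk mu e x.
Proof.
move=> mu0 e0; have r0 := rr_gt0 x e0; have mr : 0 <= mu * rr e x by rewrite mulr_ge0// ltW.
rewrite divr_ge0 ?(exprn_ge0 _ (ltW r0))// mulr_ge0 ?sqr_ge0// mulr_ge0 ?expR_ge0//.
by rewrite !addr_ge0 ?sqr_ge0// mulr_ge0.
Qed.

Lemma kk_le mu e x : 0 <= mu -> 0 < e -> kk mu e x <= 3 * e ^+ 2 / rr e x ^+ 5.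
Proof.
move=> mu0 e0; have r0 := rr_gt0 x e0; have mr : 0 <= mu * rr e x by rewrite mulr_ge0// ltW.
rewrite ler_pM2r ?invr_gt0 ?exprn_gt0// mulrC ler_pM2r ?exprn_gt0//.
exact: expR_quad_le.
Qed.

Lemma measurable_kk mu e : measurable_fun setT (kk mu e).
Proof.
have mr := @measurable_rr e.
have mmr : measurable_fun setT (fun x => mu * rr e x) by exact: measurable_funM.
apply: measurable_funM; last by apply: measurable_funV; exact: measurable_funX.
apply: measurable_funM => //; apply: measurable_funM.
  by apply: measurableT_comp => //; exact: measurableT_comp.
apply: measurable_funD => //; apply: measurable_funD; first exact: measurable_funX.
exact: measurable_funM.
Qed.

Lemma kkB mu e x y : kk mu e (x - y) = kk mu e (y - x).
Proof. by rewrite /kk rrB. Qed.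

Lemma kk_le_far mu e x : 0 <= mu -> 0 < e -> x != 0 ->
  kk mu e x <= 3 * e ^+ 2 / enorm x * (n2 x ^+ 2)^-1.
Proof.
move=> mu0 e0 x0; apply: le_trans (kk_le _ mu0 e0) _.
have ex := enorm_gt0 x0; have n0 := n2_gt0 x0.
rewrite -[leRHS]mulrA; apply: ler_wpM2l; first by rewrite mulr_ge0// sqr_ge0.
rewrite -invfM lef_pV2 ?posrE; last 2 first.
- by rewrite exprn_gt0// rr_gt0.
- by rewrite mulr_gt0// exprn_gt0.
rewrite -enorm_sqr -exprM -exprS lerXn2r ?nnegrE ?enorm_ge0 ?rr_ge0//.
exact: enorm_le_rr.
Qed.

Lemma neq0_notin_ball r x : 0 <= r -> (~` ball3 r) x -> x != 0.
Proof.
by move=> r0; rewrite /ball3/=; apply: contra_notN => /eqP ->; rewrite enorm0.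
Qed.

Lemma int_kk_far mu e (del : R) : 0 <= mu -> 0 < e -> 0 < del ->
  (\int[mu3]_(x in ~` ball3 del) (kk mu e x)%:E <= (384 * e ^+ 2 / del ^+ 2)%:E)%E.
Proof.
move=> mu0 e0 d0.
have mB : measurable (~` (@ball3 R del)) by apply: measurableC; exact: measurable_ball3.
have mi : measurable_fun setT (fun x : sp => (n2 x ^+ 2)^-1).
  by apply: measurable_funV; apply: measurable_funX; exact: measurable_n2.
apply: (@le_trans _ _ (\int[mu3]_(x in ~` ball3 del)
   ((3 * e ^+ 2 / del)%:E * ((n2 x ^+ 2)^-1)%:E))%E).
  apply: ge0_le_integral => //.
  - by move=> x _; rewrite lee_fin kk_ge0.
  - by apply/measurable_EFinP; apply: measurable_funTS; exact: measurable_kk.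
  - apply: emeasurable_funM => //; apply/measurable_EFinP; apply: measurable_funTS.
    exact: mi.
  - move=> x xd; have x0 := neq0_notin_ball (ltW d0) xd.
    rewrite -EFinM lee_fin; apply: le_trans (kk_le_far mu0 e0 x0) _.
    rewrite ler_pM2r ?invr_gt0 ?exprn_gt0 ?n2_gt0//.
    rewrite ler_pM2l ?mulr_gt0 ?exprn_gt0// lef_pV2 ?posrE ?enorm_gt0//.
    by move: xd => /= /negP; rewrite -ltNge => /ltW.
rewrite ge0_integralZl//; last 3 first.
- by apply/measurable_EFinP; apply: measurable_funTS; exact: mi.
- by move=> x _; rewrite lee_fin invr_ge0 sqr_ge0.
- by rewrite lee_fin divr_ge0 ?ltW// mulr_gt0// exprn_gt0.
apply: (@le_trans _ _ ((3 * e ^+ 2 / del)%:E * (128 / del)%:E)%E).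
  apply: lee_wpmul2l; last exact: int_far_inv4.
  by rewrite lee_fin divr_ge0 ?ltW// mulr_gt0// exprn_gt0.
rewrite -EFinM lee_fin le_eqVlt; apply/orP; left; apply/eqP; field.
by rewrite gt_eqF.
Qed.

(** Outside the ball of radius e the far estimate gives 384. Inside, [kk] is at most 3/e^3 on a set
    of volume at most 8 e^3, which gives 24. *)
Lemma int_kk_le mu e : 0 <= mu -> 0 < e ->
  (\int[mu3]_x (kk mu e x)%:E <= 408%:E)%E.
Proof.
move=> mu0 e0.
have mB : measurable (@ball3 R e) by exact: measurable_ball3.
rewrite -(setvU (ball3 e)) ge0_integral_setU//=; last 4 first.
- exact: measurableC.
- by apply/measurable_EFinP; apply: measurable_funTS; exact: measurable_kk.
- by move=> x _; rewrite lee_fin kk_ge0.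
- by apply/disj_set2P; rewrite setICl.
rewrite (_ : 408 = 384 * e ^+ 2 / e ^+ 2 + 24); last first.
  by rewrite mulfK ?gt_eqF ?exprn_gt0//; ring.
rewrite EFinD; apply: leeD; first exact: int_kk_far.
apply: (@le_trans _ _ (\int[mu3]_(x in ball3 e) (cst (3 / e ^+ 3)%:E x))%E).
  apply: ge0_le_integral => //.
  - by move=> x _; rewrite lee_fin kk_ge0.
  - by apply/measurable_EFinP; apply: measurable_funTS; exact: measurable_kk.
  - move=> x _; rewrite lee_fin; apply: le_trans (kk_le _ mu0 e0) _.
    rewrite (_ : 3 / e ^+ 3 = 3 * e ^+ 2 / e ^+ 5); last by field; rewrite gt_eqF.
    rewrite ler_pM2l ?mulr_gt0 ?exprn_gt0// lef_pV2 ?posrE ?exprn_gt0 ?rr_gt0//.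
    by rewrite lerXn2r ?nnegrE ?rr_ge0 ?le_rr// ltW.
rewrite integral_cst//=.
apply: (@le_trans _ _ ((3 / e ^+ 3)%:E * (8 * e ^+ 3)%:E)%E).
  apply: lee_wpmul2l; last by apply: lebesgue3_ball_le; exact: ltW.
  by rewrite lee_fin divr_ge0// exprn_ge0// ltW.
rewrite -EFinM lee_fin le_eqVlt; apply/orP; left; apply/eqP; field.
by rewrite gt_eqF.
Qed.

Lemma lebesgue3_ball_ge r : 0 < r -> ((r ^+ 3)%:E <= mu3 (ball3 r))%E.
Proof.
move=> r0.
pose I : set (measurableTypeR R) := `[- (r / 2), r / 2]%classic.
have mI : measurable I by exact: measurable_itv.
pose Q : set sp := (I `*` I) `*` I.
have mQ : measurable Q by apply: measurableX => //; exact: measurableX.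
have mIE : (@lebesgue_measure R) I = r%:E.
  rewrite /I lebesgue_measure_itv/= lte_fin ifT; last by lra.
  by rewrite -EFinB; congr EFin; lra.
have E1 : mu3 Q = ((@lebesgue2 R) (I `*` I) * (@lebesgue_measure R) I)%E.
  by apply: product_measure1E => //; exact: measurableX.
have E2 : (@lebesgue2 R) (I `*` I) = ((@lebesgue_measure R) I * (@lebesgue_measure R) I)%E.
  exact: product_measure1E.
apply: (@le_trans _ _ (mu3 Q)).
  by rewrite E1 E2 mIE -!EFinM lee_fin le_eqVlt; apply/orP; left; apply/eqP; ring.
apply: le_measure; rewrite ?inE//; first exact: measurable_ball3.
move=> x [[]]; rewrite /I /= !in_itv/= => a b c.
have sq (t : R) : - (r / 2) <= t <= r / 2 -> t ^+ 2 <= r ^+ 2 / 4.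
  move=> /andP[t1 t2]; rewrite -subr_ge0 (_ : _ - _ = (r / 2 - t) * (r / 2 + t)).
    by rewrite mulr_ge0; lra.
  by field.
rewrite /ball3/= -[leRHS](ger0_norm (ltW r0)) -sqrtr_sqr ler_wsqrtr//.
have := sq _ a; have := sq _ b; have := sq _ c; have := sqr_ge0 r.
by move: (r ^+ 2) (x.1.1 ^+ 2) (x.1.2 ^+ 2) (x.2 ^+ 2) => *; lra.
Qed.

(** A lower bound, uniform in e <= 1, for the mass of [kk]. A positive lower bound suffices, so the
    exact limit of the mass is never computed. *)
Definition kk_mass mu : R := 3 * expR (- (2 * mu)) / 32.

Lemma kk_mass_gt0 mu : 0 < kk_mass mu.
Proof. by rewrite divr_gt0// mulr_gt0// expR_gt0. Qed.

(** On the ball of radius e one has r <= 2e <= 2, so [kk] is at least 3 e^{-2 mu} e^2/(2e)^5 there,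
    and the ball has volume at least e^3. *)
Lemma int_kk_ge mu e : 0 <= mu -> 0 < e -> e <= 1 ->
  ((kk_mass mu)%:E <= \int[mu3]_x (kk mu e x)%:E)%E.
Proof.
move=> mu0 e0 e1.
have mB : measurable (@ball3 R e) by exact: measurable_ball3.
apply: (@le_trans _ _ (\int[mu3]_(x in ball3 e) (kk mu e x)%:E)%E); last first.
  apply: ge0_subset_integral => //.
  - by apply/measurable_EFinP; exact: measurable_kk.
  - by move=> x _; rewrite lee_fin kk_ge0.
apply: (@le_trans _ _ (\int[mu3]_(x in ball3 e) (cst (kk_mass mu / e ^+ 3)%:E x))%E).
  rewrite integral_cst//=.
  rewrite [X in (X <= _)%E](_ : _ = (kk_mass mu / e ^+ 3)%:E * (e ^+ 3)%:E)%E; last first.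
    by rewrite -EFinM divfK// gt_eqF// exprn_gt0.
  apply: lee_wpmul2l; last exact: lebesgue3_ball_ge.
  by rewrite lee_fin divr_ge0 ?exprn_ge0 ?ltW ?kk_mass_gt0.
apply: ge0_le_integral => //.
- by move=> x _; rewrite lee_fin divr_ge0 ?exprn_ge0 ?ltW ?kk_mass_gt0.
- by apply/measurable_EFinP; apply: measurable_funTS; exact: measurable_kk.
move=> x xe; rewrite lee_fin.
have r0 := rr_gt0 x e0; have mr : 0 <= mu * rr e x by rewrite mulr_ge0// ltW.
have r2 : rr e x <= 2 * e.
  by apply: le_trans (rr_le x e0) _; rewrite mulrDl mul1r lerD2r.
rewrite (_ : kk_mass mu / e ^+ 3 = e ^+ 2 * (expR (- (2 * mu)) * 3) / (2 * e) ^+ 5); last first.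
  by rewrite /kk_mass; field; rewrite gt_eqF.
rewrite ler_pM//.
- by rewrite mulr_ge0 ?sqr_ge0// mulr_ge0// expR_ge0.
- by rewrite invr_ge0 exprn_ge0// mulr_ge0// ltW.
- rewrite ler_pM2l ?exprn_gt0// ler_pM ?expR_ge0//.
    rewrite ler_expR lerN2 mulrC; apply: ler_wpM2r => //.
    by apply: le_trans r2 _; rewrite ler_piMr.
  by rewrite lerDr addr_ge0 ?sqr_ge0// mulr_ge0.
- rewrite lef_pV2 ?posrE ?exprn_gt0 ?mulr_gt0//.
  by rewrite lerXn2r ?nnegrE ?mulr_ge0// ltW.
Qed.

End Regularized_kernel.

(** * The bump as an approximate identity, tested against L^2 functions *)

Section Approximate_identity.
Variable R : realType.
Local Notation sp := (space3 R).
Local Notation mu3 := (@lebesgue3 R).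

Lemma integral_shift (z : sp) (f : sp -> \bar R) : measurable_fun setT f ->
  (\int[mu3]_x f (x + z)%R = \int[mu3]_x f x)%E.
Proof.
move=> mf; rewrite [LHS]integralE [RHS]integralE.
rewrite -[in RHS](@ge0_integral_shift _ z (f^\+)%E)//; last exact: measurable_funepos.
rewrite -[in RHS](@ge0_integral_shift _ z (f^\-)%E)//; last exact: measurable_funeneg.
congr (_ - _)%E; apply: eq_integral => x _; first by rewrite !funeposE.
by rewrite !funenegE.
Qed.

Lemma Rintegral_shift (z : sp) (f : sp -> R) : measurable_fun setT f ->
  \int[mu3]_x f (x + z) = \int[mu3]_x f x.
Proof.
move=> mf; rewrite /Rintegral; congr fine.
by apply: (@integral_shift z (fun x => (f x)%:E)); exact/measurable_EFinP.
Qed.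

Lemma measurable_shift_arg (z : sp) (f : sp -> R) : measurable_fun setT f ->
  measurable_fun setT (fun x : sp => f (x + z)).
Proof.
move=> mf; apply: (measurableT_comp mf).
by apply: measurable_add => //; exact: measurable_id.
Qed.

Lemma L2r_shift (z : sp) (f : sp -> R) : L2r mu3 f -> L2r mu3 (fun x : sp => f (x + z)).
Proof.
move=> [mf fo]; split; first exact: measurable_shift_arg.
rewrite (@ge0_integral_shift _ z (fun x => ((f x) ^+ 2)%:E))//.
- by apply/measurable_EFinP; exact: measurable_funX.
- by move=> x; rewrite lee_fin sqr_ge0.
Qed.

Lemma int_rr4 (e : R) : 0 < e -> (\int[mu3]_x ((rr e x ^+ 4)^-1)%:E < +oo)%E.
Proof.
move=> e0.
have mB : measurable (@ball3 R e) by exact: measurable_ball3.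
have mr : measurable_fun setT (fun x : sp => (rr e x ^+ 4)^-1).
  by apply: measurable_funV; apply: measurable_funX; exact: measurable_rr.
have mi : measurable_fun setT (fun x : sp => (n2 x ^+ 2)^-1).
  by apply: measurable_funV; apply: measurable_funX; exact: measurable_n2.
rewrite -(setvU (ball3 e)) ge0_integral_setU//=; last 4 first.
- exact: measurableC.
- by apply/measurable_EFinP; apply: measurable_funTS; exact: mr.
- by move=> x _; rewrite lee_fin invr_ge0 exprn_ge0// rr_ge0.
- by apply/disj_set2P; rewrite setICl.
apply: lte_add_pinfty.
  apply: le_lt_trans (_ : (\int[mu3]_(x in ~` ball3 e) ((n2 x ^+ 2)^-1)%:E < +oo)%E).
    apply: ge0_le_integral => //.
    - exact: measurableC.
    - by move=> x _; rewrite lee_fin invr_ge0 exprn_ge0// rr_ge0.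
    - by apply/measurable_EFinP; apply: measurable_funTS; exact: mr.
    - by apply/measurable_EFinP; apply: measurable_funTS; exact: mi.
    - move=> x xe; have x0 := neq0_notin_ball (ltW e0) xe.
      rewrite lee_fin lef_pV2 ?posrE ?exprn_gt0 ?n2_gt0 ?rr_gt0//.
      rewrite -enorm_sqr -exprM lerXn2r ?nnegrE ?enorm_ge0 ?rr_ge0//.
      exact: enorm_le_rr.
  by apply: le_lt_trans (int_far_inv4 e0) _; rewrite ltry.
apply: le_lt_trans (_ : (\int[mu3]_(x in ball3 e) (cst ((e ^+ 4)^-1)%:E x) < +oo)%E).
  apply: ge0_le_integral => //.
  - by move=> x _; rewrite lee_fin invr_ge0 exprn_ge0// rr_ge0.
  - by apply/measurable_EFinP; apply: measurable_funTS; exact: mr.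
  - move=> x xe; rewrite lee_fin lef_pV2 ?posrE ?exprn_gt0 ?rr_gt0//.
    by rewrite lerXn2r ?nnegrE ?(ltW e0) ?rr_ge0// le_rr.
rewrite integral_cst//= lte_mul_pinfty//.
  by rewrite lee_fin invr_ge0 exprn_ge0// ltW.
by apply: le_lt_trans (lebesgue3_ball_le (ltW e0)) _; rewrite ltry.
Qed.

(** The common criterion for the kernels: r^{-2} is square integrable on R^3, being bounded near 0
    and of integrable square at infinity. *)
Lemma L2r_rr2 (e C : R) (g : sp -> R) : 0 < e -> measurable_fun setT g ->
  (forall x, `|g x| <= C / rr e x ^+ 2) -> L2r mu3 g.
Proof.
move=> e0 mg gC.
have mr : measurable_fun setT (fun x : sp => (rr e x ^+ 2)^-1).
  by apply: measurable_funV; apply: measurable_funX; exact: measurable_rr.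
have lr : L2r mu3 (fun x => C * (rr e x ^+ 2)^-1).
  apply: L2rZ; split => //; apply: le_lt_trans (int_rr4 e0).
  rewrite le_eqVlt; apply/orP; left; apply/eqP; apply: eq_integral => x _.
  by rewrite exprVn -exprM.
apply: L2r_le lr => // x; apply: le_trans (gC x) _; exact: ler_norm.
Qed.

Lemma L2r_kk (mu e : R) : 0 <= mu -> 0 < e -> L2r mu3 (kk mu e).
Proof.
move=> mu0 e0; apply: (@L2r_rr2 e (3 / e)) => // [|x]; first exact: measurable_kk.
rewrite ger0_norm ?kk_ge0//; apply: le_trans (kk_le _ mu0 e0) _.
have r0 := rr_gt0 x e0.
rewrite [leLHS](_ : _ = 3 / e * (e ^+ 3 / rr e x ^+ 5)); last first.
  by field; rewrite !gt_eqF.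
apply: ler_wpM2l; first by rewrite divr_ge0// ltW.
rewrite ler_pdivrMr ?exprn_gt0// [leRHS](_ : _ = rr e x ^+ 3); last first.
  by field; rewrite gt_eqF.
by rewrite lerXn2r ?nnegrE ?(ltW e0) ?(ltW r0)// le_rr.
Qed.

(** The convolution of u with the even function [kk mu e]. *)
Definition smear (mu e : R) (u : sp -> R) (y : sp) : R :=
  \int[mu3]_x (u x * kk mu e (x - y)).

Lemma measurable_kk2 (mu e : R) :
  measurable_fun setT (fun p : sp * sp => kk mu e (p.1 - p.2)).
Proof.
apply: (measurableT_comp (@measurable_kk R mu e)).
by apply: measurable_sub; [exact: measurable_fst|exact: measurable_snd].
Qed.

(** Write u(y) times the mass of [kk] as the smeared value minus the integral of [kk] z times u(y+z)
    - u(y), then use the lower bound for the mass. *)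
Lemma smear_diff_le (mu e : R) (u : sp -> R) (y : sp) : 0 <= mu -> 0 < e -> e <= 1 ->
  L2r mu3 u ->
  ((kk_mass mu * `|u y|)%:E <= `|smear mu e u y|%:E +
    \int[mu3]_z (kk mu e z * `|u (y + z) - u y|)%:E)%E.
Proof.
move=> mu0 e0 e1 lu; have [mu_ _] := lu.
have lk := L2r_kk mu0 e0; have mk := measurable_kk mu e.
have ik : mu3.-integrable setT (EFin \o kk mu e).
  have H := @integrable_of_le _ _ _ mu3 (kk mu e) (kk mu e) mk _ mk.
  apply: H => [x|]; first by rewrite ger0_norm// kk_ge0.
  by apply: le_lt_trans (int_kk_le mu0 e0) _; rewrite ltry.
have -> : smear mu e u y = \int[mu3]_z (u (z + y) * kk mu e z).
  rewrite /smear -(@Rintegral_shift y (fun x => u x * kk mu e (x - y))).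
    by apply: eq_Rintegral => z _; rewrite addrK.
  apply: measurable_funM => //; exact: measurable_shift_arg.
have luy : L2r mu3 (fun z : sp => u (z + y)) by exact: L2r_shift.
have i1 : mu3.-integrable setT (EFin \o (fun z : sp => u (z + y) * kk mu e z)).
  exact: L2r_mul.
have i2 : mu3.-integrable setT (EFin \o (fun z : sp => u y * kk mu e z)).
  have -> : EFin \o (fun z : sp => u y * kk mu e z) = (fun z : sp => (u y)%:E * (kk mu e z)%:E)%E.
    by apply/funext => z; rewrite -EFinM.
  exact: integrableZl.
have i3 : mu3.-integrable setT (EFin \o (fun z : sp => u (z + y) * kk mu e z - u y * kk mu e z)).
  have -> : EFin \o (fun z : sp => u (z + y) * kk mu e z - u y * kk mu e z) =
     (fun z : sp => (u (z + y) * kk mu e z)%:E - (u y * kk mu e z)%:E)%E.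
    by apply/funext => z; rewrite -EFinB.
  exact: integrableB.
have H : `|u y| * \int[mu3]_z kk mu e z <= `|\int[mu3]_z (u (z + y) * kk mu e z)| +
    \int[mu3]_z `|u (z + y) * kk mu e z - u y * kk mu e z|.
  have m0 : 0 <= \int[mu3]_z kk mu e z by apply: Rintegral_ge0 => z _; exact: kk_ge0.
  rewrite -[X in `|u y| * X](ger0_norm m0) -normrM -RintegralZl//.
  rewrite -[X in `|X|](subKr (\int[mu3]_z (u (z + y) * kk mu e z))).
  rewrite -RintegralB//; apply: le_trans (ler_normB _ _) _; rewrite lerD2l.
  exact: le_normr_Rintegral.
have mE : (\int[mu3]_z (kk mu e z)%:E = (\int[mu3]_z kk mu e z)%:E)%E.
  by rewrite /Rintegral fineK//; exact: integrable_fin_num.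
have mlow : kk_mass mu <= \int[mu3]_z kk mu e z.
  by rewrite -lee_fin -mE; exact: int_kk_ge.
have -> : (\int[mu3]_z (kk mu e z * `|u (y + z) - u y|)%:E)%E =
   (\int[mu3]_z `|u (z + y) * kk mu e z - u y * kk mu e z|)%:E.
  rewrite /Rintegral fineK; last first.
    by apply: integrable_fin_num => //; exact: integrable_norm.
  apply: eq_integral => z _; rewrite -mulrBl normrM mulrC [z + y]addrC.
  by rewrite (ger0_norm (kk_ge0 _ mu0 e0)).
rewrite -EFinD lee_fin; apply: le_trans H; rewrite mulrC.
exact: ler_wpM2l.
Qed.

End Approximate_identity.

Section Approximate_identity_bound.
Variable R : realType.
Local Notation sp := (space3 R).
Local Notation mu3 := (@lebesgue3 R).

Lemma int3D (D : set sp) (f g : sp -> \bar R) : measurable D ->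
  measurable_fun setT f -> measurable_fun setT g ->
  (forall x, 0 <= f x)%E -> (forall x, 0 <= g x)%E ->
  (\int[mu3]_(x in D) (f x + g x) = \int[mu3]_(x in D) f x + \int[mu3]_(x in D) g x)%E.
Proof.
by move=> mD mf mg f0 g0; rewrite ge0_integralD//; apply: measurable_funTS; [exact: mf|exact: mg].
Qed.

Lemma int3Z (D : set sp) (f : sp -> \bar R) (k : \bar R) : measurable D ->
  measurable_fun setT f -> (forall x, 0 <= f x)%E -> (0 <= k)%E ->
  (\int[mu3]_(x in D) (k * f x) = k * \int[mu3]_(x in D) f x)%E.
Proof.
by move=> mD mf f0 k0; rewrite ge0_integralZl//; apply: measurable_funTS; exact: mf.
Qed.

Lemma int3_le (D : set sp) (f g : sp -> \bar R) : measurable D ->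
  measurable_fun setT f -> measurable_fun setT g ->
  (forall x, 0 <= f x)%E -> (forall x, D x -> f x <= g x)%E ->
  (\int[mu3]_(x in D) f x <= \int[mu3]_(x in D) g x)%E.
Proof.
move=> mD mf mg f0 fg.
have mf' : measurable_fun D f by apply: measurable_funTS; exact: mf.
have mg' : measurable_fun D g by apply: measurable_funTS; exact: mg.
exact: ge0_le_integral.
Qed.

Lemma int3_split (D : set sp) (f : sp -> \bar R) : measurable D ->
  measurable_fun setT f -> (forall x, 0 <= f x)%E ->
  (\int[mu3]_x f x = \int[mu3]_(x in D) f x + \int[mu3]_(x in ~` D) f x)%E.
Proof.
move=> mD mf f0; rewrite -[in LHS](setvU D) addeC ge0_integral_setU//=.
- exact: measurableC.
- by apply: measurable_funTS; exact: mf.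
- by apply/disj_set2P; rewrite setICl.
Qed.

Lemma measurable_fst3 : measurable_fun setT (fun p : sp * sp => p.1).
Proof. exact: measurable_fst. Qed.

Lemma measurable_snd3 : measurable_fun setT (fun p : sp * sp => p.2).
Proof. exact: measurable_snd. Qed.

Lemma measurable_fun1 (f : sp -> R) : measurable_fun setT f ->
  measurable_fun setT (fun p : sp * sp => f p.1).
Proof. by move=> mf; exact: (measurableT_comp mf measurable_fst3). Qed.

Lemma measurable_fun2 (f : sp -> R) : measurable_fun setT f ->
  measurable_fun setT (fun p : sp * sp => f p.2).
Proof. by move=> mf; exact: (measurableT_comp mf measurable_snd3). Qed.

Lemma measurable_funB2 (f : sp -> R) : measurable_fun setT f ->
  measurable_fun setT (fun p : sp * sp => f (p.1 - p.2)).
Proof.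
move=> mf; apply: (measurableT_comp mf).
by apply: measurable_sub; [exact: measurable_fst3|exact: measurable_snd3].
Qed.

(** This weighted form, with s free, replaces Cauchy-Schwarz where the integrals involved may be
    infinite. *)
Lemma young_s (s a b : R) : 0 < s -> a * b <= s * a ^+ 2 + s^-1 * b ^+ 2.
Proof.
move=> s0; rewrite -subr_ge0.
have -> : s * a ^+ 2 + s^-1 * b ^+ 2 - a * b =
    s^-1 * ((s * a - b / 2) ^+ 2 + 3 / 4 * b ^+ 2).
  by field; rewrite gt_eqF.
have b2 : 0 <= 3 / 4 * b ^+ 2 by rewrite mulr_ge0 ?sqr_ge0// divr_ge0.
by rewrite mulr_ge0 ?invr_ge0 ?(ltW s0)// addr_ge0// sqr_ge0.
Qed.

Lemma int_mul_le (f g : sp -> R) (s : R) (A B : \bar R) : 0 < s ->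
  measurable_fun setT f -> measurable_fun setT g ->
  (\int[mu3]_x ((f x) ^+ 2)%:E <= A)%E -> (\int[mu3]_x ((g x) ^+ 2)%:E <= B)%E ->
  (\int[mu3]_x (`|f x| * `|g x|)%:E <= s%:E * A + s^-1%:E * B)%E.
Proof.
move=> s0 mf mg fA gB.
have mf2 : measurable_fun setT (fun x => (f x ^+ 2)%:E).
  by apply/measurable_EFinP; exact: measurable_funX.
have mg2 : measurable_fun setT (fun x => (g x ^+ 2)%:E).
  by apply/measurable_EFinP; exact: measurable_funX.
apply: (@le_trans _ _ (\int[mu3]_x (s%:E * (f x ^+ 2)%:E + s^-1%:E * (g x ^+ 2)%:E))%E).
  apply: ge0_le_integral => //.
  - apply/measurable_EFinP; apply: measurable_funM; apply: measurableT_comp => //.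
  - by apply: emeasurable_funD; apply: emeasurable_funM => //.
  - move=> x _; rewrite -!EFinM -EFinD lee_fin.
    rewrite -[f x ^+ 2]real_normK ?num_real// -[g x ^+ 2]real_normK ?num_real//.
    exact: young_s.
have p0 (h : sp -> R) x : (0 <= (h x ^+ 2)%:E)%E by rewrite lee_fin sqr_ge0.
have s0' : (0 <= s%:E)%E by rewrite lee_fin ltW.
have s0'' : (0 <= s^-1%:E)%E by rewrite lee_fin invr_ge0 ltW.
rewrite int3D//.
- by rewrite !int3Z//; apply: leeD; apply: lee_wpmul2l.
- by apply: emeasurable_funM.
- by apply: emeasurable_funM.
- by move=> x; rewrite mule_ge0.
- by move=> x; rewrite mule_ge0.
Qed.

Lemma int_shift_diff_le (u : sp -> R) (z : sp) : L2r mu3 u ->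
  (\int[mu3]_x ((u (x + z) - u x) ^+ 2)%:E <= (4 * ip mu3 u u)%:E)%E.
Proof.
move=> lu; have ls := L2r_shift z lu.
have mu_ : measurable_fun setT u by case: lu.
have ms : measurable_fun setT (fun x : sp => u (x + z)) by case: ls.
have sE : (\int[mu3]_x (u (x + z)%R ^+ 2)%:E = (ip mu3 u u)%:E)%E.
  rewrite (@ge0_integral_shift _ z (fun x => (u x ^+ 2)%:E)) ?ipE//.
  - by apply/measurable_EFinP; exact: measurable_funX.
  - by move=> x; rewrite lee_fin sqr_ge0.
have m1 : measurable_fun setT (fun x : sp => (u (x + z)%R ^+ 2)%:E).
  by apply/measurable_EFinP; exact: measurable_funX.
have m2 : measurable_fun setT (fun x : sp => (u x ^+ 2)%:E).
  by apply/measurable_EFinP; exact: measurable_funX.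
apply: (@le_trans _ _ (\int[mu3]_x (2%:E * ((u (x + z)%R ^+ 2)%:E + (u x ^+ 2)%:E)))%E).
  apply: ge0_le_integral => //.
  - by move=> x _; rewrite lee_fin sqr_ge0.
  - by apply/measurable_EFinP; apply: measurable_funX; exact: measurable_funB.
  - by apply: emeasurable_funM => //; apply: emeasurable_funD; [exact: m1|exact: m2].
  - move=> x _; rewrite -EFinD -EFinM lee_fin.
    rewrite -subr_ge0 (_ : _ - _ = (u (x + z) + u x) ^+ 2) ?sqr_ge0//; ring.
have p0 (h : sp -> R) x : (0 <= (h x ^+ 2)%:E)%E by rewrite lee_fin sqr_ge0.
rewrite int3Z//; last 2 first.
- by apply: emeasurable_funD; [exact: m1|exact: m2].
- by move=> x; rewrite adde_ge0// lee_fin sqr_ge0.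
rewrite (int3D measurableT m1 m2 (p0 (fun x => u (x + z))) (p0 u)).
rewrite sE ipE// -EFinD -EFinM lee_fin le_eqVlt; apply/orP; left; apply/eqP; ring.
Qed.

(** After Tonelli the quantity is the integral of [kk] z times Phi(z), where Phi(z) pairs |f| with
    |u(. + z) - u|. Phi is small near 0 by L^2 continuity of translations and bounded everywhere,
    while the mass of [kk] away from 0 is of order e^2. *)
Lemma int_smear_diff_small (mu : R) (f u : sp -> R) (eta : R) : 0 <= mu ->
  L2r mu3 f -> L2r mu3 u -> 0 < eta ->
  exists2 e0, 0 < e0 <= 1 & forall e, 0 < e <= e0 ->
   (\int[mu3]_y (`|f y|%:E * \int[mu3]_z (kk mu e z * `|u (y + z) - u y|)%:E)
     <= eta%:E)%E.
Proof.
move=> mu0 lf lu eta0.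
have mf : measurable_fun setT f by case: lf.
have mu_ : measurable_fun setT u by case: lu.
pose A := ip mu3 f f; pose B := 4 * ip mu3 u u.
have A0 : 0 <= A by exact: ip_ge0.
have B0 : 0 <= B by rewrite mulr_ge0// ip_ge0.
(* On the small ball Phi <= s (A + 1), and [kk] has mass at most 408, so this part contributes at
   most eta/2. *)
pose s := eta / (2 * 408 * (A + 1)).
have s0 : 0 < s by rewrite divr_gt0// !mulr_gt0//; lra.
have [del d0 hdel] := L2_shift_continuous lu (exprn_gt0 2 s0).
pose d := del / 2; have dp : 0 < d by rewrite divr_gt0.
(* Chosen so that (A + B) times the far mass 384 e^2/d^2 is at most eta/2; e <= 1 allows e^2 <=
   e. *)
pose e0 := Num.min 1 (eta * d ^+ 2 / (2 * 384 * (A + B + 1))).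
have e00 : 0 < e0.
  by rewrite lt_min ltr01/= divr_gt0 ?mulr_gt0 ?exprn_gt0//; lra.
exists e0; first by rewrite e00/= ge_min lexx.
move=> e /andP[ep ee0].
have mk := measurable_kk mu e.
pose Phi z := (\int[mu3]_y (`|f y| * `|u (y + z)%R - u y|)%:E)%E.
have ms z : measurable_fun setT (fun y : sp => u (y + z) - u y).
  by apply: measurable_funB => //; exact: measurable_shift_arg.
have P1 z : (Phi z <= (A + B)%:E)%E.
  have := int_mul_le ltr01 mf (ms z) (_ : _ <= A%:E)%E (int_shift_diff_le z lu).
  rewrite invr1 !mul1e -EFinD; apply; by rewrite ipE.
have P2 z : enorm z < del -> (Phi z <= (s * (A + 1))%:E)%E.
  move=> zd; have := int_mul_le s0 mf (ms z) (_ : _ <= A%:E)%E (hdel z zd).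
  rewrite -!EFinM -EFinD (_ : s * A + s^-1 * s ^+ 2 = s * (A + 1)).
    by apply; rewrite ipE.
  by field; rewrite gt_eqF.
pose F (y z : sp) := (kk mu e z * (`|f y| * `|u (y + z)%R - u y|))%:E.
have mF : measurable_fun setT (fun p : sp * sp => F p.1 p.2).
  apply/measurable_EFinP; apply: measurable_funM; first exact: measurable_fun2.
  apply: measurable_funM; apply: measurableT_comp => //; first exact: measurable_fun1.
  apply: measurable_funB; last exact: measurable_fun1.
  apply: (measurableT_comp mu_).
  by apply: measurable_add; [exact: measurable_fst3|exact: measurable_snd3].
have k0 z : 0 <= kk mu e z by exact: kk_ge0.
have F0 y z : (0 <= F y z)%E by rewrite lee_fin; apply: mulr_ge0 => //; exact: mulr_ge0.
have -> : (\int[mu3]_y (`|f y|%:E * \int[mu3]_z (kk mu e z * `|u (y + z)%R - u y|)%:E)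
    = \int[mu3]_y \int[mu3]_z F y z)%E.
  apply: eq_integral => y _; rewrite -int3Z//.
  - by apply: eq_integral => z _; rewrite /F -EFinM; congr EFin; ring.
  - apply/measurable_EFinP; apply: measurable_funM; first exact: mk.
    apply: measurableT_comp => //; apply: measurable_funB => //.
    apply: (measurableT_comp mu_); apply: measurable_add => //; exact: measurable_id.
  - by move=> z; rewrite lee_fin; exact: mulr_ge0.
rewrite (tonelli3 mF F0).
have mP : measurable_fun setT Phi.
  apply: (@measurable_int2 _ (fun y z => (`|f y| * `|u (y + z)%R - u y|)%:E)).
    apply/measurable_EFinP; apply: measurable_funM; apply: measurableT_comp => //.
      exact: measurable_fun1.
    apply: measurable_funB; last exact: measurable_fun1.
    apply: (measurableT_comp mu_).
    by apply: measurable_add; [exact: measurable_fst3|exact: measurable_snd3].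
  by move=> x y; rewrite lee_fin mulr_ge0.
have P0 z : (0 <= Phi z)%E by apply: integral_ge0 => y _; rewrite lee_fin mulr_ge0.
have -> : (\int[mu3]_z \int[mu3]_y F y z = \int[mu3]_z ((kk mu e z)%:E * Phi z))%E.
  apply: eq_integral => z _; rewrite /Phi -int3Z//.
  - apply/measurable_EFinP; apply: measurable_funM; apply: measurableT_comp => //.
  - by rewrite lee_fin.
have mB : measurable (@ball3 R d) by exact: measurable_ball3.
have mkP : measurable_fun setT (fun z => (kk mu e z)%:E * Phi z)%E.
  by apply: emeasurable_funM => //; exact/measurable_EFinP.
have mke : measurable_fun setT (fun z => (kk mu e z)%:E).
  exact/measurable_EFinP.
have kP0 z : (0 <= (kk mu e z)%:E * Phi z)%E by rewrite mule_ge0// lee_fin kk_ge0.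
rewrite (int3_split mB mkP kP0) addeC.
rewrite (_ : eta = eta / 2 + eta / 2); last by field.
rewrite EFinD; apply: leeD.
  apply: (@le_trans _ _ (\int[mu3]_(z in ~` ball3 d) ((A + B)%:E * (kk mu e z)%:E))%E).
    apply: (int3_le _ mkP _ kP0); first exact: measurableC.
      by apply: emeasurable_funM; [exact: measurable_cst|exact: mke].
    by move=> z _; rewrite muleC; apply: lee_wpmul2r => //; rewrite lee_fin kk_ge0.
  rewrite int3Z//; [|exact: measurableC|by rewrite lee_fin addr_ge0].
  apply: (@le_trans _ _ ((A + B)%:E * (384 * e ^+ 2 / d ^+ 2)%:E)%E).
    by apply: lee_wpmul2l; [rewrite lee_fin addr_ge0|exact: int_kk_far].
  rewrite -EFinM lee_fin.
  have e1 : e <= 1 by apply: le_trans ee0 _; rewrite ge_min lexx.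
  have e2 : e <= eta * d ^+ 2 / (2 * 384 * (A + B + 1)).
    by apply: le_trans ee0 _; rewrite ge_min lexx orbT.
  have d2 : 0 < d ^+ 2 by rewrite exprn_gt0.
  have ee : e ^+ 2 <= e by rewrite expr2 ler_piMr// ltW.
  have AB : 0 < 2 * 384 * (A + B + 1) by rewrite mulr_gt0//; lra.
  move: e2; rewrite ler_pdivlMr// => e2.
  rewrite mulrA ler_pdivrMr//.
  have : (A + B) * e ^+ 2 <= (A + B + 1) * e.
    by apply: ler_pM => //; rewrite ?addr_ge0 ?sqr_ge0// lerDl.
  move: e2; rewrite !mulrA; move: (d ^+ 2) (e ^+ 2) => dd e'; move: ((A + B + 1)) (A + B) => a b.
  nra.
apply: (@le_trans _ _ (\int[mu3]_(z in ball3 d) ((s * (A + 1))%:E * (kk mu e z)%:E))%E).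
  apply: (int3_le mB mkP _ kP0).
    by apply: emeasurable_funM; [exact: measurable_cst|exact: mke].
  move=> z zd; rewrite muleC; apply: lee_wpmul2r; first by rewrite lee_fin kk_ge0.
    by apply: P2; apply: le_lt_trans zd _; rewrite /d ltr_pdivrMr//; lra.
rewrite int3Z//; last by rewrite lee_fin mulr_ge0// ?addr_ge0// ltW.
apply: (@le_trans _ _ ((s * (A + 1))%:E * 408%:E)%E).
  apply: lee_wpmul2l; first by rewrite lee_fin mulr_ge0// ?addr_ge0// ltW.
  apply: le_trans (int_kk_le mu0 ep); apply: ge0_subset_integral => //.
  by move=> z _; rewrite lee_fin.
rewrite -EFinM lee_fin /s le_eqVlt; apply/orP; left; apply/eqP; field.
by rewrite gt_eqF//; lra.
Qed.

Lemma measurable_Rint2 (f : sp -> sp -> R) :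
  measurable_fun setT (fun p : sp * sp => f p.1 p.2) ->
  measurable_fun setT (fun y => \int[mu3]_x f x y).
Proof.
move=> mf.
have mfE : measurable_fun setT (fun p : sp * sp => (f p.1 p.2)%:E) by exact/measurable_EFinP.
rewrite /Rintegral; apply: measurableT_comp; first exact: fine_measurable.
have -> : (fun y => \int[mu3]_x (f x y)%:E)%E = (fun y =>
   \int[mu3]_x maxe (f x y)%:E 0 - \int[mu3]_x maxe (- (f x y)%:E) 0)%E.
  apply/funext => y; rewrite integralE; congr (_ - _)%E; apply: eq_integral => x _.
    by rewrite funeposE.
  by rewrite funenegE.
have m0 : measurable_fun setT (fun p : sp * sp => 0%E : \bar R) by exact: measurable_cst.
apply: emeasurable_funB.
  apply: (@measurable_int2 _ (fun x y => maxe (f x y)%:E 0%E)).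
    by apply: measurable_maxe; [exact: mfE|exact: m0].
  by move=> x y; rewrite le_max lexx orbT.
apply: (@measurable_int2 _ (fun x y => maxe (- (f x y)%:E)%E 0%E)).
  by apply: measurable_maxe; [apply: measurableT_comp; [by []|exact: mfE]|exact: m0].
by move=> x y; rewrite le_max lexx orbT.
Qed.

Lemma measurable_smear (mu e : R) (u : sp -> R) : measurable_fun setT u ->
  measurable_fun setT (smear mu e u).
Proof.
move=> mu_; apply: (@measurable_Rint2 (fun x y => u x * kk mu e (x - y))).
by apply: measurable_funM; [exact: measurable_fun1|exact: measurable_kk2].
Qed.

(** Integrates [smear_diff_le] against |f|. It replaces almost everywhere convergence of
    mollifications: any bound on [smear] uniform in e passes to u at the cost of the factor
    [kk_mass mu]. *)
Lemma approximate_identity (mu : R) (f u : sp -> R) (eta : R) : 0 <= mu ->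
  L2r mu3 f -> L2r mu3 u -> 0 < eta ->
  exists2 e0, 0 < e0 <= 1 & forall e, 0 < e <= e0 ->
  ((kk_mass mu)%:E * \int[mu3]_y (`|f y| * `|u y|)%:E <=
    \int[mu3]_y (`|f y| * `|smear mu e u y|)%:E + eta%:E)%E.
Proof.
move=> mu0 lf lu eta0.
have [e0 e01 He] := int_smear_diff_small mu0 lf lu eta0.
exists e0 => // e ee; have := He e ee; have /andP[ep ee0] := ee.
have mf : measurable_fun setT f by case: lf.
have mu_ : measurable_fun setT u by case: lu.
have ms := measurable_smear mu e mu_.
set D := (fun y => \int[mu3]_z (kk mu e z * `|u (y + z)%R - u y|)%:E)%E.
have k0 z : 0 <= kk mu e z by exact: kk_ge0.
have D0 y : (0 <= D y)%E by apply: integral_ge0 => z _; rewrite lee_fin mulr_ge0.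
have mD : measurable_fun setT D.
  apply: (@measurable_int1 _ (fun y z => (kk mu e z * `|u (y + z)%R - u y|)%:E)).
    apply/measurable_EFinP; apply: measurable_funM.
      by apply: measurable_fun2; exact: measurable_kk.
    apply: measurableT_comp => //.
    apply: measurable_funB; last exact: measurable_fun1.
    apply: (measurableT_comp mu_).
    by apply: measurable_add; [exact: measurable_fst3|exact: measurable_snd3].
  by move=> x y; rewrite lee_fin mulr_ge0.
have maf : measurable_fun setT (fun y => `|f y|%:E).
  by apply/measurable_EFinP; apply: measurableT_comp => //; exact: mf.
have mfu : measurable_fun setT (fun y => (`|f y| * `|u y|)%:E).
  by apply/measurable_EFinP; apply: measurable_funM; apply: measurableT_comp.
have mfs : measurable_fun setT (fun y => (`|f y| * `|smear mu e u y|)%:E).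
  by apply/measurable_EFinP; apply: measurable_funM; apply: measurableT_comp.
have mfD : measurable_fun setT (fun y => `|f y|%:E * D y)%E.
  by apply: emeasurable_funM; [exact: maf|exact: mD].
move=> Hs; apply: le_trans (leeD (lexx _) Hs).
have e1 : e <= 1 by apply: le_trans ee0 _; case/andP: e01.
rewrite -(int3Z measurableT mfu); last 2 first.
- by move=> x; rewrite lee_fin mulr_ge0.
- by rewrite lee_fin ltW// kk_mass_gt0.
rewrite -(int3D measurableT mfs mfD); last 2 first.
- by move=> x; rewrite lee_fin mulr_ge0.
- by move=> x; rewrite mule_ge0.
apply: int3_le => //.
- by apply: emeasurable_funM; [exact: measurable_cst|exact: mfu].
- by apply: emeasurable_funD; [exact: mfs|exact: mfD].
- move=> x; rewrite mule_ge0// lee_fin ?mulr_ge0// ltW// kk_mass_gt0//.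
- move=> y _; have := smear_diff_le y mu0 ep e1 lu.
  rewrite -/(D y) => h.
  have -> : ((kk_mass mu)%:E * (`|f y| * `|u y|)%:E = `|f y|%:E * (kk_mass mu * `|u y|)%:E)%E.
    by rewrite -!EFinM; congr EFin; ring.
  have -> : ((`|f y| * `|smear mu e u y|)%:E + `|f y|%:E * D y =
      `|f y|%:E * (`|smear mu e u y|%:E + D y))%E.
    by rewrite [RHS]ge0_muleDr ?lee_fin// EFinM.
  by apply: lee_wpmul2l => //; rewrite lee_fin.
Qed.

End Approximate_identity_bound.

(** * Integrals of partial derivatives of compactly supported functions *)

Lemma integrable_bounded_support d (T : measurableType d) (R : realType)
    (mu : {measure set T -> \bar R}) (A : set T) (f : T -> R) (M : R) :
  measurable A -> (mu A < +oo)%E -> measurable_fun setT f -> 0 <= M ->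
  (forall x, `|f x| <= M) -> (forall x, ~ A x -> f x = 0) ->
  mu.-integrable setT (EFin \o f).
Proof.
move=> mA Aoo mf M0 fM fA.
apply: (@integrable_of_le _ _ _ mu f (fun x => M * \1_A x)) => //.
- move=> x; rewrite indicE; case: (boolP (x \in A)) => xA.
    by rewrite mulr1.
  by rewrite mulr0 fA ?normr0//; move/negP: xA; rewrite inE.
- by apply: measurable_funM => //; exact: measurable_indic.
- under eq_integral do rewrite EFinM.
  rewrite ge0_integralZl//.
  + by rewrite integral_indic// setIT lte_mul_pinfty.
  + by apply/measurable_EFinP; exact: measurable_indic.
Qed.

Lemma prod_integral_eq0r d1 d2 (T1 : measurableType d1) (T2 : measurableType d2)
    (R : realType) (m1 : {sigma_finite_measure set T1 -> \bar R})
    (m2 : {sigma_finite_measure set T2 -> \bar R}) (f : T1 * T2 -> R) :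
  (m1 \x m2)%E.-integrable setT (EFin \o f) ->
  (forall x, \int[m2]_y (f (x, y))%:E = 0)%E ->
  (\int[m1 \x m2]_p (f p)%:E = 0)%E.
Proof.
move=> intf f0; rewrite -(integral12_prod_meas1 intf) -[RHS](integral0 m1 setT).
by apply: eq_integral => x _; exact: f0.
Qed.

Lemma prod_integral_eq0l d1 d2 (T1 : measurableType d1) (T2 : measurableType d2)
    (R : realType) (m1 : {sigma_finite_measure set T1 -> \bar R})
    (m2 : {sigma_finite_measure set T2 -> \bar R}) (f : T1 * T2 -> R) :
  (m1 \x m2)%E.-integrable setT (EFin \o f) ->
  (forall y, \int[m1]_x (f (x, y))%:E = 0)%E ->
  (\int[m1 \x m2]_p (f p)%:E = 0)%E.
Proof.
move=> intf f0; rewrite -(integral21_prod_meas1 intf) -[RHS](integral0 m2 setT).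
by apply: eq_integral => x _; exact: f0.
Qed.

Section Integration_by_parts.
Variable R : realType.
Local Notation sp := (space3 R).
Local Notation mu3 := (@lebesgue3 R).

Definition co (i : 'I_3) (x : sp) : R :=
  if i == 0 :> nat then x.1.1 else if i == 1 :> nat then x.1.2 else x.2.

Lemma co_le_enorm i x : `|co i x| <= enorm x.
Proof.
by rewrite /co; case: (coord_le_enorm x) => h1 h2 h3; case: ifP => // _; case: ifP.
Qed.

Lemma co_line i x (s : R) : co i (x + s *: basis3 R i) = co i x + s.
Proof.
by case: i => -[|[|[|//]]] Hi; rewrite /co/=; congr (_ + _); exact: mulr1.
Qed.

Lemma line_is_derive i (f : sp -> R) x (t : R) :
  differentiable f (x + t *: basis3 R i) ->
  is_derive t (1 : R) (fun s => f (x + s *: basis3 R i)) (partial i f (x + t *: basis3 R i)).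
Proof.
set v := basis3 R i => df.
have E : (fun h : R => h^-1 *: (((fun s => f (x + s *: v)) \o shift t) (h *: (1 : R))
    - f (x + t *: v))) =
    (fun h : R => h^-1 *: ((f \o shift (x + t *: v)) (h *: v) - f (x + t *: v))).
  apply/funext => h; congr (_ *: (f _ - _)); rewrite /shift/=.
  by rewrite scalerDl /GRing.scale/= mulr1 addrCA.
have dv : derivable f (x + t *: v) v by exact: diff_derivable.
apply: DeriveDef; first by rewrite /derivable E; exact: dv.
by rewrite /derive E.
Qed.

Lemma enorm_gt_near (rho : R) x : rho < enorm x -> \forall y \near x, rho < enorm y.
Proof.
move=> rx; have : continuous (@enorm R).
  move=> y; rewrite /enorm; apply: continuous_comp; last exact: sqrt_continuous.
  have c1 : continuous (fun x : sp => x.1.1).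
    by move=> z; apply: continuous_comp; exact: fst_continuous || exact: cvg_fst.
  have c2 : continuous (fun x : sp => x.1.2).
    by move=> z; apply: continuous_comp; [exact: cvg_fst|exact: cvg_snd].
  have c3 : continuous (fun x : sp => x.2) by move=> z; exact: cvg_snd.
  apply: continuousD; last by rewrite /continuous_at; apply: cvgM; exact: c3.
  by apply: continuousD; rewrite /continuous_at; apply: cvgM; (exact: c1 || exact: c2).
by move=> ce; apply: (cvgr_gt _ (ce x)).
Qed.

Lemma partial_eq0_far i (f : sp -> R) (rho : R) :
  (forall x, rho < enorm x -> f x = 0) -> forall x, rho < enorm x -> partial i f x = 0.
Proof.
move=> f0 x rx; rewrite /partial (@near_eq_derive _ _ _ f (cst 0)) ?derive_cst//.
by apply: filterS (enorm_gt_near rx) => y /f0.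
Qed.

Lemma int_line_eq0 i (f : sp -> R) (rho : R) (x : sp) :
  (forall y, differentiable f y) -> continuous (partial i f) ->
  (forall y, rho < enorm y -> f y = 0) ->
  (\int[@lebesgue_measure R]_s (partial i f (x + s *: basis3 R i))%:E = 0)%E.
Proof.
move=> df cf f0.
pose g (s : R) := f (x + s *: basis3 R i); pose g' (s : R) := partial i f (x + s *: basis3 R i).
have dg t : is_derive t (1 : R) g (g' t) by exact: line_is_derive.
(* For |t| >= r the i-th coordinate of the point of the line already exceeds rho in absolute
   value. *)
pose r : R := `|rho| + `|co i x| + 1.
have r0 : 0 < r by rewrite ltr_wpDl// addr_ge0.
have far (t : R) : r <= `|t| -> rho < enorm (x + t *: basis3 R i).
  move=> rt; apply: lt_le_trans (co_le_enorm i _); rewrite co_line.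
  have h1 : `|t| <= `|co i x + t| + `|co i x|.
    by apply: le_trans (ler_normB _ _); rewrite [X in _ <= `|X|](_ : _ = t)//; ring.
  have h2 := ler_norm rho.
  by move: rt h1 h2; rewrite /r; move: `|co i x + t| `|t| `|co i x| `|rho| => *; lra.
have g0 (t : R) : r <= `|t| -> g t = 0 by move=> /far/f0.
have g'0 (t : R) : r <= `|t| -> g' t = 0 by move=> /far; exact: partial_eq0_far.
have cl : continuous (fun s : R => x + s *: basis3 R i).
  move=> s; apply: cvgD; first exact: cvg_cst.
  by apply: cvgZr_tmp; exact: cvg_id.
have cg' : continuous g'.
  by move=> s; apply: continuous_comp; [exact: cl|exact: cf].
have cg : continuous g.
  by move=> s; apply: differentiable_continuous; apply/derivable1_diffP; case: (dg s).
have <- : (\int[@lebesgue_measure R]_(s in `[(- r)%R, r]) (g' s)%:E = 0)%E.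
  rewrite (@continuous_FTC2 _ g' g).
  - by rewrite !g0 ?subee// ?normrN ger0_norm// ltW.
  - lra.
  - exact: continuous_subspaceT.
  - split; first by move=> s _; case: (dg s).
      by apply: cvg_at_right_filter; exact: cg.
    by apply: cvg_at_left_filter; exact: cg.
  - by move=> s _; rewrite derive1E; have [_ ->] := dg s.
rewrite [RHS]integral_mkcond; apply: eq_integral => s _; rewrite patchE.
case: ifPn => //; rewrite notin_setE/= in_itv/= => /negP h.
by congr EFin; apply: g'0; rewrite leNgt; apply: contra h => /ltW; rewrite ler_norml.
Qed.

Lemma continuous_bounded_support (F : sp -> R) (rho : R) : continuous F ->
  (forall x, rho < enorm x -> F x = 0) -> exists2 M, 0 <= M & forall x, `|F x| <= M.
Proof.
move=> cF F0.
pose I : set R := `[- `|rho|, `|rho|]%classic.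
have cI : compact I by exact: segment_compact.
have I0 : I 0 by rewrite /I/= in_itv/= oppr_le0 normr_ge0.
have [|||c _ hc] := @compact_EVT_max _ R (fun x : sp => `|F x|) ((I `*` I) `*` I).
- by exists (0, 0, 0); split.
- by apply: compact_setX => //; exact: compact_setX.
- apply: continuous_subspaceT => x.
  by apply: continuous_comp; [exact: cF|exact: norm_continuous].
exists `|F c| => // x; have [xr|xr] := leP (enorm x) rho; last by rewrite F0// normr0.
apply: hc; have [h1 h2 h3] := coord_le_enorm x.
have xr' := le_trans xr (ler_norm rho).
rewrite inE; split; [split|]; rewrite /I/= in_itv/= -ler_norml;
  [exact: le_trans h1 xr'|exact: le_trans h2 xr'|exact: le_trans h3 xr'].
Qed.

(** Fubini with integration first along lines parallel to the i-th axis, on which the fundamental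
    theorem of calculus gives 0. The three cases differ only in the order of integration. *)
Lemma int_partial_eq0 i (f : sp -> R) (rho : R) :
  (forall y, differentiable f y) -> continuous (partial i f) ->
  (forall y, rho < enorm y -> f y = 0) ->
  mu3.-integrable setT (EFin \o partial i f) /\
  (\int[mu3]_x (partial i f x)%:E = 0)%E.
Proof.
move=> df cf f0; have p0 := partial_eq0_far i f0.
have [M M0 hM] := continuous_bounded_support cf p0.
have mp : measurable_fun setT (partial i f) by exact: continuous_measurable3.
have intp : mu3.-integrable setT (EFin \o partial i f).
  apply: (@integrable_bounded_support _ _ _ mu3 (ball3 `|rho|) _ M) => //.
  - exact: measurable_ball3.
  - by apply: le_lt_trans (lebesgue3_ball_le (normr_ge0 _)) _; rewrite ltry.
  - move=> x xr; apply: p0; rewrite ltNge; apply/negP => xr'; apply: xr.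
    by rewrite /ball3/= (le_trans xr')// ler_norm.
split => //.
pose I : set (measurableTypeR R) := `[- `|rho|, `|rho|]%classic.
have mI : measurable I by exact: measurable_itv.
have Ioo : ((@lebesgue_measure R) I < +oo)%E.
  by rewrite /I lebesgue_measure_itv/=; case: ifP => // _; rewrite -EFinB ltry.
have int2 c : (@lebesgue2 R).-integrable setT (EFin \o (fun p => partial i f (p, c))).
  apply: (@integrable_bounded_support _ _ _ (@lebesgue2 R) (I `*` I) _ M) => //.
  - exact: measurableX.
  - have E2 : (@lebesgue2 R) (I `*` I) = ((@lebesgue_measure R) I * (@lebesgue_measure R) I)%E.
      exact: product_measure1E.
    have : ((@lebesgue2 R) (I `*` I) < +oo)%E by rewrite E2 lte_mul_pinfty// ge0_fin_numE.
    exact.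
  - apply: (measurableT_comp mp); apply: measurable_fun_pair => //.
  - move=> [a b] ab; apply: p0; rewrite ltNge; apply/negP => xr'; apply: ab.
    have [h1 h2 _] := coord_le_enorm (a, b, c).
    have xr2 := le_trans xr' (ler_norm rho).
    by split; rewrite /I/= in_itv/= -ler_norml; [exact: le_trans h1 xr2|exact: le_trans h2 xr2].
have := int_line_eq0 _ df cf f0.
case: i df cf p0 hM mp intp int2 => -[|[|[|//]]] Hi df cf p0 hM mp intp int2 L.
- apply: prod_integral_eq0l; first exact: intp.
  move=> c; apply: prod_integral_eq0l; first exact: (int2 c).
  move=> b; rewrite -[RHS](L (0, b, c)); apply: eq_integral => s _.
  have -> : (0, b, c) + s *: basis3 R (Ordinal Hi) = (0 + s * 1, b + s * 0, c + s * 0) :> sp by [].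
  by rewrite mulr1 !mulr0 !addr0 add0r.
- apply: prod_integral_eq0l; first exact: intp.
  move=> c; apply: prod_integral_eq0r; first exact: (int2 c).
  move=> a; rewrite -[RHS](L (a, 0, c)); apply: eq_integral => s _.
  have -> : (a, 0, c) + s *: basis3 R (Ordinal Hi) = (a + s * 0, 0 + s * 1, c + s * 0) :> sp by [].
  by rewrite mulr1 !mulr0 !addr0 add0r.
- apply: prod_integral_eq0r; first exact: intp.
  move=> [a b]; rewrite -[RHS](L (a, b, 0)); apply: eq_integral => s _.
  have -> : (a, b, 0) + s *: basis3 R (Ordinal Hi) = (a + s * 0, b + s * 0, 0 + s * 1) :> sp by [].
  by rewrite mulr1 !mulr0 !addr0 add0r.
Qed.

End Integration_by_parts.

(** * A one-variable flat function and its derivatives *)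

Section Bump.
Variable R : realType.
Implicit Types (t : R) (k : nat).

(** [flat 0] is the classical smooth function e^{-1/t} extended by 0. The powers of 1/t are included
    because the derivative of [flat k] is [flat k.+2] minus k times [flat k.+1], so all derivatives
    stay in the span of the family. *)
Definition flat k t : R := if 0 < t then t^-1 ^+ k * expR (- t^-1) else 0.

(** One term of the exponential series, e^{1/t} >= t^{-n}/n!, gives arbitrarily high order of
    vanishing at 0. *)
Lemma flat_le k n t : `|flat k t| <= n`!%:R * `|t| ^+ n / `|t| ^+ k.
Proof.
rewrite /flat; case: ifPn => t0; last first.
  by rewrite normr0 divr_ge0 ?mulr_ge0 ?exprn_ge0.
rewrite (gtr0_norm t0) ger0_norm ?mulr_ge0 ?exprn_ge0 ?expR_ge0 ?invr_ge0 ?(ltW t0)//.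
rewrite expRN mulrC exprVn ler_pM2r ?invr_gt0 ?exprn_gt0//.
rewrite -[leLHS]mul1r ler_pdivrMr ?expR_gt0//.
have n0 : 0 < n`!%:R :> R by rewrite ltr0n fact_gt0.
have h : t^-1 ^+ n <= n`!%:R * expR t^-1.
  case: n n0 => [|n] n0.
    by rewrite expr0 fact0 mul1r; apply: le_trans (expR_ge1Dx _); rewrite lerDl invr_ge0 ltW.
  have ti : 0 <= t^-1 by rewrite invr_ge0 ltW.
  have := expR_ge1Dxn n ti; rewrite -(ler_pM2l n0); apply: le_trans.
  by rewrite mulrDr mulr1 mulrCA divff ?gt_eqF// mulr1 lerDr ltW.
have tn : 0 < t ^+ n by rewrite exprn_gt0.
move: h; rewrite -(ler_pM2l tn) exprVn divff ?gt_eqF//.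
by rewrite mulrA (mulrC (t ^+ n)).
Qed.

Lemma flat_le_fact k t : `|flat k t| <= k`!%:R.
Proof.
apply: le_trans (flat_le k k t) _.
have [->|t0] := eqVneq `|t| 0; last by rewrite mulfK// expf_neq0.
by rewrite expr0n; case: k => [|k]; rewrite ?divr1 ?mulr1//= mulr0 mul0r ler0n.
Qed.

Lemma is_derive_subst (V : normedModType R) (f : V -> R) (x v : V) (a b : R) :
  is_derive x v f a -> a = b -> is_derive x v f b.
Proof. by move=> h <-. Qed.

Lemma flat_is_derive k t : is_derive t (1 : R) (flat k) (flat k.+2 t - k%:R * flat k.+1 t).
Proof.
have [t0|t0|<-] := ltgtP 0 t.
- have -> : flat k.+2 t - k%:R * flat k.+1 t =
     t^-1 ^+ k * (expR (- t^-1) * t^-1 ^+ 2) + k%:R * t^-1 ^+ k.-1 * (- t^-1 ^+ 2) * expR (- t^-1).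
    rewrite /flat t0; case: k => [|k] /=; first by rewrite !mul0r subr0 addr0 expr0 mul1r mulrC.
    by rewrite !exprS expr0; ring.
  apply: (near_eq_is_derive (f := fun s : R => s^-1 ^+ k * expR (- s^-1))).
    by near=> s; rewrite /flat ifT//; near: s; exact: (cvgr_gt t (@cvg_id _ (nbhs t))).
  have tn : t != 0 by rewrite gt_eqF.
  have dV : is_derive t (1 : R) (fun s : R => s^-1) (- t^-1 ^+ 2).
    have di : derivable (id : R -> R) t 1 by exact: derivable_id.
    apply: DeriveDef; first exact: (derivableV tn di).
    by rewrite (deriveV tn di) derive_id exprVn; exact: mulr1.
  have dE : is_derive t (1 : R) (fun s : R => expR (- s^-1)) (expR (- t^-1) * t^-1 ^+ 2).
    apply: (@is_derive1_comp _ expR (fun s : R => - s^-1)).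
    by rewrite -[t^-1 ^+ 2]opprK; exact: is_deriveN.
  have dX : is_derive t (1 : R) (fun s : R => s^-1 ^+ k) (k%:R * t^-1 ^+ k.-1 * (- t^-1 ^+ 2)).
    by have := is_deriveX k dV; rewrite exprfctE.
  have H := is_deriveM dX dE.
  rewrite mulrfctE in H; apply: (is_derive_subst H).
  by rewrite /GRing.scale/=; ring.
- have b0 j : flat j t = 0 by rewrite /flat ltNge (ltW t0).
  rewrite !b0 mulr0 subr0; apply: (near_eq_is_derive (f := cst (0 : R))).
    by near=> s; rewrite /flat ltNge ltW//; near: s; exact: lt_nbhsl.
- have b0 j : flat j 0 = 0 by rewrite /flat ltxx.
  rewrite !b0 mulr0 subr0.
  (* At the origin the difference quotient is at most (k+2)! |h|, by [flat_le] with n = k + 2. *)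
  pose c : R := (k + 2)`!%:R.
  have H : (fun h : R => h^-1 *: ((flat k \o shift 0) (h *: (1 : R)) - flat k 0)) @ 0^' --> (0 : R).
    apply/cvgr0Pnorm_le => e e0; near=> h.
    have h0 : h != 0 by near: h; exact: nbhs_dnbhs_neq.
    rewrite b0 subr0 /shift/= addr0 /GRing.scale/= mulr1 normrM normfV.
    have nh : 0 < `|h| by rewrite normr_gt0.
    rewrite mulrC ler_pdivrMr//; apply: le_trans (flat_le k (k + 2) h) _.
    rewrite exprD -mulrA mulrAC divff ?expf_neq0 ?gt_eqF// mul1r expr2 mulrA.
    rewrite ler_pM2r// -/c mulrC -ler_pdivlMr ?ltr0n ?fact_gt0//.
    near: h; apply: dnbhs0_le; rewrite divr_gt0// ltr0n fact_gt0//.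
  by apply: DeriveDef; [apply: cvgP H|exact: (cvg_lim _ H)].
Unshelve. all: by end_near. Qed.

End Bump.

Lemma inv_is_derive (R : realType) (r : R) : r != 0 ->
  is_derive r (1 : R) (fun s : R => s^-1) (- r^-1 ^+ 2).
Proof.
move=> rn; have di : derivable (id : R -> R) r 1 by exact: derivable_id.
apply: DeriveDef; first exact: (derivableV rn di).
by rewrite (deriveV rn di) derive_id exprVn; exact: mulr1.
Qed.

(** * An algebra of smooth functions closed under differentiation *)

Section Smooth_class.
Variable R : realType.
Local Notation sp := (space3 R).
Local Notation mu3 := (@lebesgue3 R).
Implicit Types (f g h : sp -> R) (i j : 'I_3).

(** Keeping differentiability and the value of the partial derivative together makes the sum,
    product and chain rules composable. *)
Definition HD i f x (a : R) := differentiable f x /\ partial i f x = a.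

Lemma HD_eq i f x a b : HD i f x a -> a = b -> HD i f x b.
Proof. by move=> h <-. Qed.

Lemma HD_cst i (c : R) x : HD i (fun=> c) x 0.
Proof. by split; [exact: differentiable_cst|exact: derive_cst]. Qed.

Lemma HD_add i f g x a b : HD i f x a -> HD i g x b ->
  HD i (fun y => f y + g y) x (a + b).
Proof.
move=> [df <-] [dg <-]; split; first exact: differentiableD.
by apply: deriveD; exact: diff_derivable.
Qed.

Lemma HD_mul i f g x a b : HD i f x a -> HD i g x b ->
  HD i (fun y => f y * g y) x (a * g x + f x * b).
Proof.
move=> [df <-] [dg <-]; split; first exact: differentiableM.
have := @deriveM _ _ f g x (basis3 R i) (diff_derivable df) (diff_derivable dg).
by rewrite /partial mulrfctE => ->; rewrite addrC; congr (_ + _); exact: mulrC.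
Qed.

Lemma HD_comp i f (h : R -> R) x a b : HD i f x a ->
  is_derive (f x) (1 : R) h b -> HD i (fun y => h (f y)) x (b * a).
Proof.
move=> [df <-] dh.
have dhd : differentiable h (f x) by apply/derivable1_diffP; case: dh.
split; first exact: differentiable_comp.
rewrite /partial deriveE; last exact: differentiable_comp.
rewrite (diff_comp df dhd)/= -[X in 'd h _ X](deriveE _ df).
have := diff1E dhd; move=> /(congr1 (fun F => F ('D_(basis3 R i) f x))) ->.
by rewrite derive1E; have [_ ->] := dh; rewrite mulrC.
Qed.

Lemma co_is_linear i : linear (co i : sp -> R).
Proof. by move=> a x y; rewrite /co; case: eqP => _ //; case: eqP. Qed.

HB.instance Definition _ i := GRing.isLinear.Build R sp R _ (co i) (co_is_linear i).

Lemma continuous_co i : continuous (co i : sp -> R).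
Proof.
case: i => -[|[|[|//]]] Hi x.
- by apply: continuous_comp; exact: cvg_fst.
- by apply: continuous_comp; [exact: cvg_fst|exact: cvg_snd].
- exact: cvg_snd.
Qed.

Lemma co_basis i j : co j (basis3 R i) = (i == j)%:R :> R.
Proof.
by case: i => -[|[|[|//]]] Hi; case: j => -[|[|[|//]]] Hj.
Qed.

Lemma HD_co i j x : HD i (co j) x (i == j)%:R.
Proof.
have cc : continuous (co j : sp -> R) := @continuous_co j.
split; first exact: linear_differentiable.
rewrite /partial deriveE; last exact: linear_differentiable.
by rewrite diff_lin//; exact: co_basis.
Qed.

Lemma HD_n2 i (y x : sp) : HD i (fun x => n2 (x - y)) x (2 * co i (x - y)).
Proof.
have Hc j : HD i (fun x => co j (x - y) ^+ 2) x (2 * co j (x - y) * (i == j)%:R).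
  have -> : (fun x => co j (x - y) ^+ 2) = (fun x => (co j x - co j y) * (co j x - co j y)).
    by apply/funext => z; rewrite -raddfB expr2.
  have h := HD_add (HD_co i j x) (HD_cst i (- co j y) x).
  apply: HD_eq (HD_mul h h) _; rewrite addr0 raddfB/=; ring.
have -> : (fun x => n2 (x - y)) = (fun x => co 0 (x - y) ^+ 2 + co 1 (x - y) ^+ 2
    + co ord_max (x - y) ^+ 2).
  by apply/funext => z; rewrite /co/=.
apply: HD_eq (HD_add (HD_add (Hc _) (Hc _)) (Hc _)) _.
by case: i Hc => -[|[|[|//]]] Hi Hc; rewrite /= !mulr0 !mulr1 ?addr0 ?add0r /co.
Qed.

Variables (e mu : R).
Hypothesis e0 : 0 < e.

Lemma HD_rinv i (y x : sp) : HD i (fun x => (rr e (x - y))^-1) x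
  (- co i (x - y) * (rr e (x - y))^-1 ^+ 3).
Proof.
have r0 := rr_gt0 (x - y) e0.
have h1 : HD i (fun x => n2 (x - y) + e ^+ 2) x (2 * co i (x - y)).
  by apply: HD_eq (HD_add (HD_n2 i y x) (HD_cst i (e ^+ 2) x)) _; rewrite addr0.
have p0 : 0 < n2 (x - y) + e ^+ 2 by rewrite ltr_wpDl ?n2_ge0// exprn_gt0.
have h2 := HD_comp h1 (is_derive1_sqrt p0).
have dV := inv_is_derive (lt0r_neq0 r0).
apply: HD_eq (HD_comp h2 dV) _.
by rewrite -/(rr e (x - y)); field; rewrite gt_eqF.
Qed.

Lemma HD_exp i (y x : sp) : HD i (fun x => expR (- (mu * rr e (x - y)))) x
  (- mu * co i (x - y) * (rr e (x - y))^-1 * expR (- (mu * rr e (x - y)))).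
Proof.
have r0 := rr_gt0 (x - y) e0.
have h1 : HD i (fun x => n2 (x - y) + e ^+ 2) x (2 * co i (x - y)).
  by apply: HD_eq (HD_add (HD_n2 i y x) (HD_cst i (e ^+ 2) x)) _; rewrite addr0.
have p0 : 0 < n2 (x - y) + e ^+ 2 by rewrite ltr_wpDl ?n2_ge0// exprn_gt0.
have h2 := HD_comp h1 (is_derive1_sqrt p0).
have h3 := HD_mul (HD_cst i (- mu) x) h2.
have -> : (fun x => expR (- (mu * rr e (x - y)))) =
    (fun x => expR (- mu * Num.sqrt (n2 (x - y) + e ^+ 2))).
  by apply/funext => z; rewrite mulNr.
apply: HD_eq (HD_comp h3 (is_derive_expR _)) _.
by rewrite -/(rr e (x - y)) mulNr; field; rewrite gt_eqF.
Qed.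

Lemma HD_flat i k f x a : HD i f x a -> HD i (fun y => flat k (f y)) x
  ((flat k.+2 (f x) - k%:R * flat k.+1 (f x)) * a).
Proof. by move=> hf; apply: HD_comp hf (flat_is_derive k (f x)). Qed.

(** Smoothness asks for differentiability of all iterated partial derivatives. The class contains
    every function differentiated later (kernels and cutoffs) and is closed under [partial], so one
    induction over it settles all orders. *)
Inductive sm : (sp -> R) -> Prop :=
| sm_cst c : sm (fun=> c)
| sm_co j : sm (co j)
| sm_add f g : sm f -> sm g -> sm (fun x => f x + g x)
| sm_mul f g : sm f -> sm g -> sm (fun x => f x * g x)
| sm_rinv (y : sp) : sm (fun x => (rr e (x - y))^-1)
| sm_exp (y : sp) : sm (fun x => expR (- (mu * rr e (x - y))))
| sm_flat k f : sm f -> sm (fun x => flat k (f x)).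

Lemma sm_opp f : sm f -> sm (fun x => - f x).
Proof.
move=> sf; have -> : (fun x => - f x) = (fun x => -1 * f x).
  by apply/funext => x; rewrite mulN1r.
by apply: sm_mul => //; exact: sm_cst.
Qed.

Lemma sm_exprn f n : sm f -> sm (fun x => f x ^+ n).
Proof.
move=> sf; elim: n => [|n IH].
  by under eq_fun do rewrite expr0; exact: sm_cst.
by under eq_fun do rewrite exprS; exact: sm_mul.
Qed.

Lemma sm_co_shift j y : sm (fun x => co j (x - y)).
Proof.
have -> : (fun x => co j (x - y)) = (fun x => co j x + - co j y).
  by apply/funext => x; rewrite raddfB.
by apply: sm_add; [exact: sm_co|exact: sm_cst].
Qed.

Lemma sm_HD f i : sm f -> exists2 f', sm f' & forall x, HD i f x (f' x).
Proof.
elim=> {f} [c|j|f g _ [f' sf' Hf] _ [g' sg' Hg]|f g sf [f' sf' Hf] sg [g' sg' Hg]|y|y|k f sf [f' sf' Hf]].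
- by exists (fun=> 0) => [|x]; [exact: sm_cst|exact: HD_cst].
- by exists (fun=> (i == j)%:R) => [|x]; [exact: sm_cst|exact: HD_co].
- by exists (fun x => f' x + g' x) => [|x]; [exact: sm_add|exact: HD_add].
- exists (fun x => f' x * g x + f x * g' x) => [|x]; last exact: HD_mul.
  by apply: sm_add; exact: sm_mul.
- exists (fun x => - co i (x - y) * (rr e (x - y))^-1 ^+ 3) => [|x]; last exact: HD_rinv.
  apply: sm_mul; first by apply: sm_opp; exact: sm_co_shift.
  by apply: sm_exprn; exact: sm_rinv.
- exists (fun x => - mu * co i (x - y) * (rr e (x - y))^-1 * expR (- (mu * rr e (x - y)))) => [|x]; last exact: HD_exp.
  apply: sm_mul; last exact: sm_exp.
  apply: sm_mul; last exact: sm_rinv.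
  by apply: sm_mul; [exact: sm_cst|exact: sm_co_shift].
- exists (fun x => (flat k.+2 (f x) - k%:R * flat k.+1 (f x)) * f' x) => [|x]; last exact: HD_flat.
  apply: sm_mul => //; apply: sm_add; first exact: sm_flat.
  by apply: sm_opp; apply: sm_mul; [exact: sm_cst|exact: sm_flat].
Qed.

Lemma sm_partial f i : sm f -> sm (partial i f).
Proof.
move=> /(@sm_HD _ i)[f' sf' H]; have -> : partial i f = f' by apply/funext => x; have [] := H x.
exact: sf'.
Qed.

Lemma sm_differentiable f x : sm f -> differentiable f x.
Proof. by move=> /(@sm_HD _ ord0)[f' _ /(_ x)[]]. Qed.

Lemma sm_continuous f : sm f -> continuous f.
Proof. by move=> sf x; apply: differentiable_continuous; exact: sm_differentiable. Qed.

Lemma sm_measurable f : sm f -> measurable_fun setT f.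
Proof. by move=> sf; apply: continuous_measurable3; exact: sm_continuous. Qed.

Lemma sm_smooth f : sm f -> smooth f.
Proof.
move=> sf s x; apply: sm_differentiable; elim: s => //= i s IH; exact: sm_partial.
Qed.

Lemma sm_test f (rho : R) : sm f -> (forall x, rho < enorm x -> f x = 0) ->
  test_function f.
Proof.
move=> sf f0; split; first exact: sm_smooth.
pose I : set R := `[- `|rho|, `|rho|]%classic.
have cI : compact I by exact: segment_compact.
have cQ : compact ((I `*` I) `*` I).
  by apply: compact_setX => //; exact: compact_setX.
apply: (subclosed_compact _ cQ); first exact: closed_closure.
have clQ : closed ((I `*` I) `*` I).
  by apply: (compact_closed _ cQ); exact: norm_hausdorff.
rewrite ((closure_id _).1 clQ); apply: closureS => x /= /eqP fx.
have xr : enorm x <= `|rho|.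
  by rewrite leNgt; apply/negP => h; apply: fx; apply: f0; apply: le_lt_trans h; exact: ler_norm.
have [h1 h2 h3] := coord_le_enorm x.
split; [split|]; rewrite /I/= in_itv/= -ler_norml;
  [exact: le_trans h1 xr|exact: le_trans h2 xr|exact: le_trans h3 xr].
Qed.

End Smooth_class.

Lemma cvg_mull (R : realType) (c l : R) (u : nat -> R) : u @ \oo --> l ->
  (fun n => c * u n) @ \oo --> c * l.
Proof. by move=> ul; apply: cvgM => //; exact: cvg_cst. Qed.

Lemma cvg_mulr (R : realType) (c l : R) (u : nat -> R) : u @ \oo --> l ->
  (fun n => u n * c) @ \oo --> l * c.
Proof. by move=> ul; apply: cvgM => //; exact: cvg_cst. Qed.

(** * Weak derivatives tested against functions without compact support *)

Section Weak_derivatives.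
Variable R : realType.
Local Notation sp := (space3 R).
Local Notation mu3 := (@lebesgue3 R).

Lemma Rint_dct (F : nat -> sp -> R) (f h : sp -> R) :
  (forall n, measurable_fun setT (F n)) ->
  (forall x, (fun n => F n x) @ \oo --> f x) ->
  mu3.-integrable setT (EFin \o h) -> (forall n x, `|F n x| <= h x) ->
  (fun n => \int[mu3]_x F n x) @ \oo --> \int[mu3]_x f x.
Proof.
move=> mF Ff ih Fh.
have mf : measurable_fun setT f.
  by apply: (measurable_fun_cvg mF) => x _; exact: Ff.
have [||||| intf _ c] := @dominated_convergence _ _ _ mu3 setT measurableT
   (fun n x => (F n x)%:E) (fun x => (f x)%:E) (EFin \o h).
- by move=> n; apply/measurable_EFinP; exact: mF.
- by apply/measurable_EFinP; exact: mf.
- by apply: aeW => x _; apply: cvg_EFin; [exact: nearW|exact: Ff].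
- exact: ih.
- by apply: aeW => x n _; rewrite /= lee_fin.
have fE : (\int[mu3]_x (f x)%:E = (\int[mu3]_x f x)%:E)%E.
  by rewrite /Rintegral fineK//; exact: integrable_fin_num.
by rewrite fE in c; exact: (fine_cvg c).
Qed.

(** Smooth cutoff supported in the ball of radius n+1. The factor e normalizes the pointwise limit
    to 1, since [flat 0] takes the value 1/e at 1. *)
Definition cut (n : nat) (x : sp) : R :=
  expR 1 * flat 0 (1 + - (n2 (x - 0)) * (n.+1%:R ^+ 2)^-1).

Section Smooth_pairing.
Variables (e mu : R).
Hypothesis e0 : 0 < e.
Local Notation sm := (sm e mu).

Lemma sm_n2 : sm (fun x => n2 (x - 0)).
Proof.
have -> : (fun x : sp => n2 (x - 0)) = (fun x => co 0 x ^+ 2 + co 1 x ^+ 2 + co ord_max x ^+ 2).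
  by apply/funext => z; rewrite subr0 /co/=.
by apply: sm_add; [apply: sm_add|]; apply: sm_exprn; exact: sm_co.
Qed.

Lemma sm_cut n : sm (cut n).
Proof.
apply: sm_mul; first exact: sm_cst.
apply: sm_flat; apply: sm_add; first exact: sm_cst.
by apply: sm_mul; [apply: sm_opp; exact: sm_n2|exact: sm_cst].
Qed.

Lemma cut_arg_le n x : n.+1%:R < enorm x -> 1 + - (n2 (x - 0)) * (n.+1%:R ^+ 2)^-1 <= 0 :> R.
Proof.
move=> nx; have n0 : 0 < n.+1%:R ^+ 2 :> R by rewrite exprn_gt0// ltr0n.
rewrite mulNr subr_le0 subr0 ler_pdivlMr// mul1r -enorm_sqr.
by rewrite lerXn2r ?nnegrE ?enorm_ge0 ?ler0n// ltW.
Qed.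

Lemma flat_neg k (t : R) : t <= 0 -> flat k t = 0.
Proof. by move=> t0; rewrite /flat ltNge t0. Qed.

Lemma cut_far n x : n.+1%:R < enorm x -> cut n x = 0.
Proof. by move=> /cut_arg_le h; rewrite /cut flat_neg// mulr0. Qed.

Lemma cut_le n x : `|cut n x| <= expR 1.
Proof.
rewrite /cut normrM gtr0_norm ?expR_gt0// ler_piMr ?expR_ge0//.
exact: flat_le_fact.
Qed.

Lemma cvg_inv_sqr : (fun n => (n.+1%:R ^+ 2)^-1 : R) @ \oo --> (0 : R).
Proof.
have H : (fun n => n.+1%:R^-1 : R) @ \oo --> (0 : R) by exact: cvg_harmonic.
have -> : (fun n => (n.+1%:R ^+ 2)^-1 : R) = (fun n => n.+1%:R^-1 * n.+1%:R^-1).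
  by apply/funext => n; rewrite -invfM -expr2.
by rewrite -[X in _ --> X](mulr0 (0 : R)); exact: cvgM.
Qed.

Lemma cut_cvg x : (fun n => cut n x) @ \oo --> (1 : R).
Proof.
have -> : 1 = expR 1 * flat 0 (1 + - (n2 (x - 0)) * 0) :> R.
  rewrite mulr0 addr0 /flat ltr01 expr0 mul1r invr1 expRN mulfV//.
apply: cvg_mull.
have cf : continuous (flat 0 : R -> R).
  move=> t; apply: differentiable_continuous; apply/derivable1_diffP.
  by case: (flat_is_derive 0 t).
have H : (fun n => 1 + - (n2 (x - 0)) * (n.+1%:R ^+ 2)^-1) @ \oo --> 1 + - (n2 (x - 0)) * 0.
  by apply: cvgD; [exact: cvg_cst|apply: cvg_mull; exact: cvg_inv_sqr].
exact: (cvg_comp _ _ H (cf _)).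
Qed.

Lemma HD_cut i n x : HD i (cut n) x
  (expR 1 * (flat 2 (1 + - (n2 (x - 0)) * (n.+1%:R ^+ 2)^-1) *
     (- (2 * co i x) * (n.+1%:R ^+ 2)^-1))).
Proof.
have h0 := HD_n2 i 0 x.
have h1 := HD_mul (HD_mul (HD_cst i (-1) x) h0) (HD_cst i (n.+1%:R ^+ 2)^-1 x).
have h2 := HD_add (HD_cst i 1 x) h1.
have h3 := HD_mul (HD_cst i (expR 1) x) (HD_flat 0 h2).
have E : cut n = (fun y => expR 1 * flat 0 (1 + -1 * n2 (y - 0) * (n.+1%:R ^+ 2)^-1)).
  by apply/funext => y; rewrite /cut !mulN1r.
rewrite E; apply: HD_eq h3 _.
rewrite !mul0r !mulr0 !addr0 !add0r subr0 !mulN1r subr0; congr (_ * (_ * _)).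
Qed.

(** On the support |co i x| <= n+1, and [flat 2] is at most 2! = 2, so the chain rule gives e times
    2 times 2(n+1)/(n+1)^2. *)
Lemma partial_cut_le i n x : `|partial i (cut n) x| <= 4 * expR 1 * n.+1%:R^-1.
Proof.
have [_ ->] := HD_cut i n x.
have n0 : 0 < n.+1%:R :> R by rewrite ltr0n.
have [nx|nx] := ltP n.+1%:R (enorm x).
  by rewrite flat_neg ?cut_arg_le// mul0r mulr0 normr0 !mulr_ge0 ?expR_ge0// invr_ge0 ltW.
rewrite normrM gtr0_norm ?expR_gt0// [4 * _]mulrC -!mulrA ler_pM2l ?expR_gt0//.
rewrite normrM (_ : 4 / n.+1%:R = 2 * (2 * n.+1%:R * (n.+1%:R ^+ 2)^-1)); last first.
  by field; rewrite gt_eqF.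
apply: ler_pM => //; first exact: flat_le_fact.
rewrite normrM normrN normrM (ger0_norm (_ : 0 <= 2))//.
rewrite [`|(_ ^+ 2)^-1|]gtr0_norm ?invr_gt0 ?exprn_gt0//.
rewrite ler_pM2r ?invr_gt0 ?exprn_gt0// ler_pM2l//.
exact: le_trans (co_le_enorm i x) nx.
Qed.

(** The products [cut n] times X are test functions. Dominated convergence removes the cutoff, whose
    derivative is of order 1/(n+1). This admits as tests the kernels below, which have no compact
    support. *)
Lemma weak_partial_sm i (u g X : sp -> R) : L2r mu3 u -> L2r mu3 g ->
  weak_partial_real i u g -> sm X -> L2r mu3 X -> L2r mu3 (partial i X) ->
  ip mu3 u (partial i X) = - ip mu3 g X.
Proof.
move=> lu lg wg sX lX lX'.
have mX := sm_measurable e0 sX; have mX' := sm_measurable e0 (sm_partial e0 i sX).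
have mu_ : measurable_fun setT u by case: lu.
have mg : measurable_fun setT g by case: lg.
have mc n := sm_measurable e0 (sm_cut n).
pose phi n x := cut n x * X x.
have sphi n : sm (phi n) by apply: sm_mul => //; exact: sm_cut.
have tphi n : test_function (phi n).
  apply: (sm_test (rho := n.+1%:R) e0 (sphi n)) => x nx.
  by rewrite /phi (cut_far nx) mul0r.
have dphi n x : partial i (phi n) x = partial i (cut n) x * X x + cut n x * partial i X x.
  have h1 : HD i (cut n) x (partial i (cut n) x).
    exact: (conj (sm_differentiable e0 x (sm_cut n)) erefl).
  have h2 : HD i X x (partial i X x).
    exact: (conj (sm_differentiable e0 x sX) erefl).
  by have [_ ->] := HD_mul h1 h2.
have W n := wg _ (tphi n).
have c1 : (fun n => \int[mu3]_x (u x * partial i (phi n) x)) @ \oo --> ip mu3 u (partial i X).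
  apply: (@Rint_dct _ _ (fun x => expR 1 * `|u x * partial i X x| + 4 * expR 1 * `|u x * X x|)).
  - move=> n; apply: measurable_funM; first exact: mu_.
    exact: (sm_measurable e0 (sm_partial e0 i (sphi n))).
  - move=> x.
    have T : u x * partial i X x = u x * (0 * X x + 1 * partial i X x).
      by rewrite mul0r add0r mul1r.
    have E : (fun n => u x * partial i (phi n) x) =
        (fun n => u x * (partial i (cut n) x * X x + cut n x * partial i X x)).
      by apply/funext => n; rewrite dphi.
    have C0 : (fun n => partial i (cut n) x) @ \oo --> (0 : R).
      apply/norm_cvg0P.
      apply: (@squeeze_cvgr _ _ _ _ (cst 0) (fun n => 4 * expR 1 * n.+1%:R^-1)).
      + by apply: nearW => n; rewrite /= normr_ge0 partial_cut_le.
      + exact: cvg_cst.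
      + have := @cvg_mull R (4 * expR 1) 0 _ (@cvg_harmonic R).
        by rewrite mulr0.
    rewrite E T; apply: cvg_mull; apply: cvgD; apply: cvg_mulr; first exact: C0.
    exact: cut_cvg.
  - have -> : EFin \o (fun x => expR 1 * `|u x * partial i X x| + 4 * expR 1 * `|u x * X x|) =
      (fun x => (expR 1)%:E * (`|u x * partial i X x|)%:E + (4 * expR 1)%:E * (`|u x * X x|)%:E)%E.
      by apply/funext => x; rewrite -!EFinM -EFinD.
    apply: integrableD => //; apply: integrableZl => //.
      exact: (integrable_norm (L2r_mul lu lX')).
    exact: (integrable_norm (L2r_mul lu lX)).
  - move=> n x; rewrite dphi mulrDr; apply: le_trans (ler_normD _ _) _.
    rewrite addrC; apply: lerD.
      by rewrite mulrCA normrM; apply: ler_wpM2r => //; exact: cut_le.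
    rewrite mulrCA normrM; apply: ler_wpM2r => //.
    apply: le_trans (partial_cut_le i n x) _; rewrite ler_piMr ?mulr_ge0 ?expR_ge0//.
    by rewrite invf_le1 ?ltr0n// ler1n.
have c2 : (fun n => - \int[mu3]_x (g x * phi n x)) @ \oo --> - ip mu3 g X.
  apply: cvgN; apply: (@Rint_dct _ _ (fun x => expR 1 * `|g x * X x|)).
  - by move=> n; apply: measurable_funM; [exact: mg|exact: (sm_measurable e0 (sphi n))].
  - move=> x; have T : g x * X x = g x * (1 * X x) by rewrite mul1r.
    by rewrite T; apply: cvg_mull; apply: cvg_mulr; exact: cut_cvg.
  - have -> : EFin \o (fun x => expR 1 * `|g x * X x|) =
      (fun x => (expR 1)%:E * (`|g x * X x|)%:E)%E by apply/funext => x; rewrite -EFinM.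
    apply: integrableZl => //.
    exact: (integrable_norm (L2r_mul lg lX)).
  - by move=> n x; rewrite /phi mulrCA normrM; apply: ler_wpM2r => //; exact: cut_le.
rewrite -(cvg_lim _ c1)//; under eq_fun do rewrite W.
exact: cvg_lim c2.
Qed.

End Smooth_pairing.

Lemma continuous_enorm : continuous (@enorm R).
Proof.
move=> y; rewrite /enorm; apply: continuous_comp; last exact: sqrt_continuous.
have c i : continuous (co i : sp -> R) := @continuous_co R i.
apply: continuousD; last by rewrite /continuous_at; apply: cvgM; exact: (c ord_max).
by apply: continuousD; rewrite /continuous_at; apply: cvgM; (exact: (c 0) || exact: (c 1)).
Qed.

Lemma test_function_bounded (phi : sp -> R) : test_function phi ->
  [/\ forall x, differentiable phi x, continuous phi,
      forall i, continuous (partial i phi) &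
      exists2 rho, 0 <= rho & forall x, rho < enorm x -> phi x = 0].
Proof.
move=> [sphi cphi]; split.
- exact: (sphi [::]).
- by move=> x; apply: differentiable_continuous; exact: (sphi [::]).
- by move=> i x; apply: differentiable_continuous; exact: (sphi [:: i]).
- have [[x0 cx0]|ne] := pselect (closure [set x | phi x != 0] !=set0); last first.
    exists 0 => // x _; apply/eqP; apply: contrapT => /negP px; apply: ne; exists x.
    exact: subset_closure.
  have [|c _ hc] := compact_EVT_max (ex_intro _ x0 cx0) cphi (f := @enorm R).
    by apply: continuous_subspaceT; exact: continuous_enorm.
  exists (enorm c); first exact: enorm_ge0.
  move=> x xc; apply/eqP; apply: contrapT => /negP px.
  have : enorm x <= enorm c by apply: hc; rewrite inE; exact: subset_closure.
  by rewrite leNgt xc.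
Qed.

Lemma continuous_support_integrable (f : sp -> R) (rho : R) : continuous f ->
  (forall x, rho < enorm x -> f x = 0) -> mu3.-integrable setT (EFin \o f).
Proof.
move=> cf f0; have [M M0 hM] := continuous_bounded_support cf f0.
apply: (@integrable_bounded_support _ _ _ mu3 (ball3 `|rho|) _ M) => //.
- exact: measurable_ball3.
- by apply: le_lt_trans (lebesgue3_ball_le (normr_ge0 _)) _; rewrite ltry.
- exact: continuous_measurable3.
- move=> x xr; apply: f0; rewrite ltNge; apply/negP => xr'; apply: xr.
  by rewrite /ball3/= (le_trans xr')// ler_norm.
Qed.

(** X phi is compactly supported, so the integral of its partial derivative vanishes; the product
    rule is then integration by parts. *)
Lemma weak_partial_smooth i (X : sp -> R) : (forall x, differentiable X x) ->
  continuous (partial i X) -> weak_partial_real i X (partial i X).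
Proof.
move=> dX cX' phi tphi; have [dp cp cp' [rho rho0 p0]] := test_function_bounded tphi.
have cX : continuous X by move=> x; exact: differentiable_continuous.
have dE x : partial i (fun x => X x * phi x) x = partial i X x * phi x + X x * partial i phi x.
  by have [_ ->] := HD_mul (conj (dX x) erefl : HD i X x _) (conj (dp x) erefl : HD i phi x _).
have cM (f g : sp -> R) : continuous f -> continuous g -> continuous (fun x => f x * g x).
  by move=> cf cg x; apply: cvgM; [exact: cf|exact: cg].
have c1 : continuous (fun x => partial i X x * phi x) by exact: cM.
have c2 : continuous (fun x => X x * partial i phi x) by apply: cM => //; exact: cp'.
have i1 : mu3.-integrable setT (EFin \o (fun x => partial i X x * phi x)).
  by apply: (@continuous_support_integrable _ rho) => // x /p0 ->; rewrite mulr0.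
have i2 : mu3.-integrable setT (EFin \o (fun x => X x * partial i phi x)).
  apply: (@continuous_support_integrable _ rho) => // x /(partial_eq0_far i p0) ->.
  by rewrite mulr0.
have [||| _ I0] := @int_partial_eq0 _ i (fun x => X x * phi x) rho.
- by move=> x; exact: differentiableM.
- have -> : partial i (fun x => X x * phi x) = (fun x => partial i X x * phi x + X x * partial i phi x).
    exact/funext.
  by move=> x; apply: cvgD; [exact: c1|exact: c2].
- by move=> x /p0 ->; rewrite mulr0.
apply/eqP; rewrite -addr_eq0 addrC -RintegralD//; apply/eqP.
by rewrite /Rintegral -[RHS](congr1 fine I0); congr fine; apply: eq_integral => x _; rewrite dE.
Qed.

End Weak_derivatives.

(** * The regularized Yukawa kernel, its derivatives and the representation of [smear] *)

Section Kernel_calculus.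
Variable R : realType.
Local Notation sp := (space3 R).
Local Notation mu3 := (@lebesgue3 R).

(** The regularization of e^{-mu|x-y|}/|x-y|. Its i-th partial derivative in x is [XX], and [dXX] is
    the second one ([partial_FF], [partial_XX]). *)
Definition FF (mu e : R) (y x : sp) : R :=
  expR (- (mu * rr e (x - y))) * (rr e (x - y))^-1.

Definition XX (mu e : R) (i : 'I_3) (y x : sp) : R :=
  -1 * co i (x - y) * (expR (- (mu * rr e (x - y))) *
    (mu * (rr e (x - y))^-1 ^+ 2 + (rr e (x - y))^-1 ^+ 3)).

Definition dXX (mu e : R) (i : 'I_3) (y x : sp) : R :=
  - (expR (- (mu * rr e (x - y))) *
    (mu * (rr e (x - y))^-1 ^+ 2 + (rr e (x - y))^-1 ^+ 3)) +
  co i (x - y) ^+ 2 * (expR (- (mu * rr e (x - y))) *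
    (mu ^+ 2 * (rr e (x - y))^-1 ^+ 3 + 3 * mu * (rr e (x - y))^-1 ^+ 4
      + 3 * (rr e (x - y))^-1 ^+ 5)).

Section Fixed_parameters.
Variables (mu e : R).
Hypothesis e0 : 0 < e.
Hypothesis mu0 : 0 <= mu.
Local Notation sm := (sm e mu).

Lemma sm_FF y : sm (FF mu e y).
Proof. by apply: sm_mul; [exact: sm_exp|exact: sm_rinv]. Qed.

Lemma sm_XX i y : sm (XX mu e i y).
Proof.
apply: sm_mul; first by apply: sm_mul; [exact: sm_cst|exact: sm_co_shift].
apply: sm_mul; first exact: sm_exp.
apply: sm_add; last by apply: sm_exprn; exact: sm_rinv.
by apply: sm_mul; [exact: sm_cst|apply: sm_exprn; exact: sm_rinv].
Qed.

Lemma HD_rinvX i n (y x : sp) : HD i (fun x => (rr e (x - y))^-1 ^+ n.+1) x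
  (n.+1%:R * (rr e (x - y))^-1 ^+ n * (- co i (x - y) * (rr e (x - y))^-1 ^+ 3)).
Proof.
have h := HD_rinv e0 i y x.
elim: n => [|n IH].
  by under eq_fun do rewrite expr1; rewrite expr0 !mul1r.
under eq_fun do rewrite exprS.
apply: HD_eq (HD_mul h IH) _; rewrite -[n.+2%:R]natr1 !exprS; ring.
Qed.

Lemma partial_FF i y : partial i (FF mu e y) = XX mu e i y.
Proof.
apply/funext => x; have [_ ->] := HD_mul (HD_exp mu e0 i y x) (HD_rinv e0 i y x).
by rewrite /XX; ring.
Qed.

Lemma HD_co_shift i (y x : sp) : HD i (fun x => co i (x - y)) x 1.
Proof.
have -> : (fun x => co i (x - y)) = (fun x => co i x + - co i y).
  by apply/funext => z; rewrite raddfB.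
by apply: HD_eq (HD_add (HD_co i i x) (HD_cst i _ x)) _; rewrite eqxx addr0.
Qed.

Lemma partial_XX i y : partial i (XX mu e i y) = dXX mu e i y.
Proof.
apply/funext => x.
have h1 := HD_mul (HD_cst i (-1) x) (HD_co_shift i y x).
have h2 := HD_add (HD_mul (HD_cst i mu x) (HD_rinvX i 1 y x)) (HD_rinvX i 2 y x).
have h3 := HD_mul h1 (HD_mul (HD_exp mu e0 i y x) h2).
rewrite /XX; have [_ ->] := h3; rewrite /dXX.
move: (expR _) (co i (x - y)) (rr e (x - y))^-1 => E c r; ring.
Qed.

(** The squared coordinates sum to r^2 - e^2. The r^2 part produces mu^2 [FF]; what remains carries
    the factor e^2 and is [kk]. *)
Lemma sum_dXX y x : \sum_(i < 3) dXX mu e i y x =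
  mu ^+ 2 * FF mu e y x - kk mu e (x - y).
Proof.
have r0 := rr_gt0 (x - y) e0.
have nE : co 0 (x - y) ^+ 2 + co 1 (x - y) ^+ 2 + co ord_max (x - y) ^+ 2 =
    rr e (x - y) ^+ 2 - e ^+ 2.
  by rewrite rr_sqr addrK /n2 /co.
have sumE (F : 'I_3 -> R) : \sum_(i < 3) F i = F 0 + F 1 + F ord_max.
  rewrite !big_ord_recr big_ord0 /= add0r; congr (F _ + F _ + F _); exact/val_inj.
rewrite sumE /dXX /FF /kk.
set E := expR _; set r := rr e (x - y) in r0 nE *.
have -> (a b c A B : R) : - A + a * B + (- A + b * B) + (- A + c * B) = - 3 * A + (a + b + c) * B.
  by ring.
by rewrite nE; field; rewrite gt_eqF.
Qed.

Lemma FF_ge0 y x : 0 <= FF mu e y x.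
Proof. by rewrite mulr_ge0 ?expR_ge0// invr_ge0 rr_ge0. Qed.

(** The bound does not involve mu, because e^{-s}(1+s) <= 1 with s = mu r; with r >= |x-y| it will
    give |x-y|^{-2} uniformly in e. *)
Lemma XX_le i y x : `|XX mu e i y x| <= (rr e (x - y) ^+ 2)^-1.
Proof.
have r0 := rr_gt0 (x - y) e0.
have cr : `|co i (x - y)| <= rr e (x - y).
  exact: le_trans (co_le_enorm _ _) (enorm_le_rr _ _).
rewrite /XX mulN1r normrM normrN.
set r := rr e (x - y) in r0 cr *.
have s0 : 0 <= mu * r by rewrite mulr_ge0// ltW.
have -> : mu * r^-1 ^+ 2 + r^-1 ^+ 3 = (mu * r + 1) / r ^+ 3 by field; rewrite gt_eqF.
rewrite mulrA normrM (gtr0_norm (_ : 0 < (r ^+ 3)^-1)) ?invr_gt0 ?exprn_gt0//.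
rewrite ger0_norm; last by rewrite mulr_ge0 ?expR_ge0// addr_ge0.
have -> : (r ^+ 2)^-1 = r * (1 * (r ^+ 3)^-1) by field; rewrite gt_eqF.
apply: ler_pM => //.
  by rewrite mulr_ge0 ?invr_ge0 ?exprn_ge0 ?(ltW r0)// mulr_ge0 ?expR_ge0// addr_ge0.
by rewrite ler_pM2r ?invr_gt0 ?exprn_gt0// expR_lin_le.
Qed.

Lemma dXX_le i y x : `|dXX mu e i y x| <= (4 / e) / rr e (x - y) ^+ 2.
Proof.
have r0 := rr_gt0 (x - y) e0; have er := le_rr (x - y) e0.
have cr : co i (x - y) ^+ 2 <= rr e (x - y) ^+ 2.
  rewrite -[co _ _ ^+ 2]real_normK ?num_real// lerXn2r ?nnegrE ?rr_ge0//.
  exact: le_trans (co_le_enorm _ _) (enorm_le_rr _ _).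
rewrite /dXX.
set r := rr e (x - y) in r0 er cr *; set c := co i (x - y) in cr *.
have s0 : 0 <= mu * r by rewrite mulr_ge0// ltW.
have E0 := expR_ge0 (- (mu * r)).
have -> : mu * r^-1 ^+ 2 + r^-1 ^+ 3 = (mu * r + 1) / r ^+ 3 by field; rewrite gt_eqF.
have -> : mu ^+ 2 * r^-1 ^+ 3 + 3 * mu * r^-1 ^+ 4 + 3 * r^-1 ^+ 5 =
   ((mu * r) ^+ 2 + 3 * (mu * r) + 3) / r ^+ 5 by field; rewrite gt_eqF.
have h1 : 0 <= expR (- (mu * r)) * ((mu * r + 1) / r ^+ 3) <= 1 / r ^+ 3.
  rewrite mulrA; apply/andP; split.
    by rewrite mulr_ge0 ?invr_ge0 ?exprn_ge0 ?(ltW r0)// mulr_ge0// addr_ge0.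
  by rewrite ler_pM2r ?invr_gt0 ?exprn_gt0// expR_lin_le.
have h2 : 0 <= c ^+ 2 * (expR (- (mu * r)) * (((mu * r) ^+ 2 + 3 * (mu * r) + 3) / r ^+ 5))
    <= 3 / r ^+ 3.
  have q0 : 0 <= (mu * r) ^+ 2 + 3 * (mu * r) + 3.
    by rewrite !addr_ge0 ?sqr_ge0// mulr_ge0.
  apply/andP; split.
    rewrite mulr_ge0 ?sqr_ge0// mulr_ge0// divr_ge0// exprn_ge0// ltW//.
  have -> : 3 / r ^+ 3 = r ^+ 2 * (3 / r ^+ 5) by field; rewrite gt_eqF.
  apply: ler_pM; rewrite ?sqr_ge0//.
    by rewrite mulr_ge0// divr_ge0// exprn_ge0// ltW.
  by rewrite mulrA ler_pM2r ?invr_gt0 ?exprn_gt0// expR_quad_le.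
have h3 : 4 / r ^+ 3 <= 4 / e / r ^+ 2.
  have -> : 4 / e / r ^+ 2 = 4 * (e * r ^+ 2)^-1 by field; rewrite !gt_eqF.
  rewrite ler_pM2l// lef_pV2 ?posrE ?mulr_gt0 ?exprn_gt0//.
  by rewrite (exprS r 2) ler_pM2r// exprn_gt0.
apply: le_trans h3; have -> : 4 / r ^+ 3 = 1 / r ^+ 3 + 3 / r ^+ 3 by field; rewrite gt_eqF.
have /andP[a1 a2] := h1; have /andP[b1 b2] := h2.
apply: le_trans (ler_normD _ _) _; rewrite normrN !ger0_norm//.
exact: lerD.
Qed.

Lemma L2r_rr2_shift (C : R) (y : sp) (f : sp -> R) : measurable_fun setT f ->
  (forall x, `|f x| <= C / rr e (x - y) ^+ 2) -> L2r mu3 f.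
Proof.
move=> mf fC.
have : L2r mu3 (fun x => f (x + y)).
  apply: (L2r_rr2 e0 (C := C)); first exact: measurable_shift_arg.
  by move=> x; have := fC (x + y); rewrite addrK.
move=> /(L2r_shift (- y)); congr L2r; apply/funext => x.
by rewrite subrK.
Qed.

Lemma L2r_XX i y : L2r mu3 (XX mu e i y).
Proof.
apply: (@L2r_rr2_shift 1 y); first exact: (sm_measurable e0 (sm_XX i y)).
by move=> x; rewrite mul1r XX_le.
Qed.

Lemma L2r_dXX i y : L2r mu3 (dXX mu e i y).
Proof.
apply: (@L2r_rr2_shift (4 / e) y) => [|x]; last exact: dXX_le.
by rewrite -partial_XX; exact: (sm_measurable e0 (sm_partial e0 i (sm_XX i y))).
Qed.

Lemma FF_le_rr2 y x : 0 < mu -> `|FF mu e y x| <= mu^-1 / rr e (x - y) ^+ 2.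
Proof.
move=> mup; rewrite ger0_norm ?FF_ge0//.
have r0 := rr_gt0 (x - y) e0; rewrite /FF; set r := rr e (x - y) in r0 *.
have -> : mu^-1 / r ^+ 2 = (mu * r)^-1 * r^-1 by field; rewrite !gt_eqF.
have sp0 : 0 < mu * r by rewrite mulr_gt0.
rewrite ler_pM2r ?invr_gt0// -[leRHS]mul1r ler_pdivlMr//.
apply: le_trans (expR_lin_le (ltW sp0)); rewrite ler_wpM2l ?expR_ge0//.
by rewrite lerDl.
Qed.

Lemma L2r_FF y : 0 < mu -> L2r mu3 (FF mu e y).
Proof.
move=> mup; apply: (@L2r_rr2_shift mu^-1 y) => [|x]; last exact: FF_le_rr2.
exact: (sm_measurable e0 (sm_FF y)).
Qed.

Lemma L2r_kk_shift y : L2r mu3 (fun x => kk mu e (x - y)).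
Proof. exact: (L2r_shift (- y) (L2r_kk mu0 e0)). Qed.

Definition H1r (u : sp -> R) (g : 'I_3 -> sp -> R) :=
  L2r mu3 u /\ forall i, L2r mu3 (g i) /\ weak_partial_real i u (g i).

Lemma H1r_FF y : 0 < mu -> H1r (FF mu e y) (fun i => XX mu e i y).
Proof.
move=> mup; split; first exact: L2r_FF.
move=> i; split; first exact: L2r_XX.
rewrite -partial_FF; apply: weak_partial_smooth => [x|].
  exact: (sm_differentiable e0 x (sm_FF y)).
exact: (sm_continuous e0 (sm_partial e0 i (sm_FF y))).
Qed.

Lemma ip_dXX u g i y : H1r u g -> ip mu3 u (dXX mu e i y) = - ip mu3 (g i) (XX mu e i y).
Proof.
move=> [lu Hg]; have [lg wg] := Hg i.
rewrite -partial_XX; apply: (weak_partial_sm e0 lu lg wg (sm_XX i y)).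
- exact: L2r_XX.
- by rewrite partial_XX; exact: L2r_dXX.
Qed.

Lemma smearE u y : smear mu e u y = ip mu3 u (fun x => kk mu e (x - y)).
Proof. by []. Qed.

(** Replace [kk] by mu^2 [FF] minus the divergence of [XX], and integrate the divergence by parts
    against the weak gradient of u. *)
Lemma smear_H1 u g y : H1r u g -> 0 < mu ->
  smear mu e u y = \sum_i ip mu3 (g i) (XX mu e i y) + mu ^+ 2 * ip mu3 u (FF mu e y).
Proof.
move=> H mup; have [lu Hg] := H.
have lF := L2r_FF y mup; have lk := L2r_kk_shift y.
have -> : \sum_i ip mu3 (g i) (XX mu e i y) = - \sum_i ip mu3 u (dXX mu e i y).
  by rewrite -sumrN; apply: eq_bigr => i _; rewrite (ip_dXX i y H) opprK.
have -> : \sum_i ip mu3 u (dXX mu e i y) = ip mu3 u (fun x => mu ^+ 2 * FF mu e y x - kk mu e (x - y)).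
  under eq_bigr do rewrite ipC.
  rewrite -ip_suml//; last by move=> i; exact: L2r_dXX.
  by rewrite ipC; congr ip; apply/funext => x; rewrite sum_dXX.
rewrite ipC ipBl//; last exact: L2rZ.
rewrite ipZl// smearE.
have aux (A m B C D : R) : A = C -> B = D -> A = - (m * B - C) + m * D.
  by move=> -> ->; ring.
by apply: aux; exact: ipC.
Qed.

End Fixed_parameters.

(** For mu = 0 the kernel 1/r is not square integrable, so the identity is obtained from [dXX]
    directly and [FF] is never paired with u. *)
Lemma smear_H1_0 e u g y : 0 < e -> H1r u g ->
  smear 0 e u y = \sum_i ip mu3 (g i) (XX 0 e i y).
Proof.
move=> e0 H; have [lu Hg] := H; have z0 : 0 <= 0 :> R by [].
have lk := L2r_kk_shift e0 z0 y.
have -> : \sum_i ip mu3 (g i) (XX 0 e i y) = - \sum_i ip mu3 u (dXX 0 e i y).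
  by rewrite -sumrN; apply: eq_bigr => i _; rewrite (ip_dXX e0 z0 i y H) opprK.
have -> : \sum_i ip mu3 u (dXX 0 e i y) = ip mu3 u (fun x => - kk 0 e (x - y)).
  under eq_bigr do rewrite ipC.
  rewrite -ip_suml//; last by move=> i; exact: L2r_dXX.
  by rewrite ipC; congr ip; apply/funext => x; rewrite sum_dXX// expr0n/= mul0r sub0r.
by rewrite ipC ipNl// opprK ipC.
Qed.

End Kernel_calculus.

(** * The kernel |x|^{-2} convolved with itself *)

Section Newton_kernel.
Variable R : realType.
Local Notation sp := (space3 R).
Local Notation mu3 := (@lebesgue3 R).

Lemma measurable_point3 (y : sp) : measurable [set y].
Proof.
have -> : [set y] = [set x | enorm (x - y) <= 0].
  apply/seteqP; split => x /= => [->|]; first by rewrite subrr enorm0.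
  move=> h; apply/eqP; rewrite -subr_eq0; apply/eqP/enorm_eq0/le_anti.
  by rewrite h enorm_ge0.
have m : measurable_fun setT (fun x : sp => enorm (x - y)).
  exact: (measurable_shift_arg (- y) (@measurable_enorm R)).
have -> : [set x | enorm (x - y) <= 0] = setT `&` (fun x : sp => enorm (x - y)) @^-1` `]-oo, 0]%classic.
  by rewrite setTI; apply/seteqP; split=> x /=; rewrite in_itv.
by apply: m; [exact: measurableT|exact: measurable_itv].
Qed.

Lemma lebesgue3_point (y : sp) : mu3 [set y] = 0%E.
Proof.
have m1 (a : R) : measurable [set a] by exact: measurable_set1.
have -> : [set y] = ([set y.1.1] `*` [set y.1.2]) `*` [set y.2].
  apply/seteqP; split => [x /= ->//|[[a b] c] /= [[-> ->] ->]].
  by case: y => -[].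
have m2 : measurable ([set y.1.1] `*` [set y.1.2]) by exact: measurableX.
rewrite /lebesgue3 product_measure1E//.
have z : (@lebesgue_measure R) [set y.2] = 0%E by exact: lebesgue_measure_set1.
by rewrite [X in (_ * X)%E]z mule0.
Qed.

Lemma ae_neq (y : sp) : {ae mu3, forall x, x != y}.
Proof.
exists [set y]; split; [exact: measurable_point3|exact: lebesgue3_point|].
by move=> x /= /negP; rewrite negbK => /eqP.
Qed.

Lemma int3_le_ae (f g : sp -> \bar R) : measurable_fun setT f -> measurable_fun setT g ->
  (forall x, 0 <= f x)%E -> (forall x, 0 <= g x)%E ->
  {ae mu3, forall x, (f x <= g x)%E} ->
  (\int[mu3]_x f x <= \int[mu3]_x g x)%E.
Proof.
move=> mf mg f0 g0 fg.
have H := @ae_ge0_le_integral _ _ _ mu3 setT measurableT f g (fun x _ => f0 x) mf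
  (fun x _ => g0 x) mg.
by apply: H; case: fg => N [mN N0 sN]; exists N; split=> // x /= h; apply: sN => /= h'; apply: h.
Qed.

(** Division by zero yields 0, so a singular kernel vanishes at its pole and may fail to dominate
    there; a single point is negligible. *)
Lemma int3_le_off (y : sp) (f g : sp -> \bar R) : measurable_fun setT f ->
  measurable_fun setT g -> (forall x, 0 <= f x)%E -> (forall x, 0 <= g x)%E ->
  (forall x, x != y -> f x <= g x)%E ->
  (\int[mu3]_x f x <= \int[mu3]_x g x)%E.
Proof.
move=> mf mg f0 g0 fg; apply: (int3_le_ae mf mg f0 g0).
case: (ae_neq y) => N [mN N0 sN]; exists N; split=> // x /= h; apply: sN => /= h'.
by apply: h; exact: fg.
Qed.

Definition kn (x : sp) : R := (n2 x)^-1.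

Lemma kn_ge0 x : 0 <= kn x. Proof. by rewrite invr_ge0 n2_ge0. Qed.

Lemma knB x y : kn (x - y) = kn (y - x).
Proof. by rewrite /kn -!enorm_sqr enormB. Qed.

Lemma measurable_kn : measurable_fun setT kn.
Proof. exact: (measurable_funV (@measurable_n2 R)). Qed.

(* On the ball of radius r one factor of the product is compared with its value
   at distance r, outside AM-GM is used. *)
Definition knsplit (r : R) (x : sp) : R :=
  if enorm x <= r then (r ^+ 2)^-1 * kn x else 2^-1 * (n2 x ^+ 2)^-1.

Lemma knsplit_ge0 r x : 0 <= knsplit r x.
Proof.
rewrite /knsplit; case: ifP => _; rewrite mulr_ge0 ?kn_ge0 ?invr_ge0 ?sqr_ge0//.
Qed.

Lemma measurable_knsplit r : measurable_fun setT (knsplit r).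
Proof.
apply: measurable_fun_ifT.
- apply: measurable_fun_ler; [exact: measurable_enorm|exact: measurable_cst].
- by apply: measurable_funM; [exact: measurable_cst|exact: measurable_kn].
- apply: measurable_funM; first exact: measurable_cst.
  by apply: measurable_funV; apply: measurable_funX; exact: measurable_n2.
Qed.

Lemma int_knsplit r : 0 < r -> (\int[mu3]_x (knsplit r x)%:E <= (128 / r)%:E)%E.
Proof.
move=> r0; have mB := @measurable_ball3 R r.
have mf : measurable_fun setT (fun x => (knsplit r x)%:E).
  by apply/measurable_EFinP; exact: measurable_knsplit.
rewrite (int3_split mB)//; last by move=> x; rewrite lee_fin knsplit_ge0.
have -> : 128 / r = (r ^+ 2)^-1 * (64 * r) + 2^-1 * (128 / r).
  by field; rewrite gt_eqF.
rewrite EFinD; apply: leeD.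
- have -> : (\int[mu3]_(x in ball3 r) (knsplit r x)%:E =
      \int[mu3]_(x in ball3 r) (((r ^+ 2)^-1)%:E * (kn x)%:E))%E.
    by apply: eq_integral => x /[!inE]; rewrite /ball3/= /knsplit => ->.
  rewrite int3Z ?lee_fin ?invr_ge0 ?sqr_ge0//.
  + rewrite EFinM; apply: lee_wpmul2l; first by rewrite lee_fin invr_ge0 sqr_ge0.
    exact: int_ball_inv2.
  + by apply/measurable_EFinP; exact: measurable_kn.
  + by move=> x; rewrite lee_fin kn_ge0.
- have -> : (\int[mu3]_(x in ~` ball3 r) (knsplit r x)%:E =
      \int[mu3]_(x in ~` ball3 r) ((2^-1)%:E * ((n2 x ^+ 2)^-1)%:E))%E.
    by apply: eq_integral => x /[!inE]; rewrite /ball3/= /knsplit => /negP/negbTE ->.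
  rewrite int3Z//.
  + by rewrite EFinM; apply: lee_wpmul2l => //; exact: int_far_inv4.
  + exact: measurableC.
  + apply/measurable_EFinP; apply: measurable_funV; apply: measurable_funX; exact: measurable_n2.
  + by move=> x; rewrite lee_fin invr_ge0 sqr_ge0.
Qed.

Lemma kn_le (r : R) x : 0 < r -> r < enorm x -> kn x <= (r ^+ 2)^-1.
Proof.
move=> r0 rx; have x0 := lt_trans r0 rx.
rewrite /kn -enorm_sqr lef_pV2 ?posrE ?exprn_gt0//.
by rewrite lerXn2r ?nnegrE ?enorm_ge0 ?(ltW r0) ?(ltW rx).
Qed.

(** At most one of the points is strictly inside the ball of radius r. If one of them lies in it,
    the factor at the other is at most r^{-2}; if both are outside, ab <= (a^2+b^2)/2. *)
Lemma kn_mul_le (r : R) x y : 0 < r -> 2 * r <= enorm (x - y) ->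
  kn x * kn y <= knsplit r x + knsplit r y.
Proof.
move=> r0 rxy.
have tri : enorm (x - y) <= enorm x + enorm y by rewrite -(enormN y) enormD.
have s0 z := knsplit_ge0 r z.
have [xr|xr] := leP (enorm x) r; have [yr|yr] := leP (enorm y) r.
- have [->|x0] := eqVneq x 0.
    by rewrite {1}/kn -enorm_sqr enorm0 expr0n invr0 mul0r addr_ge0.
  have [->|y0] := eqVneq y 0.
    by rewrite {2}/kn -enorm_sqr enorm0 expr0n invr0 mulr0 addr_ge0.
  have ex : enorm x = r by lra.
  have kx : kn x <= (r ^+ 2)^-1 by rewrite /kn -enorm_sqr ex.
  rewrite {2}/knsplit yr; apply: le_trans (ler_wpM2r (kn_ge0 y) kx) _.
  by rewrite lerDr.
- rewrite {1}/knsplit xr mulrC; apply: le_trans (ler_wpM2r (kn_ge0 x) (kn_le r0 yr)) _.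
  by rewrite lerDl.
- rewrite {2}/knsplit yr; apply: le_trans (ler_wpM2r (kn_ge0 y) (kn_le r0 xr)) _.
  by rewrite lerDr.
- rewrite /knsplit !leNgt xr yr/= /kn -!exprVn.
  by move: (n2 x)^-1 (n2 y)^-1 => a b; have := sqr_ge0 (a - b); nra.
Qed.

(** Apply [kn_mul_le] at half the distance d: each of the two terms integrates to at most
    128/(d/2). *)
Lemma int_kn_mul (y z : sp) : y != z ->
  (\int[mu3]_x (kn (x - y) * kn (x - z))%:E <= (512 / enorm (y - z))%:E)%E.
Proof.
move=> yz; set d := enorm (y - z).
have d0 : 0 < d by rewrite enorm_gt0// subr_eq0.
have r0 : 0 < d / 2 by lra.
have ms w : measurable_fun setT (fun x : sp => (knsplit (d / 2) (x - w))%:E).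
  by apply/measurable_EFinP; exact: (measurable_shift_arg (- w) (@measurable_knsplit _)).
have mk w : measurable_fun setT (fun x : sp => kn (x - w)).
  exact: (measurable_shift_arg (- w) measurable_kn).
apply: (@le_trans _ _ (\int[mu3]_x ((knsplit (d / 2) (x - y)%R)%:E +
    (knsplit (d / 2) (x - z)%R)%:E))%E).
  apply: int3_le => //.
  - by apply/measurable_EFinP; apply: measurable_funM; exact: mk.
  - by apply: emeasurable_funD; exact: ms.
  - by move=> x; rewrite lee_fin mulr_ge0 ?kn_ge0.
  - move=> x _; rewrite -EFinD lee_fin kn_mul_le//.
    rewrite (_ : x - y - (x - z) = z - y); first by rewrite enormB -/d; lra.
    by rewrite opprB addrC addrA subrK.
rewrite int3D//; [|by move=> x; rewrite lee_fin knsplit_ge0..].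
have H w : (\int[mu3]_x (knsplit (d / 2) (x - w)%R)%:E <= (256 / d)%:E)%E.
  have -> : 256 / d = 128 / (d / 2) by field; rewrite gt_eqF.
  rewrite (@integral_shift _ (- w) (fun x => (knsplit (d / 2) x)%:E)).
    exact: int_knsplit.
  by apply/measurable_EFinP; exact: measurable_knsplit.
have -> : 512 / d = 256 / d + 256 / d by field; rewrite gt_eqF.
by rewrite EFinD leeD.
Qed.

Lemma int_kn_mul_bounded : exists2 c : R, 0 < c & forall y z : sp, y != z ->
  (\int[mu3]_x (kn (x - y) * kn (x - z))%:E <= (c / enorm (y - z))%:E)%E.
Proof. by exists 512 => // y z; exact: int_kn_mul. Qed.

End Newton_kernel.

(** * Riesz potentials and duality with the gradient *)

Section Riesz_potential.
Variable R : realType.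
Local Notation sp := (space3 R).
Local Notation mu3 := (@lebesgue3 R).

Lemma ereal_young (s a : R) (b : \bar R) : 0 < s -> 0 <= a -> (0 <= b)%E ->
  (a%:E * b <= s%:E * (a ^+ 2)%:E + s^-1%:E * (b * b))%E.
Proof.
move=> s0 a0; case: b => [b|_|//].
  by move=> _; rewrite -!EFinM -EFinD lee_fin -expr2 young_s.
rewrite mulyy (_ : (s^-1%:E * +oo = +oo)%E); last by rewrite gt0_muley ?lte_fin ?invr_gt0.
by rewrite -EFinM addey ?leey.
Qed.

Lemma abs_Rintegral_le (f : sp -> R) : measurable_fun setT f ->
  (`|\int[mu3]_x f x|%:E <= \int[mu3]_x `|f x|%:E)%E.
Proof.
move=> mf; have mf' : measurable_fun setT (fun x : sp => (f x)%:E) by apply/measurable_EFinP; exact: mf.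
have H := @le_abse_integral _ _ _ mu3 setT _ measurableT mf'.
apply: le_trans H; rewrite /Rintegral; case: (\int[mu3]_x _)%E => [r||] //=.
- by rewrite normr0 leey.
- by rewrite normr0 leey.
Qed.

Lemma measurable_kn2 : measurable_fun setT (fun p : sp * sp => kn (p.1 - p.2)).
Proof. by apply: measurable_funB2; exact: measurable_kn. Qed.

(** The convolution with |x|^{-2}, a multiple of the Riesz potential of order one, with values in
    the extended reals. *)
Definition pot (f : sp -> R) (x : sp) : \bar R := (\int[mu3]_y (f y * kn (x - y))%:E)%E.

Section Pot.
Variables (c : R) (f : sp -> R).
Hypotheses (c0 : (0 <= c%:E)%E) (energy : forall y z : sp, y != z ->
  (\int[mu3]_x (kn (x - y) * kn (x - z))%:E <= (c / enorm (y - z))%:E)%E).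
Hypotheses (mf : measurable_fun setT f) (f0 : forall x, 0 <= f x).

Let mfk : measurable_fun setT (fun p : sp * sp => (f p.2 * kn (p.1 - p.2))%:E).
Proof.
apply/measurable_EFinP; apply: measurable_funM; last exact: measurable_kn2.
exact: measurable_fun2.
Qed.

Let fk0 x y : (0 <= (f y * kn (x - y))%:E)%E.
Proof. by rewrite lee_fin mulr_ge0 ?kn_ge0. Qed.

Lemma pot_ge0 x : (0 <= pot f x)%E.
Proof. by apply: integral_ge0 => y _. Qed.

Lemma measurable_pot : measurable_fun setT (pot f).
Proof. exact: (@measurable_int1 _ (fun x y => (f y * kn (x - y))%:E)). Qed.

Lemma measurable_slice1 (F : sp -> sp -> \bar R) x :
  measurable_fun setT (fun p : sp * sp => F p.1 p.2) -> measurable_fun setT (F x).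
Proof.
move=> mF; apply: (@measurableT_comp _ _ _ _ _ _ (fun p : sp * sp => F p.1 p.2) _ (fun y => (x, y))).
  exact: mF.
exact: measurable_pair1.
Qed.

Lemma measurable_slice2 (F : sp -> sp -> \bar R) y :
  measurable_fun setT (fun p : sp * sp => F p.1 p.2) ->
  measurable_fun setT (fun x : sp => F x y).
Proof.
move=> mF; apply: (@measurableT_comp _ _ _ _ _ _ (fun p : sp * sp => F p.1 p.2) _ (fun x => (x, y))).
  exact: mF.
exact: measurable_pair2.
Qed.

Let mfz z : measurable_fun setT (fun p : sp * sp => (f z * kn (p.1 - z))%:E).
Proof.
apply/measurable_EFinP; apply: measurable_funM; first exact: measurable_cst.
apply: (measurable_fun1 (f := fun x => kn (x - z))).
exact: (measurable_shift_arg (- z) (@measurable_kn _)).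
Qed.

(** Expand the square as a double integral in y and z and integrate in x first, where [energy]
    applies; the diagonal y = z is null. *)
Lemma int_pot_sqr : (\int[mu3]_x (pot f x * pot f x) <=
  c%:E * \int[mu3]_y \int[mu3]_z (f y * f z / enorm (y - z))%:E)%E.
Proof.
have mpot := measurable_pot.
have E x : (pot f x * pot f x = \int[mu3]_y (pot f x * (f y * kn (x - y)%R)%:E))%E.
  rewrite int3Z//; last exact: pot_ge0.
  exact: (@measurable_slice1 (fun x y => (f y * kn (x - y))%:E) x mfk).
under eq_integral do rewrite E.
have mG : measurable_fun setT (fun p : sp * sp => pot f p.1 * (f p.2 * kn (p.1 - p.2)%R)%:E)%E.
  apply: emeasurable_funM; last exact: mfk.
  by apply: (measurableT_comp mpot); exact: measurable_fst3.
have mE : measurable_fun setT (fun p : sp * sp => (f p.1 * f p.2 / enorm (p.1 - p.2))%:E).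
  apply/measurable_EFinP; apply: measurable_funM.
    by apply: measurable_funM; [exact: measurable_fun1|exact: measurable_fun2].
  by apply: measurable_funV; apply: measurable_funB2; exact: measurable_enorm.
have E0 y z : (0 <= (f y * f z / enorm (y - z))%:E)%E.
  by rewrite lee_fin divr_ge0 ?enorm_ge0// mulr_ge0.
rewrite (@tonelli3 _ (fun x y => pot f x * (f y * kn (x - y)%R)%:E)%E)//; last first.
  by move=> x y; rewrite mule_ge0// pot_ge0.
have mEy y : measurable_fun setT (fun z : sp => (f y * f z / enorm (y - z))%:E).
  exact: (@measurable_slice1 (fun y z => (f y * f z / enorm (y - z))%:E) y mE).
have mE1 : measurable_fun setT (fun y : sp => \int[mu3]_z (f y * f z / enorm (y - z))%:E)%E.
  exact: (@measurable_int1 _ (fun y z => (f y * f z / enorm (y - z))%:E) mE E0).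
have E1 y : (0 <= \int[mu3]_z (f y * f z / enorm (y - z))%:E)%E.
  by apply: integral_ge0 => z _; exact: E0.
have G0 x y : (0 <= pot f x * (f y * kn (x - y)%R)%:E)%E by exact: (mule_ge0 (pot_ge0 x) (fk0 x y)).
rewrite -(int3Z measurableT mE1 E1 c0).
apply: int3_le; first exact: measurableT.
- exact: (@measurable_int2 _ (fun x y => pot f x * (f y * kn (x - y)%R)%:E)%E mG G0).
- by apply: emeasurable_funM; [exact: measurable_cst|exact: mE1].
- by move=> y; apply: integral_ge0 => x _; exact: G0.
move=> y _.
have E2 x : (pot f x * (f y * kn (x - y)%R)%:E =
    \int[mu3]_z ((f y * kn (x - y)%R)%:E * (f z * kn (x - z)%R)%:E))%E.
  rewrite muleC -int3Z//.
  exact: (@measurable_slice1 (fun x y => (f y * kn (x - y))%:E) x mfk).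
under eq_integral do rewrite E2.
have mH : measurable_fun setT (fun p : sp * sp =>
    ((f y * kn (p.1 - y)%R)%:E * (f p.2 * kn (p.1 - p.2)%R)%:E)%E).
  by apply: emeasurable_funM; [exact: mfz|exact: mfk].
rewrite (@tonelli3 _ (fun x z => (f y * kn (x - y)%R)%:E * (f z * kn (x - z)%R)%:E)%E)//; last first.
  by move=> x z; rewrite mule_ge0.
have H0 x z : (0 <= (f y * kn (x - y)%R)%:E * (f z * kn (x - z)%R)%:E)%E.
  exact: (mule_ge0 (fk0 x y) (fk0 x z)).
rewrite -(int3Z measurableT (mEy y) (E0 y) c0).
apply: (@int3_le_off _ y).
- exact: (@measurable_int2 _ (fun x z => (f y * kn (x - y)%R)%:E * (f z * kn (x - z)%R)%:E)%E mH H0).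
- by apply: emeasurable_funM; [exact: measurable_cst|exact: mEy].
- by move=> z; apply: integral_ge0 => x _; exact: H0.
- by move=> z; exact: (mule_ge0 c0 (E0 y z)).
move=> z zy; rewrite (_ : (c%:E * _)%E = (f y * f z)%:E * (c / enorm (y - z))%:E)%E; last first.
  by rewrite -!EFinM; congr EFin; ring.
apply: le_trans (lee_wpmul2l _ (energy _)); rewrite ?lee_fin ?mulr_ge0//; last first.
  by rewrite eq_sym.
have mk w : measurable_fun setT (fun x : sp => kn (x - w)).
  exact: (measurable_shift_arg (- w) (@measurable_kn _)).
have mkk : measurable_fun setT (fun x : sp => (kn (x - y) * kn (x - z))%:E).
  by apply/measurable_EFinP; apply: measurable_funM; exact: mk.
have kk0 (x : sp) : (0 <= (kn (x - y) * kn (x - z))%:E)%E by rewrite lee_fin mulr_ge0 ?kn_ge0.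
have ff0 : (0 <= (f y * f z)%:E)%E by rewrite lee_fin mulr_ge0.
rewrite -(int3Z measurableT mkk kk0 ff0).
rewrite le_eqVlt; apply/orP; left; apply/eqP; apply: eq_integral => x _.
by rewrite -!EFinM; congr EFin; ring.
Qed.

(** By Tonelli the left side is at most the pairing of |g| with [pot f], to which the weighted Young
    inequality applies. *)
Lemma int_mul_ip_le (g : sp -> R) (X : sp -> sp -> R) (s : R) : 0 < s -> L2r mu3 g ->
  measurable_fun setT (fun p : sp * sp => X p.2 p.1) ->
  (forall y x, x != y -> `|X y x| <= kn (x - y)) ->
  (\int[mu3]_y (f y * `|ip mu3 g (X y)|)%:E <=
    s%:E * (ip mu3 g g)%:E + s^-1%:E * \int[mu3]_x (pot f x * pot f x))%E.
Proof.
move=> s0 lg mX Xk; have mg : measurable_fun setT g by case: lg.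
have mng : measurable_fun setT (fun x : sp => `|g x|) by exact: measurableT_comp.
have mgX : measurable_fun setT (fun p : sp * sp => g p.1 * X p.2 p.1).
  by apply: measurable_funM => //; exact: measurable_fun1.
have mI : measurable_fun setT (fun y : sp => ip mu3 g (X y)).
  exact: (@measurable_Rint2 _ (fun x y => g x * X y x)).
have mh : measurable_fun setT (fun p : sp * sp => (`|g p.2| * (f p.1 * kn (p.2 - p.1)))%:E).
  apply/measurable_EFinP; apply: measurable_funM.
    exact: (measurable_fun2 mng).
  apply: measurable_funM; first exact: measurable_fun1.
  under eq_fun do rewrite knB.
  exact: measurable_kn2.
have h0 y x : (0 <= (`|g x| * (f y * kn (x - y)))%:E)%E.
  by rewrite lee_fin !mulr_ge0 ?kn_ge0.
have mkk y : measurable_fun setT (fun x : sp => (`|g x| * kn (x - y))%:E).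
  apply/measurable_EFinP; apply: measurable_funM => //.
  exact: (measurable_shift_arg (- y) (@measurable_kn _)).
apply: (@le_trans _ _ (\int[mu3]_y \int[mu3]_x (`|g x| * (f y * kn (x - y)))%:E)%E).
  apply: int3_le => //.
  - apply/measurable_EFinP; apply: measurable_funM => //; exact: measurableT_comp.
  - exact: (@measurable_int1 _ (fun y x => (`|g x| * (f y * kn (x - y)))%:E)).
  - by move=> y; rewrite lee_fin mulr_ge0.
  move=> y _; rewrite EFinM.
  have -> : (\int[mu3]_x (`|g x| * (f y * kn (x - y)))%:E =
      (f y)%:E * \int[mu3]_x (`|g x| * kn (x - y))%:E)%E.
    rewrite -int3Z ?lee_fin//; last by move=> x; rewrite lee_fin mulr_ge0 ?kn_ge0.
    by apply: eq_integral => x _; rewrite -EFinM; congr EFin; ring.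
  apply: lee_wpmul2l; first by rewrite lee_fin.
  have mgy : measurable_fun setT (fun x : sp => g x * X y x).
    have := @measurable_slice2 (fun x y => (g x * X y x)%:E) y.
    move=> H; apply/measurable_EFinP; apply: H.
    by apply/measurable_EFinP; exact: mgX.
  apply: le_trans (abs_Rintegral_le mgy) _.
  apply: (@int3_le_off _ y) => //.
  - by apply/measurable_EFinP; apply: measurableT_comp => //; exact: mgy.
  - by move=> x; rewrite lee_fin mulr_ge0 ?kn_ge0.
  - by move=> x xy; rewrite lee_fin normrM ler_wpM2l// Xk.
rewrite (@tonelli3 _ (fun y x => (`|g x| * (f y * kn (x - y)))%:E))//.
have -> : (\int[mu3]_x \int[mu3]_y (`|g x| * (f y * kn (x - y)))%:E =
    \int[mu3]_x (`|g x|%:E * pot f x))%E.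
  apply: eq_integral => x _; rewrite -int3Z//.
  exact: (@measurable_slice1 (fun x y => (f y * kn (x - y))%:E) x mfk).
have mg2 : measurable_fun setT (fun x : sp => (g x ^+ 2)%:E).
  by apply/measurable_EFinP; apply: measurable_funX; exact: mg.
have mp2 : measurable_fun setT (fun x : sp => pot f x * pot f x)%E.
  by apply: emeasurable_funM; exact: measurable_pot.
have g20 x : (0 <= (g x ^+ 2)%:E)%E by rewrite lee_fin sqr_ge0.
have p20 x : (0 <= pot f x * pot f x)%E by exact: (mule_ge0 (pot_ge0 x) (pot_ge0 x)).
have s0' : (0 <= s%:E)%E by rewrite lee_fin ltW.
have s0'' : (0 <= s^-1%:E)%E by rewrite lee_fin invr_ge0 ltW.
have m1 : measurable_fun setT (fun x : sp => s%:E * (g x ^+ 2)%:E)%E.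
  by apply: emeasurable_funM; [exact: measurable_cst|exact: mg2].
have m2 : measurable_fun setT (fun x : sp => s^-1%:E * (pot f x * pot f x))%E.
  by apply: emeasurable_funM; [exact: measurable_cst|exact: mp2].
rewrite -(ipE lg) -(int3Z measurableT mg2 g20 s0') -(int3Z measurableT mp2 p20 s0'').
rewrite -(int3D measurableT m1 m2 (fun x => mule_ge0 s0' (g20 x)) (fun x => mule_ge0 s0'' (p20 x))).
apply: int3_le; first exact: measurableT.
- apply: emeasurable_funM; last exact: measurable_pot.
  by apply/measurable_EFinP; exact: mng.
- by apply: emeasurable_funD; [exact: m1|exact: m2].
- by move=> x; rewrite mule_ge0 ?lee_fin// pot_ge0.
- move=> x _; rewrite -[g x ^+ 2]real_normK ?num_real//.
  by apply: ereal_young; [|exact: normr_ge0|exact: pot_ge0].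
Qed.

End Pot.

End Riesz_potential.

(** * Potentials of finite Kato norm are form-bounded *)

Section Form_bound_truncated.
Variable R : realType.
Local Notation sp := (space3 R).
Local Notation mu3 := (@lebesgue3 R).

Definition katob (W : sp -> R) (K : R) := forall y,
  (\int[mu3]_x (`|W x| / enorm (x - y))%:E <= K%:E)%E.

Lemma kato_norm_katob W K : (kato_norm W <= K%:E)%E -> katob W K.
Proof.
move=> WK y; apply: le_trans WK; apply: ereal_sup_ubound.
by exists y.
Qed.

Lemma measurable_abs3 (f : sp -> R) : measurable_fun setT f -> measurable_fun setT (fun x => `|f x|).
Proof. by move=> mf; exact: measurableT_comp. Qed.

Lemma energy_young (A B a b e : R) : 0 <= A -> 0 <= B -> 0 <= e ->
  A * `|a| * (B * `|b|) * e <= A * a ^+ 2 * (B * e) + B * b ^+ 2 * (A * e).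
Proof.
move=> A0 B0 e0; rewrite -[a ^+ 2]real_normK ?num_real// -[b ^+ 2]real_normK ?num_real//.
move: (`|a|) (`|b|) => {}a {}b.
have ab0 : 0 <= A * B * e by rewrite !mulr_ge0.
have -> : A * a ^+ 2 * (B * e) + B * b ^+ 2 * (A * e) = A * B * e * (a ^+ 2 + b ^+ 2) by ring.
have -> : A * a * (B * b) * e = A * B * e * (a * b) by ring.
by apply: ler_wpM2l => //; have := sqr_ge0 (a - b); have := sqr_ge0 (a + b); lra.
Qed.

(** A Schur test: |t(y) t(z)| <= t(y)^2 + t(z)^2, and in each term the other variable is integrated
    out by the Kato bound. Hence the factor 2. *)
Lemma riesz_energy (W t : sp -> R) (K : R) : measurable_fun setT W ->
  measurable_fun setT t -> 0 <= K -> katob W K ->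
  (\int[mu3]_y \int[mu3]_z (`|W y| * `|t y| * (`|W z| * `|t z|) / enorm (y - z))%:E
    <= (2 * K)%:E * \int[mu3]_y (`|W y| * t y ^+ 2)%:E)%E.
Proof.
move=> mW mt K0 WK.
have mW' := measurable_abs3 mW; have mt' := measurable_abs3 mt.
pose a (y z : sp) : \bar R := (`|W y| * t y ^+ 2 * (`|W z| / enorm (z - y)))%:E.
have men : measurable_fun setT (fun p : sp * sp => (enorm (p.1 - p.2))^-1).
  by apply: measurable_funV; apply: measurable_funB2; exact: measurable_enorm.
have mq : measurable_fun setT (fun y : sp => `|W y| * t y ^+ 2).
  by apply: measurable_funM => //; exact: measurable_funX.
have ma : measurable_fun setT (fun p : sp * sp => a p.1 p.2).
  apply/measurable_EFinP; apply: measurable_funM; first exact: (measurable_fun1 mq).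
  apply: measurable_funM; first exact: (measurable_fun2 mW').
  by under eq_fun do rewrite enormB.
have ma' : measurable_fun setT (fun p : sp * sp => a p.2 p.1).
  apply/measurable_EFinP; apply: measurable_funM; first exact: (measurable_fun2 mq).
  by apply: measurable_funM => //; first exact: (measurable_fun1 mW').
have a0 y z : (0 <= a y z)%E.
  by rewrite lee_fin mulr_ge0 ?divr_ge0 ?enorm_ge0// mulr_ge0 ?sqr_ge0.
have a0' y z : (0 <= a z y)%E by [].
have mf : measurable_fun setT (fun p : sp * sp =>
    (`|W p.1| * `|t p.1| * (`|W p.2| * `|t p.2|) / enorm (p.1 - p.2))%:E).
  apply/measurable_EFinP; apply: measurable_funM; last exact: men.
  apply: measurable_funM.
    by apply: (@measurable_fun1 _ (fun x => `|W x| * `|t x|)); exact: measurable_funM.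
  by apply: (@measurable_fun2 _ (fun x => `|W x| * `|t x|)); exact: measurable_funM.
have f0 y z : (0 <= (`|W y| * `|t y| * (`|W z| * `|t z|) / enorm (y - z))%:E)%E.
  by rewrite lee_fin divr_ge0 ?enorm_ge0// !mulr_ge0.
have ms1 y : measurable_fun setT (a y) by exact: (measurable_slice1 y ma).
have ms2 y : measurable_fun setT (fun z : sp => a z y) by exact: (measurable_slice2 y ma).
have ms3 y := measurable_slice1 (F := fun y z : sp =>
  (`|W y| * `|t y| * (`|W z| * `|t z|) / enorm (y - z))%:E) y mf.
have i1 y : (0 <= \int[mu3]_z a y z)%E by apply: integral_ge0.
have i2 y : (0 <= \int[mu3]_z a z y)%E by apply: integral_ge0.
have I1 : (\int[mu3]_y \int[mu3]_z a y z <= K%:E * \int[mu3]_y (`|W y| * t y ^+ 2)%:E)%E.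
  have q0 y : (0 <= (`|W y| * t y ^+ 2)%:E)%E by rewrite lee_fin mulr_ge0 ?sqr_ge0.
  have mqE : measurable_fun setT (fun y : sp => (`|W y| * t y ^+ 2)%:E).
    by apply/measurable_EFinP; exact: mq.
  have K0E : (0 <= K%:E)%E by [].
  rewrite -(int3Z measurableT mqE q0 K0E).
  apply: int3_le => //.
  - exact: (measurable_int1 ma a0).
  - by apply: emeasurable_funM => //; exact: measurable_cst.
  move=> y _; have mWy : measurable_fun setT (fun z : sp => (`|W z| / enorm (z - y))%:E).
    apply/measurable_EFinP; apply: measurable_funM => //; apply: measurable_funV.
    exact: (measurable_shift_arg (- y) (@measurable_enorm R)).
  have W0 z : (0 <= (`|W z| / enorm (z - y))%:E)%E by rewrite lee_fin divr_ge0 ?enorm_ge0.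
  have -> : (\int[mu3]_z a y z = (`|W y| * t y ^+ 2)%:E * \int[mu3]_z (`|W z| / enorm (z - y))%:E)%E.
    by rewrite -(int3Z measurableT mWy W0 (q0 y)).
  by rewrite muleC; apply: lee_wpmul2r.
have I2 : (\int[mu3]_y \int[mu3]_z a z y = \int[mu3]_y \int[mu3]_z a y z)%E.
  exact: (@tonelli3 _ (fun y z => a z y)).
rewrite (_ : (2 * K)%:E = K%:E + K%:E)%E; last by rewrite -EFinD; congr EFin; ring.
have I3 : (\int[mu3]_y \int[mu3]_z a z y <= K%:E * \int[mu3]_y (`|W y| * t y ^+ 2)%:E)%E.
  by rewrite I2; exact: I1.
have K0E : (0 <= K%:E)%E by [].
rewrite (ge0_muleDl _ K0E K0E); have I4 := leeD I1 I3; apply: le_trans I4.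
have mi1 : measurable_fun setT (fun y => \int[mu3]_z a y z)%E by exact: (measurable_int1 ma a0).
have mi2 : measurable_fun setT (fun y => \int[mu3]_z a z y)%E.
  exact: (@measurable_int1 _ (fun y z => a z y)).
rewrite -(int3D measurableT mi1 mi2 i1 i2).
apply: int3_le; first exact: measurableT.
- exact: (measurable_int1 (f := fun y z : sp =>
    (`|W y| * `|t y| * (`|W z| * `|t z|) / enorm (y - z))%:E) mf f0).
- by apply: emeasurable_funD; [exact: mi1|exact: mi2].
- by move=> y; apply: integral_ge0.
move=> y _; rewrite -(int3D measurableT (ms1 y) (ms2 y) (a0 y) (a0' y)).
apply: int3_le; first exact: measurableT.
- exact: ms3.
- by apply: emeasurable_funD; [exact: ms1|exact: ms2].
- exact: f0.
move=> z _; rewrite /a -EFinD lee_fin (enormB z y).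
have e0 : 0 <= (enorm (y - z))^-1 by rewrite invr_ge0 enorm_ge0.
exact: (@energy_young `|W y| `|W z| (t y) (t z) (enorm (y - z))^-1 (normr_ge0 _) (normr_ge0 _) e0).
Qed.

Lemma measurable_XX2 (mu e : R) i : 0 < e ->
  measurable_fun setT (fun p : sp * sp => XX mu e i p.2 p.1).
Proof.
move=> e0; have -> : (fun p : sp * sp => XX mu e i p.2 p.1) = (fun p => XX mu e i 0 (p.1 - p.2)).
  by apply/funext => p; rewrite /XX !subr0.
by apply: measurable_funB2; exact: (sm_measurable e0 (sm_XX mu e i 0)).
Qed.

Lemma XX_le_kn (mu e : R) i (y x : sp) : 0 < e -> 0 <= mu -> x != y ->
  `|XX mu e i y x| <= kn (x - y).
Proof.
move=> e0 mu0 xy; apply: le_trans (XX_le e0 mu0 i y x) _.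
rewrite /kn lef_pV2 ?posrE ?exprn_gt0 ?rr_gt0 ?n2_gt0 ?subr_eq0//.
by rewrite rr_sqr lerDl sqr_ge0.
Qed.

(** Test [approximate_identity] for mu = 0 with f = |W||t|, where t is u or 0 at each point. The
    smeared u is a pairing of its gradient with [XX], so duality and [riesz_energy] bound the right
    side by the gradient term plus half of m q. The latter is absorbed, which needs q finite and
    explains the truncation. *)
Lemma form_bound_truncated (c K : R) (W t u : sp -> R) (g : 'I_3 -> sp -> R) (q : R) :
  0 < c -> (forall y z : sp, y != z ->
    (\int[mu3]_x (kn (x - y) * kn (x - z))%:E <= (c / enorm (y - z))%:E)%E) ->
  0 < K -> katob W K -> measurable_fun setT W -> measurable_fun setT t ->
  L2r mu3 (fun x => `|W x| * `|t x|) -> (forall x, `|t x| * `|u x| = t x ^+ 2) ->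
  (\int[mu3]_x (`|W x| * t x ^+ 2)%:E = q%:E)%E -> H1r u g ->
  q <= 24 * c / kk_mass (0 : R) ^+ 2 * K * \sum_i ip mu3 (g i) (g i).
Proof.
move=> c0 energy K0 WK mW mt lf tu qE H; have [lu Hg] := H.
have [mu_ _] := lu; have [mf _] := lf.
set m := kk_mass 0; have m0 : 0 < m by exact: kk_mass_gt0.
(* For this s each of the three components contributes s^{-1} c 2K q = m q/6, together m q/2. *)
set G := \sum_i _; pose s := 12 * c * K / m.
have s0 : 0 < s by rewrite divr_gt0// !mulr_gt0.
pose f x := `|W x| * `|t x|.
have f0 x : 0 <= f x by rewrite mulr_ge0.
suff h eta : 0 < eta -> m * q <= s * G + m * q / 2 + eta.
  have : m * q <= s * G + m * q / 2 by apply/ler_addgt0Pr.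
  move=> h'; have : m * q <= 2 * s * G by lra.
  rewrite -ler_pdivlMl// => /le_trans; apply.
  by rewrite le_eqVlt; apply/orP; left; apply/eqP; rewrite /s; field; rewrite gt_eqF.
move=> eta0; have [e /andP[e0 _] /(_ e)] := approximate_identity (lexx 0) lf lu eta0.
rewrite e0 lexx => /(_ isT).
have -> : (\int[mu3]_y (`|f y| * `|u y|)%:E = q%:E)%E.
  by rewrite -qE; apply: eq_integral => x _; rewrite ger0_norm// /f -mulrA tu.
rewrite -EFinM -lee_fin => /le_trans; apply.
rewrite EFinD; apply: leeD => //.
have mX i := measurable_XX2 0 i e0.
have Xk i y x := @XX_le_kn 0 e i y x e0 (lexx 0).
have lg i : L2r mu3 (g i) by case: (Hg i).
have mgX i : measurable_fun setT (fun y => ip mu3 (g i) (XX 0 e i y)).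
  apply: (@measurable_Rint2 _ (fun x y => g i x * XX 0 e i y x)).
  by apply: measurable_funM; [apply: measurable_fun1; case: (lg i)|exact: mX].
have mfi i : measurable_fun setT (fun y => (f y * `|ip mu3 (g i) (XX 0 e i y)|)%:E).
  apply/measurable_EFinP; apply: measurable_funM; first exact: mf.
  exact: measurable_abs3.
have fi0 i y : (0 <= (f y * `|ip mu3 (g i) (XX 0 e i y)|)%:E)%E.
  by rewrite lee_fin mulr_ge0.
have step i : (\int[mu3]_y (f y * `|ip mu3 (g i) (XX 0 e i y)|)%:E <=
    (s * ip mu3 (g i) (g i) + m * q / 6)%:E)%E.
  apply: le_trans (int_mul_ip_le mf f0 s0 (lg i) (mX i) (Xk i)) _.
  rewrite EFinD EFinM; apply: leeD => //.
  have c0' : (0 <= c%:E)%E by rewrite lee_fin ltW.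
  have := int_pot_sqr c0' energy mf f0.
  have := riesz_energy mW mt (ltW K0) WK; rewrite qE.
  move=> h1 h2; apply: le_trans (lee_wpmul2l _ (le_trans h2 (lee_wpmul2l c0' h1))) _.
    by rewrite lee_fin invr_ge0 ltW.
  rewrite -!EFinM lee_fin le_eqVlt; apply/orP; left; apply/eqP.
  by rewrite /s; field; rewrite !gt_eqF.
apply: (@le_trans _ _ (\int[mu3]_y (\sum_(i < 3) (f y * `|ip mu3 (g i) (XX 0 e i y)|)%:E))%E).
  apply: int3_le; first exact: measurableT.
  - apply/measurable_EFinP; apply: measurable_funM; apply: measurable_abs3 => //.
    exact: measurable_smear.
  - by apply: emeasurable_sum => i; exact: mfi.
  - by move=> y; rewrite lee_fin mulr_ge0.
  move=> y _; rewrite (ger0_norm (f0 y)) (smear_H1_0 y e0 H) sumEFin lee_fin -mulr_sumr.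
  by rewrite ler_wpM2l// ler_norm_sum.
rewrite (@ge0_integral_sum _ _ _ mu3 setT measurableT _ (fun i y => (f y * `|ip mu3 (g i) (XX 0 e i y)|)%:E)); last 2 first.
  exact: mfi.
  by move=> i y _; exact: fi0.
apply: (@le_trans _ _ (\sum_(i < 3) (s * ip mu3 (g i) (g i) + m * q / 6)%:E)%E).
  by apply: lee_sum => i _; exact: step.
rewrite sumEFin lee_fin big_split/= -mulr_sumr -/G sumr_const card_ord.
by rewrite lerD2l -mulr_natr; lra.
Qed.

End Form_bound_truncated.

Section Form_bound.
Variable R : realType.
Local Notation sp := (space3 R).
Local Notation mu3 := (@lebesgue3 R).

Lemma ball_bounded_fin (f : sp -> R) (r M : R) : measurable_fun setT f -> 0 <= M ->
  0 <= r -> (forall x, `|f x| <= M) -> (forall x, r < enorm x -> f x = 0) ->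
  mu3.-integrable setT (EFin \o f).
Proof.
move=> mf M0 r0 fM f0; apply: (@integrable_bounded_support _ _ _ mu3 (ball3 r) _ M) => //.
- exact: measurable_ball3.
- by apply: le_lt_trans (lebesgue3_ball_le r0) _; rewrite ltry.
- by move=> x xr; apply: f0; rewrite ltNge; apply/negP.
Qed.

(** Restrict to the set [A n] where |x|, |W| and |u| are at most n, so that all quantities are
    finite, and let n grow by monotone convergence. *)
Lemma form_bound : exists2 C : R, 0 < C & forall W u g K, measurable_fun setT W ->
  0 < K -> katob W K -> H1r u g ->
  (\int[mu3]_x (`|W x| * u x ^+ 2)%:E <= (C * K * \sum_i ip mu3 (g i) (g i))%:E)%E.
Proof.
have [c c0 energy] := int_kn_mul_bounded R.
exists (24 * c / kk_mass (0 : R) ^+ 2).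
  by rewrite divr_gt0 ?exprn_gt0 ?kk_mass_gt0// mulr_gt0.
move=> W u g K mW K0 WK H; have [[mu_ _] _] := H.
have mW' := measurable_abs3 mW; have mu' := measurable_abs3 mu_.
pose A (n : nat) : set sp := [set x | [&& enorm x <= n%:R, `|W x| <= n%:R & `|u x| <= n%:R]].
have mb n : measurable_fun setT (fun x : sp => [&& enorm x <= n%:R, `|W x| <= n%:R & `|u x| <= n%:R]).
  apply: measurable_and; first exact: (measurable_fun_ler (@measurable_enorm R) (measurable_cst _)).
  by apply: measurable_and; [exact: (measurable_fun_ler mW' (measurable_cst _))|exact: (measurable_fun_ler mu' (measurable_cst _))].
have mA n : measurable (A n).
  have -> : A n = setT `&` (fun x : sp => [&& enorm x <= n%:R, `|W x| <= n%:R & `|u x| <= n%:R]) @^-1` [set true].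
    by rewrite setTI.
  exact: mb.
pose t n x : R := if [&& enorm x <= n%:R, `|W x| <= n%:R & `|u x| <= n%:R] then u x else 0.
have mt n : measurable_fun setT (t n).
  by apply: measurable_fun_ifT; [exact: mb|exact: mu_|exact: measurable_cst].
have t0 n x : n%:R < enorm x -> t n x = 0.
  by move=> nx; rewrite /t leNgt nx.
have tW n x : `|W x| * `|t n x| <= n%:R ^+ 2.
  rewrite /t; case: ifP => [/and3P[_ a b]|_]; last by rewrite normr0 mulr0 sqr_ge0.
  by rewrite expr2 ler_pM.
have tW2 n x : `|W x| * t n x ^+ 2 <= n%:R ^+ 3.
  rewrite /t; case: ifP => [/and3P[_ a b]|_]; last by rewrite expr0n mulr0 exprn_ge0.
  rewrite -[u x ^+ 2]real_normK ?num_real// (exprS n%:R 2).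
  by apply: ler_pM; rewrite ?sqr_ge0// lerXn2r ?nnegrE.
have lt n : L2r mu3 (fun x => `|W x| * `|t n x|).
  have m1 : measurable_fun setT (fun x : sp => `|W x| * `|t n x|).
    by apply: measurable_funM; [exact: mW'|exact: measurable_abs3].
  split; first exact: m1.
  have h : mu3.-integrable setT (EFin \o (fun x : sp => (`|W x| * `|t n x|) ^+ 2)).
    apply: (@ball_bounded_fin _ n%:R ((n%:R ^+ 2) ^+ 2)); rewrite ?exprn_ge0//.
    - exact: measurable_funX.
    - move=> x; rewrite ger0_norm ?sqr_ge0// lerXn2r ?nnegrE ?mulr_ge0 ?sqr_ge0//.
    - by move=> x /t0 ->; rewrite normr0 mulr0 expr0n.
  have := integrable_fin_num measurableT h; rewrite ge0_fin_numE//.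
  by apply: integral_ge0 => x _; rewrite lee_fin sqr_ge0.
have it n : mu3.-integrable setT (EFin \o (fun x : sp => `|W x| * t n x ^+ 2)).
  apply: (@ball_bounded_fin _ n%:R (n%:R ^+ 3)); rewrite ?exprn_ge0//.
  - by apply: measurable_funM; [exact: mW'|apply: measurable_funX; exact: mt].
  - by move=> x; rewrite ger0_norm ?tW2// mulr_ge0 ?sqr_ge0.
  - by move=> x /t0 ->; rewrite expr0n mulr0.
have step n : (\int[mu3]_(x in A n) (`|W x| * u x ^+ 2)%:E <=
   (24 * c / kk_mass 0 ^+ 2 * K * (\sum_i ip mu3 (g i) (g i)))%:E)%E.
  have -> : (\int[mu3]_(x in A n) (`|W x| * u x ^+ 2)%:E = \int[mu3]_x (`|W x| * t n x ^+ 2)%:E)%E.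
    rewrite integral_mkcond; apply: eq_integral => x _; rewrite /patch /t.
    case: ifPn => [|]; rewrite ?inE /A/=; first by move=> ->.
    by rewrite notin_setE/= => /negP/negbTE ->; rewrite expr0n mulr0.
  have fin := integrable_fin_num measurableT (it n).
  rewrite -(fineK fin) lee_fin.
  apply: (form_bound_truncated c0 energy K0 WK mW (mt n) (lt n) _ (esym (fineK fin)) H).
  move=> x; rewrite /t; case: ifP => _; last by rewrite normr0 mul0r expr0n.
  by rewrite -expr2 real_normK ?num_real.
have mq : measurable_fun setT (fun x : sp => (`|W x| * u x ^+ 2)%:E).
  by apply/measurable_EFinP; apply: measurable_funM; [exact: mW'|exact: measurable_funX].
have ndA : nondecreasing_seq A.
  move=> n m nm; apply/subsetPset => x /and3P[a b d]; have nm' : n%:R <= m%:R :> R by rewrite ler_nat.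
  by apply/and3P; split; apply: le_trans nm'.
have AT : \bigcup_i A i = setT.
  apply/seteqP; split=> // x _; pose M := Num.max (enorm x) (Num.max `|W x| `|u x|).
  have [n nM] : exists n : nat, M <= n%:R.
    by exists (Num.trunc M).+1; apply: ltW; rewrite truncnS_gt.
  have : (M <= n%:R) by []; rewrite !ge_max => h; by exists n.
rewrite -AT; have h0 i x : A i x -> (0 <= (`|W x| * u x ^+ 2)%:E)%E.
  by rewrite lee_fin mulr_ge0 ?sqr_ge0.
have mcvg := fun F f => @ge0_nondecreasing_set_cvg_integral _ _ _ F f mu3.
have cvg := mcvg _ _ ndA mA (fun i => measurable_funTS mq) h0.
apply: (cvge_le _ cvg).
by apply: nearW => n; exact: step.
Qed.

End Form_bound.

(** * The weak Schroedinger equation for real functions *)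

Section Weak_equation.
Variable R : realType.
Local Notation sp := (space3 R).
Local Notation mu3 := (@lebesgue3 R).

(** The way membership in [kato0] is used: phi is a test function close to V, and W is the
    remainder. *)
Lemma kato_split (V : sp -> R) (eta : R) : kato0 V -> 0 < eta ->
  exists phi W : sp -> R, [/\ measurable_fun setT phi, measurable_fun setT W,
    katob W eta, forall x, V x = phi x + W x & exists M rho : R,
    [/\ 0 < M, 0 < rho, forall x, `|phi x| <= M & forall x, rho < enorm x -> phi x = 0]].
Proof.
move=> [mV hV] eta0; have [phi tphi pe] := hV _ eta0.
have [_ cp _ [rho rho0 p0]] := test_function_bounded tphi.
have [M M0 hM] := continuous_bounded_support cp p0.
have mp := continuous_measurable3 cp.
exists phi, (fun x => V x - phi x); split.
- exact: mp.
- by apply: measurable_funB; [exact: mV|exact: mp].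
- by apply: kato_norm_katob; apply: ltW.
- by move=> x; rewrite addrC subrK.
- exists (M + 1), (rho + 1); split; [lra|lra| |].
    by move=> x; apply: le_trans (hM x) _; lra.
  by move=> x rx; apply: p0; lra.
Qed.

Lemma L2r_ae (u u' : sp -> R) : measurable_fun setT u' ->
  {ae mu3, forall x, u x = u' x} -> L2r mu3 u -> L2r mu3 u'.
Proof.
move=> mu' uu' [mu_ fu]; split; first exact: mu'.
apply: le_lt_trans fu; apply: int3_le_ae.
- by apply/measurable_EFinP; apply: measurable_funX; exact: mu'.
- by apply/measurable_EFinP; apply: measurable_funX; exact: mu_.
- by move=> x; rewrite lee_fin sqr_ge0.
- by move=> x; rewrite lee_fin sqr_ge0.
- case: uu' => N [mN N0 sN]; exists N; split=> // x /= h; apply: sN => /= h'.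
  by apply: h; rewrite h'.
Qed.

Lemma L2r_bounded_support (f : sp -> R) (r M : R) : measurable_fun setT f -> 0 <= M ->
  0 <= r -> (forall x, `|f x| <= M) -> (forall x, r < enorm x -> f x = 0) -> L2r mu3 f.
Proof.
move=> mf M0 r0 fM f0; split => //.
have h : mu3.-integrable setT (EFin \o (fun x : sp => f x ^+ 2)).
  apply: (@ball_bounded_fin _ _ r (M ^+ 2)); rewrite ?sqr_ge0//.
  - by apply: measurable_funX; exact: mf.
  - by move=> x; rewrite normrX lerXn2r ?nnegrE.
  - by move=> x /f0 ->; rewrite expr0n.
have := integrable_fin_num measurableT h; rewrite ge0_fin_numE//.
by apply: integral_ge0 => x _; rewrite lee_fin sqr_ge0.
Qed.

Lemma test_L2r (phi : sp -> R) i : test_function phi ->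
  L2r mu3 phi /\ L2r mu3 (partial i phi).
Proof.
move=> tphi; have [_ cp cp' [rho rho0 p0]] := test_function_bounded tphi.
have p0' := @partial_eq0_far _ i _ _ p0.
have [M M0 hM] := continuous_bounded_support cp p0.
have [M' M'0 hM'] := continuous_bounded_support (cp' i) p0'.
split; first exact: (L2r_bounded_support (continuous_measurable3 cp) M0 rho0 hM p0).
exact: (L2r_bounded_support (continuous_measurable3 (cp' i)) M'0 rho0 hM' p0').
Qed.

Lemma H1r_L2 (u : sp -> R) g : H1r u g -> L2r mu3 u. Proof. by case. Qed.
Lemma H1r_L2g (u : sp -> R) g i : H1r u g -> L2r mu3 (g i).
Proof. by move=> [_ /(_ i)[]]. Qed.

Lemma H1rD (u v : sp -> R) g h : H1r u g -> H1r v h ->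
  H1r (fun x => u x + v x) (fun i x => g i x + h i x).
Proof.
move=> [lu Hu] [lv Hv]; split; first exact: L2rD.
move=> i; have [lg wg] := Hu i; have [lh wh] := Hv i; split; first exact: L2rD.
move=> phi tphi; have [lp lp'] := test_L2r i tphi.
have E1 := ipDl lu lv lp'; have E2 := ipDl lg lh lp.
apply: (etrans E1); apply: (etrans _ (esym (congr1 -%R E2))).
by rewrite opprD; congr (_ + _); [exact: wg|exact: wh].
Qed.

Lemma H1rZ c (u : sp -> R) g : H1r u g -> H1r (fun x => c * u x) (fun i x => c * g i x).
Proof.
move=> [lu Hu]; split; first exact: L2rZ.
move=> i; have [lg wg] := Hu i; split; first exact: L2rZ.
move=> phi tphi; have [lp lp'] := test_L2r i tphi.
have E1 := ipZl c lu lp'; have E2 := ipZl c lg lp.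
apply: (etrans E1); apply: (etrans _ (esym (congr1 -%R E2))).
by rewrite -mulrN; congr (_ * _); exact: wg.
Qed.

Lemma H1r0 : H1r (fun=> 0 : R) (fun _ : 'I_3 => fun=> 0).
Proof.
split; first exact: L2r0.
move=> i; split; first exact: L2r0.
move=> phi _; rewrite -[RHS]mulN1r /Rintegral.
under eq_integral do rewrite mul0r.
by under [in RHS]eq_integral do rewrite mul0r; rewrite integral0 /= mulr0.
Qed.

Lemma H1r_ae (u u' : sp -> R) g : measurable_fun setT u' ->
  {ae mu3, forall x, u x = u' x} -> H1r u g -> H1r u' g.
Proof.
move=> mu' uu' [lu Hu]; split; first exact: (L2r_ae mu' uu').
move=> i; have [lg wg] := Hu i; split => // phi tphi.
have [_ [mp' _]] := test_L2r i tphi; have [mu_ _] := lu.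
rewrite -(wg phi tphi); apply: esym.
exact: (ip_ae mu_ mu' mp' uu').
Qed.

Variable V : sp -> R.
Hypothesis kV : kato0 V.

Lemma int_V_sqr (u : sp -> R) g : H1r u g ->
  (\int[mu3]_x (`|V x| * u x ^+ 2)%:E < +oo)%E.
Proof.
move=> H; have [phi [W [mp mW kW VE [M [rho [M0 _ pM _]]]]]] := kato_split kV ltr01.
have [C C0 /(_ W u g 1 mW ltr01 kW H) hC] := form_bound R.
have [mu_ fu] := H1r_L2 H; have [mV _] := kV.
have mu2 : measurable_fun setT (fun x : sp => u x ^+ 2) by exact: measurable_funX.
have m1 : measurable_fun setT (fun x : sp => (u x ^+ 2)%:E) by apply/measurable_EFinP; exact: mu2.
have m2 : measurable_fun setT (fun x : sp => (`|W x| * u x ^+ 2)%:E).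
  by apply/measurable_EFinP; apply: measurable_funM; [exact: measurable_abs3|exact: mu2].
have M0' : (0 <= M%:E)%E by rewrite lee_fin ltW.
have u20 x : (0 <= (u x ^+ 2)%:E)%E by rewrite lee_fin sqr_ge0.
have m3 : measurable_fun setT (fun x : sp => M%:E * (u x ^+ 2)%:E)%E.
  by apply: emeasurable_funM; [exact: measurable_cst|exact: m1].
have w0 x : (0 <= (`|W x| * u x ^+ 2)%:E)%E by rewrite lee_fin mulr_ge0 ?sqr_ge0.
apply: (@le_lt_trans _ _ (\int[mu3]_x (M%:E * (u x ^+ 2)%:E + (`|W x| * u x ^+ 2)%:E))%E).
  apply: int3_le; first exact: measurableT.
  - by apply/measurable_EFinP; apply: measurable_funM; [apply: measurable_abs3; exact: mV|exact: mu2].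
  - by apply: emeasurable_funD; [exact: m3|exact: m2].
  - by move=> x; rewrite lee_fin mulr_ge0 ?sqr_ge0.
  - move=> x _; rewrite -EFinM -EFinD lee_fin -mulrDl ler_wpM2r ?sqr_ge0// VE.
    by apply: le_trans (ler_normD _ _) _; rewrite lerD2r.
rewrite (int3D measurableT m3 m2 (fun x => mule_ge0 M0' (u20 x)) w0).
rewrite (int3Z measurableT m1 u20 M0').
apply: lte_add_pinfty; first exact: lte_mul_pinfty.
by apply: le_lt_trans hC _; rewrite ltry.
Qed.

Lemma integrable_V (u p : sp -> R) g dp : H1r u g -> H1r p dp ->
  mu3.-integrable setT (EFin \o (fun x => V x * u x * p x)).
Proof.
move=> Hu Hp; have := int_V_sqr Hu; have := int_V_sqr Hp.
have [mu_ _] := H1r_L2 Hu; have [mp _] := H1r_L2 Hp; have [mV _] := kV.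
have mV' : measurable_fun setT (fun x : sp => `|V x|) by apply: measurable_abs3; exact: mV.
have m1 : measurable_fun setT (fun x : sp => `|V x| * u x ^+ 2).
  by apply: measurable_funM; [exact: mV'|apply: measurable_funX; exact: mu_].
have m2 : measurable_fun setT (fun x : sp => `|V x| * p x ^+ 2).
  by apply: measurable_funM; [exact: mV'|apply: measurable_funX; exact: mp].
move=> ip_ iu_; apply: (@integrable_of_le _ _ _ mu3 (fun x => V x * u x * p x) (fun x => `|V x| * u x ^+ 2 + `|V x| * p x ^+ 2)).
- by apply: measurable_funM; [apply: measurable_funM; [exact: mV|exact: mu_]|exact: mp].
- move=> x; rewrite -mulrDr -mulrA normrM ler_wpM2l// normrM.
  rewrite -[u x ^+ 2]real_normK ?num_real// -[p x ^+ 2]real_normK ?num_real//.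
  by move: `|u x| `|p x| => a b; have := sqr_ge0 (a - b); have := sqr_ge0 (a + b); lra.
- by apply: measurable_funD; [exact: m1|exact: m2].
under eq_integral do rewrite EFinD.
have e1 : measurable_fun setT (fun x : sp => (`|V x| * u x ^+ 2)%:E) by apply/measurable_EFinP; exact: m1.
have e2 : measurable_fun setT (fun x : sp => (`|V x| * p x ^+ 2)%:E) by apply/measurable_EFinP; exact: m2.
have n1 x : (0 <= (`|V x| * u x ^+ 2)%:E)%E by rewrite lee_fin mulr_ge0 ?sqr_ge0.
have n2 x : (0 <= (`|V x| * p x ^+ 2)%:E)%E by rewrite lee_fin mulr_ge0 ?sqr_ge0.
by rewrite (int3D measurableT e1 e2 n1 n2); exact: lte_add_pinfty.
Qed.

(** Weak form of -Delta u + V u = F, with g the weak gradient of u. A general F rather than a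
    multiple of u keeps the relation linear, so that eigenfunctions of different energies can be
    combined. *)
Definition weq (u : sp -> R) (g : 'I_3 -> sp -> R) (F : sp -> R) :=
  [/\ H1r u g, L2r mu3 F & forall p dp, H1r p dp ->
    \sum_i ip mu3 (g i) (dp i) + \int[mu3]_x (V x * u x * p x) = ip mu3 F p].

Lemma weqD u g F u' g' F' : weq u g F -> weq u' g' F' ->
  weq (fun x => u x + u' x) (fun i x => g i x + g' i x) (fun x => F x + F' x).
Proof.
move=> [H lF h] [H' lF' h']; split; [exact: H1rD|exact: L2rD|].
move=> p dp Hp; have lp := H1r_L2 Hp.
have E : \int[mu3]_x (V x * (u x + u' x) * p x) =
    \int[mu3]_x (V x * u x * p x) + \int[mu3]_x (V x * u' x * p x).
  rewrite -RintegralD//; [|exact: (integrable_V H Hp)|exact: (integrable_V H' Hp)].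
  by apply: eq_Rintegral => x _; ring.
rewrite E (ipDl lF lF' lp) -(h _ _ Hp) -(h' _ _ Hp).
under eq_bigr => i _ do rewrite (ipDl (H1r_L2g i H) (H1r_L2g i H') (H1r_L2g i Hp)).
by rewrite big_split/=; ring.
Qed.

Lemma weqZ c u g F : weq u g F ->
  weq (fun x => c * u x) (fun i x => c * g i x) (fun x => c * F x).
Proof.
move=> [H lF h]; split; [exact: H1rZ|exact: L2rZ|].
move=> p dp Hp; have lp := H1r_L2 Hp.
have E : \int[mu3]_x (V x * (c * u x) * p x) = c * \int[mu3]_x (V x * u x * p x).
  rewrite -RintegralZl//; last exact: (integrable_V H Hp).
  by apply: eq_Rintegral => x _; ring.
rewrite E (ipZl _ lF lp) -(h _ _ Hp) mulrDr mulr_sumr; congr (_ + _).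
by apply: eq_bigr => i _; rewrite (ipZl _ (H1r_L2g i H) (H1r_L2g i Hp)).
Qed.

Lemma weq0 : weq (fun=> 0) (fun _ => fun=> 0) (fun=> 0).
Proof.
have [H h] : H1r (fun=> 0 : R) (fun _ : 'I_3 => fun=> 0) /\ L2r mu3 (fun=> 0) by split; [exact: H1r0|exact: L2r0].
split=> // p dp Hp.
have ip0 f : ip mu3 (fun=> 0) f = 0.
  by rewrite /ip /Rintegral; under eq_integral do rewrite mul0r; rewrite integral0.
rewrite big1 ?ip0 ?add0r//.
by rewrite /Rintegral; under eq_integral do rewrite mulr0 mul0r; rewrite integral0.
Qed.

Lemma weq_eq u u' g g' F F' : (forall x, u' x = u x) -> (forall i x, g' i x = g i x) ->
  (forall x, F' x = F x) -> weq u g F -> weq u' g' F'.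
Proof.
move=> /funext -> gg' /funext ->; suff -> : g' = g by [].
by apply/funext => i; apply/funext.
Qed.

Lemma weq_sum (I : Type) (s : seq I) (c : I -> R) u g F :
  (forall k, weq (u k) (g k) (F k)) ->
  weq (fun x => \sum_(k <- s) c k * u k x) (fun i x => \sum_(k <- s) c k * g k i x)
    (fun x => \sum_(k <- s) c k * F k x).
Proof.
move=> h; elim: s => [|k s IH].
  apply: weq_eq weq0 => [x|i x|x]; by rewrite big_nil.
apply: weq_eq (weqD (weqZ (c k) (h k)) IH) => [x|i x|x]; by rewrite big_cons.
Qed.

Lemma weq_ae u u' g F F' : measurable_fun setT u' -> measurable_fun setT F' ->
  {ae mu3, forall x, u x = u' x} -> {ae mu3, forall x, F x = F' x} ->
  weq u g F -> weq u' g F'.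
Proof.
move=> mu' mF' uu' FF' [H lF h]; have H' := H1r_ae mu' uu' H.
split; [exact: H'|exact: (L2r_ae mF' FF')|].
move=> p dp Hp; have [mp _] := H1r_L2 Hp; have [mF _] := lF.
rewrite -(ip_ae mF mF' mp FF') -(h _ _ Hp); congr (_ + _).
have [mu_ _] := H1r_L2 H; have [mV _] := kV.
have m1 : measurable_fun setT (fun x : sp => V x * p x) by apply: measurable_funM; [exact: mV|exact: mp].
have E (w : sp -> R) : \int[mu3]_x (V x * w x * p x) = ip mu3 w (fun x => V x * p x).
  by apply: eq_Rintegral => x _; ring.
rewrite !E; apply: esym.
exact: (ip_ae mu_ mu' m1 uu').
Qed.

End Weak_equation.

(** * From integrated to almost everywhere inequalities *)

Section Almost_everywhere.
Variable R : realType.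
Local Notation sp := (space3 R).
Local Notation mu3 := (@lebesgue3 R).

Lemma ae_imp (P Q : sp -> Prop) : (forall x, P x -> Q x) ->
  {ae mu3, forall x, P x} -> {ae mu3, forall x, Q x}.
Proof.
move=> PQ [N [mN N0 sN]]; exists N; split=> // x /= h; apply: sN => /= h'.
by apply: h; exact: PQ.
Qed.

Lemma ae_imp2 (P P' Q : sp -> Prop) : (forall x, P x -> P' x -> Q x) ->
  {ae mu3, forall x, P x} -> {ae mu3, forall x, P' x} -> {ae mu3, forall x, Q x}.
Proof.
move=> PQ [N [mN N0 sN]] [N' [mN' N0' sN']].
exists (N `|` N'); split; first exact: measurableU.
  have : (mu3 (N `|` N') <= mu3 N + mu3 N')%E by exact: measureU2.
  move: N0 N0'; rewrite /= => -> ->; rewrite adde0 => h.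
  by apply/le_anti; rewrite h measure_ge0.
move=> x /= h; apply: contrapT => /not_orP[xN xN'].
by apply: h; apply: PQ; apply: contrapT => h'; [apply: xN; apply: sN|apply: xN'; apply: sN'].
Qed.

Lemma ae_eq0_of_int (f : sp -> R) : measurable_fun setT f -> (forall x, 0 <= f x) ->
  (\int[mu3]_x (f x)%:E = 0)%E -> {ae mu3, forall x, f x = 0}.
Proof.
move=> mf f0 h; have mf' : measurable_fun setT (EFin \o f) by apply/measurable_EFinP; exact: mf.
have H := @ae_eq_integral_abs _ _ _ mu3 setT measurableT _ mf'.
have : ae_eq mu3 setT (EFin \o f) (cst 0%E).
  apply/H; rewrite -h; apply: eq_integral => x _.
  by rewrite gee0_abs ?lee_fin.
by apply: ae_imp => x /= /(_ I)[].
Qed.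

(** Test with the indicator of the set where |x| <= n, u <= n and u exceeds T by at least 1/(n+1).
    It must be null, and these sets exhaust the set where T < u. *)
Lemma ae_le_of_int (u : sp -> R) (T : sp -> \bar R) : measurable_fun setT u ->
  measurable_fun setT T -> (forall x, 0 <= u x) -> (forall x, 0 <= T x)%E ->
  (forall f : sp -> R, L2r mu3 f -> (forall x, 0 <= f x) ->
     (\int[mu3]_x (f x * u x)%:E <= \int[mu3]_x ((f x)%:E * T x))%E) ->
  {ae mu3, forall x, ((u x)%:E <= T x)%E}.
Proof.
move=> mu_ mT u0 T0 H.
have muE : measurable_fun setT (fun x : sp => (u x)%:E) by apply/measurable_EFinP; exact: mu_.
pose d (n : nat) : R := n.+1%:R^-1.
have d0 n : 0 < d n by rewrite invr_gt0 ltr0n.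
pose b n (x : sp) : bool := [&& enorm x <= n%:R, u x <= n%:R & (T x + (d n)%:E <= (u x)%:E)%E].
have mb n : measurable_fun setT (b n).
  apply: measurable_and; first exact: (measurable_fun_ler (@measurable_enorm R) (measurable_cst _)).
  apply: measurable_and; first exact: (measurable_fun_ler mu_ (measurable_cst _)).
  apply: measurable_fun_lee; last exact: muE.
  by apply: emeasurable_funD; [exact: mT|exact: measurable_cst].
pose f n (x : sp) : R := if b n x then 1 else 0.
have mf n : measurable_fun setT (f n).
  by apply: measurable_fun_ifT; [exact: mb|exact: measurable_cst|exact: measurable_cst].
have f01 n x : 0 <= f n x <= 1 by rewrite /f; case: ifP; rewrite ?lexx ler01.
have f0 n x : 0 <= f n x by case/andP: (f01 n x).
have fa n x : `|f n x| <= 1 by rewrite ger0_norm; case/andP: (f01 n x).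
have fs n x : n%:R < enorm x -> f n x = 0 by move=> nx; rewrite /f /b leNgt nx.
have lf n : L2r mu3 (f n).
  exact: (@L2r_bounded_support _ (f n) n%:R 1 (mf n) ler01 (ler0n _ n) (fa n) (fs n)).
have key n : {ae mu3, forall x, f n x = 0}.
  apply: (ae_eq0_of_int (mf n) (f0 n)).
  have fin1 : mu3.-integrable setT (EFin \o (fun x : sp => f n x * u x)).
    apply: (@ball_bounded_fin _ _ n%:R n%:R) => //.
    - by apply: measurable_funM; [exact: mf|exact: mu_].
    - move=> x; rewrite /f /b; case: ifP => [/and3P[_ h _]|_]; first by rewrite mul1r ger0_norm.
      by rewrite mul0r normr0.
    - by move=> x /fs ->; rewrite mul0r.
  have fin := integrable_fin_num measurableT fin1.
  have mfE : measurable_fun setT (fun x : sp => (f n x)%:E) by apply/measurable_EFinP; exact: mf.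
  have f0E x : (0 <= (f n x)%:E)%E by rewrite lee_fin.
  have mfT : measurable_fun setT (fun x : sp => (f n x)%:E * T x)%E.
    by apply: emeasurable_funM; [exact: mfE|exact: mT].
  have mfd : measurable_fun setT (fun x : sp => (d n)%:E * (f n x)%:E)%E.
    by apply: emeasurable_funM; [exact: measurable_cst|exact: mfE].
  have d0E : (0 <= (d n)%:E)%E by rewrite lee_fin ltW.
  (* Together with the hypothesis [H] at [f n], whose left side is finite, this forces the integral
     of [f n] to vanish. *)
  have : (\int[mu3]_x ((f n x)%:E * T x) + (d n)%:E * \int[mu3]_x (f n x)%:E <=
      \int[mu3]_x (f n x * u x)%:E)%E.
    rewrite -(int3Z measurableT mfE f0E d0E).
    rewrite -(int3D measurableT mfT mfd (fun x => mule_ge0 (f0E x) (T0 x)) (fun x => mule_ge0 d0E (f0E x))).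
    apply: int3_le; first exact: measurableT.
    - by apply: emeasurable_funD; [exact: mfT|exact: mfd].
    - by apply/measurable_EFinP; apply: measurable_funM; [exact: mf|exact: mu_].
    - by move=> x; rewrite adde_ge0// mule_ge0.
    - move=> x _; rewrite /f; case: ifP => [/and3P[_ _ h]|_].
        by rewrite mul1e mule1 mul1r.
      by rewrite mul0e mule0 mul0r adde0.
  have := H (f n) (lf n) (f0 n).
  have I0 : (0 <= \int[mu3]_x (f n x)%:E)%E by apply: integral_ge0.
  have J0 : (0 <= \int[mu3]_x ((f n x)%:E * T x))%E by apply: integral_ge0 => x _; rewrite mule_ge0.
  rewrite /= -(fineK fin).
  move: (fine _) (\int[mu3]_x ((f n x)%:E * T x))%E J0 I0 => a J J0.
  have := d0 n; move: (d n) (\int[mu3]_x (f n x)%:E)%E => dd [I|//|//] dd0 I0; last first.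
    move=> _; rewrite gt0_muley ?lte_fin//; case: J J0 => //=.
  move=> aJ h; have : (0 <= J < +oo)%E.
    rewrite J0; apply: le_lt_trans (ltry a); apply: le_trans h.
    by rewrite leeDl// mule_ge0// lee_fin ltW.
  case: J J0 aJ h => [J|//|//] J0 aJ h _; move: aJ h I0.
  rewrite -EFinM -EFinD !lee_fin => aJ h I0; congr EFin.
  apply/le_anti; rewrite I0 andbT -(ler_pM2l dd0) mulr0; lra.
have := ae_foralln key; apply: ae_imp => x fx; rewrite leNgt; apply/negP => Tu.
have Tfin : T x \is a fin_num by rewrite ge0_fin_numE// (lt_trans Tu)// ltry.
have Tu' : fine (T x) < u x by rewrite -lte_fin fineK.
pose m := Num.max (enorm x) (Num.max (u x) (u x - fine (T x))^-1).
have [n hn] : exists n : nat, m <= n%:R.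
  by exists (Num.trunc m).+1; apply: ltW; rewrite truncnS_gt.
have := fx n; rewrite /f /b; move: hn; rewrite /m !ge_max => /and3P[-> -> h] /=.
suff -> : (T x + (d n)%:E <= (u x)%:E)%E by move/eqP; rewrite oner_eq0.
rewrite -(fineK Tfin) -EFinD lee_fin addrC -lerBrDr.
have p0 : 0 < u x - fine (T x) by rewrite subr_gt0.
rewrite -[leRHS]invrK lef_pV2 ?posrE ?invr_gt0 ?ltr0n//.
by apply: le_trans h _; rewrite ler_nat.
Qed.

End Almost_everywhere.

(** * The Yukawa operator and its weight *)

Section Yukawa_operator.
Variable R : realType.
Local Notation sp := (space3 R).
Local Notation mu3 := (@lebesgue3 R).
Variable mu : R.
Hypothesis mu0 : 0 < mu.

(** The Yukawa potential, 4 pi times the kernel of (-Delta + mu^2)^{-1}. *)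
Definition gg (x : sp) : R := expR (- (mu * enorm x)) / enorm x.

Lemma gg_ge0 x : 0 <= gg x.
Proof. by rewrite divr_ge0 ?expR_ge0 ?enorm_ge0. Qed.

Lemma measurable_exp_enorm : measurable_fun setT (fun x : sp => expR (- (mu * enorm x))).
Proof.
apply: measurableT_comp; first exact: measurable_expR.
apply: measurableT_comp; first exact: oppr_measurable.
by apply: measurable_funM; [exact: measurable_cst|exact: measurable_enorm].
Qed.

Lemma measurable_gg : measurable_fun setT gg.
Proof.
apply: measurable_funM; first exact: measurable_exp_enorm.
by apply: measurable_funV; exact: measurable_enorm.
Qed.

Lemma exp_enorm_le1 (x : sp) : expR (- (mu * enorm x)) <= 1.
Proof. by rewrite -expR0 ler_expR oppr_le0 mulr_ge0 ?enorm_ge0 ?ltW. Qed.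

Lemma gg_le x : gg x <= (enorm x)^-1.
Proof. by rewrite /gg -[leRHS]mul1r ler_wpM2r ?invr_ge0 ?enorm_ge0// exp_enorm_le1. Qed.

Lemma FF_le_gg e (y x : sp) : 0 < e -> x != y -> FF mu e y x <= gg (x - y).
Proof.
move=> e0 xy; have d0 : 0 < enorm (x - y) by rewrite enorm_gt0// subr_eq0.
have dr := enorm_le_rr e (x - y).
apply: ler_pM; rewrite ?expR_ge0 ?invr_ge0 ?rr_ge0//.
  by rewrite ler_expR lerN2 ler_pM2l.
by rewrite lef_pV2 ?posrE// rr_gt0.
Qed.

Definition tt (f : sp -> R) (y : sp) : \bar R := (\int[mu3]_x (f x * gg (x - y))%:E)%E.

Lemma measurable_tt2 (f : sp -> R) : measurable_fun setT f ->
  measurable_fun setT (fun p : sp * sp => (f p.1 * gg (p.1 - p.2))%:E).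
Proof.
move=> mf; apply/measurable_EFinP; apply: measurable_funM; first exact: measurable_fun1.
by apply: measurable_funB2; exact: measurable_gg.
Qed.

Lemma measurable_tt1 (f : sp -> R) y : measurable_fun setT f ->
  measurable_fun setT (fun x : sp => (f x * gg (x - y))%:E).
Proof. by move=> mf; exact: (@measurable_slice2 _ (fun x y => (f x * gg (x - y))%:E) y (measurable_tt2 mf)). Qed.

Lemma tt_ge0 f y : (forall x, 0 <= f x) -> (0 <= tt f y)%E.
Proof. by move=> f0; apply: integral_ge0 => x _; rewrite lee_fin mulr_ge0 ?gg_ge0. Qed.

Lemma measurable_tt (f : sp -> R) : measurable_fun setT f -> (forall x, 0 <= f x) ->
  measurable_fun setT (tt f).
Proof.
move=> mf f0; apply: (@measurable_int2 _ (fun x y => (f x * gg (x - y))%:E) (measurable_tt2 mf)) => x y.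
by rewrite lee_fin mulr_ge0 ?gg_ge0.
Qed.

Lemma tt_le (f h : sp -> R) y : measurable_fun setT f -> measurable_fun setT h ->
  (forall x, 0 <= f x) -> (forall x, f x <= h x) -> (tt f y <= tt h y)%E.
Proof.
move=> mf mh f0 fh; apply: int3_le; first exact: measurableT.
- exact: measurable_tt1.
- exact: measurable_tt1.
- by move=> x; rewrite lee_fin mulr_ge0 ?gg_ge0.
- by move=> x _; rewrite lee_fin ler_wpM2r ?gg_ge0.
Qed.

Lemma ttD (f h : sp -> R) y : measurable_fun setT f -> measurable_fun setT h ->
  (forall x, 0 <= f x) -> (forall x, 0 <= h x) ->
  (tt (fun x => f x + h x)%R y = tt f y + tt h y)%E.
Proof.
move=> mf mh f0 h0.
have p0 (k : sp -> R) x : (forall x, 0 <= k x) -> (0 <= (k x * gg (x - y))%:E)%E.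
  by move=> k0; rewrite lee_fin mulr_ge0 ?gg_ge0.
rewrite /tt -(int3D measurableT (measurable_tt1 y mf) (measurable_tt1 y mh) (p0 f ^~ f0) (p0 h ^~ h0)).
by apply: eq_integral => x _; rewrite -EFinD mulrDl.
Qed.

Lemma ttZ (c : R) (f : sp -> R) y : measurable_fun setT f -> (forall x, 0 <= f x) -> 0 <= c ->
  (tt (fun x => c * f x)%R y = c%:E * tt f y)%E.
Proof.
move=> mf f0 c0.
have p0 x : (0 <= (f x * gg (x - y))%:E)%E by rewrite lee_fin mulr_ge0 ?gg_ge0.
have c0' : (0 <= c%:E)%E by [].
rewrite /tt -(int3Z measurableT (measurable_tt1 y mf) p0 c0').
by apply: eq_integral => x _; rewrite -EFinM -(mulrA c).
Qed.

Lemma tt_ae0 (f : sp -> R) y : measurable_fun setT f -> (forall x, 0 <= f x) ->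
  {ae mu3, forall x, f x = 0} -> tt f y = 0%E.
Proof.
move=> mf f0 fz; apply/le_anti; rewrite tt_ge0// andbT -(integral0 mu3 setT).
apply: int3_le_ae.
- exact: measurable_tt1.
- exact: measurable_cst.
- by move=> x; rewrite lee_fin mulr_ge0 ?gg_ge0.
- by [].
- by move: fz; apply: ae_imp => x ->; rewrite mul0r.
Qed.

(** The decay of the Yukawa potential without its singularity; [tt] reproduces this weight up to a
    Kato norm. *)
Definition ww (x : sp) : R := expR (- (mu * enorm x)) / (1 + enorm x).

Lemma enorm1_gt0 (x : sp) : 0 < 1 + enorm x.
Proof. by rewrite ltr_pwDl// enorm_ge0. Qed.

Lemma ww_gt0 x : 0 < ww x.
Proof. by rewrite divr_gt0 ?expR_gt0 ?enorm1_gt0. Qed.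

Lemma ww_le1 x : ww x <= 1.
Proof.
rewrite ler_pdivrMr ?enorm1_gt0// mul1r (le_trans (exp_enorm_le1 x))//.
by rewrite lerDl enorm_ge0.
Qed.

Lemma measurable_ww : measurable_fun setT ww.
Proof.
apply: measurable_funM; first exact: measurable_exp_enorm.
apply: measurable_funV; apply: measurable_funD; first exact: measurable_cst.
exact: measurable_enorm.
Qed.

Lemma expD_le (x y : sp) :
  expR (- (mu * enorm (x - y))) * expR (- (mu * enorm x)) <= expR (- (mu * enorm y)).
Proof.
rewrite -expRD ler_expR -opprD lerN2 -mulrDr ler_pM2l//.
by have := enorm_triangle x y 0; rewrite !subr0 (enormB y x).
Qed.

(** The triangle inequality gives e^{-mu|x|} e^{-mu|x-y|} <= e^{-mu|y|}, and 1+|y| <= (1+|x|) +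
    |x-y| bounds the quotient of the denominators by 1/|x-y| + 1/|x|. Each of these two terms costs
    one Kato norm, with poles y and 0. *)
Lemma tt_ww_le (W : sp -> R) (K : R) (y : sp) : measurable_fun setT W -> katob W K ->
  (tt (fun x => `|W x| * ww x)%R y <= (2 * K * ww y)%:E)%E.
Proof.
move=> mW WK; have mW' := measurable_abs3 mW.
have me z : measurable_fun setT (fun x : sp => (`|W x| / enorm (x - z))%:E).
  apply/measurable_EFinP; apply: measurable_funM; first exact: mW'.
  by apply: measurable_funV; exact: (measurable_shift_arg (- z) (@measurable_enorm R)).
have e0 z x : (0 <= (`|W x| / enorm (x - z))%:E)%E by rewrite lee_fin divr_ge0 ?enorm_ge0.
have w0 : (0 <= (ww y)%:E)%E by rewrite lee_fin ltW ?ww_gt0.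
have mS : measurable_fun setT (fun x : sp => (`|W x| / enorm (x - y))%:E + (`|W x| / enorm (x - 0))%:E)%E.
  by apply: emeasurable_funD; exact: me.
have mww : measurable_fun setT (fun x : sp => `|W x| * ww x).
  by apply: measurable_funM; [exact: mW'|exact: measurable_ww].
apply: (@le_trans _ _ (\int[mu3]_x ((ww y)%:E * ((`|W x| / enorm (x - y))%:E + (`|W x| / enorm (x - 0)%R)%:E)))%E).
  apply: (@int3_le_off _ 0).
  - exact: (measurable_tt1 y mww).
  - by apply: emeasurable_funM; [exact: measurable_cst|exact: mS].
  - by move=> x; rewrite lee_fin; apply: mulr_ge0; [apply: mulr_ge0; [|exact: ltW (ww_gt0 _)]|exact: gg_ge0].
  - by move=> x; rewrite mule_ge0// adde_ge0.
  move=> x x0; rewrite -EFinD -EFinM lee_fin subr0.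
  have -> : ww y * (`|W x| / enorm (x - y) + `|W x| / enorm x) =
    `|W x| * (ww y * ((enorm (x - y))^-1 + (enorm x)^-1)) by ring.
  rewrite -(mulrA `|W x|); apply: ler_wpM2l => //.
  have [->|xy] := eqVneq x y.
    rewrite /gg subrr enorm0 invr0 !mulr0 add0r mulr_ge0 ?(ltW (ww_gt0 _))//.
    by rewrite invr_ge0 enorm_ge0.
  have d0 : 0 < enorm (x - y) by rewrite enorm_gt0// subr_eq0.
  have x0' : 0 < enorm x by rewrite enorm_gt0.
  have a0 := enorm1_gt0 x; have b0 := enorm1_gt0 y.
  rewrite /gg /ww; set E := expR (- (mu * enorm (x - y))); set F := expR (- (mu * enorm x)).
  have -> : F / (1 + enorm x) * (E / enorm (x - y)) = (E * F) * ((1 + enorm x) * enorm (x - y))^-1.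
    by field; rewrite !gt_eqF.
  rewrite -[leRHS]mulrA; apply: ler_pM.
  - by rewrite mulr_ge0 ?expR_ge0.
  - by rewrite invr_ge0 mulr_ge0 ?ltW.
  - exact: expD_le.
  rewrite ler_pdivlMl//.
  have h1 : 1 + enorm y <= (1 + enorm x) + enorm (x - y).
    rewrite -addrA lerD2l; have := enorm_triangle x y 0.
    by rewrite !subr0 (enormB y x) addrC.
  apply: (@le_trans _ _ (((1 + enorm x) + enorm (x - y)) * ((1 + enorm x) * enorm (x - y))^-1)).
    by rewrite ler_wpM2r// invr_ge0 mulr_ge0 ?ltW.
  have -> : (1 + enorm x + enorm (x - y)) / ((1 + enorm x) * enorm (x - y)) = (enorm (x - y))^-1 + (1 + enorm x)^-1.
    by field; rewrite !gt_eqF.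
  by rewrite lerD2l lef_pV2 ?posrE// lerDr.
rewrite (int3Z measurableT mS _ w0); last by move=> x; rewrite adde_ge0.
rewrite (int3D measurableT (me y) (me 0) (e0 y) (e0 0)).
rewrite (_ : (2 * K * ww y)%:E = (ww y)%:E * (K%:E + K%:E))%E; last first.
  by rewrite -EFinD -EFinM; congr EFin; ring.
by apply: lee_wpmul2l => //; apply: leeD; exact: WK.
Qed.

(** Within distance 1 of y the kernel contributes at most 64; elsewhere it is at most 1 on a ball of
    volume at most 8 rho^3. *)
Lemma int_ball_kn_shift (rho : R) (y : sp) : 0 < rho ->
  (\int[mu3]_(x in ball3 rho) (kn (x - y))%:E <= (64 + 8 * rho ^+ 3)%:E)%E.
Proof.
move=> rho0.
have mB := @measurable_ball3 R rho; have mB1 := @measurable_ball3 R 1.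
pose k1 (x : sp) : R := if enorm x <= 1 then kn x else 0.
have mk1 : measurable_fun setT k1.
  apply: measurable_fun_ifT; [|exact: measurable_kn|exact: measurable_cst].
  exact: (measurable_fun_ler (@measurable_enorm R) (measurable_cst _)).
have mk1y : measurable_fun setT (fun x : sp => (k1 (x - y))%:E).
  by apply/measurable_EFinP; exact: (measurable_shift_arg (- y) mk1).
have k10 x : (0 <= (k1 (x - y))%:E)%E by rewrite lee_fin /k1; case: ifP => // _; exact: kn_ge0.
have m1 : measurable_fun setT (fun _ : sp => 1%:E : \bar R) by exact: measurable_cst.
apply: (@le_trans _ _ (\int[mu3]_(x in ball3 rho) ((k1 (x - y)%R)%:E + 1%:E))%E).
  apply: int3_le => //.
  - by apply/measurable_EFinP; exact: (measurable_shift_arg (- y) (@measurable_kn R)).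
  - by apply: emeasurable_funD; [exact: mk1y|exact: m1].
  - by move=> x; rewrite lee_fin kn_ge0.
  - move=> x _; rewrite -EFinD lee_fin /k1; case: ifPn => [_|]; first by rewrite lerDl.
    rewrite -ltNge => h; rewrite add0r; apply: le_trans (kn_le ltr01 h) _.
    by rewrite expr1n invr1.
rewrite (int3D mB mk1y m1 k10) ?lee_fin//; rewrite EFinD; apply: leeD.
  apply: (@le_trans _ _ (\int[mu3]_x (k1 (x - y)%R)%:E)%E).
    by apply: ge0_subset_integral.
  rewrite (@integral_shift _ (- y) (fun x => (k1 x)%:E)); last by apply/measurable_EFinP; exact: mk1.
  have -> : (\int[mu3]_x (k1 x)%:E = \int[mu3]_(x in ball3 1) (kn x)%:E)%E.
    rewrite [RHS]integral_mkcond; apply: eq_integral => x _; rewrite /patch /k1.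
    case: ifPn => [h|/negP h]; first by rewrite mem_set.
    by rewrite memNset.
  by rewrite -[X in (X%:E)%E]mulr1; exact: int_ball_inv2.
rewrite integral_cst// mul1e; exact: lebesgue3_ball_le (ltW rho0).
Qed.

(** For |x| <= rho the factor e^{-mu|x-y|} is at most e^{mu rho} e^{-mu|y|} and 1+|y| <=
    1+rho+|x-y|. It remains to bound the integral of |u| (1 + rho + |x-y|)/|x-y| over the ball
    uniformly in y; Young's inequality splits it into u^2, 1 and |x-y|^{-2}. *)
Lemma tt_bounded_support_le (phi u : sp -> R) (M rho : R) :
  measurable_fun setT phi -> 0 < M -> 0 < rho -> (forall x, `|phi x| <= M) ->
  (forall x, rho < enorm x -> phi x = 0) -> L2r mu3 u ->
  exists2 C, 0 <= C & forall y, (tt (fun x => `|phi x| * `|u x|)%R y <= (C * ww y)%:E)%E.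
Proof.
move=> mphi M0 rho0 phiM phi0 lu; have [mu_ _] := lu.
have mB := @measurable_ball3 R rho.
pose A := ip mu3 u u; have A0 : 0 <= A by exact: ip_ge0.
pose c := expR (mu * rho) * M.
have c0 : 0 <= c by rewrite mulr_ge0 ?expR_ge0 ?ltW.
exists (c * (A + 8 * rho ^+ 3 + (1 + rho) * (A + (64 + 8 * rho ^+ 3)))).
  have r3 : 0 <= 8 * rho ^+ 3 by rewrite mulr_ge0 ?exprn_ge0 ?ltW.
  have r1 : 0 <= 1 + rho by lra.
  by rewrite mulr_ge0// !addr_ge0// mulr_ge0// !addr_ge0.
move=> y.
have w0 := ww_gt0 y.
pose h (x : sp) : R := u x ^+ 2 + 1 + (1 + rho) * (u x ^+ 2 + kn (x - y)).
have mu2 : measurable_fun setT (fun x : sp => u x ^+ 2) by apply: measurable_funX; exact: mu_.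
have mkn : measurable_fun setT (fun x : sp => kn (x - y)).
  exact: (measurable_shift_arg (- y) (@measurable_kn R)).
have r10 : 0 <= 1 + rho by lra.
have me : measurable_fun setT (fun x : sp => (u x ^+ 2)%:E) by apply/measurable_EFinP; exact: mu2.
have mke : measurable_fun setT (fun x : sp => (kn (x - y))%:E) by apply/measurable_EFinP; exact: mkn.
have m1 : measurable_fun setT (fun _ : sp => 1%:E : \bar R) by exact: measurable_cst.
have u20 x : (0 <= (u x ^+ 2)%:E)%E by rewrite lee_fin sqr_ge0.
have kn0 x : (0 <= (kn (x - y))%:E)%E by rewrite lee_fin kn_ge0.
have h0 x : (0 <= (h x)%:E)%E.
  rewrite lee_fin; have a := sqr_ge0 (u x); have b := kn_ge0 (x - y).
  by apply: addr_ge0; [exact: addr_ge0|apply: mulr_ge0 => //; exact: addr_ge0].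
have mh : measurable_fun setT (fun x : sp => (h x)%:E).
  apply/measurable_EFinP; apply: measurable_funD.
    by apply: measurable_funD; [exact: mu2|exact: measurable_cst].
  apply: measurable_funM; first exact: measurable_cst.
  by apply: measurable_funD; [exact: mu2|exact: mkn].
have mphiu : measurable_fun setT (fun x : sp => `|phi x| * `|u x|).
  by apply: measurable_funM; apply: measurable_abs3; [exact: mphi|exact: mu_].
have cw0 : (0 <= (c * ww y)%:E)%E by rewrite lee_fin (mulr_ge0 c0 (ltW w0)).
apply: (@le_trans _ _ (\int[mu3]_(x in ball3 rho) ((c * ww y)%:E * (h x)%:E))%E).
  rewrite /tt (int3_split mB (measurable_tt1 y mphiu)); last first.
    by move=> x; rewrite lee_fin mulr_ge0 ?gg_ge0// mulr_ge0.
  rewrite [X in (_ + X)%E](_ : _ = 0%E) ?adde0; last first.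
    rewrite (eq_integral (cst 0%E)) ?integral0// => x; rewrite inE /= => xr.
    by rewrite phi0 ?normr0 ?mul0r// ltNge; apply/negP.
  apply: int3_le => //.
  - exact: (measurable_tt1 y mphiu).
  - by apply: emeasurable_funM; [exact: measurable_cst|exact: mh].
  - by move=> x; rewrite lee_fin mulr_ge0 ?gg_ge0// mulr_ge0.
  move=> x xr; rewrite -EFinM lee_fin.
  have [->|xy] := eqVneq x y.
    rewrite /gg subrr enorm0 invr0 !mulr0; apply: mulr_ge0; first exact: (mulr_ge0 c0 (ltW w0)).
    by have := h0 y; rewrite lee_fin.
  have d0 : 0 < enorm (x - y) by rewrite enorm_gt0// subr_eq0.
  set d := enorm (x - y) in d0.
  have b0 := enorm1_gt0 y.
  have e1 : expR (- (mu * d)) <= expR (mu * rho) * expR (- (mu * enorm y)).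
    rewrite -expRD ler_expR -mulrN -mulrN -mulrDr ler_pM2l//.
    have := enorm_triangle x y 0; rewrite !subr0 (enormB y x) -/d => tri.
    have : enorm x <= rho by [].
    lra.
  have e2 : 1 + enorm y <= 1 + rho + d.
    have := enorm_triangle x y 0; rewrite !subr0 (enormB y x) -/d => tri.
    have : enorm x <= rho by [].
    lra.
  have -> : c * ww y * h x = M * (expR (mu * rho) * expR (- (mu * enorm y))) * (h x / (1 + enorm y)).
    by rewrite /c /ww; field; rewrite gt_eqF.
  have -> : `|phi x| * `|u x| * gg (x - y) = `|phi x| * expR (- (mu * d)) * (`|u x| / d).
    by rewrite /gg -/d; field; rewrite gt_eqF.
  apply: ler_pM; rewrite ?mulr_ge0 ?expR_ge0 ?invr_ge0 ?(ltW d0)//.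
    by apply: ler_pM; rewrite ?expR_ge0.
  rewrite ler_pdivlMr//.
  have kE : kn (x - y) = d^-1 ^+ 2 by rewrite /kn -enorm_sqr exprVn.
  have i0 : 0 < d^-1 by rewrite invr_gt0.
  apply: (@le_trans _ _ (`|u x| / d * (1 + rho + d))).
    by rewrite ler_wpM2l// mulr_ge0// ltW.
  have -> : `|u x| / d * (1 + rho + d) = `|u x| + (1 + rho) * (`|u x| * d^-1).
    by field; rewrite gt_eqF.
  rewrite /h kE -[u x ^+ 2]real_normK ?num_real//.
  move: (`|u x|) (d^-1) => a b; apply: lerD; first by have := sqr_ge0 (a - 2^-1); lra.
  apply: ler_wpM2l => //; have := sqr_ge0 (a - b); have := sqr_ge0 (a + b); lra.
rewrite (int3Z mB mh h0 cw0).
have -> (B : R) : c * B * ww y = c * ww y * B by ring.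
rewrite [leRHS]EFinM; apply: lee_wpmul2l => //.
have uA : (\int[mu3]_(x in ball3 rho) (u x ^+ 2)%:E <= A%:E)%E.
  rewrite /A -(ipE lu); by apply: ge0_subset_integral.
rewrite /h.
have r1E : (0 <= (1 + rho)%:E)%E by [].
have mD : measurable_fun setT (fun x : sp => (u x ^+ 2)%:E + (kn (x - y))%:E)%E.
  by apply: emeasurable_funD; [exact: me|exact: mke].
have D0 x : (0 <= (u x ^+ 2)%:E + (kn (x - y))%:E)%E by rewrite adde_ge0.
have mD1 : measurable_fun setT (fun x : sp => (u x ^+ 2)%:E + 1%:E)%E.
  by apply: emeasurable_funD; [exact: me|exact: m1].
have D10 x : (0 <= (u x ^+ 2)%:E + 1%:E)%E by rewrite adde_ge0.
have mD2 : measurable_fun setT (fun x : sp => (1 + rho)%:E * ((u x ^+ 2)%:E + (kn (x - y))%:E))%E.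
  by apply: emeasurable_funM; [exact: measurable_cst|exact: mD].
have -> : (\int[mu3]_(x in ball3 rho) (u x ^+ 2 + 1 + (1 + rho) * (u x ^+ 2 + kn (x - y)))%:E =
  \int[mu3]_(x in ball3 rho) ((u x ^+ 2)%:E + 1%:E + (1 + rho)%:E * ((u x ^+ 2)%:E + (kn (x - y)%R)%:E)))%E.
  by apply: eq_integral.
rewrite (int3D mB mD1 mD2 D10 (fun x => mule_ge0 r1E (D0 x))) (int3Z mB mD D0 r1E).
rewrite (int3D mB me mke u20 kn0) (int3D mB me m1 u20 (fun=> lee01)).
rewrite !EFinD EFinM; apply: leeD.
  apply: leeD => //; rewrite integral_cst// mul1e; exact: lebesgue3_ball_le (ltW rho0).
rewrite -EFinD EFinM; apply: lee_wpmul2l => //; rewrite EFinD.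
by apply: leeD => //; exact: int_ball_kn_shift.
Qed.

End Yukawa_operator.

(** * Exponential decay of eigenfunctions *)

Section Eigenfunction_decay.
Variable R : realType.
Local Notation sp := (space3 R).
Local Notation mu3 := (@lebesgue3 R).
Variable V : sp -> R.
Hypothesis kV : kato0 V.

Definition eigr (lam : R) (u : sp -> R) := exists g, weq V u g (fun x => lam * u x).

Variables (mu : R).
Hypothesis mu0 : 0 < mu.

(** Testing the weak equation with [FF mu e y] cancels the mu^2 term of [smear_H1] and leaves minus
    the integral of V u [FF]; and [FF] is at most [gg] for every e. *)
Lemma smear_eig_le e u y : 0 < e -> eigr (- mu ^+ 2) u ->
  (`|smear mu e u y|%:E <= tt mu (fun x => `|V x| * `|u x|)%R y)%E.
Proof.
move=> e0 [g [H lF h]]; have lu := H1r_L2 H; have [mu_ _] := lu; have [mV _] := kV.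
have lFF := L2r_FF e0 y mu0.
have E : smear mu e u y = - \int[mu3]_x (V x * u x * FF mu e y x).
  rewrite (smear_H1 e0 (ltW mu0) y H mu0).
  have := h _ _ (H1r_FF e0 (ltW mu0) y mu0); rewrite (ipZl _ lu lFF) => h'.
  by apply/eqP; rewrite -subr_eq0 opprK addrAC; apply/eqP; rewrite h'; ring.
rewrite E normrN.
have mF : measurable_fun setT (fun x : sp => V x * u x * FF mu e y x).
  apply: measurable_funM; first by apply: measurable_funM; [exact: mV|exact: mu_].
  by case: lFF.
apply: le_trans (abs_Rintegral_le mF) _.
have mVu : measurable_fun setT (fun x : sp => `|V x| * `|u x|).
  by apply: measurable_funM; apply: measurable_abs3; [exact: mV|exact: mu_].
apply: (@int3_le_off _ y).
- by apply/measurable_EFinP; apply: measurable_abs3; exact: mF.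
- exact: (measurable_tt1 mu y mVu).
- by move=> x; rewrite lee_fin.
- by move=> x; rewrite lee_fin mulr_ge0 ?gg_ge0// mulr_ge0.
- move=> x xy; rewrite lee_fin (normrM (V x * u x)) (normrM (V x)) (ger0_norm (FF_ge0 mu e y x)).
  by rewrite ler_wpM2l ?mulr_ge0// FF_le_gg.
Qed.

Lemma eig_le_tt u : eigr (- mu ^+ 2) u ->
  {ae mu3, forall x, ((kk_mass mu * `|u x|)%:E <= tt mu (fun x => `|V x| * `|u x|)%R x)%E}.
Proof.
move=> hu; have [g [H lF h]] := hu; have lu := H1r_L2 H; have [mu_ _] := lu; have [mV _] := kV.
have mVu : measurable_fun setT (fun x : sp => `|V x| * `|u x|).
  by apply: measurable_funM; apply: measurable_abs3; [exact: mV|exact: mu_].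
have Vu0 x : 0 <= `|V x| * `|u x| by rewrite mulr_ge0.
have mT := measurable_tt mu mVu Vu0.
have c0 := kk_mass_gt0 mu.
apply: ae_le_of_int.
- by apply: measurable_funM; [exact: measurable_cst|apply: measurable_abs3; exact: mu_].
- exact: mT.
- by move=> x; exact: (mulr_ge0 (ltW c0) (normr_ge0 _)).
- by move=> x; exact: tt_ge0.
move=> f lf f0; have [mf _] := lf.
have mfu : measurable_fun setT (fun x : sp => (f x * `|u x|)%:E).
  by apply/measurable_EFinP; apply: measurable_funM; [exact: mf|apply: measurable_abs3; exact: mu_].
have fu0 x : (0 <= (f x * `|u x|)%:E)%E by rewrite lee_fin mulr_ge0.
have c0E : (0 <= (kk_mass mu)%:E)%E by rewrite lee_fin ltW.
rewrite (_ : (\int[mu3]_x (f x * (kk_mass mu * `|u x|))%:E = (kk_mass mu)%:E * \int[mu3]_x (`|f x| * `|u x|)%:E)%E); last first.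
  rewrite (_ : (\int[mu3]_x (`|f x| * `|u x|)%:E = \int[mu3]_x (f x * `|u x|)%:E)%E); last first.
    by apply: eq_integral => x _; rewrite (ger0_norm (f0 x)).
  rewrite -(int3Z measurableT mfu fu0 c0E).
  by apply: eq_integral => x _; rewrite -EFinM; congr EFin; ring.
apply/lee_addgt0Pr => eta eta0.
have [e /andP[e0 _] /(_ e)] := approximate_identity (ltW mu0) lf lu eta0.
rewrite e0 lexx => /(_ isT) /le_trans; apply; apply: leeD => //.
apply: int3_le; first exact: measurableT.
- apply/measurable_EFinP; apply: measurable_funM; apply: measurable_abs3; first exact: mf.
  by apply: measurable_smear; exact: mu_.
- by apply: emeasurable_funM; [apply/measurable_EFinP; exact: mf|exact: mT].
- by move=> x; rewrite lee_fin mulr_ge0.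
- move=> x _; rewrite EFinM (ger0_norm (f0 x)); apply: lee_wpmul2l; first by rewrite lee_fin.
  exact: smear_eig_le.
Qed.

(** Since [gg] is at most 1/|x|, this is the energy estimated in [riesz_energy]. *)
Lemma tt_energy_le (W m : sp -> R) (K : R) : measurable_fun setT W ->
  measurable_fun setT m -> 0 <= K -> katob W K ->
  (\int[mu3]_y ((`|W y| * `|m y|)%:E * tt mu (fun x => `|W x| * `|m x|)%R y) <=
    (2 * K)%:E * \int[mu3]_y (`|W y| * m y ^+ 2)%:E)%E.
Proof.
move=> mW mm K0 WK; have := riesz_energy mW mm K0 WK; apply: le_trans.
have mWm : measurable_fun setT (fun x : sp => `|W x| * `|m x|).
  by apply: measurable_funM; apply: measurable_abs3; [exact: mW|exact: mm].
have Wm0 x : 0 <= `|W x| * `|m x| by rewrite mulr_ge0.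
have mf : measurable_fun setT (fun p : sp * sp =>
    (`|W p.1| * `|m p.1| * (`|W p.2| * `|m p.2|) / enorm (p.1 - p.2))%:E).
  apply/measurable_EFinP; apply: measurable_funM.
    by apply: measurable_funM; [exact: (measurable_fun1 mWm)|exact: (measurable_fun2 mWm)].
  by apply: measurable_funV; apply: measurable_funB2; exact: measurable_enorm.
have f0 y z : (0 <= (`|W y| * `|m y| * (`|W z| * `|m z|) / enorm (y - z))%:E)%E.
  by rewrite lee_fin divr_ge0 ?enorm_ge0// mulr_ge0.
apply: int3_le; first exact: measurableT.
- apply: emeasurable_funM; first by apply/measurable_EFinP; exact: mWm.
  exact: measurable_tt.
- exact: (@measurable_int1 _ (fun y z => (`|W y| * `|m y| * (`|W z| * `|m z|) / enorm (y - z))%:E) mf f0).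
- by move=> y; apply: mule_ge0; [rewrite lee_fin|exact: tt_ge0].
move=> y _.
have p0 x : (0 <= (`|W x| * `|m x| * gg mu (x - y))%:E)%E by rewrite lee_fin mulr_ge0 ?gg_ge0.
have wy0 : (0 <= (`|W y| * `|m y|)%:E)%E by rewrite lee_fin.
rewrite -(int3Z measurableT (measurable_tt1 mu y mWm) p0 wy0).
apply: int3_le; first exact: measurableT.
- apply: emeasurable_funM; first exact: measurable_cst.
  exact: (measurable_tt1 mu y mWm).
- exact: (@measurable_slice1 _ (fun y z => (`|W y| * `|m y| * (`|W z| * `|m z|) / enorm (y - z))%:E) y mf).
- by move=> x; exact: mule_ge0.
- move=> x _; rewrite -EFinM lee_fin [leLHS]mulrA enormB.
  by apply: ler_wpM2l; [exact: mulr_ge0|exact: gg_le].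
Qed.

(** The part m of |u| exceeding K [ww] satisfies c m <= tt(|W| m). Pairing with |W| m gives c q <=
    (c/2) q for a finite q, so |W| m = 0 almost everywhere, and then the inequality itself gives m =
    0. *)
Theorem eigenfunction_decay u : eigr (- mu ^+ 2) u ->
  exists2 K, 0 <= K & {ae mu3, forall x, `|u x| <= K * ww mu x}.
Proof.
move=> hu; have [g [H lF h]] := hu; have lu := H1r_L2 H; have [mu_ _] := lu; have [mV _] := kV.
set c := kk_mass mu; have c0 : 0 < c by exact: kk_mass_gt0.
have k0 : 0 < c / 4 by rewrite divr_gt0.
have [phi [W [mphi mW kW VE [M [rho [M0 rho0 phiM phi0]]]]]] := kato_split kV k0.
have [C C0 hC] := tt_bounded_support_le mu0 mphi M0 rho0 phiM phi0 lu.
(* K solves C + 2 (c/4) K = c K, so that the contributions of phi and of W times K [ww] add up to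
   exactly c K [ww]. *)
pose K := 2 * C / c; have K0 : 0 <= K by rewrite divr_ge0 ?mulr_ge0// ltW.
exists K => //.
have w0 x : 0 <= K * ww mu x by rewrite mulr_ge0// ltW ?ww_gt0.
pose m (x : sp) : R := if `|u x| <= K * ww mu x then 0 else `|u x| - K * ww mu x.
have mau := measurable_abs3 mu_.
have mKw : measurable_fun setT (fun x : sp => K * ww mu x).
  by apply: measurable_funM; [exact: measurable_cst|exact: measurable_ww].
have mm : measurable_fun setT m.
  apply: measurable_fun_ifT; first exact: (measurable_fun_ler mau mKw).
    exact: measurable_cst.
  by apply: measurable_funB; [exact: mau|exact: mKw].
have m0 x : 0 <= m x by rewrite /m; case: (leP `|u x| (K * ww mu x)) => // h'; rewrite subr_ge0 ltW.
have mle x : m x <= `|u x| by rewrite /m; case: (leP `|u x| (K * ww mu x)) => // h'; rewrite lerBlDr lerDl.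
have um x : `|u x| <= K * ww mu x + m x by rewrite /m; case: (leP `|u x| (K * ww mu x)) => // h'; [rewrite addr0|rewrite addrC subrK].
have mWm : measurable_fun setT (fun x : sp => `|W x| * `|m x|).
  by apply: measurable_funM; apply: measurable_abs3; [exact: mW|exact: mm].
have Wm0 x : 0 <= `|W x| * `|m x| by rewrite mulr_ge0.
have mWw : measurable_fun setT (fun x : sp => `|W x| * ww mu x).
  by apply: measurable_funM; [apply: measurable_abs3; exact: mW|exact: measurable_ww].
have Ww0 x : 0 <= `|W x| * ww mu x by rewrite mulr_ge0// ltW ?ww_gt0.
have mpu : measurable_fun setT (fun x : sp => `|phi x| * `|u x|).
  by apply: measurable_funM; [apply: measurable_abs3; exact: mphi|exact: mau].
have pu0 x : 0 <= `|phi x| * `|u x| by rewrite mulr_ge0.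
have mKWw : measurable_fun setT (fun x : sp => K * (`|W x| * ww mu x)).
  by apply: measurable_funM; [exact: measurable_cst|exact: mWw].
have KWw0 x : 0 <= K * (`|W x| * ww mu x) by rewrite mulr_ge0.
have mVu : measurable_fun setT (fun x : sp => `|V x| * `|u x|).
  by apply: measurable_funM; [apply: measurable_abs3; exact: mV|exact: mau].
have mWu : measurable_fun setT (fun x : sp => K * (`|W x| * ww mu x) + `|W x| * `|m x|).
  by apply: measurable_funD; [exact: mKWw|exact: mWm].
have Wu0 x : 0 <= K * (`|W x| * ww mu x) + `|W x| * `|m x| by rewrite addr_ge0.
have TV y : (tt mu (fun x => `|V x| * `|u x|)%R y <=
    (c * (K * ww mu y))%:E + tt mu (fun x => `|W x| * `|m x|)%R y)%E.
  apply: (@le_trans _ _ (tt mu (fun x => `|phi x| * `|u x| + (K * (`|W x| * ww mu x) + `|W x| * `|m x|))%R y)).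
    apply: tt_le => //.
    - by apply: measurable_funD; [exact: mpu|exact: mWu].
    move=> x; rewrite VE; apply: (@le_trans _ _ ((`|phi x| + `|W x|) * `|u x|)).
      by rewrite ler_wpM2r// ler_normD.
    rewrite mulrDl lerD2l (ger0_norm (m0 x)) (mulrCA K) -mulrDr ler_wpM2l//.
  rewrite (ttD mu y mpu mWu pu0 Wu0) (ttD mu y mKWw mWm KWw0 Wm0) (ttZ mu y mWw Ww0 K0) addeA.
  apply: leeD => //.
  have -> : (c * (K * ww mu y))%:E = ((C * ww mu y)%:E + K%:E * (2 * (c / 4) * ww mu y)%:E)%E.
    by rewrite -EFinM -EFinD; congr EFin; rewrite /K; field; rewrite gt_eqF.
  apply: leeD; first exact: hC.
  by apply: lee_wpmul2l => //; exact: tt_ww_le.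
have key : {ae mu3, forall x, ((c * m x)%:E <= tt mu (fun x => `|W x| * `|m x|)%R x)%E}.
  have := eig_le_tt hu; apply: ae_imp => y hy.
  have := le_trans hy (TV y); have := tt_ge0 mu y Wm0.
  case: (tt mu _ y) => [t|_ _|//]; last by rewrite leey.
  rewrite -EFinD !lee_fin => t0 h'; rewrite /m; case: (leP `|u y| (K * ww mu y)) => // _; first by rewrite mulr0.
  by rewrite mulrBr lerBlDl.
(* Finiteness from the form bound, as m <= |u|; without it c q <= (c/2) q would not give q = 0. *)
have fin : (\int[mu3]_y (`|W y| * m y ^+ 2)%:E < +oo)%E.
  have [C' C'0 /(_ W u g _ mW k0 kW H) hC'] := form_bound R.
  apply: le_lt_trans (le_lt_trans hC' (ltry _)).
  apply: int3_le; first exact: measurableT.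
  - apply/measurable_EFinP; apply: measurable_funM; first by apply: measurable_abs3; exact: mW.
    by apply: measurable_funX; exact: mm.
  - apply/measurable_EFinP; apply: measurable_funM; first by apply: measurable_abs3; exact: mW.
    by apply: measurable_funX; exact: mu_.
  - by move=> x; rewrite lee_fin mulr_ge0 ?sqr_ge0.
  - move=> x _; rewrite lee_fin ler_wpM2l// -[leRHS]real_normK ?num_real//.
    by rewrite lerXn2r ?nnegrE.
have mq : measurable_fun setT (fun x : sp => `|W x| * m x ^+ 2).
  by apply: measurable_funM; [apply: measurable_abs3; exact: mW|apply: measurable_funX; exact: mm].
have q0 x : 0 <= `|W x| * m x ^+ 2 by rewrite mulr_ge0 ?sqr_ge0.
have mqE : measurable_fun setT (fun x : sp => (`|W x| * m x ^+ 2)%:E) by apply/measurable_EFinP; exact: mq.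
have q0E x : (0 <= (`|W x| * m x ^+ 2)%:E)%E by rewrite lee_fin.
have c0E : (0 <= c%:E)%E by rewrite lee_fin ltW.
have Iq : (c%:E * \int[mu3]_y (`|W y| * m y ^+ 2)%:E <=
    (2 * (c / 4))%:E * \int[mu3]_y (`|W y| * m y ^+ 2)%:E)%E.
  apply: le_trans (tt_energy_le mW mm (ltW k0) kW).
  rewrite -(int3Z measurableT mqE q0E c0E).
  apply: int3_le_ae.
  - by apply: emeasurable_funM; [exact: measurable_cst|exact: mqE].
  - apply: emeasurable_funM; first by apply/measurable_EFinP; exact: mWm.
    exact: measurable_tt.
  - by move=> x; exact: mule_ge0.
  - by move=> x; apply: mule_ge0; [rewrite lee_fin|exact: tt_ge0].
  move: key; apply: ae_imp => x hx.
  rewrite (_ : (c%:E * (`|W x| * m x ^+ 2)%:E)%E = ((`|W x| * `|m x|)%:E * (c * m x)%:E)%E).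
    by apply: lee_wpmul2l => //; rewrite lee_fin.
  by rewrite -!EFinM (ger0_norm (m0 x)); congr EFin; ring.
have q_0 : (\int[mu3]_y (`|W y| * m y ^+ 2)%:E = 0)%E.
  have : (0 <= \int[mu3]_y (`|W y| * m y ^+ 2)%:E)%E by apply: integral_ge0.
  move: fin Iq; case: (\int[mu3]_y _)%E => [q|//|//] _; rewrite -!EFinM !lee_fin => h1 h2.
  congr EFin; apply/le_anti; rewrite h2 andbT -(ler_pM2l c0) mulr0; lra.
have z : {ae mu3, forall x, `|W x| * `|m x| = 0}.
  move: (ae_eq0_of_int mq q0 q_0); apply: ae_imp => x /eqP.
  by rewrite mulf_eq0 sqrf_eq0 => /orP[/eqP -> |/eqP ->]; rewrite ?mul0r// normr0 mulr0.
move: key; apply: ae_imp => x; rewrite (tt_ae0 mu x mWm Wm0 z) lee_fin pmulr_rle0// => mx.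
by apply: le_trans (um x) _; rewrite gerDl.
Qed.

End Eigenfunction_decay.

Lemma ipBr d (T : measurableType d) (R : realType) (mu : {measure set T -> \bar R})
    (h f g : T -> R) : L2r mu h -> L2r mu f -> L2r mu g ->
  ip mu h (fun x => f x - g x) = ip mu h f - ip mu h g.
Proof. by move=> lh lf lg; rewrite ipC ipBl// (ipC _ h f) (ipC _ h g). Qed.

(** * Comparison of the mu = 0 kernels at two scales *)

Section Finiteness.
Variable R : realType.
Local Notation sp := (space3 R).
Local Notation mu3 := (@lebesgue3 R).

(** For n = |x| and a, b the regularized distances at two scales: drop b^{-3} for the near bound.
    For the far bound factor a^{-3} - b^{-3} and use 1/a - 1/b <= e^2/a^3. *)
Lemma inv_cube_diff_le (a b n e : R) : 0 < n -> n <= a -> a <= b -> b ^+ 2 - a ^+ 2 <= e ^+ 2 ->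
  n * (a^-1 ^+ 3 - b^-1 ^+ 3) <= (n ^+ 2)^-1 /\
  n * (a^-1 ^+ 3 - b^-1 ^+ 3) <= 3 * e ^+ 2 * (n ^+ 2 ^+ 2)^-1.
Proof.
move=> n0 na ab be; have a0 : 0 < a by lra. have b0 : 0 < b by lra.
have v0 : 0 < n^-1 by rewrite invr_gt0.
have al : a^-1 <= n^-1 by rewrite lef_pV2.
have bl : b^-1 <= a^-1 by rewrite lef_pV2.
have ai : 0 < a^-1 by rewrite invr_gt0.
have bi : 0 < b^-1 by rewrite invr_gt0.
have d : a^-1 - b^-1 <= e ^+ 2 * a^-1 ^+ 3.
  have -> : a^-1 - b^-1 = (b ^+ 2 - a ^+ 2) * (a * b * (a + b))^-1.
    by field; rewrite !gt_eqF// addr_gt0.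
  apply: ler_pM => //.
  - by rewrite subr_ge0 lerXn2r ?nnegrE ?(ltW a0) ?(ltW b0).
  - by rewrite invr_ge0 mulr_ge0 ?addr_ge0 ?mulr_ge0 ?(ltW a0) ?(ltW b0).
  rewrite exprVn lef_pV2 ?posrE ?exprn_gt0 ?mulr_gt0 ?addr_gt0// exprS expr2 mulrA.
  by apply: ler_pM; rewrite ?mulr_ge0 ?(ltW a0)//; [rewrite ler_wpM2l// (ltW a0)|rewrite lerDl (ltW b0)].
have -> : (n ^+ 2)^-1 = n * n^-1 ^+ 3 by field; rewrite gt_eqF.
have -> : 3 * e ^+ 2 * (n ^+ 2 ^+ 2)^-1 = n * (3 * e ^+ 2 * n^-1 ^+ 5) by field; rewrite gt_eqF.
move: (n^-1) (a^-1) (b^-1) v0 al bl ai bi d => v x y v0 al bl ai bi d.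
have x3 : x ^+ 3 <= v ^+ 3 by rewrite lerXn2r ?nnegrE ?(ltW ai) ?(ltW v0).
split; rewrite ler_pM2l//.
  by have := exprn_gt0 3 bi; lra.
have -> : x ^+ 3 - y ^+ 3 = (x - y) * (x ^+ 2 + x * y + y ^+ 2) by ring.
have s3 : x ^+ 2 + x * y + y ^+ 2 <= 3 * x ^+ 2 by nra.
apply: (@le_trans _ _ ((e ^+ 2 * x ^+ 3) * (3 * x ^+ 2))).
  apply: ler_pM => //; first by rewrite subr_ge0.
  by rewrite !addr_ge0 ?sqr_ge0// mulr_ge0 ?(ltW ai) ?(ltW bi).
have -> : e ^+ 2 * x ^+ 3 * (3 * x ^+ 2) = 3 * e ^+ 2 * x ^+ 5 by ring.
apply: ler_wpM2l; first by rewrite mulr_ge0 ?sqr_ge0.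
by rewrite lerXn2r ?nnegrE ?(ltW ai) ?(ltW v0).
Qed.

(** The bound is independent of the finer scale e', and its integral is at most 6 e^2 times 128/e =
    768 e. *)
Lemma XX0_diff_le (e' e : R) i (y x : sp) : 0 < e' -> e' <= e -> x != y ->
  `|XX 0 e' i y x - XX 0 e i y x| <= 6 * e ^+ 2 * knsplit e (x - y).
Proof.
move=> e'0 e'e xy; have e0 : 0 < e by lra.
set n := enorm (x - y); have n0 : 0 < n by rewrite enorm_gt0// subr_eq0.
have na := enorm_le_rr e' (x - y); rewrite -/n in na.
have ab : rr e' (x - y) <= rr e (x - y).
  by rewrite /rr ler_wsqrtr// lerD2l lerXn2r ?nnegrE ?(ltW e'0) ?(ltW e0).
have be : rr e (x - y) ^+ 2 - rr e' (x - y) ^+ 2 <= e ^+ 2.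
  by rewrite !rr_sqr; have := sqr_ge0 e'; lra.
have [h1 h2] := inv_cube_diff_le n0 na ab be.
have cn : `|co i (x - y)| <= n := co_le_enorm i (x - y).
have h0 : 0 <= (rr e' (x - y))^-1 ^+ 3 - (rr e (x - y))^-1 ^+ 3.
  rewrite subr_ge0 lerXn2r ?nnegrE ?invr_ge0 ?rr_ge0// lef_pV2// ?posrE ?rr_gt0//.
have -> : XX 0 e' i y x - XX 0 e i y x =
    - (co i (x - y) * ((rr e' (x - y))^-1 ^+ 3 - (rr e (x - y))^-1 ^+ 3)).
  by rewrite /XX !mul0r oppr0 expR0; ring.
rewrite normrN normrM (ger0_norm h0).
apply: (@le_trans _ _ (n * ((rr e' (x - y))^-1 ^+ 3 - (rr e (x - y))^-1 ^+ 3))).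
  by rewrite ler_wpM2r.
rewrite /knsplit -/n; case: ifP => _.
  have -> : 6 * e ^+ 2 * ((e ^+ 2)^-1 * kn (x - y)) = 6 * kn (x - y) by field; rewrite gt_eqF.
  by apply: le_trans h1 _; rewrite /kn -enorm_sqr -/n ler_peMl ?invr_ge0 ?sqr_ge0// ler1n.
apply: le_trans h2 _; rewrite -enorm_sqr -/n le_eqVlt; apply/orP; left; apply/eqP.
by field; rewrite gt_eqF.
Qed.

(** Young's convolution inequality in quadratic form: |f(y) g(x)| <= f(y)^2 + g(x)^2, then D is
    integrated in the free variable. *)
Lemma conv_young (f g D : sp -> R) (d : R) : L2r mu3 f -> L2r mu3 g ->
  measurable_fun setT D -> (forall x, 0 <= D x) -> (forall x y, D (x - y) = D (y - x)) ->
  (\int[mu3]_x (D x)%:E <= d%:E)%E ->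
  (\int[mu3]_y \int[mu3]_x (`|f y| * (`|g x| * D (x - y)))%:E <=
    (d * (ip mu3 f f + ip mu3 g g))%:E)%E.
Proof.
move=> lf lg mD D0 DB hd; have [mf _] := lf; have [mg _] := lg.
have mf2 : measurable_fun setT (fun x : sp => f x ^+ 2) by apply: measurable_funX; exact: mf.
have mg2 : measurable_fun setT (fun x : sp => g x ^+ 2) by apply: measurable_funX; exact: mg.
have mD2 : measurable_fun setT (fun p : sp * sp => D (p.2 - p.1)).
  apply: (measurableT_comp mD); apply: measurable_sub; [exact: measurable_snd3|exact: measurable_fst3].
have mDE : measurable_fun setT (fun x : sp => (D x)%:E) by apply/measurable_EFinP; exact: mD.
have D0E x : (0 <= (D x)%:E)%E by rewrite lee_fin.
pose a (y x : sp) : \bar R := (f y ^+ 2 * D (x - y))%:E.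
pose b (y x : sp) : \bar R := (g x ^+ 2 * D (x - y))%:E.
have ma : measurable_fun setT (fun p : sp * sp => a p.1 p.2).
  by apply/measurable_EFinP; apply: measurable_funM; [exact: (measurable_fun1 mf2)|exact: mD2].
have mb : measurable_fun setT (fun p : sp * sp => b p.1 p.2).
  by apply/measurable_EFinP; apply: measurable_funM; [exact: (measurable_fun2 mg2)|exact: mD2].
have a0 y x : (0 <= a y x)%E by rewrite lee_fin mulr_ge0 ?sqr_ge0.
have b0 y x : (0 <= b y x)%E by rewrite lee_fin mulr_ge0 ?sqr_ge0.
have ds y : (\int[mu3]_x (D (x - y)%R)%:E <= d%:E)%E.
  by rewrite (@integral_shift _ (- y) (fun x => (D x)%:E)).
have mDy y : measurable_fun setT (fun x : sp => (D (x - y))%:E).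
  by apply/measurable_EFinP; exact: (measurable_shift_arg (- y) mD).
have d0 : (0 <= d%:E)%E by apply: le_trans hd; apply: integral_ge0.
have step (h : sp -> R) : L2r mu3 h -> measurable_fun setT h ->
    (\int[mu3]_y ((h y ^+ 2)%:E * d%:E) = (d * ip mu3 h h)%:E)%E.
  move=> lh mh; rewrite EFinM -(ipE lh).
  have mh2 : measurable_fun setT (fun x : sp => (h x ^+ 2)%:E).
    by apply/measurable_EFinP; apply: measurable_funX; exact: mh.
  have h20 x : (0 <= (h x ^+ 2)%:E)%E by rewrite lee_fin sqr_ge0.
  by rewrite -(int3Z measurableT mh2 h20 d0); apply: eq_integral => x _; rewrite muleC.
have Ia : (\int[mu3]_y \int[mu3]_x a y x <= (d * ip mu3 f f)%:E)%E.
  rewrite -(step f lf mf); apply: int3_le; first exact: measurableT.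
  - exact: (measurable_int1 ma a0).
  - apply: emeasurable_funM; last exact: measurable_cst.
    by apply/measurable_EFinP; exact: mf2.
  - by move=> y; apply: integral_ge0.
  move=> y _; have q0 : (0 <= (f y ^+ 2)%:E)%E by rewrite lee_fin sqr_ge0.
  have -> : (\int[mu3]_x a y x = (f y ^+ 2)%:E * \int[mu3]_x (D (x - y)%R)%:E)%E.
    by rewrite -(int3Z measurableT (mDy y) (fun x => D0E _) q0).
  exact: lee_wpmul2l.
have Ib : (\int[mu3]_y \int[mu3]_x b y x <= (d * ip mu3 g g)%:E)%E.
  rewrite (tonelli3 mb b0) -(step g lg mg); apply: int3_le; first exact: measurableT.
  - exact: (measurable_int2 mb b0).
  - apply: emeasurable_funM; last exact: measurable_cst.
    by apply/measurable_EFinP; exact: mg2.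
  - by move=> y; apply: integral_ge0.
  move=> x _; have q0 : (0 <= (g x ^+ 2)%:E)%E by rewrite lee_fin sqr_ge0.
  have -> : (\int[mu3]_y b y x = (g x ^+ 2)%:E * \int[mu3]_y (D (y - x)%R)%:E)%E.
    rewrite -(int3Z measurableT (mDy x) (fun y => D0E _) q0).
    by apply: eq_integral => y _; rewrite /b EFinM DB.
  exact: lee_wpmul2l.
have I1 := leeD Ia Ib; rewrite mulrDr EFinD; apply: le_trans I1.
have mi1 : measurable_fun setT (fun y => \int[mu3]_x a y x)%E by exact: (measurable_int1 ma a0).
have mi2 : measurable_fun setT (fun y => \int[mu3]_x b y x)%E by exact: (measurable_int1 mb b0).
have i1 y : (0 <= \int[mu3]_x a y x)%E by apply: integral_ge0.
have i2 y : (0 <= \int[mu3]_x b y x)%E by apply: integral_ge0.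
have ms1 y : measurable_fun setT (a y) by exact: (measurable_slice1 y ma).
have ms2 y : measurable_fun setT (b y) by exact: (measurable_slice1 y mb).
have mF : measurable_fun setT (fun p : sp * sp => (`|f p.1| * (`|g p.2| * D (p.2 - p.1)))%:E).
  apply/measurable_EFinP; apply: measurable_funM; first exact: (measurable_fun1 (measurable_abs3 mf)).
  by apply: measurable_funM; [exact: (measurable_fun2 (measurable_abs3 mg))|exact: mD2].
have F0 y x : (0 <= (`|f y| * (`|g x| * D (x - y)))%:E)%E by rewrite lee_fin !mulr_ge0.
rewrite -(int3D measurableT mi1 mi2 i1 i2).
apply: int3_le; first exact: measurableT.
- exact: (@measurable_int1 _ (fun y x => (`|f y| * (`|g x| * D (x - y)))%:E) mF F0).
- by apply: emeasurable_funD; [exact: mi1|exact: mi2].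
- by move=> y; apply: integral_ge0.
move=> y _; rewrite -(int3D measurableT (ms1 y) (ms2 y) (a0 y) (b0 y)).
apply: int3_le; first exact: measurableT.
- exact: (@measurable_slice1 _ (fun y x => (`|f y| * (`|g x| * D (x - y)))%:E) y mF).
- by apply: emeasurable_funD; [exact: ms1|exact: ms2].
- exact: F0.
move=> x _; rewrite /a /b -EFinD lee_fin mulrA -mulrDl ler_wpM2r//.
rewrite -[f y ^+ 2]real_normK ?num_real// -[g x ^+ 2]real_normK ?num_real//.
by move: (`|f y|) (`|g x|) => p q; have := sqr_ge0 (p - q); have := sqr_ge0 (p + q); lra.
Qed.

Lemma measurable_ip_XX (mu e : R) i (g : sp -> R) : 0 < e -> L2r mu3 g ->
  measurable_fun setT (fun y => ip mu3 g (XX mu e i y)).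
Proof.
move=> e0 [mg _]; apply: (@measurable_Rint2 _ (fun x y => g x * XX mu e i y x)).
by apply: measurable_funM; [apply: measurable_fun1; exact: mg|exact: measurable_XX2].
Qed.

Lemma int_ip_diff_le (e' e : R) i (f g : sp -> R) : 0 < e' -> e' <= e ->
  L2r mu3 f -> L2r mu3 g ->
  (\int[mu3]_y (`|f y| * `|ip mu3 g (XX 0 e' i y) - ip mu3 g (XX 0 e i y)|)%:E <=
    (768 * e * (ip mu3 f f + ip mu3 g g))%:E)%E.
Proof.
move=> e'0 e'e lf lg; have e0 : 0 < e by lra.
have [mf _] := lf; have [mg _] := lg.
pose D x := 6 * e ^+ 2 * knsplit e x.
have e2 : 0 <= 6 * e ^+ 2 by rewrite mulr_ge0 ?sqr_ge0.
have mD : measurable_fun setT D.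
  by apply: measurable_funM; [exact: measurable_cst|exact: measurable_knsplit].
have D0 x : 0 <= D x by apply: mulr_ge0 => //; exact: knsplit_ge0.
have DB (x y : sp) : D (x - y) = D (y - x) by rewrite /D /knsplit enormB knB -!enorm_sqr enormB.
have hd : (\int[mu3]_x (D x)%:E <= (768 * e)%:E)%E.
  have e2E : (0 <= (6 * e ^+ 2)%:E)%E by rewrite lee_fin.
  have mk : measurable_fun setT (fun x : sp => (knsplit e x)%:E).
    by apply/measurable_EFinP; exact: measurable_knsplit.
  have k0 x : (0 <= (knsplit e x)%:E)%E by rewrite lee_fin; exact: knsplit_ge0.
  have -> : (\int[mu3]_x (D x)%:E = (6 * e ^+ 2)%:E * \int[mu3]_x (knsplit e x)%:E)%E.
    by rewrite -(int3Z measurableT mk k0 e2E).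
  apply: le_trans (lee_wpmul2l e2E (int_knsplit e0)) _.
  by rewrite -EFinM lee_fin le_eqVlt; apply/orP; left; apply/eqP; field; rewrite gt_eqF.
apply: le_trans (conv_young lf lg mD D0 DB hd).
have mF : measurable_fun setT (fun p : sp * sp => (`|f p.1| * (`|g p.2| * D (p.2 - p.1)))%:E).
  apply/measurable_EFinP; apply: measurable_funM; first exact: (measurable_fun1 (measurable_abs3 mf)).
  apply: measurable_funM; first exact: (measurable_fun2 (measurable_abs3 mg)).
  by apply: (measurableT_comp mD); apply: measurable_sub; [exact: measurable_snd3|exact: measurable_fst3].
have F0 y x : (0 <= (`|f y| * (`|g x| * D (x - y)))%:E)%E by rewrite lee_fin; apply: mulr_ge0 => //; apply: mulr_ge0.
have e0' : 0 < e' by [].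
apply: int3_le; first exact: measurableT.
- apply/measurable_EFinP; apply: measurable_funM; apply: measurable_abs3; first exact: mf.
  by apply: measurable_funB; exact: measurable_ip_XX.
- exact: (@measurable_int1 _ (fun y x => (`|f y| * (`|g x| * D (x - y)))%:E) mF F0).
- by move=> y; rewrite lee_fin mulr_ge0.
move=> y _.
have lX := L2r_XX e0 (lexx 0) i y; have lX' := L2r_XX e'0 (lexx 0) i y.
have -> : ip mu3 g (XX 0 e' i y) - ip mu3 g (XX 0 e i y) =
    ip mu3 g (fun x => XX 0 e' i y x - XX 0 e i y x) by exact: (esym (ipBr lg lX' lX)).
have mgD : measurable_fun setT (fun x : sp => (`|g x| * D (x - y))%:E).
  apply/measurable_EFinP; apply: measurable_funM; first exact: measurable_abs3.
  exact: (measurable_shift_arg (- y) mD).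
have gD0 x : (0 <= (`|g x| * D (x - y))%:E)%E by rewrite lee_fin; apply: mulr_ge0.
have fy0 : (0 <= `|f y|%:E)%E by rewrite lee_fin.
have -> : (\int[mu3]_x (`|f y| * (`|g x| * D (x - y)))%:E = `|f y|%:E * \int[mu3]_x (`|g x| * D (x - y))%:E)%E.
  by rewrite -(int3Z measurableT mgD gD0 fy0).
rewrite EFinM; apply: lee_wpmul2l => //.
have md : measurable_fun setT (fun x : sp => g x * (XX 0 e' i y x - XX 0 e i y x)).
  by apply: measurable_funM; [exact: mg|apply: measurable_funB; [case: lX'|case: lX]].
apply: le_trans (abs_Rintegral_le md) _.
apply: (@int3_le_off _ y).
- by apply/measurable_EFinP; apply: measurable_abs3; exact: md.
- exact: mgD.
- by move=> x; rewrite lee_fin.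
- exact: gD0.
- by move=> x xy; rewrite lee_fin normrM; apply: ler_wpM2l => //; exact: XX0_diff_le.
Qed.

End Finiteness.

(** * Compactness by finite nets *)

Section Eigenvalue_count.
Variable R : realType.
Local Notation sp := (space3 R).
Local Notation mu3 := (@lebesgue3 R).

Lemma cover1 (rho del : R) : 0 < del -> exists s : seq R,
  forall t, `|t| <= rho -> exists2 x, x \in s & `|t - x| < del.
Proof.
move=> del0; pose n := (Num.trunc (2 * rho / del)).+1.
exists [seq k%:R * del - rho | k <- iota 0 n] => t; rewrite ler_norml => /andP[h1 h2].
have p0 : 0 <= (t + rho) / del by rewrite divr_ge0 ?(ltW del0)//; lra.
have /andP[k1 k2] := truncn_itv p0; set k := Num.trunc _ in k1 k2.
exists (k%:R * del - rho).
  apply: (map_f (fun k : nat => k%:R * del - rho)); rewrite mem_iota add0n /n ltnS; apply: le_truncn.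
  by rewrite ler_wpM2r ?invr_ge0 ?(ltW del0)//; lra.
rewrite ler_pdivlMr// in k1; rewrite ltr_pdivrMr// -natr1 in k2.
rewrite ltr_norml; apply/andP; split; lra.
Qed.

Lemma enorm_le_sum (x : sp) : enorm x <= `|x.1.1| + `|x.1.2| + `|x.2|.
Proof.
have s0 : 0 <= `|x.1.1| + `|x.1.2| + `|x.2| by rewrite !addr_ge0.
rewrite -ler_sqr ?nnegrE ?enorm_ge0// enorm_sqr /n2.
rewrite -[x.1.1 ^+ 2]real_normK ?num_real// -[x.1.2 ^+ 2]real_normK ?num_real//.
rewrite -[x.2 ^+ 2]real_normK ?num_real//.
have a := normr_ge0 x.1.1; have b := normr_ge0 x.1.2; have c := normr_ge0 x.2.
move: (`|x.1.1|) (`|x.1.2|) (`|x.2|) a b c => a b c a0 b0 c0.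
have := mulr_ge0 a0 b0; have := mulr_ge0 a0 c0; have := mulr_ge0 b0 c0.
rewrite -subr_ge0; have -> : (a + b + c) ^+ 2 - (a ^+ 2 + b ^+ 2 + c ^+ 2) = 2 * (a * b) + 2 * (a * c) + 2 * (b * c) by ring.
by move=> h1 h2 h3; lra.
Qed.

Lemma cover3 (rho del : R) : 0 < del -> exists s : seq sp,
  forall y, enorm y <= rho -> exists2 p, p \in s & enorm (y - p) < del.
Proof.
move=> del0; have d3 : 0 < del / 3 by rewrite divr_gt0.
have [s hs] := cover1 rho d3.
exists (allpairs (fun a b => (a, b)) (allpairs (fun a b => (a, b)) s s) s) => y yr.
have [c1 c2 c3] := coord_le_enorm y.
have [a as_ ha] := hs _ (le_trans c1 yr).
have [b bs hb] := hs _ (le_trans c2 yr).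
have [c cs hc] := hs _ (le_trans c3 yr).
exists (a, b, c); first by apply: allpairs_f => //; exact: allpairs_f.
by apply: le_lt_trans (enorm_le_sum _) _; rewrite /=; lra.
Qed.

Lemma XX_shift mu e i (y x : sp) : XX mu e i y x = XX mu e i 0 (x - y).
Proof. by rewrite /XX !subr0. Qed.

Lemma ip_XX_diff_sqr_le e i (g : sp -> R) (y p : sp) (eps : R) : 0 < e -> L2r mu3 g ->
  (\int[mu3]_x ((XX 0 e i 0 (x + (p - y))%R - XX 0 e i 0 x) ^+ 2)%:E <= eps%:E)%E ->
  (ip mu3 g (XX 0 e i y) - ip mu3 g (XX 0 e i p)) ^+ 2 <= eps * ip mu3 g g.
Proof.
move=> e0 lg h; have lX := L2r_XX e0 (lexx 0) i y; have lX' := L2r_XX e0 (lexx 0) i p.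
have -> : ip mu3 g (XX 0 e i y) - ip mu3 g (XX 0 e i p) =
    ip mu3 g (fun x => XX 0 e i y x - XX 0 e i p x) by exact: (esym (ipBr lg lX lX')).
have lD := L2rB lX lX'.
apply: le_trans (ip_cauchy_schwarz lg lD) _; rewrite mulrC ler_wpM2r ?ip_ge0//.
rewrite -lee_fin -(ipE lD); apply: le_trans h.
pose F (x : sp) : \bar R := ((XX 0 e i 0 (x + (p - y))%R - XX 0 e i 0 x) ^+ 2)%:E.
have mX := sm_measurable e0 (sm_XX 0 e i 0).
have mF : measurable_fun setT F.
  apply/measurable_EFinP; apply: measurable_funX; apply: measurable_funB; last exact: mX.
  exact: (measurable_shift_arg (p - y) mX).
rewrite -(integral_shift (- p) mF) le_eqVlt; apply/orP; left; apply/eqP.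
apply: eq_integral => x _; rewrite /F (XX_shift 0 e i y) (XX_shift 0 e i p).
by rewrite addrA subrK.
Qed.

Lemma sqr_sum3_le (a : 'I_3 -> R) : (\sum_i a i) ^+ 2 <= 3 * \sum_i a i ^+ 2.
Proof.
have sumE (F : 'I_3 -> R) : \sum_(i < 3) F i = F 0 + F 1 + F ord_max.
  rewrite !big_ord_recr big_ord0 /= add0r; congr (F _ + F _ + F _); exact/val_inj.
rewrite !sumE; move: (a 0) (a 1) (a ord_max) => x y z; rewrite -subr_ge0.
have -> : 3 * (x ^+ 2 + y ^+ 2 + z ^+ 2) - (x + y + z) ^+ 2 =
  (x - y) ^+ 2 + (y - z) ^+ 2 + (x - z) ^+ 2 by ring.
by rewrite !addr_ge0 ?sqr_ge0.
Qed.

(** A quantitative substitute for Rellich compactness: the kernels depend L^2-continuously on the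
    pole y, so the pairings at all y in a ball are controlled by those at a finite net, assumed to
    vanish. *)
Lemma ip_XX_small (e eps rho : R) : 0 < e -> 0 < eps -> exists s : seq sp,
  forall g : 'I_3 -> sp -> R, (forall i, L2r mu3 (g i)) ->
  (forall p, p \in s -> \sum_i ip mu3 (g i) (XX 0 e i p) = 0) ->
  forall y, enorm y <= rho ->
   (\sum_i ip mu3 (g i) (XX 0 e i y)) ^+ 2 <= eps * \sum_i ip mu3 (g i) (g i).
Proof.
move=> e0 eps0; have eps3 : 0 < eps / 3 by rewrite divr_gt0.
have h i := L2_shift_continuous (L2r_XX e0 (lexx 0) i 0) eps3.
have [del del0 hdel] := fin_all_exists2 h.
pose d := \big[Num.min/1]_i del i.
have d0 : 0 < d by apply: lt_bigmin => //.
have [s hs] := cover3 rho d0; exists s => g lg gs y yr.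
have [p ps yp] := hs y yr.
have -> : \sum_i ip mu3 (g i) (XX 0 e i y) =
    \sum_i (ip mu3 (g i) (XX 0 e i y) - ip mu3 (g i) (XX 0 e i p)).
  by rewrite sumrB (gs p ps) subr0.
apply: le_trans (sqr_sum3_le _) _; rewrite !mulr_sumr; apply: ler_sum => i _.
have H : (ip mu3 (g i) (XX 0 e i y) - ip mu3 (g i) (XX 0 e i p)) ^+ 2 <= eps / 3 * ip mu3 (g i) (g i).
  apply: ip_XX_diff_sqr_le => //; apply: (hdel i).
  rewrite enormB; apply: lt_le_trans yp _.
  by rewrite /d bigmin_le_cond.
rewrite (_ : eps * _ = 3 * (eps / 3 * ip mu3 (g i) (g i))); last by field.
by rewrite ler_wpM2l.
Qed.

(* f is u cut off to a ball carrying the bounded part of the potential, and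
   G, F are the squared norms of the gradient and of f. *)
Lemma local_norm_le (e rho : R) (u : sp -> R) g : 0 < e -> e <= 1 -> 0 < rho ->
  H1r u g ->
  let f x := if enorm x <= rho then u x else 0 in
  forall eps : R, 0 <= eps -> (forall y, enorm y <= rho ->
    (\sum_i ip mu3 (g i) (XX 0 e i y)) ^+ 2 <= eps) ->
  kk_mass 0 * ip mu3 f f <= kk_mass 0 / 4 * ip mu3 f f
    + (kk_mass 0 / 4)^-1 * (eps * (8 * rho ^+ 3))
    + 768 * e * (3 * ip mu3 f f + \sum_i ip mu3 (g i) (g i)).
Proof.
move=> e0 e1 rho0 H f eps eps0 hU.
set m := kk_mass 0; have m0 : 0 < m by exact: kk_mass_gt0.
have lu := H1r_L2 H; have [mu_ _] := lu.
have mb : measurable_fun setT (fun x : sp => enorm x <= rho).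
  exact: (measurable_fun_ler (@measurable_enorm R) (measurable_cst _)).
have mf : measurable_fun setT f.
  by apply: measurable_fun_ifT; [exact: mb|exact: mu_|exact: measurable_cst].
have lf : L2r mu3 f.
  have h x : `|f x| <= `|u x| by rewrite /f; case: ifP => // _; rewrite normr0.
  exact: (@L2r_le _ _ _ mu3 f u mf h lu).
have fu x : `|f x| * `|u x| = f x ^+ 2.
  by rewrite /f; case: ifP => _; [rewrite -expr2 real_normK ?num_real|rewrite normr0 mul0r expr0n].
have lg i : L2r mu3 (g i) by exact: (H1r_L2g i H).
pose U y := \sum_i ip mu3 (g i) (XX 0 e i y).
have mU : measurable_fun setT U by apply: measurable_sum => i; exact: measurable_ip_XX.
pose U1 y := if enorm y <= rho then U y else 0.
have mU1 : measurable_fun setT U1.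
  by apply: measurable_fun_ifT; [exact: mb|exact: mU|exact: measurable_cst].
have lU1 : (\int[mu3]_x (U1 x ^+ 2)%:E <= (eps * (8 * rho ^+ 3))%:E)%E.
  have mB := @measurable_ball3 R rho.
  apply: (@le_trans _ _ (\int[mu3]_(x in ball3 rho) eps%:E)%E).
    rewrite (_ : (\int[mu3]_x (U1 x ^+ 2)%:E = \int[mu3]_(x in ball3 rho) (U1 x ^+ 2)%:E)%E); last first.
      rewrite [RHS]integral_mkcond; apply: eq_integral => x _; rewrite /patch.
      case: ifPn => //; rewrite notin_setE => /negP xr.
      by rewrite /U1 ifN ?expr0n//; apply/negP.
    apply: int3_le => //.
    - by apply/measurable_EFinP; apply: measurable_funX; exact: mU1.
    - by move=> x; rewrite lee_fin sqr_ge0.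
    - by move=> x xr; rewrite lee_fin /U1 ifT// hU.
  rewrite integral_cst// EFinM; apply: lee_wpmul2l; first by rewrite lee_fin.
  exact: lebesgue3_ball_le (ltW rho0).
set F := ip mu3 f f; set G := \sum_i _.
have m4 : 0 < m / 4 by rewrite divr_gt0.
apply/ler_addgt0Pr => eta eta0.
(* The scale d good for the approximate identity depends on eta. The pairings are therefore moved
   back to the fixed scale e, at a cost 768 e per component that does not depend on d. *)
have [e' /andP[e'0 e'1] /(_ (Num.min e' e))] := approximate_identity (lexx 0) lf lu eta0.
set d := Num.min e' e; have d0 : 0 < d by rewrite lt_min e'0.
have de : d <= e by rewrite ge_min lexx orbT.
rewrite d0 ge_min lexx => /(_ isT).
have -> : (\int[mu3]_y (`|f y| * `|u y|)%:E = F%:E)%E.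
  by rewrite /F -(ipE lf); apply: eq_integral => x _; rewrite fu.
rewrite -EFinM -lee_fin => /le_trans; apply; rewrite [leRHS]EFinD; apply: leeD => //.
pose D i y := `|ip mu3 (g i) (XX 0 d i y) - ip mu3 (g i) (XX 0 e i y)|.
have mD i : measurable_fun setT (fun y : sp => (`|f y| * D i y)%:E).
  apply/measurable_EFinP; apply: measurable_funM; first exact: measurable_abs3.
  by apply: measurable_abs3; apply: measurable_funB; exact: measurable_ip_XX.
have D0 i y : (0 <= (`|f y| * D i y)%:E)%E by rewrite lee_fin mulr_ge0 ?normr_ge0.
have mfU : measurable_fun setT (fun y : sp => (`|f y| * `|U1 y|)%:E).
  by apply/measurable_EFinP; apply: measurable_funM; exact: measurable_abs3.
have fU0 y : (0 <= (`|f y| * `|U1 y|)%:E)%E by rewrite lee_fin mulr_ge0.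
have mSD : measurable_fun setT (fun y : sp => \sum_(i < 3) (`|f y| * D i y)%:E)%E.
  by apply: emeasurable_sum => i; exact: mD.
apply: (@le_trans _ _ (\int[mu3]_y ((`|f y| * `|U1 y|)%:E + \sum_(i < 3) (`|f y| * D i y)%:E))%E).
  apply: int3_le; first exact: measurableT.
  - apply/measurable_EFinP; apply: measurable_funM; apply: measurable_abs3; first exact: mf.
    exact: measurable_smear.
  - by apply: emeasurable_funD; [exact: mfU|exact: mSD].
  - by move=> y; rewrite lee_fin mulr_ge0.
  move=> y _; rewrite sumEFin -EFinD lee_fin -mulr_sumr -mulrDr.
  have [yr|yr] := boolP (enorm y <= rho); last by rewrite /f (negbTE yr) normr0 !mul0r.
  rewrite ler_wpM2l// (smear_H1_0 y d0 H) /U1 yr.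
  have -> : \sum_i ip mu3 (g i) (XX 0 d i y) =
      U y + \sum_i (ip mu3 (g i) (XX 0 d i y) - ip mu3 (g i) (XX 0 e i y)).
    by rewrite sumrB addrC subrK.
  by apply: le_trans (ler_normD _ _) _; rewrite lerD2l ler_norm_sum.
rewrite (int3D measurableT mfU mSD fU0); last by move=> y; apply: sume_ge0.
rewrite [leRHS]EFinD; apply: leeD.
  have h1 : (\int[mu3]_x (f x ^+ 2)%:E <= F%:E)%E by rewrite (ipE lf).
  apply: le_trans (int_mul_le m4 mf mU1 h1 lU1) _.
  by rewrite EFinD !EFinM.
rewrite (@ge0_integral_sum _ _ _ mu3 setT measurableT _ (fun i y => (`|f y| * D i y)%:E)); last 2 first.
  exact: mD.
  by move=> i y _; exact: D0.
apply: (@le_trans _ _ (\sum_(i < 3) (768 * e * (F + ip mu3 (g i) (g i)))%:E)%E).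
  by apply: lee_sum => i _; exact: int_ip_diff_le.
rewrite sumEFin lee_fin -mulr_sumr big_split/= sumr_const card_ord -/G.
by rewrite (mulr_natl F 3).
Qed.

End Eigenvalue_count.

(** * Bounding the number of negative eigenvalues *)

Section Count.
Variable R : realType.
Local Notation sp := (space3 R).
Local Notation mu3 := (@lebesgue3 R).
Variable V : sp -> R.
Hypothesis kV : kato0 V.

(** Here [ip F u] is the quadratic form G + I of H at u, with G the squared norm of the gradient and
    I the potential term. With Q the squared norm of u on the ball carrying phi, |I| <= M Q + G/2,
    so a nonpositive form gives G <= 2 M Q. Then [local_norm_le] yields m Q <= (3/4) m Q, so Q, G
    and the form vanish. *)
Lemma weq_form_eq0 : exists2 e : R, 0 < e & exists s : seq sp,
  forall u g F, weq V u g F ->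
  (forall p, p \in s -> \sum_i ip mu3 (g i) (XX 0 e i p) = 0) ->
  ip mu3 F u <= 0 -> ip mu3 F u = 0.
Proof.
have [C C0 hC] := form_bound R.
have k0 : 0 < (2 * C)^-1 by rewrite invr_gt0 mulr_gt0.
have [phi [W [mphi mW kW VE [M [rho [M0 rho0 phiM phi0]]]]]] := kato_split kV k0.
set m := kk_mass (0 : R); have m0 : 0 < m by exact: kk_mass_gt0.
have m32 : 0 < 3 + 2 * M by lra.
(* [q] names the constant 768 of [local_norm_le]. *)
have [q q0 qE] : exists2 q : R, 0 < q & 768 = q by exists 768; [rewrite ltr0n|exact: erefl].
have q4 : 0 < 4 * q * (3 + 2 * M) by rewrite mulr_gt0// mulr_gt0.
pose e := Num.min 1 (m / (4 * q * (3 + 2 * M))).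
have e0 : 0 < e by rewrite lt_min ltr01 divr_gt0.
have e1 : e <= 1 by rewrite ge_min lexx.
have em : q * e * (3 + 2 * M) <= m / 4.
  have : e <= m / (4 * q * (3 + 2 * M)) by rewrite ge_min lexx orbT.
  by rewrite ler_pdivlMr// => h; rewrite ler_pdivlMr//; apply: le_trans h; rewrite le_eqVlt; apply/orP; left; apply/eqP; ring.
have r3 : 0 < 2 * M * (8 * rho ^+ 3).
  by apply: mulr_gt0; [exact: mulr_gt0|apply: mulr_gt0 => //; exact: exprn_gt0].
(* Both [e] and [eps] are tuned so that, once G <= 2 M Q, the last two terms of [local_norm_le] are
   at most (m/4) Q each. *)
pose eps := (m / 4) ^+ 2 / (2 * M * (8 * rho ^+ 3)).
have m4 : 0 < m / 4 by rewrite divr_gt0.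
have eps0 : 0 < eps by rewrite divr_gt0 ?exprn_gt0.
have [s hs] := ip_XX_small rho e0 eps0.
exists e => //; exists s => u g F [H lF h] gs S0.
have lu := H1r_L2 H; have [mu_ _] := lu; have [mV _] := kV.
have lg i : L2r mu3 (g i) by exact: (H1r_L2g i H).
set G := \sum_i ip mu3 (g i) (g i).
have G0 : 0 <= G by apply: sumr_ge0 => i _; exact: ip_ge0.
have hG := h _ _ H; rewrite -/G in hG.
pose f (x : sp) : R := if enorm x <= rho then u x else 0.
have U y : enorm y <= rho -> (\sum_i ip mu3 (g i) (XX 0 e i y)) ^+ 2 <= eps * G.
  by apply: hs.
have eG : 0 <= eps * G by apply: mulr_ge0 => //; exact: ltW.
have loc := local_norm_le e0 e1 rho0 H eG U; rewrite -/m -/G -/f qE in loc.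
have lf : L2r mu3 f.
  have mf : measurable_fun setT f.
    apply: measurable_fun_ifT; [|exact: mu_|exact: measurable_cst].
    exact: (measurable_fun_ler (@measurable_enorm R) (measurable_cst _)).
  have hf x : `|f x| <= `|u x| by rewrite /f; case: ifP => // _; rewrite normr0.
  exact: (@L2r_le _ _ _ mu3 f u mf hf lu).
set Q := ip mu3 f f in loc; have Q0 : 0 <= Q by exact: ip_ge0.
have Vle : `|\int[mu3]_x (V x * u x * u x)| <= M * Q + G / 2.
  have mf : measurable_fun setT (fun x : sp => f x ^+ 2) by apply: measurable_funX; case: lf.
  have mu2 : measurable_fun setT (fun x : sp => u x ^+ 2) by apply: measurable_funX; exact: mu_.
  have mfE : measurable_fun setT (fun x : sp => (f x ^+ 2)%:E) by apply/measurable_EFinP; exact: mf.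
  have mWE : measurable_fun setT (fun x : sp => (`|W x| * u x ^+ 2)%:E).
    by apply/measurable_EFinP; apply: measurable_funM; [exact: measurable_abs3|exact: mu2].
  have mfM : measurable_fun setT (fun x : sp => M%:E * (f x ^+ 2)%:E)%E.
    by apply: emeasurable_funM; [exact: measurable_cst|exact: mfE].
  have mVu : measurable_fun setT (fun x : sp => V x * u x * u x).
    by apply: measurable_funM; [apply: measurable_funM; [exact: mV|exact: mu_]|exact: mu_].
  have f20 x : (0 <= (f x ^+ 2)%:E)%E by rewrite lee_fin sqr_ge0.
  have W0 x : (0 <= (`|W x| * u x ^+ 2)%:E)%E by rewrite lee_fin mulr_ge0 ?sqr_ge0.
  have M0E : (0 <= M%:E)%E by rewrite lee_fin ltW.
  rewrite -lee_fin; apply: le_trans (abs_Rintegral_le mVu) _.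
  apply: (@le_trans _ _ (\int[mu3]_x (M%:E * (f x ^+ 2)%:E + (`|W x| * u x ^+ 2)%:E))%E).
    apply: int3_le; first exact: measurableT.
    - by apply/measurable_EFinP; apply: measurable_abs3; exact: mVu.
    - by apply: emeasurable_funD; [exact: mfM|exact: mWE].
    - by move=> x; rewrite lee_fin.
    move=> x _; rewrite -EFinM -EFinD lee_fin -mulrA normrM -expr2 normrX.
    rewrite real_normK ?num_real// VE.
    apply: (@le_trans _ _ ((`|phi x| + `|W x|) * u x ^+ 2)).
      by rewrite ler_wpM2r ?sqr_ge0// ler_normD.
    rewrite mulrDl lerD2r /f; case: ifPn => xr; first by rewrite ler_wpM2r ?sqr_ge0.
    by rewrite phi0 ?normr0 ?mul0r ?mulr_ge0 ?sqr_ge0 ?(ltW M0)// ltNge.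
  rewrite (int3D measurableT mfM mWE (fun x => mule_ge0 M0E (f20 x)) W0).
  rewrite (int3Z measurableT mfE f20 M0E) (ipE lf) EFinD EFinM; apply: leeD => //.
  apply: le_trans (hC W u g _ mW k0 kW H) _; rewrite lee_fin -/G.
  by rewrite le_eqVlt; apply/orP; left; apply/eqP; field; rewrite gt_eqF.
have [Va Vb] : - (M * Q + G / 2) <= \int[mu3]_x (V x * u x * u x) /\
    \int[mu3]_x (V x * u x * u x) <= M * Q + G / 2.
  by move: Vle; rewrite ler_norml => /andP[].
move: (\int[mu3]_x _) (ip mu3 F u) hG S0 Va Vb => I S hG S0 Va Vb.
have GQ : G <= 2 * M * Q by lra.
have t2 : (m / 4)^-1 * (eps * G * (8 * rho ^+ 3)) <= m / 4 * Q.
  apply: (@le_trans _ _ ((m / 4)^-1 * (eps * (2 * M * Q) * (8 * rho ^+ 3)))).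
    apply: ler_wpM2l; first by rewrite invr_ge0 ltW.
    apply: ler_wpM2r; first by apply: mulr_ge0 => //; exact: exprn_ge0 (ltW rho0).
    by apply: ler_wpM2l => //; exact: ltW.
  rewrite /eps le_eqVlt; apply/orP; left; apply/eqP; field.
  by rewrite !gt_eqF.
have t3 : q * e * (3 * Q + G) <= m / 4 * Q.
  apply: (@le_trans _ _ (q * e * (3 + 2 * M) * Q)); last by apply: ler_wpM2r.
  rewrite -[leRHS]mulrA; apply: ler_wpM2l; first by rewrite mulr_ge0 ?(ltW q0) ?(ltW e0).
  by lra.
have mE : m * Q = 4 * (m / 4 * Q) by field.
have d0 : 0 <= m / 4 * Q by rewrite mulr_ge0// ltW.
have : m / 4 * Q = 0.
  move: (m / 4 * Q) (m * Q) (_^-1 * _) (q * e * _) mE d0 loc t2 t3 => d c a b -> d0 loc t2 t3.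
  by lra.
move/eqP; rewrite mulf_eq0 (gt_eqF m4) => /eqP Qz.
by rewrite Qz mulr0 in GQ Va Vb; lra.
Qed.

(** With more eigenfunctions than conditions, some nontrivial combination meets all conditions of
    [weq_form_eq0]. By orthonormality the form there is the sum of c_k^2 lam_k, which is negative,
    yet it should vanish. *)
Lemma eig_count : exists N0 : nat, forall N (lam : 'I_N -> R) (u : 'I_N -> sp -> R),
  (forall k, lam k < 0) -> (forall k, eigr V (lam k) (u k)) ->
  (forall k l, ip mu3 (u k) (u l) = (k == l)%:R) -> (N <= N0)%N.
Proof.
have [e e0 [s hs]] := weq_form_eq0.
exists (size s) => N lam u lam0 eu ou.
have [g hg] := fin_all_exists eu.
rewrite leqNgt; apply/negP => sN.
pose A : 'M[R]_(N, size s) := \matrix_(k, j) \sum_i ip mu3 (g k i) (XX 0 e i (nth 0 s j)).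
(* [A] has N rows and fewer columns, so its rows are dependent; the dependency supplies the
   coefficients. *)
have /rowV0Pn[v vA v0] : kermx A != 0.
  rewrite kermx_eq0 /row_free; apply/negP => /eqP r.
  by have := rank_leq_col A; rewrite r leqNgt sN.
have vA0 : v *m A = 0 by apply/sub_kermxP.
pose c k := v 0 k.
have hw := @weq_sum _ V kV 'I_N (index_enum 'I_N) c u g (fun k x => lam k * u k x) hg.
have lu k : L2r mu3 (u k) by have [[[]]] := hg k.
have lg k i : L2r mu3 (g k i) by have [H _ _] := hg k; exact: (H1r_L2g i H).
have lcu k : L2r mu3 (fun x => c k * u k x) by exact: L2rZ.
have llu k : L2r mu3 (fun x => lam k * u k x) by exact: L2rZ.
have SE : ip mu3 (fun x => \sum_(k <- index_enum 'I_N) c k * (lam k * u k x))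
   (fun x => \sum_(k <- index_enum 'I_N) c k * u k x) = \sum_k c k ^+ 2 * lam k.
  have lS : L2r mu3 (fun x => \sum_(k <- index_enum 'I_N) c k * u k x) by exact: L2r_sum.
  rewrite ip_suml//; last by move=> k; exact: L2rZ.
  apply: eq_bigr => k _; rewrite (ipZl _ (llu k) lS) (ipZl _ (lu k) lS).
  have -> : ip mu3 (u k) (fun x => \sum_(l <- index_enum 'I_N) c l * u l x) = c k.
    have E : ip mu3 (fun x => \sum_(l <- index_enum 'I_N) c l * u l x) (u k) = c k.
      rewrite ip_suml// (bigD1 k)//= (ipZl _ (lu k) (lu k)) ou eqxx mulr1 big1 ?addr0// => l lk.
      by rewrite (ipZl _ (lu l) (lu k)) ou (negbTE lk) mulr0.
    by rewrite -[RHS]E; exact: ipC.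
  by rewrite expr2; ring.
have := hs _ _ _ hw; rewrite SE => H.
have S0 : \sum_k c k ^+ 2 * lam k = 0.
  apply: H; last first.
    by apply: sumr_le0 => k _; rewrite mulr_ge0_le0 ?sqr_ge0// ltW.
  move=> p ps.
  transitivity (\sum_k c k * \sum_i ip mu3 (g k i) (XX 0 e i p)).
    under [RHS]eq_bigr do rewrite mulr_sumr.
    rewrite exchange_big/=; apply: eq_bigr => i _.
    have lX := L2r_XX e0 (lexx 0) i p.
    rewrite ip_suml//; last by move=> k; exact: L2rZ.
    by apply: eq_bigr => k _; rewrite (ipZl _ (lg k i) lX).
  have ij : (index p s < size s)%N by rewrite index_mem.
  have := congr1 (fun B : 'rV_(size s) => B 0 (Ordinal ij)) vA0.
  rewrite /= mxE [RHS]mxE => h; rewrite -[RHS]h; apply: eq_bigr => k _.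
  by rewrite mxE /= nth_index.
have : exists k, c k != 0.
  by apply/existsP; move: v0; apply: contraNT; rewrite negb_exists => /forallP z; apply/eqP/rowP => k; rewrite mxE; apply/eqP; have := z k; rewrite negbK.
move=> [k ck].
have : \sum_k c k ^+ 2 * lam k < 0.
  rewrite (bigD1 k)//=; apply: (@lt_le_trans _ _ (0 + \sum_(i | i != k) c i ^+ 2 * lam i)).
    by rewrite ltrD2r pmulr_rlt0// exprn_even_gt0.
  by rewrite add0r; apply: sumr_le0 => i _; rewrite mulr_ge0_le0 ?sqr_ge0// ltW.
by rewrite S0 ltxx.
Qed.

End Count.

(** * Finite orthonormal bases of the negative eigenspaces *)

Section Eigenspaces.
Variable R : realType.
Local Notation sp := (space3 R).
Local Notation mu3 := (@lebesgue3 R).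
Variable V : sp -> R.
Hypothesis kV : kato0 V.
Local Notation eigr := (eigr V).

Lemma ae_forall_ord N (P : 'I_N -> sp -> Prop) : (forall k, {ae mu3, forall x, P k x}) ->
  {ae mu3, forall x, forall k, P k x}.
Proof.
move=> h; pose Q n x := forall k : 'I_N, k = n :> nat -> P k x.
have H n : {ae mu3, forall x, Q n x}.
  have [nN|nN] := ltnP n N.
    move: (h (Ordinal nN)); apply: ae_imp => x hx k kn.
    by rewrite (_ : k = Ordinal nN)//; exact: val_inj.
  apply: (@ae_imp _ (fun=> True)); last exact: aeW.
  by move=> x _ k kn; have := ltn_ord k; rewrite kn ltnNge nN.
by move: (ae_foralln H); apply: ae_imp => x hx k; exact: (hx k).
Qed.

Lemma eigr_L2 lam u : eigr lam u -> L2r mu3 u.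
Proof. by move=> [g [H _ _]]; exact: H1r_L2 H. Qed.

Lemma eigr_sum lam (I : Type) (s : seq I) (c : I -> R) (u : I -> sp -> R) :
  (forall k, eigr lam (u k)) -> eigr lam (fun x => \sum_(k <- s) c k * u k x).
Proof.
move=> h; have [g hg] := boolp.choice h.
exists (fun i x => \sum_(k <- s) c k * g k i x).
apply: weq_eq (weq_sum kV s c hg) => // x.
by rewrite mulr_sumr; apply: eq_bigr => k _; rewrite mulrCA.
Qed.

Lemma eigrZ lam c u : eigr lam u -> eigr lam (fun x => c * u x).
Proof.
move=> [g hg]; exists (fun i x => c * g i x).
by apply: weq_eq (weqZ kV c hg) => // x; rewrite mulrCA.
Qed.

Lemma eigrB lam u v : eigr lam u -> eigr lam v -> eigr lam (fun x => u x - v x).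
Proof.
move=> [g hg] [h hh]; exists (fun i x => g i x + -1 * h i x).
by apply: weq_eq (weqD kV hg (weqZ kV (-1) hh)) => // x; ring.
Qed.

Lemma eigr_ae lam u u' : measurable_fun setT u' -> {ae mu3, forall x, u x = u' x} ->
  eigr lam u -> eigr lam u'.
Proof.
move=> mu' uu' [g hg]; exists g; apply: (weq_ae kV mu' _ uu' _ hg).
  by apply: measurable_funM; [exact: measurable_cst|exact: mu'].
by move: uu'; apply: ae_imp => x ->.
Qed.

(** Symmetry of the form: each function serves as test in the equation of the other. *)
Lemma eigr_orthogonal lam lam' u v : eigr lam u -> eigr lam' v -> lam != lam' ->
  ip mu3 u v = 0.
Proof.
move=> [g [Hu _ hu]] [h [Hv _ hv]] ll.
have lu := H1r_L2 Hu; have lv := H1r_L2 Hv.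
have e1 := hu _ _ Hv; have e2 := hv _ _ Hu.
rewrite (ipZl _ lu lv) in e1; rewrite (ipZl _ lv lu) in e2.
have E1 : \sum_i ip mu3 (h i) (g i) = \sum_i ip mu3 (g i) (h i).
  by apply: eq_bigr => i _; exact: ipC.
have E2 : \int[mu3]_x (V x * v x * u x) = \int[mu3]_x (V x * u x * v x).
  by apply: eq_Rintegral => x _; ring.
have E3 : ip mu3 v u = ip mu3 u v by exact: ipC.
have /eqP e3 : (lam - lam') * ip mu3 u v = 0.
  apply/eqP; rewrite mulrBl subr_eq0; apply/eqP.
  by rewrite -[in RHS]E3 -e2 -e1 E1 E2.
by apply/eqP; move: e3; rewrite mulf_eq0 subr_eq0 (negbTE ll).
Qed.

Definition orthonormal_family N (u : 'I_N -> sp -> R) :=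
  forall k l, ip mu3 (u k) (u l) = (k == l)%:R.

Definition extend N (u : 'I_N -> sp -> R) (r : sp -> R) (k : 'I_N.+1) : sp -> R :=
  if unlift ord_max k is Some j then u j else r.

Lemma extend_orthonormal N (u : 'I_N -> sp -> R) r : orthonormal_family u ->
  (forall k, ip mu3 r (u k) = 0) -> ip mu3 r r = 1 -> orthonormal_family (extend u r).
Proof.
move=> ou ru rr k l; rewrite /extend.
case: unliftP => [i ->|->]; case: unliftP => [j ->|->].
- by rewrite ou (inj_eq lift_inj).
- by rewrite [LHS]ipC ru eq_sym (negbTE (neq_lift _ _)).
- by rewrite ru (negbTE (neq_lift _ _)).
- by rewrite rr eqxx.
Qed.

Lemma normalize r : L2r mu3 r -> ip mu3 r r != 0 ->
  exists2 c, c != 0 & ip mu3 (fun x => c * r x) (fun x => c * r x) = 1.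
Proof.
move=> lr r0; have rp : 0 < ip mu3 r r by rewrite lt_neqAle eq_sym r0 ip_ge0.
pose c := (Num.sqrt (ip mu3 r r))^-1.
have sp0 : 0 < Num.sqrt (ip mu3 r r) by rewrite sqrtr_gt0.
exists c; first by rewrite invr_neq0// gt_eqF.
have lc : L2r mu3 (fun x => c * r x) by exact: L2rZ.
have E : ip mu3 r (fun x => c * r x) = c * ip mu3 r r.
  by transitivity (ip mu3 (fun x => c * r x) r); [exact: ipC|exact: ipZl].
rewrite (ipZl _ lr lc) E mulrA -expr2 /c exprVn sqr_sqrtr ?(ltW rp)//.
by rewrite mulVf.
Qed.

Lemma maximal_nat (P : nat -> Prop) N0 : P 0%N -> (forall n, P n -> (n <= N0)%N) ->
  exists2 n, P n & ~ P n.+1.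
Proof.
move=> P0 PN; apply: contrapT => h.
have all n : P n.
  elim: n => // n IH; apply: contrapT => h'; apply: h; by exists n.
by have := PN _ (all N0.+1); rewrite ltnn.
Qed.

(** A family of maximal size exists by [eig_count]. If v differed from its projection, the
    normalized remainder would extend the family. *)
Lemma eig_basis lam : lam < 0 -> exists N (u : 'I_N -> sp -> R),
  [/\ forall k, eigr lam (u k), orthonormal_family u &
    forall v, eigr lam v ->
      {ae mu3, forall x, v x = \sum_k ip mu3 v (u k) * u k x}].
Proof.
move=> lam0; have [N0 hN0] := eig_count kV.
pose P N := exists u : 'I_N -> sp -> R, (forall k, eigr lam (u k)) /\ orthonormal_family u.
have P0 : P 0%N by exists (fun _ _ => 0); split => [] [].
have PN n : P n -> (n <= N0)%N.
  by move=> [u [eu ou]]; apply: (hN0 n (fun=> lam) u).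
have [N [u [eu ou]] nP] := maximal_nat P0 PN.
exists N, u; split=> // v ev.
pose w x := \sum_k ip mu3 v (u k) * u k x.
have ew : eigr lam w by exact: eigr_sum.
pose r x := v x - w x; have er : eigr lam r by exact: eigrB.
have lv := eigr_L2 ev; have lw := eigr_L2 ew; have lr := eigr_L2 er.
have lu k := eigr_L2 (eu k).
have ru k : ip mu3 r (u k) = 0.
  rewrite /r (ipBl lv lw (lu k)).
  have -> : ip mu3 w (u k) = ip mu3 v (u k).
    rewrite /w ip_suml//; last by move=> l; exact: L2rZ.
    rewrite (bigD1 k)//= (ipZl _ (lu k) (lu k)) ou eqxx mulr1 big1 ?addr0// => l lk.
    by rewrite (ipZl _ (lu l) (lu k)) ou (negbTE lk) mulr0.
  by rewrite subrr.
have [r0|r0] := eqVneq (ip mu3 r r) 0.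
  by move: (ip_eq0 lr r0); apply: ae_imp => x /eqP; rewrite subr_eq0 => /eqP.
have [c c0 c1] := normalize lr r0.
exfalso; apply: nP; exists (extend u (fun x => c * r x)); split.
  by move=> k; rewrite /extend; case: unlift => // ; exact: eigrZ.
by apply: extend_orthonormal => // k; rewrite (ipZl _ lr (lu k)) ru mulr0.
Qed.

(** Normalized eigenfunctions of distinct energies are orthonormal, so [eig_count] bounds the length
    of a duplicate-free list of such mu; a list of maximal length contains them all. *)
Lemma finitely_many_eig : exists s : seq R, forall mu u, 0 < mu ->
  eigr (- mu ^+ 2) u -> ~ {ae mu3, forall x, u x = 0} -> mu \in s.
Proof.
have [N0 hN0] := eig_count kV.
pose ev mu := 0 < mu /\ exists2 u, eigr (- mu ^+ 2) u & ip mu3 u u = 1.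
pose P N := exists2 s : seq R, size s = N & uniq s /\ forall mu, mu \in s -> ev mu.
have P0 : P 0%N by exists [::].
have PN n : P n -> (n <= N0)%N.
  move=> [s <- [us hs]].
  have mk (k : 'I_(size s)) : s`_k \in s by exact: mem_nth.
  have [u hu hu1] := fin_all_exists2 (fun k => (hs _ (mk k)).2).
  apply: (hN0 (size s) (fun k => - s`_k ^+ 2) u).
  - by move=> k; rewrite oppr_lt0 exprn_gt0//; case: (hs _ (mk k)).
  - by move=> k; exact: (hu k).
  move=> k l; have [<-|kl] := eqVneq k l; first exact: hu1.
  apply: (eigr_orthogonal (hu k) (hu l)).
  rewrite eqr_opp eqrXn2 ?(ltW (hs _ (mk _)).1)//.
  by rewrite nth_uniq.
have [N [s sN [us hs]] nP] := maximal_nat P0 PN.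
exists s => mu u mu0 eu u0; apply: contrapT => /negP mus; apply: nP.
exists (mu :: s); first by rewrite /= sN.
split; first by rewrite /= mus.
move=> nu; rewrite inE => /orP[/eqP ->|]; last exact: hs.
split => //; have lu := eigr_L2 eu.
have r0 : ip mu3 u u != 0 by apply/eqP => /(ip_eq0 lu).
have [c _ c1] := normalize lu r0.
by exists (fun x => c * u x) => //; exact: eigrZ.
Qed.

Lemma decaying_eig_basis mu : 0 < mu -> exists N (u : 'I_N -> sp -> R) (K : R),
  [/\ 0 <= K, forall k x, `|u k x| <= K * ww mu x, forall k, eigr (- mu ^+ 2) (u k),
    orthonormal_family u &
    forall v, eigr (- mu ^+ 2) v ->
      {ae mu3, forall x, v x = \sum_k ip mu3 v (u k) * u k x}].
Proof.
move=> mu0; have lam0 : - mu ^+ 2 < 0 by rewrite oppr_lt0 exprn_gt0.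
have [N [u [eu ou cu]]] := eig_basis lam0.
have [K hK0 hK] := fin_all_exists2 (fun k => eigenfunction_decay kV mu0 (eu k)).
(* The kernel bound is claimed at every pair x <> y, so the basis is changed on a null set to make
   the decay hold at every point. *)
pose u' k x := if `|u k x| <= K k * ww mu x then u k x else 0.
have lu k := eigr_L2 (eu k); have mu_ k : measurable_fun setT (u k) by case: (lu k).
have mu' k : measurable_fun setT (u' k).
  apply: measurable_fun_ifT; [|exact: mu_|exact: measurable_cst].
  apply: measurable_fun_ler; first by apply: measurable_abs3; exact: mu_.
  by apply: measurable_funM; [exact: measurable_cst|exact: measurable_ww].
have uu' k : {ae mu3, forall x, u k x = u' k x}.
  by move: (hK k); apply: ae_imp => x h; rewrite /u' h.
have ipu (v : sp -> R) k : L2r mu3 v -> ip mu3 v (u' k) = ip mu3 v (u k).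
  move=> [mv _]; transitivity (ip mu3 (u' k) v); first exact: ipC.
  have E := @ip_ae _ _ _ mu3 (u k) (u' k) v (mu_ k) (mu' k) mv (uu' k).
  apply: (etrans (esym E)); exact: ipC.
have eu' k : eigr (- mu ^+ 2) (u' k) by exact: (eigr_ae (mu' k) (uu' k) (eu k)).
exists N, u', (\sum_k K k); split=> //.
- by apply: sumr_ge0.
- move=> k x; apply: (@le_trans _ _ (K k * ww mu x)).
    rewrite /u'; case: ifP => // _; rewrite normr0; apply: mulr_ge0 => //; exact: ltW (ww_gt0 _ _).
  apply: ler_wpM2r; first exact: ltW (ww_gt0 _ _).
  by rewrite (bigD1 k)//= lerDl sumr_ge0.
- move=> k l; rewrite (ipu _ l (eigr_L2 (eu' k))) -(ou k l).
  have [ml _] := lu l.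
  exact: (esym (@ip_ae _ _ _ mu3 (u k) (u' k) (u l) (mu_ k) (mu' k) ml (uu' k))).
- move=> v ev; have lv := eigr_L2 ev.
  move: (ae_forall_ord uu') (cu v ev); apply: ae_imp2 => x ux ->.
  by apply: eq_bigr => k _; rewrite (ipu v k lv) ux.
Qed.

End Eigenspaces.

(** * Reduction of complex eigenfunctions to real and imaginary parts *)

Section Complex.
Variable R : realType.
Local Notation sp := (space3 R).
Local Notation mu3 := (@lebesgue3 R).
Local Notation Re := complex.Re.
Local Notation Im := complex.Im.
Local Open Scope complex_scope.
Implicit Types (z w : R[i]) (f g : sp -> R[i]).

Lemma cabs_sqr z : cabs z ^+ 2 = Re z ^+ 2 + Im z ^+ 2.
Proof.
case: z => a b; rewrite /cabs normc_def /= sqr_sqrtr//.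
by rewrite addr_ge0 ?sqr_ge0.
Qed.

Lemma cabs_ge0 z : 0 <= cabs z.
Proof. by case: z => a b; rewrite /cabs normc_def /= sqrtr_ge0. Qed.

Lemma cabs_le z (a b : R) : `|Re z| <= a -> `|Im z| <= b -> cabs z <= a + b.
Proof.
move=> ha hb; have a0 := le_trans (normr_ge0 _) ha; have b0 := le_trans (normr_ge0 _) hb.
rewrite -ler_sqr ?nnegrE ?cabs_ge0 ?addr_ge0// cabs_sqr.
rewrite -[Re z ^+ 2]real_normK ?num_real// -[Im z ^+ 2]real_normK ?num_real//.
apply: (@le_trans _ _ (a ^+ 2 + b ^+ 2)); first by rewrite lerD// lerXn2r ?nnegrE.
have ab := mulr_ge0 a0 b0; rewrite -subr_ge0.
by rewrite (_ : _ - _ = 2 * (a * b)); [rewrite mulr_ge0|ring].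
Qed.

Lemma cabs_real (r : R) : cabs r%:C = `|r|.
Proof. by rewrite /cabs normc_def /= expr0n addr0 sqrtr_sqr. Qed.

Lemma Re_conj z w : Re (z * w^*) = Re z * Re w + Im z * Im w.
Proof. by case: z w => a b [c d] /=; rewrite mulrN opprK. Qed.

Lemma Im_conj z w : Im (z * w^*) = Im z * Re w - Re z * Im w.
Proof. by case: z w => a b [c d] /=; ring. Qed.

Lemma Re_scale (r : R) z : Re (r%:C * z) = r * Re z.
Proof. by case: z => a b /=; ring. Qed.

Lemma Im_scale (r : R) z : Im (r%:C * z) = r * Im z.
Proof. by case: z => a b /=; ring. Qed.

Lemma ReD z w : Re (z + w) = Re z + Re w. Proof. by case: z w => a b []. Qed.
Lemma ImD z w : Im (z + w) = Im z + Im w. Proof. by case: z w => a b []. Qed.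

Lemma Re_sum (I : Type) (s : seq I) (F : I -> R[i]) :
  Re (\sum_(i <- s) F i) = \sum_(i <- s) Re (F i).
Proof. by elim: s => [|k s IH]; rewrite ?big_nil// !big_cons ReD IH. Qed.

Lemma Im_sum (I : Type) (s : seq I) (F : I -> R[i]) :
  Im (\sum_(i <- s) F i) = \sum_(i <- s) Im (F i).
Proof. by elim: s => [|k s IH]; rewrite ?big_nil// !big_cons ImD IH. Qed.

Lemma complex_eq z w : Re z = Re w -> Im z = Im w -> z = w.
Proof. by case: z w => a b [c d] /= -> ->. Qed.

Lemma L2_ReIm f : L2 f <-> L2r mu3 (fun x => Re (f x)) /\ L2r mu3 (fun x => Im (f x)).
Proof.
split=> [[[mr mi] fin]|[[mr fr] [mi fi]]].
  have mc : measurable_fun setT (fun x : sp => (cabs (f x) ^+ 2)%:E).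
    under eq_fun do rewrite cabs_sqr.
    by apply/measurable_EFinP; apply: measurable_funD; apply: measurable_funX; [exact: mr|exact: mi].
  split; split.
  - exact: mr.
  - apply: le_lt_trans fin; apply: int3_le; first exact: measurableT.
    + by apply/measurable_EFinP; apply: measurable_funX; exact: mr.
    + exact: mc.
    + by move=> x; rewrite lee_fin sqr_ge0.
    + by move=> x _; rewrite lee_fin cabs_sqr lerDl sqr_ge0.
  - exact: mi.
  - apply: le_lt_trans fin; apply: int3_le; first exact: measurableT.
    + by apply/measurable_EFinP; apply: measurable_funX; exact: mi.
    + exact: mc.
    + by move=> x; rewrite lee_fin sqr_ge0.
    + by move=> x _; rewrite lee_fin cabs_sqr lerDr sqr_ge0.
split; first by split; [exact: mr|exact: mi].
have m1 : measurable_fun setT (fun x : sp => (Re (f x) ^+ 2)%:E).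
  by apply/measurable_EFinP; apply: measurable_funX; exact: mr.
have m2 : measurable_fun setT (fun x : sp => (Im (f x) ^+ 2)%:E).
  by apply/measurable_EFinP; apply: measurable_funX; exact: mi.
have s0 (h : sp -> R) x : (0 <= (h x ^+ 2)%:E)%E by rewrite lee_fin sqr_ge0.
rewrite (_ : (\int[mu3]_x (cabs (f x) ^+ 2)%:E =
    \int[mu3]_x ((Re (f x) ^+ 2)%:E + (Im (f x) ^+ 2)%:E))%E).
  by rewrite (int3D measurableT m1 m2 (s0 _) (s0 _)) lte_add_pinfty.
by apply: eq_integral => x _; rewrite -EFinD cabs_sqr.
Qed.

Local Notation integ h := (mu3.-integrable setT (EFin \o h)).

Lemma innerE f g :
  integ (fun x => Re (f x) * Re (g x)) -> integ (fun x => Im (f x) * Im (g x)) ->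
  integ (fun x => Im (f x) * Re (g x)) -> integ (fun x => Re (f x) * Im (g x)) ->
  inner f g =
   (\int[mu3]_x (Re (f x) * Re (g x)) + \int[mu3]_x (Im (f x) * Im (g x))) +i*
   (\int[mu3]_x (Im (f x) * Re (g x)) - \int[mu3]_x (Re (f x) * Im (g x))).
Proof.
move=> i1 i2 i3 i4; rewrite /inner /cintegral.
have E1 : \int[mu3]_x Re (f x * (g x)^*) =
    \int[mu3]_x (Re (f x) * Re (g x)) + \int[mu3]_x (Im (f x) * Im (g x)).
  by rewrite -(RintegralD measurableT i1 i2); apply: eq_Rintegral => x _; rewrite Re_conj.
have E2 : \int[mu3]_x Im (f x * (g x)^*) =
    \int[mu3]_x (Im (f x) * Re (g x)) - \int[mu3]_x (Re (f x) * Im (g x)).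
  by rewrite -(RintegralB measurableT i3 i4); apply: eq_Rintegral => x _; rewrite Im_conj.
by rewrite E1 E2.
Qed.

Lemma inner_L2 f g : L2 f -> L2 g -> inner f g =
   (ip mu3 (fun x => Re (f x)) (fun x => Re (g x)) +
    ip mu3 (fun x => Im (f x)) (fun x => Im (g x))) +i*
   (ip mu3 (fun x => Im (f x)) (fun x => Re (g x)) -
    ip mu3 (fun x => Re (f x)) (fun x => Im (g x))).
Proof.
move=> /L2_ReIm[a b] /L2_ReIm[c d]; apply: innerE.
- exact: (L2r_mul a c).
- exact: (L2r_mul b d).
- exact: (L2r_mul b c).
- exact: (L2r_mul a d).
Qed.

Lemma H1_gradient_H1r f df : H1_gradient f df <->
  H1r (fun x => Re (f x)) (fun i x => Re (df i x)) /\
  H1r (fun x => Im (f x)) (fun i x => Im (df i x)).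
Proof.
split=> [[/L2_ReIm[a b] h]|[[a ha] [b hb]]].
  by split; split=> // i; have [/L2_ReIm[c d] [p q]] := h i.
split; first by apply/L2_ReIm; split; [exact: a|exact: b].
move=> i; have [c p] := ha i; have [d q] := hb i; split.
  by apply/L2_ReIm; split; [exact: c|exact: d].
by split; [exact: p|exact: q].
Qed.

Variable V : sp -> R.
Hypothesis kV : kato0 V.

Lemma H_form (psi phi : sp -> R[i]) dpsi dphi : H1_gradient psi dpsi ->
  H1_gradient phi dphi ->
  let S (p q : R[i] -> R) := \sum_i ip mu3 (fun x => p (dpsi i x)) (fun x => q (dphi i x)) +
     \int[mu3]_x (V x * p (psi x) * q (phi x)) in
  \sum_(i < 3) inner (dpsi i) (dphi i) + inner (fun x => (V x)%:C * psi x) phi =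
  (S (@Re R) (@Re R) + S (@Im R) (@Im R)) +i* (S (@Im R) (@Re R) - S (@Re R) (@Im R)).
Proof.
move=> hpsi hphi S.
have /H1_gradient_H1r[Ha Hb] := hpsi; have /H1_gradient_H1r[Hp Hq] := hphi.
have EV : inner (fun x => (V x)%:C * psi x) phi =
   (\int[mu3]_x (V x * Re (psi x) * Re (phi x)) + \int[mu3]_x (V x * Im (psi x) * Im (phi x))) +i*
   (\int[mu3]_x (V x * Im (psi x) * Re (phi x)) - \int[mu3]_x (V x * Re (psi x) * Im (phi x))).
  rewrite innerE.
  - by congr ((_ + _) +i* (_ - _)); apply: eq_Rintegral => x _; rewrite ?Re_scale ?Im_scale.
  - by under eq_fun do rewrite Re_scale; exact: (integrable_V kV Ha Hp).
  - by under eq_fun do rewrite Im_scale; exact: (integrable_V kV Hb Hq).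
  - by under eq_fun do rewrite Im_scale; exact: (integrable_V kV Hb Hp).
  - by under eq_fun do rewrite Re_scale; exact: (integrable_V kV Ha Hq).
have [_ gpsi] := hpsi; have [_ gphi] := hphi.
have ES i := inner_L2 (proj1 (gpsi i)) (proj1 (gphi i)).
rewrite EV; under eq_bigr do rewrite ES.
apply: complex_eq.
  by rewrite ReD Re_sum /= big_split/= /S; ring.
by rewrite ImD Im_sum /= sumrB /S; ring.
Qed.

(** V is real, so testing with real functions separates the equation into its real and imaginary
    parts. *)
Lemma eigr_of_H lam psi : H_eigenspace V lam psi ->
  eigr V lam (fun x => Re (psi x)) /\ eigr V lam (fun x => Im (psi x)).
Proof.
move=> [lF [dpsi hpsi h]].
have /H1_gradient_H1r[Ha Hb] := hpsi.
have /L2_ReIm[lFr lFi] := lF.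
have FrE : (fun x => Re (lam%:C * psi x)) = (fun x => lam * Re (psi x)) by apply/funext => x; rewrite Re_scale.
have FiE : (fun x => Im (lam%:C * psi x)) = (fun x => lam * Im (psi x)) by apply/funext => x; rewrite Im_scale.
rewrite FrE in lFr; rewrite FiE in lFi.
have ip0 (u : sp -> R) : ip mu3 u (fun=> 0) = 0.
  by rewrite /ip /Rintegral; under eq_integral do rewrite mulr0; rewrite integral0.
have key p dp : H1r p dp ->
   \sum_i ip mu3 (fun x => Re (dpsi i x)) (dp i) + \int[mu3]_x (V x * Re (psi x) * p x) =
     ip mu3 (fun x => lam * Re (psi x)) p /\
   \sum_i ip mu3 (fun x => Im (dpsi i x)) (dp i) + \int[mu3]_x (V x * Im (psi x) * p x) =
     ip mu3 (fun x => lam * Im (psi x)) p.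
  move=> Hp; have hphi : H1_gradient (fun x => (p x)%:C) (fun i x => (dp i x)%:C).
    by apply/H1_gradient_H1r; split; [exact: Hp|exact: H1r0].
  have := h _ _ hphi; rewrite (H_form hpsi hphi) (inner_L2 lF (proj1 hphi)) /=.
  rewrite FrE FiE.
  have V0 (w : sp -> R) : \int[mu3]_x (V x * w x * 0) = 0.
    by rewrite /Rintegral; under eq_integral do rewrite mulr0; rewrite integral0.
  have S0 (w : 'I_3 -> sp -> R) : \sum_i ip mu3 (w i) (fun=> 0) = 0.
    by rewrite big1// => i _; exact: ip0.
  by rewrite !V0 !ip0 !S0 !addr0 !subr0 => -[].
split.
  exists (fun i x => Re (dpsi i x)); split=> // p dp Hp; exact: (key p dp Hp).1.
exists (fun i x => Im (dpsi i x)); split=> // p dp Hp; exact: (key p dp Hp).2.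
Qed.

Lemma H_of_eigr lam (a b : sp -> R) : eigr V lam a -> eigr V lam b ->
  H_eigenspace V lam (fun x => a x +i* b x).
Proof.
move=> [ga [Ha la ha]] [gb [Hb lb hb]].
have lF : L2 (fun x => lam%:C * (a x +i* b x)).
  apply/L2_ReIm; split.
    by under eq_fun do rewrite Re_scale; exact: la.
  by under eq_fun do rewrite Im_scale; exact: lb.
split; first exact: lF.
have hpsi : H1_gradient (fun x => a x +i* b x) (fun i x => ga i x +i* gb i x).
  by apply/H1_gradient_H1r; split; [exact: Ha|exact: Hb].
exists (fun i x => ga i x +i* gb i x) => // phi dphi hphi.
have /H1_gradient_H1r[Hp Hq] := hphi.
rewrite (H_form hpsi hphi) (inner_L2 lF (proj1 hphi)) /=.
have FrE : (fun x => Re (lam%:C * (a x +i* b x))) = (fun x => lam * a x) by apply/funext => x; rewrite Re_scale.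
have FiE : (fun x => Im (lam%:C * (a x +i* b x))) = (fun x => lam * b x) by apply/funext => x; rewrite Im_scale.
rewrite FrE FiE -(ha _ _ Hp) -(ha _ _ Hq) -(hb _ _ Hp) -(hb _ _ Hq).
by congr (_ +i* _).
Qed.

End Complex.

(** * The projection kernel and its bound *)

Section Kernel_bound.
Variable R : realType.
Local Notation sp := (space3 R).
Local Notation mu3 := (@lebesgue3 R).
Local Notation Re := complex.Re.
Local Notation Im := complex.Im.

Lemma powR_le1D (r a : R) : 0 <= r -> 0 <= a <= 1 -> r `^ a <= 1 + r.
Proof.
move=> r0 /andP[a0 a1]; have [r1|r1] := leP 1 r.
  apply: (@le_trans _ _ (r `^ 1)); first by rewrite ler_powR.
  by rewrite powRr1// lerDr.
have [->|rp] := eqVneq r 0.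
  by rewrite addr0; have [->|an] := eqVneq a 0; rewrite ?powRr0// powR0// ler01.
apply: (@le_trans _ _ 1); last by rewrite lerDl.
rewrite -(powRr0 r) ger_powR//; first by rewrite lt_neqAle eq_sym rp r0 ltW.
Qed.

(** Because 1 <= 2 - a <= 2, the power mu^{2-a} is at least mu when mu >= 1 and at least mu^2 when
    mu < 1. The prefactor does not depend on a. *)
Lemma scale_le (mu a : R) : 0 < mu -> 0 <= a <= 1 ->
  1 <= (mu^-1 + mu^-1 ^+ 2) * mu `^ (2 - a).
Proof.
move=> mu0 /andP[a0 a1]; have i0 : 0 < mu^-1 by rewrite invr_gt0.
have p0 : 0 < mu `^ (2 - a) by exact: powR_gt0.
have [m1|m1] := leP 1 mu.
  apply: (@le_trans _ _ (mu^-1 * mu `^ (2 - a))); last first.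
    by rewrite ler_wpM2r ?(ltW p0)// lerDl sqr_ge0.
  rewrite ler_pdivlMl// mulr1 -[leLHS]powRr1 ?(ltW mu0)//.
  by rewrite ler_powR//; lra.
apply: (@le_trans _ _ (mu^-1 ^+ 2 * mu `^ (2 - a))); last first.
  by rewrite ler_wpM2r ?(ltW p0)// lerDr ltW.
rewrite exprVn ler_pdivlMl ?exprn_gt0// mulr1 -[leLHS]powR_mulrn ?(ltW mu0)//.
by rewrite ger_powR ?mu0 ?(ltW m1)//; lra.
Qed.

(** Both factors come from |x-y| <= |x|+|y|, the denominator through (1+|x|)(1+|y|) >= 1+|x|+|y|. *)
Lemma ww_mul_le (mu : R) (x y : sp) : 0 < mu ->
  ww mu x * ww mu y <= expR (- mu * enorm (x - y)) / (1 + enorm (x - y)).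
Proof.
move=> mu0; have a0 := enorm1_gt0 x; have b0 := enorm1_gt0 y; have c0 := enorm1_gt0 (x - y).
have tri : enorm (x - y) <= enorm x + enorm y by rewrite -(enormN y) enormD.
have -> : ww mu x * ww mu y = expR (- mu * enorm x) * expR (- mu * enorm y) * ((1 + enorm x) * (1 + enorm y))^-1.
  by rewrite /ww !mulNr; field; rewrite !gt_eqF.
apply: ler_pM.
- by rewrite mulr_ge0 ?expR_ge0.
- by rewrite invr_ge0 mulr_ge0 ?ltW.
- by rewrite -expRD ler_expR -mulrDr !mulNr lerN2 ler_pM2l.
- rewrite lef_pV2 ?posrE ?mulr_gt0//.
  have := mulr_ge0 (enorm_ge0 x) (enorm_ge0 y); move: tri.
  by move: (enorm (x - y)) (enorm x) (enorm y) => r p q h1 h2; rewrite mulrDl mul1r mulrDr mulr1; lra.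
Qed.

Variable V : sp -> R.
Hypothesis kV : kato0 V.

Definition has_kernel_bound (mu C : R) :=
  exists2 P : sp -> sp -> R[i], projection_kernel (H_eigenspace V (- mu ^+ 2)) P &
   forall x y : sp, x <> y ->
        cabs (P x y) <= C * mu * (expR (- mu * enorm (x - y)) / enorm (x - y)) /\
        forall a : R, 0 <= a <= 1 ->
          cabs (P x y) <=
            C * mu `^ (2 - a) *
            (expR (- mu * enorm (x - y)) / enorm (x - y) `^ a).

Lemma has_kernel_bound_le mu C C' : 0 < mu -> C <= C' ->
  has_kernel_bound mu C -> has_kernel_bound mu C'.
Proof.
move=> mu0 CC [P hP h]; exists P => // x y xy; have [h1 h2] := h x y xy.
have e0 : 0 <= expR (- mu * enorm (x - y)) by exact: expR_ge0.
split=> [|a a01].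
  apply: le_trans h1 _; apply: ler_wpM2r; first by rewrite divr_ge0 ?enorm_ge0.
  by rewrite ler_wpM2r// ltW.
apply: le_trans (h2 a a01) _; apply: ler_wpM2r; first by rewrite divr_ge0 ?powR_ge0.
by rewrite ler_wpM2r// powR_ge0.
Qed.

Section Projection.
Variables (lam : R) (N : nat) (u : 'I_N -> sp -> R).
Hypotheses (eu : forall k, eigr V lam (u k)) (ou : orthonormal_family u).
Hypothesis cu : forall v, eigr V lam v ->
  {ae mu3, forall x, v x = \sum_k ip mu3 v (u k) * u k x}.

Let lu k : L2r mu3 (u k) := eigr_L2 (eu k).

(** By completeness p is almost everywhere a combination of the u_k, and the remainder of F is
    orthogonal to each of these. *)
Lemma ip_projection (F p : sp -> R) : L2r mu3 F -> eigr V lam p ->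
  ip mu3 (fun x => F x - \sum_k ip mu3 (u k) F * u k x) p = 0.
Proof.
move=> lF ep; have lp := eigr_L2 ep.
pose S (v : sp -> R) (x : sp) := \sum_k ip mu3 v (u k) * u k x.
pose T x := \sum_k ip mu3 (u k) F * u k x.
have lT : L2r mu3 T by apply: L2r_sum => k; exact: L2rZ.
have lS : L2r mu3 (S p) by apply: L2r_sum => k; exact: L2rZ.
have E (h : sp -> R) : L2r mu3 h -> ip mu3 h p = \sum_k ip mu3 p (u k) * ip mu3 (u k) h.
  move=> lh; have [mh _] := lh; have [mp _] := lp; have [mS _] := lS.
  have E1 : ip mu3 h p = ip mu3 p h by exact: ipC.
  rewrite E1 (@ip_ae _ _ _ mu3 p (S p) h mp mS mh (cu ep)) /S.
  rewrite ip_suml//; last by move=> k; exact: L2rZ.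
  by apply: eq_bigr => k _; rewrite (ipZl _ (lu k) lh).
rewrite (ipBl lF lT lp) (E _ lF) (E _ lT) -sumrB big1// => k _.
rewrite -mulrBr (_ : ip mu3 (u k) T = ip mu3 (u k) F) ?subrr ?mulr0//.
have E2 : ip mu3 (u k) T = ip mu3 T (u k) by exact: ipC.
rewrite E2 /T ip_suml//; last by move=> l; exact: L2rZ.
rewrite (bigD1 k)//= (ipZl _ (lu k) (lu k)) ou eqxx mulr1 big1 ?addr0// => l lk.
by rewrite (ipZl _ (lu l) (lu k)) ou (negbTE lk) mulr0.
Qed.

(** The real basis u_k also spans the complex eigenspace, so no conjugation appears. *)
Definition eig_kernel (x y : sp) : R[i] := (\sum_k u k x * u k y)%:C%C.

Lemma eig_kernelP : projection_kernel (H_eigenspace V lam) eig_kernel.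
Proof.
split.
  split; last exact: measurable_cst.
  have mS : measurable_fun setT (fun xy : sp * sp => \sum_k u k xy.1 * u k xy.2).
    apply: measurable_sum => k; have [mk _] := lu k.
    by apply: measurable_funM; [exact: measurable_fun1|exact: measurable_fun2].
  exact: mS.
move=> f /L2_ReIm[lr li].
have eT (F : sp -> R) : eigr V lam (fun x => \sum_k ip mu3 (u k) F * u k x) by exact: eigr_sum.
pose gr x := \sum_k ip mu3 (u k) (fun y => Re (f y)) * u k x.
pose gi x := \sum_k ip mu3 (u k) (fun y => Im (f y)) * u k x.
exists (fun x => (gr x +i* gi x)%C).
  split; first exact: (H_of_eigr kV (eT _) (eT _)).
  move=> h Hh; have [ep eq_] := eigr_of_H kV Hh.
  have lgr : L2r mu3 gr := eigr_L2 (eT _); have lgi : L2r mu3 gi := eigr_L2 (eT _).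
  have ReE : (fun x => Re (f x - (gr x +i* gi x)%C)) = (fun x => Re (f x) - gr x).
    by apply/funext => x; case: (f x).
  have ImE : (fun x => Im (f x - (gr x +i* gi x)%C)) = (fun x => Im (f x) - gi x).
    by apply/funext => x; case: (f x).
  rewrite inner_L2; last 2 first.
  - by apply/L2_ReIm; rewrite ReE ImE; split; [exact: (L2rB lr lgr)|exact: (L2rB li lgi)].
  - by apply/L2_ReIm; split; [exact: (eigr_L2 ep)|exact: (eigr_L2 eq_)].
  rewrite ReE ImE (ip_projection lr ep) (ip_projection li eq_) (ip_projection li ep) (ip_projection lr eq_).
  by rewrite addr0 subr0.
apply: (@ae_imp _ (fun=> True)); last exact: aeW.
move=> x _.
have lK : L2r mu3 (fun y => \sum_k u k x * u k y) by apply: L2r_sum => k; exact: L2rZ.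
have KE F : L2r mu3 F -> ip mu3 (fun y => \sum_k u k x * u k y) F = \sum_k ip mu3 (u k) F * u k x.
  move=> lF; rewrite ip_suml//; last by move=> k; exact: L2rZ.
  by apply: eq_bigr => k _; rewrite (ipZl _ (lu k) lF) mulrC.
have ReE : (fun y => Re (eig_kernel x y * f y)) = (fun y => (\sum_k u k x * u k y) * Re (f y)).
  by apply/funext => y; rewrite /eig_kernel Re_scale.
have ImE : (fun y => Im (eig_kernel x y * f y)) = (fun y => (\sum_k u k x * u k y) * Im (f y)).
  by apply/funext => y; rewrite /eig_kernel Im_scale.
split.
  split.
    have := L2r_mul lK lr; congr (_.-integrable _ _); apply/funext => y.
    exact: (congr1 EFin (esym (Re_scale _ _))).
  have := L2r_mul lK li; congr (_.-integrable _ _); apply/funext => y.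
  exact: (congr1 EFin (esym (Im_scale _ _))).
rewrite /cintegral; congr (_ +i* _)%C.
  rewrite /gr -(KE _ lr); apply: eq_Rintegral => y _.
  by rewrite Re_scale.
rewrite /gi -(KE _ li); apply: eq_Rintegral => y _.
by rewrite Im_scale.
Qed.

End Projection.

Lemma kernel_bound mu : 0 < mu -> exists2 C, 0 <= C & has_kernel_bound mu C.
Proof.
move=> mu0; have [N [u [K [K0 uK eu ou cu]]]] := decaying_eig_basis kV mu0.
pose B := N%:R * K ^+ 2; have B0 : 0 <= B by rewrite mulr_ge0 ?sqr_ge0.
have i0 : 0 < mu^-1 by rewrite invr_gt0.
(* This factor pays for inserting the power of mu by [scale_le]; one constant then serves all
   exponents a. *)
pose s := mu^-1 + mu^-1 ^+ 2; have s0 : 0 <= s by rewrite addr_ge0 ?sqr_ge0 ?(ltW i0).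
exists (B * s); first exact: mulr_ge0.
exists (eig_kernel u); first exact: (eig_kernelP eu ou cu).
have main x y : cabs (eig_kernel u x y) <= B * (expR (- mu * enorm (x - y)) / (1 + enorm (x - y))).
  rewrite /eig_kernel cabs_real; apply: le_trans (ler_norm_sum _ _ _) _.
  apply: (@le_trans _ _ (\sum_(k < N) K ^+ 2 * (ww mu x * ww mu y))).
    apply: ler_sum => k _; rewrite normrM expr2 mulrACA.
    by apply: ler_pM.
  rewrite sumr_const card_ord -mulr_natl mulrA -/B.
  by apply: ler_wpM2l => //; exact: ww_mul_le.
have bound a x y : x <> y -> 0 <= a <= 1 -> cabs (eig_kernel u x y) <=
    B * s * mu `^ (2 - a) * (expR (- mu * enorm (x - y)) / enorm (x - y) `^ a).
  move=> xy a01; apply: le_trans (main x y) _.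
  have d0 : 0 < enorm (x - y) by rewrite enorm_gt0// subr_eq0; apply/eqP.
  rewrite -(mulrA B) -mulrA; apply: ler_wpM2l => //.
  rewrite -[leLHS]mul1r; apply: ler_pM => //.
  - by rewrite divr_ge0 ?expR_ge0 ?addr_ge0 ?(ltW d0).
  - exact: scale_le.
  - apply: ler_wpM2l; first exact: expR_ge0.
    have p0 : 0 < enorm (x - y) `^ a by exact: powR_gt0.
    by rewrite lef_pV2 ?posrE ?enorm1_gt0// powR_le1D// ltW.
move=> x y xy; split; last by move=> a; exact: bound.
have d0 : 0 < enorm (x - y) by rewrite enorm_gt0// subr_eq0; apply/eqP.
(* The first estimate is the case a = 1 of the second. *)
have h1 : 0 <= (1 : R) <= 1 by rewrite ler01 lexx.
have := bound 1 x y xy h1; rewrite powRr1 ?(ltW d0)//.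
by rewrite (_ : 2 - 1 = 1) ?powRr1 ?(ltW mu0)//; ring.
Qed.

Lemma kernel_bound_seq (s : seq R) : exists C, forall mu, mu \in s -> 0 < mu ->
  has_kernel_bound mu C.
Proof.
elim: s => [|nu s [C hC]]; first by exists 0.
have [nu0|nu0] := ltP 0 nu; last first.
  exists C => mu; rewrite inE => /orP[/eqP ->|]; last exact: hC.
  by rewrite ltNge nu0.
have [C' _ hC'] := kernel_bound nu0.
exists (Num.max C' C) => mu; rewrite inE => /orP[/eqP ->|ms] mu0.
  by apply: has_kernel_bound_le hC' => //; rewrite le_max lexx.
by apply: has_kernel_bound_le (hC _ ms mu0) => //; rewrite le_max lexx orbT.
Qed.

Lemma eigenvalue_in (s : seq R) mu : (forall mu u, 0 < mu ->
  eigr V (- mu ^+ 2) u -> ~ {ae mu3, forall x, u x = 0} -> mu \in s) ->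
  0 < mu -> H_eigenvalue V (- mu ^+ 2) -> mu \in s.
Proof.
move=> hs mu0 [psi [Hpsi nz]]; have [ea eb] := eigr_of_H kV Hpsi.
have [za|za] := pselect {ae mu3, forall x, Re (psi x) = 0}; last exact: (hs mu _ mu0 ea za).
have [zb|zb] := pselect {ae mu3, forall x, Im (psi x) = 0}; last exact: (hs mu _ mu0 eb zb).
by exfalso; apply: nz; move: za zb; apply: ae_imp2 => x ha hb; exact: complex_eq.
Qed.

Lemma negative_eigenfunction_bounded mu psi : 0 < mu ->
  H_eigenspace V (- mu ^+ 2) psi -> ess_bounded psi.
Proof.
move=> mu0 /(eigr_of_H kV)[ea eb].
have [A A0 hA] := eigenfunction_decay kV mu0 ea.
have [B B0 hB] := eigenfunction_decay kV mu0 eb.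
exists (A + B); move: hA hB; apply: ae_imp2 => x a b; apply: cabs_le.
  by apply: le_trans a _; rewrite -[leRHS]mulr1 ler_wpM2l ?ww_le1.
by apply: le_trans b _; rewrite -[leRHS]mulr1 ler_wpM2l ?ww_le1.
Qed.

End Kernel_bound.

Theorem lemma3p4 (R : realType) (V : space3 R -> R) :
  kato0 V ->
  ~ H_eigenvalue V 0 ->
  ~ (exists psi, zero_resonance V psi) ->
  (forall lam : R, 0 < lam -> ~ H_eigenvalue V lam) ->
  (forall (lam : R) (psi : space3 R -> R[i]),
     H_eigenfunction V lam psi -> ess_bounded psi) /\
  exists C : R, forall mu : R, 0 < mu -> H_eigenvalue V (- mu ^+ 2) ->
    exists2 P : space3 R -> space3 R -> R[i],
      projection_kernel (H_eigenspace V (- mu ^+ 2)) P &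
      forall x y : space3 R, x <> y ->
        cabs (P x y) <= C * mu * (expR (- mu * enorm (x - y)) / enorm (x - y)) /\
        forall a : R, 0 <= a <= 1 ->
          cabs (P x y) <=
            C * mu `^ (2 - a) *
            (expR (- mu * enorm (x - y)) / enorm (x - y) `^ a).
Proof.
move=> kV n0 _ npos; split.
  (* Negative energies are handled by the decay estimate, since [ww] is at most 1; the other two
     signs are excluded by hypothesis. *)
  move=> lam psi Hpsi; have [l0|l0|l0] := ltgtP lam 0.
  - have m0 : 0 < Num.sqrt (- lam) by rewrite sqrtr_gt0 oppr_gt0.
    apply: (negative_eigenfunction_bounded kV m0).
    by rewrite sqr_sqrtr ?oppr_ge0 ?(ltW l0)// opprK; case: Hpsi.
  - by case: (npos lam l0); exists psi.
  - by case: n0; exists psi; rewrite -l0.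
have [s hs] := finitely_many_eig kV; have [C hC] := kernel_bound_seq kV s.
by exists C => mu mu0 ev; exact: (hC mu (eigenvalue_in kV hs mu0 ev) mu0).
Qed.
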